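(* For $j=0,1$ let $p_{j}(\cdot)\in\mathcal{P}_{\gamma_{d}}^{\infty}(\mathbb{R}^{d})\cap LH_{0}(\mathbb{R}^{d})$ and $q_{j}(\cdot)\in\mathcal{P}_{0,\infty}$ with $1<p_j^-$, $1<q_j^-$, $p_j^+<\infty$, $q_j^+<\infty$, and let $\alpha_j\ge0$. For $0<\theta<1$ put $\alpha=\alpha_{0}(1-\theta)+\alpha_{1}\theta$ and define $p(\cdot)$, $q(\cdot)$ by $$\frac{1}{p(x)}=\frac{1-\theta}{p_{0}(x)}+\frac{\theta}{p_{1}(x)}\ \text{ for a.e. } x\in\mathbb{R}^{d},\qquad \frac{1}{q(t)}=\frac{1-\theta}{q_{0}(t)}+\frac{\theta}{q_{1}(t)}\ \text{ for a.e. } t\in\mathbb{R}^{+}.$$ (i) If $f\in B_{p_{j}(\cdot),q_{j}(\cdot)}^{\alpha_{j}}(\gamma_d)$ for $j=0,1$, then $f\in B_{p(\cdot),q(\cdot)}^{\alpha}(\gamma_d)$ for all $0<\theta<1$. (ii) If $f\in F_{p_{j}(\cdot),q_{j}(\cdot)}^{\alpha_{j}}(\gamma_d)$ for $j=0,1$, then $f\in F_{p(\cdot),q(\cdot)}^{\alpha}(\gamma_d)$ for all $0<\theta<1$.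
   Context: Measures: $\gamma_d(dx)=\pi^{-d/2}e^{-|x|^2}dx$ on $\mathbb{R}^d$, and $\mu(dt)=dt/t$ on $\mathbb{R}^+=(0,\infty)$. For an exponent $p(\cdot)$, $p^-$ and $p^+$ denote its essential infimum and essential supremum. Variable Lebesgue norm: for a measure $\nu$ on $\Omega$ and a measurable finite-valued exponent $p(\cdot):\Omega\to[1,\infty)$, $\|f\|_{p(\cdot),\nu}=\inf\{\lambda>0:\int_\Omega |f(x)/\lambda|^{p(x)}\,\nu(dx)\le 1\}$, and $L^{p(\cdot)}(\Omega,\nu)$ is the set of measurable $f$ with $\|f\|_{p(\cdot),\nu}<\infty$. $L^{p(\cdot)}(\gamma_d)=L^{p(\cdot)}(\mathbb{R}^d,\gamma_d)$. Exponent classes: $p(\cdot)\in LH_0(\mathbb{R}^d)$ means $p(\cdot)$ is real-valued and there is $C_1>0$ with $|p(x)-p(y)|\le C_1/\log(e+1/|x-y|)$ for all $x,y\in\mathbb{R}^d$. $p(\cdot)\in\mathcal{P}^\infty_{\gamma_d}(\mathbb{R}^d)$ means $p(\cdot)$ is a measurable exponent with values $\ge1$ and there are $C_{\gamma_d}>0$, $p_\infty\ge1$ with $|p(x)-p_\infty|\le C_{\gamma_d}/|x|^2$ for all $x\ne0$. $\mathcal{P}_{0,\infty}$ is the set of measurable $q(\cdot):\mathbb{R}^+\to\mathbb{R}^+$ with $1\le \operatorname{ess\,inf} q\le\operatorname{ess\,sup} q<\infty$, such that the limits $q(0)=\lim_{x\to0}q(x)$ and $q(\infty)=\lim_{x\to\infty}q(x)$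 exist and, for some constant $A$, $|q(x)-q(0)|\le A/\ln(1/x)$ for $0<x\le1/2$ and $|q(x)-q(\infty)|\le A/\ln x$ for $x>2$. Semigroups: the Ornstein–Uhlenbeck semigroup is $T_tf(x)=(1-e^{-2t})^{-d/2}\int_{\mathbb{R}^d}\exp\left(-\frac{e^{-2t}(|x|^2+|y|^2)-2e^{-t}\langle x,y\rangle}{1-e^{-2t}}\right)f(y)\,\gamma_d(dy)$, $t>0$; the Poisson–Hermite semigroup is $P_tf(x)=\frac1{\sqrt\pi}\int_0^\infty\frac{e^{-u}}{\sqrt u}T_{t^2/4u}f(x)\,du$, $t>0$. Spaces: for $\alpha\ge0$ and $k$ the smallest integer greater than $\alpha$, the variable Gaussian Besov–Lipschitz space $B^\alpha_{p(\cdot),q(\cdot)}(\gamma_d)$ is the set of $f\in L^{p(\cdot)}(\gamma_d)$ such that $\left\|t^{k-\alpha}\left\|\frac{\partial^kP_tf}{\partial t^k}\right\|_{p(\cdot),\gamma_d}\right\|_{q(\cdot),\mu}<\infty$, and the variable Gaussian Triebel–Lizorkin space $F^\alpha_{p(\cdot),q(\cdot)}(\gamma_d)$ is the set of $f\in L^{p(\cdot)}(\gamma_d)$ such that $\left\|\left\|t^{k-\alpha}\frac{\partial^kP_tf}{\partial t^k}\right\|_{q(\cdot),\mu}\right\|_{p(\cdot),\gamma_d}<\infty$. Here the $\|\cdot\|_{q(\cdot),\mu}$ norm is taken in $t\in\mathbb{R}^+$ and the $\|\cdot\|_{p(\cdot),\gamma_d}$ norm in $x\in\mathbb{R}^d$.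 *)

(* Defs.v *)
From HB Require Import structures.
From mathcomp Require Import all_boot all_order all_algebra.
From mathcomp Require Import all_classical all_reals all_analysis.
From mathcomp Require Import measurable_realfun ess_sup_inf.

Set Implicit Arguments.
Unset Strict Implicit.
Unset Printing Implicit Defensive.

Import Order.TTheory GRing.Theory Num.Def Num.Theory.
Import numFieldNormedType.Exports.

Local Open Scope classical_set_scope.
Local Open Scope ring_scope.

(* R^d is d.-tuple R, whose library sigma-algebra is generated by the
   coordinate projections, i.e. it is the Borel sigma-algebra. *)
Section euclidean.
Context {R : realType} {d : nat}.
Implicit Types x y : d.-tuple R.

Definition vzero : d.-tuple R := [tuple 0 | i < d].
Definition vsub x y : d.-tuple R := [tuple tnth x i - tnth y i | i < d].
Definition inner x y : R := \sum_(i < d) tnth x i * tnth y i.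
Definition enorm x : R := Num.sqrt (inner x x).

Lemma measurable_enormX2 : measurable_fun setT (fun x => enorm x ^+ 2).
Proof.
have -> : (fun x => enorm x ^+ 2) = (fun x => \sum_(i < d) tnth x i ^+ 2).
  apply/funext => x; rewrite sqr_sqrtr; last first.
    by apply: sumr_ge0 => i _; rewrite -expr2 sqr_ge0.
  by apply: eq_bigr => i _; rewrite expr2.
apply: measurable_sum => i; apply: measurable_funX; exact: measurable_tnth.
Qed.

End euclidean.

Section lebesgue_on_tuples.
Context {R : realType}.

Definition tcons n (z : measurableTypeR R * n.-tuple R) : n.+1.-tuple R :=
  [the n.+1.-tuple R of z.1 :: z.2].

Lemma measurable_tcons n : measurable_fun setT (@tcons n).
Proof. by apply: measurable_cons. Qed.

Definition lebesgue_tcons n (m : {sigma_finite_measure set (n.-tuple R) -> \bar R})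
  : set (n.+1.-tuple R) -> \bar R :=
  pushforward (lebesgue_measure \x m)%E (@tcons n).

Section lebesgue_tcons.
Variables (n : nat) (m : {sigma_finite_measure set (n.-tuple R) -> \bar R}).

Let tcons0 : lebesgue_tcons m set0 = 0%E.
Proof. by rewrite /lebesgue_tcons /pushforward preimage_set0 measure0. Qed.

Let tcons_ge0 A : (0 <= lebesgue_tcons m A)%E.
Proof. by rewrite /lebesgue_tcons /pushforward measure_ge0. Qed.

Let tcons_sigma_additive : semi_sigma_additive (lebesgue_tcons m).
Proof.
move=> F mF tF mUF; rewrite /lebesgue_tcons /pushforward preimage_bigcup.
have mp A : measurable A -> measurable (@tcons n @^-1` A).
  by move=> mA; rewrite -[X in measurable X]setTI; exact: measurable_tcons.
apply: measure_semi_sigma_additive.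
- by move=> k; exact: mp.
- apply/trivIsetP => /= i j _ _ ij; rewrite -preimage_setI.
  by move/trivIsetP : tF => /(_ _ _ _ _ ij) ->//; rewrite preimage_set0.
- by rewrite -preimage_bigcup; exact: mp.
Qed.

HB.instance Definition _ := isMeasure.Build _ _ _
  (lebesgue_tcons m) tcons0 tcons_ge0 tcons_sigma_additive.

Let tcons_sigma_finite : sigma_finite setT (lebesgue_tcons m).
Proof.
have /sigma_finiteP[F [TF ndF Foo]] : sigma_finite setT (@lebesgue_measure R).
  exact: sigma_finiteT.
have /sigma_finiteP[G [TG ndG Goo]] : sigma_finite setT m by exact: sigma_finiteT.
pose g (t : n.+1.-tuple R) : measurableTypeR R * n.-tuple R :=
  (thead t, [tuple of behead t]).
have mg : measurable_fun setT g.
  apply/measurable_fun_pairP; split => /=; last exact: measurable_behead.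
  exact: measurable_tnth.
have tgK z : g (tcons z) = z.
  by case: z => a b; congr pair; exact: val_inj.
exists (fun k => g @^-1` (F k `*` G k)).
  apply/seteqP; split => // t _.
  have : setT (g t).1 by [].
  rewrite TF => -[i _ Fi].
  have : setT (g t).2 by [].
  rewrite TG => -[j _ Gj].
  exists (maxn i j) => //; split.
  - by move: (g t).1 Fi; apply/subsetPset/ndF/leq_maxl.
  - by move: (g t).2 Gj; apply/subsetPset/ndG/leq_maxr.
move=> k; have [mF Fk] := Foo k; have [mG Gk] := Goo k; split.
  by rewrite -[X in measurable X]setTI; apply: mg => //; exact: measurableX.
rewrite /lebesgue_tcons /pushforward (_ : _ @^-1` _ = F k `*` G k).
  by rewrite product_measure1E// lte_mul_pinfty// ge0_fin_numE.
by apply/funext => z; rewrite -[LHS]/((F k `*` G k) (g (tcons z))) tgK.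
Qed.

HB.instance Definition _ := Measure_isSigmaFinite.Build _ _ _
  (lebesgue_tcons m) tcons_sigma_finite.

End lebesgue_tcons.

(* d-dimensional Lebesgue measure, as the iterated product measure. *)
Fixpoint lebesgue_tuple (d : nat) :
    {sigma_finite_measure set (d.-tuple R) -> \bar R} :=
  match d with
  | 0 => [the {sigma_finite_measure set (0.-tuple R) -> \bar R} of
           @dirac _ (0.-tuple R) [tuple] R]
  | n.+1 => [the {sigma_finite_measure set (n.+1.-tuple R) -> \bar R} of
              lebesgue_tcons (lebesgue_tuple n)]
  end.

End lebesgue_on_tuples.

Section gaussian_measure.
Context {R : realType} (d : nat).

Definition gauss_density (x : d.-tuple R) : R :=
  pi `^ (- (d%:R / 2)) * expR (- (enorm x ^+ 2)).

Definition gauss_measure : set (d.-tuple R) -> \bar R := fun A =>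
  (\int[lebesgue_tuple d]_(x in A) (gauss_density x)%:E)%E.

Lemma gauss_density_ge0 x : 0 <= gauss_density x.
Proof. by rewrite mulr_ge0 ?powR_ge0 ?expR_ge0. Qed.

Lemma measurable_gauss_density : measurable_fun setT gauss_density.
Proof.
apply: measurable_funM => //; apply: measurableT_comp => //.
exact: measurableT_comp measurable_enormX2.
Qed.

Let gauss0 : gauss_measure set0 = 0%E.
Proof. exact: integral_set0. Qed.

Let gauss_ge0 A : (0 <= gauss_measure A)%E.
Proof. by apply: integral_ge0 => x _; rewrite lee_fin gauss_density_ge0. Qed.

Let gauss_sigma_additive : semi_sigma_additive gauss_measure.
Proof.
move=> /= A mA tA mUA; rewrite /gauss_measure/= ge0_integral_bigcup//=.
- apply: is_cvg_ereal_nneg_natsum_cond => n _ _.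
  by apply: integral_ge0 => /= x ?; rewrite lee_fin gauss_density_ge0.
- by apply/measurable_EFinP; apply: measurable_funTS measurable_gauss_density.
- by move=> x _; rewrite lee_fin gauss_density_ge0.
Qed.

HB.instance Definition _ := isMeasure.Build _ _ _
  gauss_measure gauss0 gauss_ge0 gauss_sigma_additive.

End gaussian_measure.
Arguments gauss_measure {R} d _.

Section haar_measure.
Context {R : realType}.

Definition posline : set R := `]0, +oo[.

Lemma measurable_posline : measurable posline.
Proof. by rewrite /posline; exact: measurable_itv. Qed.

(* dt/t on R^+, as a measure on R carried by R^+; in particular its null sets,
   hence its a.e. statements and essential bounds, only see R^+. *)
Definition haar_measure : set R -> \bar R := fun A =>
  (\int[lebesgue_measure]_(t in A `&` posline) (t^-1)%:E)%E.

Let haar0 : haar_measure set0 = 0%E.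
Proof. by rewrite /haar_measure set0I integral_set0. Qed.

Let haar_ge0 A : (0 <= haar_measure A)%E.
Proof.
apply: integral_ge0 => t [_]; rewrite /posline/= in_itv/= andbT => t0.
by rewrite lee_fin invr_ge0 ltW.
Qed.

Let haar_sigma_additive : semi_sigma_additive haar_measure.
Proof.
move=> /= A mA tA mUA; rewrite /haar_measure/= setI_bigcupl ge0_integral_bigcup//=.
- apply: is_cvg_ereal_nneg_natsum_cond => n _ _; exact: (haar_ge0 (A n)).
- by move=> k; apply: measurableI; [exact: mA | exact: measurable_posline].
- apply/measurable_EFinP; apply: (@measurable_funS _ _ _ _ posline).
  + exact: measurable_posline.
  + by move=> t [k _ []].
  + apply: (@eq_measurable_fun _ _ _ _ _ (fun t : R => t `^ (-1))).
      by move=> t; rewrite inE /posline/= in_itv/= andbT => t0; rewrite powR_inv1 ?ltW.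
    by apply: measurable_funTS; exact: measurable_powR.
- move=> t [k _ [_]]; rewrite /posline/= in_itv/= andbT => t0.
  by rewrite lee_fin invr_ge0 ltW.
- exact: trivIset_setIr.
Qed.

HB.instance Definition _ := isMeasure.Build _ _ _
  haar_measure haar0 haar_ge0 haar_sigma_additive.

End haar_measure.

(* Luxemburg norm of the variable Lebesgue space on Omega. Functions take
   extended real values because inner norms may be infinite; the infimum of
   the empty set is +oo. *)
Definition luxnorm dT (T : measurableType dT) (R : realType)
    (nu : {measure set T -> \bar R}) (Omega : set T) (p : T -> R)
    (f : T -> \bar R) : \bar R :=
  ereal_inf [set l%:E | l in [set l : R | 0 < l /\
    (\int[nu]_(x in Omega) (`|(l^-1)%:E * f x| `^ p x) <= 1)%E]].

Section exponents.
Context {R : realType}.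

(* For x = y the library convention 0^-1 = 0 makes the bound C, against a
   left-hand side equal to 0. *)
Definition LH0 d (p : d.-tuple R -> R) : Prop :=
  exists2 C : R, 0 < C & forall x y,
    `|p x - p y| <= C / ln (expR 1 + (enorm (vsub x y))^-1).

Definition Pgamma d (p : d.-tuple R -> R) : Prop :=
  [/\ measurable_fun setT p, forall x, 1 <= p x &
    exists C pinf : R, [/\ 0 < C, 1 <= pinf &
      forall x, x != vzero -> `|p x - pinf| <= C / enorm x ^+ 2]].

(* Exponents on R^+ are functions on R whose values outside R^+ are ignored. *)
Definition P0oo (q : R -> R) : Prop :=
  [/\ measurable_fun posline q, forall t, 0 < t -> 0 < q t,
    (1 <= ess_inf haar_measure (EFin \o q))%E,
    (ess_sup haar_measure (EFin \o q) < +oo)%E &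
    exists q0 qoo A : R, [/\ q t @[t --> 0^'+] --> q0,
      q t @[t --> +oo] --> qoo,
      forall t, 0 < t -> t <= 2^-1 -> `|q t - q0| <= A / ln (t^-1) &
      forall t, 2 < t -> `|q t - qoo| <= A / ln t]].

End exponents.

Section spaces.
Context {R : realType} {d : nat}.
Implicit Types (f : d.-tuple R -> R) (x : d.-tuple R) (t alpha : R).
Implicit Types (p : d.-tuple R -> R) (q : R -> R).

Definition ornstein_uhlenbeck t f x : R :=
  (1 - expR (- (2 * t))) `^ (- (d%:R / 2)) *
  \int[gauss_measure d]_y
    (expR (- ((expR (- (2 * t)) * (enorm x ^+ 2 + enorm y ^+ 2)
               - 2 * expR (- t) * inner x y) / (1 - expR (- (2 * t))))) * f y).

Definition poisson_hermite t f x : R :=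
  (Num.sqrt pi)^-1 *
  \int[lebesgue_measure]_(u in posline)
    (expR (- u) / Num.sqrt u * ornstein_uhlenbeck (t ^+ 2 / (4 * u)) f x).

Definition dpoisson_hermite (k : nat) t f x : R :=
  derive1n k (fun s => poisson_hermite s f x) t.

(* Functions rather than classes modulo null sets; the norm only depends on the
   class. *)
Definition Lvar p : set (d.-tuple R -> R) :=
  [set f | measurable_fun setT f /\
    (luxnorm (gauss_measure d) setT p (EFin \o f) < +oo)%E].

(* For alpha >= 0, the smallest integer greater than alpha (order_aboveP). *)
Definition order_above alpha : nat := (Num.truncn alpha).+1.

Lemma order_aboveP alpha : 0 <= alpha ->
  alpha < (order_above alpha)%:R /\
  forall m : int, alpha < m%:~R -> ((order_above alpha)%:Z <= m)%R.
Proof.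
move=> a0; split; first exact: truncnS_gt.
case=> [n|n].
  by rewrite -pmulrn lez_nat /order_above truncn_lt_nat.
rewrite NegzE mulrNz => /(le_lt_trans a0).
by rewrite oppr_gt0 -pmulrn ltrn0.
Qed.

Definition besov_lipschitz alpha p q : set (d.-tuple R -> R) :=
  [set f | Lvar p f /\
    let k := order_above alpha in
    (luxnorm haar_measure posline q (fun t =>
       (t `^ (k%:R - alpha))%:E *
       luxnorm (gauss_measure d) setT p
         (fun x => (dpoisson_hermite k t f x)%:E)) < +oo)%E].

Definition triebel_lizorkin alpha p q : set (d.-tuple R -> R) :=
  [set f | Lvar p f /\
    let k := order_above alpha in
    (luxnorm (gauss_measure d) setT p (fun x =>
       luxnorm haar_measure posline q (fun t =>
         (t `^ (k%:R - alpha) * dpoisson_hermite k t f x)%:E)) < +oo)%E].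

End spaces.

(* Main.v *)
(* The derivatives v_k(t) of the Poisson-Hermite semigroup satisfy, for s <= t/2,
   |v_{k+1}(t)| <= (C/t) M |v_k(s)|, where M is the maximal function of the
   Ornstein-Uhlenbeck averages.  By the Hopf ergodic maximal inequality M is bounded on
   L^m(gamma) for constant m > 1, and the log-Hoelder and decay conditions on p let one
   trade p(x) for p(y) inside the Mehler kernel, so M is bounded on L^{p(.)}(gamma).
   Hence the finiteness of a Besov or Triebel-Lizorkin norm passes from the order k to
   every larger order, and both spaces of the couple can be compared at one common order
   l, where the interpolation is Hoelder's inequality for 1/p = (1-theta)/p0 + theta/p1,
   applied in x for each t and then in t (Besov).
   Descending from l to the order prescribed by alpha uses v_k(t) = - int_t^oo v_{k+1}: in
   the Besov case with Minkowski's inequality and a Hardy inequality on L^{q(.)}(dt/t), in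
   which the decay of q at 0 and at infinity again trades q(t) for q(s).
   In the Triebel-Lizorkin case an average over s in [t/4,t/2] gives pointwise bounds
   |v_l(t,x)| <= t^{alpha_j - l} A_j(x) with A_j in L^{p_j(.)}; when alpha_0 <> alpha_1,
   interpolating these bounds with the two parameters theta +- eta makes the descent to k
   dominated by A_0^{1-theta} A_1^theta min(Z, 1/Z) with Z a power of t/r(x), which is
   integrable for dt/t uniformly in r; when alpha_0 = alpha_1 one applies Hoelder twice. *)
Require Import Defs.
From HB Require Import structures.
From mathcomp Require Import all_boot all_order all_algebra.
From mathcomp Require Import all_classical all_reals all_analysis.
From mathcomp Require Import measurable_realfun ess_sup_inf.
From mathcomp Require Import ring lra.

Set Implicit Arguments.
Unset Strict Implicit.
Unset Printing Implicit Defensive.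

Import Order.TTheory GRing.Theory Num.Def Num.Theory.
Import numFieldNormedType.Exports.

Local Open Scope classical_set_scope.
Local Open Scope ring_scope.

(** * Nonnegative integrals and Luxemburg norms *)

(** The bounds on the exponents hold only almost everywhere, while the kernel estimates are
    pointwise; Luxemburg norms see exponents modulo null sets, so truncated representatives are used
    throughout. For the maximal bound one writes [p = m e] with a constant [m > 1] and [e >= 1]:
    exponents are traded for [e], at the price of an additive [exp (kap |x|^2)] with [kap] as small
    as desired, and the constant-exponent bound in [L^m] is applied to [|g|^e]. The two scales
    differ in how the order can be raised. In the Besov case the norm in [x] is the inner one, so a
    scalar maximal inequality suffices at each time. In the Triebel-Lizorkin case the norm in [t] is
    the inner one, and keeping it would call for a vector-valued maximal inequality. The maximal
    function is applied instead to the single function of [x] given by the inner norm. This retains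
    only a supremum in [t]; the lost integrability in [t] is what the two parameters [theta +- eta]
    recover, and they do so only if the smoothness indices differ. If these agree, so do the
    prescribed orders, and no order has to be raised. *)

Section integral_tools.
Local Open Scope ereal_scope.
Context dT (T : measurableType dT) (R : realType) (nu : {measure set T -> \bar R}).
Implicit Types (f g k : T -> \bar R) (D : set T).

Import HBNNSimple.

(** The integral of a nonnegative function is a supremum over the simple functions below it, so
    monotonicity needs no measurability. *)
Lemma ge0_integral_mono D f g : (forall x, D x -> 0 <= f x) ->
  (forall x, D x -> f x <= g x) ->
  \int[nu]_(x in D) f x <= \int[nu]_(x in D) g x.
Proof.
move=> f0 fg; rewrite !(integral_mkcond D).
rewrite !ge0_integralTE; last 2 first.
- by apply: erestrict_ge0 => x Dx; exact: le_trans (f0 _ Dx) (fg _ Dx).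
- by apply: erestrict_ge0.
apply: ereal_sup_le => _ [h /= hf <-]; exists h => //= x; apply: le_trans (hf x) _; rewrite /patch.
by case: ifPn => // /set_mem; exact: fg.
Qed.

(** Young's inequality for the product of [x / a] and [1]; the free scale [a] is what allows
    Jensen's inequality to be derived by optimisation. *)
Lemma poweR_young (p a : R) (x : \bar R) : (1 <= p)%R -> (0 < a)%R -> 0 <= x ->
  x <= (a * (1 - p^-1))%:E + (a `^ (1 - p) / p)%:E * x `^ p.
Proof.
move=> p1 a0; have p0 : (0 < p)%R by lra.
case: x => [x| |]//.
  rewrite lee_fin poweR_EFin -EFinM -EFinD lee_fin => x0.
  have [->|/eqP pn1] := eqVneq p 1%R.
    by rewrite subrr powRr0 invr1 subrr mulr0 add0r powRr1// !mul1r.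
  have p1' : (1 < p)%R by lra.
  have q0 : (0 < (1 - p^-1)^-1)%R by rewrite invr_gt0 subr_gt0 invf_lt1.
  have := @conjugate_powR R (x / a)%R 1%R p (1 - p^-1)^-1%R.
  rewrite divr_ge0 ?(ltW a0)// ler01 p0 q0 invrK subrKC => /(_ isT isT isT isT erefl).
  rewrite mulr1 powR1 mul1r powRM ?invr_ge0 ?(ltW a0)// => H.
  have -> : (a `^ (1 - p) = a * a^-1 `^ p)%R.
    rewrite powRB; last by apply/implyP => _; rewrite gt_eqF.
    by rewrite powRr1 ?(ltW a0)// -[in RHS]powR_inv1 ?(ltW a0)// -powRrM mulN1r powRN.
  rewrite ler_pdivrMr// in H; apply: le_trans H _; rewrite mulrDl addrC.
  by rewrite le_eqVlt; apply/orP; left; apply/eqP; congr (_ + _)%R; [rewrite mulrC|ring].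
rewrite poweRyr ?gt_eqF// gt0_muley// lte_fin divr_gt0 ?powR_gt0//.
Qed.

(** Young's inequality is integrated against the weight [k], first with [a = 1] to see that the mean
    is finite, then with [a] equal to that mean, which is the optimal scale. *)
Lemma ge0_poweR_jensen D k f (p : R) : measurable D ->
  measurable_fun D k -> measurable_fun D f ->
  (forall x, D x -> 0 <= k x) -> (forall x, D x -> 0 <= f x) -> (1 <= p)%R ->
  \int[nu]_(x in D) k x <= 1 ->
  (\int[nu]_(x in D) (k x * f x)) `^ p <= \int[nu]_(x in D) (k x * f x `^ p).
Proof.
move=> mD mk mf k0 f0 p1 k1; have p0 : (0 < p)%R by lra.
set A := \int[nu]_(x in D) (k x * f x).
have A0 : 0 <= A by apply: integral_ge0 => x Dx; rewrite mule_ge0 ?k0 ?f0.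
have mfp : measurable_fun D (fun x => f x `^ p) by exact: measurableT_comp (measurable_poweR _) mf.
set B := \int[nu]_(x in D) (k x * f x `^ p).
have B0 : 0 <= B by apply: integral_ge0 => x Dx; rewrite mule_ge0 ?k0 ?poweR_ge0.
have kint (a : R) : (0 < a)%R ->
   A <= (a * (1 - p^-1))%:E + (a `^ (1 - p) / p)%:E * B.
  move=> a0.
  have c0 : (0 <= a * (1 - p^-1))%R.
    by rewrite mulr_ge0 ?(ltW a0)// subr_ge0 invf_le1.
  have d0 : (0 <= a `^ (1 - p) / p)%R by rewrite divr_ge0 ?powR_ge0 ?(ltW p0).
  apply: (@le_trans _ _ (\int[nu]_(x in D) ((a * (1 - p^-1))%:E * k x +
      (a `^ (1 - p) / p)%:E * (k x * f x `^ p)))).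
    apply: ge0_integral_mono => x Dx; first by rewrite mule_ge0 ?k0 ?f0.
    have := lee_wpmul2l (k0 _ Dx) (poweR_young p1 a0 (f0 _ Dx)).
    move=> /le_trans; apply; rewrite ge0_muleDr ?mule_ge0 ?lee_fin ?poweR_ge0//.
    by rewrite muleC (muleCA (k x)).
  rewrite ge0_integralD//=; last 4 first.
  - by move=> x Dx; rewrite mule_ge0 ?k0.
  - exact: emeasurable_funM.
  - by move=> x Dx; rewrite !mule_ge0 ?k0 ?lee_fin ?poweR_ge0.
  - by apply: emeasurable_funM => //; exact: emeasurable_funM.
  rewrite ge0_integralZl_EFin// ge0_integralZl_EFin//; last 2 first.
  - by move=> x Dx; rewrite mule_ge0 ?k0 ?poweR_ge0.
  - exact: emeasurable_funM.
  by rewrite leeD2r// -[leRHS]mule1 lee_wpmul2l.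
have [Boo|] := eqVneq B +oo; first by rewrite Boo leey.
rewrite -ltey -ge0_fin_numE// => /fineK Bfin.
have [A00|A0'] := eqVneq A 0; first by rewrite A00 poweR0r ?gt_eqF.
have [a Aa] : exists a, A = a%:E.
  exists (fine A); rewrite fineK// ge0_fin_numE//.
  by apply: le_lt_trans (kint 1%R ltr01) _; rewrite -Bfin -EFinM -EFinD ltry.
have a0 : (0 < a)%R by rewrite -lte_fin -Aa lt0e A0'.
have := kint _ a0; rewrite Aa -Bfin -EFinM -EFinD poweR_EFin !lee_fin => H.
have {H} : (a / p <= a `^ (1 - p) / p * fine B)%R by lra.
rewrite mulrAC ler_pdivlMr ?mulfVK ?gt_eqF//.
rewrite powRB; last by apply/implyP => _; rewrite gt_eqF.
rewrite powRr1 ?(ltW a0)// -mulrA ler_pMr// mulrC ler_pdivlMr ?powR_gt0// mul1r.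
by [].
Qed.

End integral_tools.

(** * Integration against a measure with a density *)

Section density.
Local Open Scope ereal_scope.
Context dT (T : measurableType dT) (R : realType).
Variables (mu nu : {measure set T -> \bar R}) (w : T -> \bar R).
Hypotheses (mw : measurable_fun setT w) (w0 : forall x, 0 <= w x).
Hypothesis nuE : forall A, measurable A -> nu A = \int[mu]_(x in A) w x.

Import HBNNSimple.

Lemma ge0_integral_density f : measurable_fun setT f -> (forall x, 0 <= f x) ->
  \int[nu]_x f x = \int[mu]_x (w x * f x).
Proof.
move=> mf f0; pose f_ := nnsfun_approx measurableT mf.
have cvgf x : (f_ n x)%:E @[n --> \oo] --> f x.
  by apply: cvg_nnsfun_approx => //.
transitivity (limn (fun n => \int[nu]_x (f_ n x)%:E)).
  rewrite -monotone_convergence//.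
  - by apply: eq_integral => y _; apply/esym/cvg_lim => //; exact: cvgf.
  - by move=> n; exact/measurable_EFinP/measurable_funP.
  - by move=> n y _; rewrite lee_fin.
  - by move=> y _ m n mn; rewrite lee_fin; exact/lefP/nd_nnsfun_approx.
rewrite [X in limn X](_ : _ = (fun n => \int[mu]_x (w x * (f_ n x)%:E))).
  rewrite -monotone_convergence//; last 3 first.
    - move=> n /=; apply: emeasurable_funM => //.
      exact/measurable_EFinP/measurable_funP.
    - by move=> n x _ /=; rewrite mule_ge0 ?lee_fin.
    - move=> x _ m n mn; apply: lee_wpmul2l => //.
      by rewrite lee_fin; exact/lefP/nd_nnsfun_approx.
  apply: eq_integral => x _ /=; apply/cvg_lim => //.
  have : {homo (fun n => (f_ n x)%:E) : m n / (m <= n)%N >-> m <= n}.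
    by move=> m n mn; rewrite lee_fin; exact/lefP/nd_nnsfun_approx.
  (* Multiplication by [+oo] is not continuous at [0]. If [w x = +oo], either [f x = 0] and all
     approximants vanish, or they are eventually positive and the products eventually [+oo]. *)
  have [wfin|] := boolP (w x \is a fin_num).
    by move=> _; apply: cvgeZl.
  rewrite ge0_fin_numE// -leNgt leye_eq => /eqP wx ndf.
  have [fx0|fx0] := eqVneq (f x) 0.
    rewrite fx0 mule0 (_ : (fun n => _) = cst 0); first exact: cvg_cst.
    apply/funext => n; have -> : (f_ n x)%:E = 0; last by rewrite mule0.
    apply/eqP; rewrite eq_le; apply/andP; split; last by rewrite lee_fin.
    rewrite -fx0.
    by apply: (cvge_to_ge (cvgf x)); exists n => // m /= nm; exact: ndf.
  have fxgt0 : 0 < f x by rewrite lt0e fx0 f0.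
  rewrite wx gt0_mulye//; apply: cvg_near_cst.
  have : \forall n \near \oo, 0 < (f_ n x)%:E.
    have [n fn0] : exists n, 0 < (f_ n x)%:E.
      apply: contrapT => /forallNP fn0; move: fxgt0; apply/negP; rewrite -leNgt.
      apply: (cvge_to_le (cvgf x)); apply: nearW => n.
      by rewrite leNgt; apply/negP/fn0.
    by exists n => // m /= nm; apply: lt_le_trans fn0 _; exact: ndf.
  by apply: filterS => n fn0; rewrite gt0_mulye.
apply/funext => n.
transitivity (\sum_(k \in range (f_ n))
    \int[mu]_x (k%:E * (w x * (\1_(f_ n @^-1` [set k]) x)%:E))).
  under eq_integral do rewrite fimfunE -fsumEFin//.
  rewrite ge0_integral_fsum//; last 2 first.
  - by move=> y; exact/measurable_EFinP/measurable_funM.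
  - by move=> y x _; rewrite nnfun_muleindic_ge0.
  apply: eq_fsbigr => r; rewrite inE => -[x _ <-].
  rewrite integralZl_indic_nnsfun// integral_indic//= setIT nuE//.
  rewrite ge0_integralZl_EFin//.
  - congr (_ * _); rewrite integral_mkcond; apply: eq_integral => y _.
    by rewrite epatch_indic.
  - by move=> y _; rewrite mule_ge0 ?lee_fin.
  - by apply: emeasurable_funM => //; exact/measurable_EFinP.
rewrite -ge0_integral_fsum//.
- apply: eq_integral => x _; rewrite [in RHS]fimfunE -fsumEFin//.
  rewrite ge0_mule_fsumr; last by move=> r; rewrite nnfun_muleindic_ge0.
  by apply: eq_fsbigr => r _; rewrite EFinM muleCA.
- move=> r; apply: emeasurable_funM => //; apply: emeasurable_funM => //.
  exact/measurable_EFinP.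
- move=> r x _; rewrite muleCA mule_ge0//.
  by rewrite -EFinM nnfun_muleindic_ge0.
Qed.

End density.

(** * Modulars and Luxemburg norms *)

Section luxemburg.
Local Open Scope ereal_scope.
Context dT (T : measurableType dT) (R : realType) (nu : {measure set T -> \bar R}).
Variable D : set T.
Implicit Types (f g : T -> \bar R) (p : T -> R).

Lemma abseZl (l : R) (x : \bar R) : (0 <= l)%R -> `|l%:E * x| = l%:E * `|x|.
Proof. by move=> l0; rewrite abseM/= ger0_norm. Qed.

Lemma measurable_fun_powR2 (g h : T -> R) : measurable_fun setT g ->
  measurable_fun setT h -> measurable_fun setT (fun x => g x `^ h x)%R.
Proof.
move=> mg mh; rewrite /powR; apply: measurable_fun_ifT.
- exact: measurable_fun_eqr.
- apply: (@measurableT_comp _ _ _ _ _ _ (fun b : bool => b%:R : R)) => //.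
  exact: measurable_fun_eqr.
- apply: measurableT_comp => //; apply: measurable_funM => //.
  exact: measurableT_comp.
Qed.

Lemma measurable_fun_poweR f p : measurable D -> measurable_fun D f ->
  measurable_fun D p -> (forall x, D x -> 0 <= f x) ->
  measurable_fun D (fun x => f x `^ p x).
Proof.
move=> mD /(measurable_restrictT _ mD) mf /(measurable_restrictT _ mD) mp f0.
apply/(measurable_restrictT _ mD).
set f1 := f \_ D in mf; set p1 := p \_ D in mp.
(* Outside [D] both restrictions vanish and [0 ^ 0 = 1]; the indicator restores the value [0]
   there. *)
have -> : (fun x => f x `^ p x) \_ D = (fun x => if f1 x == +oo then
    (if p1 x == 0%R then 1 else +oo) else (fine (f1 x) `^ p1 x)%:E * (\1_D x)%:E).
  apply/funext => x; rewrite /f1 /p1 !patchE indicE.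
  case: (boolP (x \in D)) => xD /=; last by rewrite mule0.
  by have := f0 x (set_mem xD); case: (f x) => //= r _; rewrite mule1.
apply: measurable_fun_ifT; first exact: measurable_fun_eqe.
  by apply: measurable_fun_ifT => //; exact: measurable_fun_eqr.
apply: emeasurable_funM; apply/measurable_EFinP => //.
apply: measurable_fun_powR2 => //.
exact: measurableT_comp (fine_measurable measurableT) mf.
Qed.

Lemma luxnorm_ltP p f (c : \bar R) : luxnorm nu D p f < c ->
  exists l : R, [/\ (0 < l)%R, l%:E < c &
    \int[nu]_(x in D) (`|(l^-1)%:E * f x| `^ p x) <= 1].
Proof. by move=> /ereal_inf_lt[_ [l [l0 lf] <-] lc]; exists l. Qed.

Lemma luxnorm_le p f (l : R) : (0 < l)%R ->
  \int[nu]_(x in D) (`|(l^-1)%:E * f x| `^ p x) <= 1 -> luxnorm nu D p f <= l%:E.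
Proof. by move=> l0 lf; apply: ereal_inf_lbound; exists l. Qed.

Lemma luxnorm_ge0 p f : 0 <= luxnorm nu D p f.
Proof. by apply: le_ereal_inf_tmp => _ [l [l0 _] <-]; rewrite lee_fin ltW. Qed.

Lemma modular_mono p f g : (forall x, D x -> 0 <= p x)%R ->
  (forall x, D x -> `|f x| <= `|g x|) ->
  \int[nu]_(x in D) (`|f x| `^ p x) <= \int[nu]_(x in D) (`|g x| `^ p x).
Proof.
move=> p0 fg; apply: ge0_integral_mono => x Dx; first exact: poweR_ge0.
by rewrite gt0_ler_poweR ?p0// ?in_itv/= ?andbT ?abse_ge0 ?leey ?fg.
Qed.

Lemma luxnorm_gt_modular p f (l : R) : (forall x, D x -> 0 <= p x)%R ->
  luxnorm nu D p f < l%:E ->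
  \int[nu]_(x in D) (`|(l^-1)%:E * f x| `^ p x) <= 1.
Proof.
move=> p0 /luxnorm_ltP[l' [l'0]]; rewrite lte_fin => l'l; apply: le_trans.
apply: modular_mono => // x Dx; rewrite !abseZl ?invr_ge0 ?(ltW l'0)//; last first.
  by rewrite ltW// (lt_trans l'0).
by rewrite lee_wpmul2r// lee_fin lef_pV2 ?posrE ?(ltW l'l)// (lt_trans l'0).
Qed.

(** As [p >= 1] and [C >= 1], dividing the function by [C] divides the modular by at least [C].
    Modular estimates with a constant thus become norm estimates. *)
Lemma luxnorm_le_modular p f (l C : R) : (forall x, D x -> 1 <= p x)%R ->
  measurable D -> measurable_fun D p -> measurable_fun D f -> (0 < l)%R -> (1 <= C)%R ->
  \int[nu]_(x in D) (`|(l^-1)%:E * f x| `^ p x) <= C%:E ->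
  luxnorm nu D p f <= (l * C)%:E.
Proof.
move=> p1 mD mp mf l0 C1 lC; have C0 : (0 < C)%R by exact: lt_le_trans C1.
apply: luxnorm_le; first by rewrite mulr_gt0.
apply: (@le_trans _ _ (\int[nu]_(x in D)
    ((C^-1)%:E * `|(l^-1)%:E * f x| `^ p x))); last first.
  rewrite ge0_integralZl_EFin ?invr_ge0 ?(ltW C0)//; last 2 first.
  - by move=> x _; exact: poweR_ge0.
  - apply: measurable_fun_poweR => //; apply: measurableT_comp => //.
    exact: emeasurable_funM.
  rewrite -[leRHS](_ : (C^-1)%:E * C%:E = 1); last by rewrite -EFinM mulVf ?gt_eqF.
  by rewrite lee_wpmul2l// lee_fin invr_ge0 ltW.
apply: ge0_integral_mono => x Dx; first exact: poweR_ge0.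
rewrite invfM mulrC EFinM -muleA abseZl ?invr_ge0 ?(ltW C0)//.
rewrite poweRM ?lee_fin ?invr_ge0 ?(ltW C0)// lee_wpmul2r ?poweR_ge0//.
by rewrite poweR_EFin lee_fin ge1r_powR ?p1// invr_gt0 C0 invf_le1.
Qed.

Lemma luxnorm_mono p f g : (forall x, D x -> 0 <= p x)%R ->
  (forall x, D x -> `|f x| <= `|g x|) -> luxnorm nu D p f <= luxnorm nu D p g.
Proof.
move=> p0 fg; apply: ereal_inf_le_tmp => _ [l [l0 lg] <-]; exists l => //; split => //.
apply: le_trans lg; apply: modular_mono => // x Dx.
by rewrite !abseZl ?invr_ge0 ?(ltW l0)// lee_wpmul2l ?fg// lee_fin invr_ge0 ltW.
Qed.

Lemma luxnormZ_le p f (c : R) : (0 < c)%R ->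
  luxnorm nu D p (fun x => c%:E * f x) <= c%:E * luxnorm nu D p f.
Proof.
move=> c0; rewrite -lee_pdivrMl//; apply: le_ereal_inf_tmp => _ [l [l0 lf] <-].
rewrite lee_pdivrMl// -EFinM; apply: luxnorm_le; first by rewrite mulr_gt0.
apply: le_trans lf; apply: ge0_integral_mono => x Dx; first exact: poweR_ge0.
by rewrite muleA -EFinM invfM mulrAC mulVf ?gt_eqF// mul1r.
Qed.

(** Only the class of the exponent matters, which permits replacing [p] and [q] by representatives
    whose bounds hold everywhere. *)
Lemma luxnorm_ae_eq p p' f : measurable D -> measurable_fun D f ->
  measurable_fun D p -> measurable_fun D p' ->
  {ae nu, forall x, D x -> p x = p' x} -> luxnorm nu D p f = luxnorm nu D p' f.
Proof.
move=> mD mf mp mp' pp'; rewrite /luxnorm; congr ereal_inf; congr image.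
apply/seteqP; split => l /= [l0 lf]; split => //; apply: le_trans lf;
  rewrite le_eqVlt; apply/orP; left; apply/eqP; apply: ge0_ae_eq_integral => //;
  try (by move=> x _; exact: poweR_ge0);
  try (by apply: measurable_fun_poweR => //; apply: measurableT_comp => //;
        exact: emeasurable_funM);
  by apply: filterS pp' => x pp' Dx; rewrite pp'.
Qed.

End luxemburg.

(** The modular decreases in [l], so [norm < r] amounts to a modular at most [1] at one of the
    countably many levels [r - 1 / (n + 1)]. *)
Lemma measurable_luxnorm d1 d2 (X : measurableType d1) (Y : measurableType d2)
    (R : realType) (nu : {measure set Y -> \bar R}) (D : set Y) (p : Y -> R)
    (F : X -> Y -> \bar R) :
  (forall y, D y -> 0 <= p y) ->
  (forall l : R, 0 < l -> measurable_fun setT (fun x =>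
     \int[nu]_(y in D) (`|(l^-1)%:E * F x y| `^ p y))%E) ->
  measurable_fun setT (fun x => luxnorm nu D p (F x)).
Proof.
move=> p0 mF; apply: (measurability _ (ErealGenInftyO.measurableE R)) => //.
move=> /= _ [_ [r ->] <-]; rewrite setTI.
rewrite (_ : _ @^-1` _ = \bigcup_n [set x | 0 < r - n.+1%:R^-1 /\
    (\int[nu]_(y in D) (`|((r - n.+1%:R^-1)^-1)%:E * F x y| `^ p y) <= 1)%E]).
  apply: bigcup_measurable => n _; case: (ltP 0 (r - n.+1%:R^-1)) => rn.
    rewrite (_ : mkset _ = setT `&` [set x | (\int[nu]_(y in D)
        (`|((r - n.+1%:R^-1)^-1)%:E * F x y| `^ p y) <= 1)%E]).
      by apply: emeasurable_fun_infty_c => //; exact: mF.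
    by apply/seteqP; split => [x [_ ?]|x [_ ?]].
  by rewrite (_ : mkset _ = set0)//; apply/seteqP; split => // x [] /=.
apply/seteqP; split => [x|x [n _ [rn Fn]]] /=.
  rewrite in_itv/= => /luxnorm_ltP[l [l0 lr Fl]].
  have lr' : 0 < r - l by rewrite subr_gt0 -lte_fin.
  exists (Num.truncn (r - l)^-1) => //=.
  have nl : l <= r - (Num.truncn (r - l)^-1).+1%:R^-1.
    by rewrite lerBrDl -lerBrDr invf_ple ?posrE// ltW// truncnS_gt.
  have rn : 0 < r - (Num.truncn (r - l)^-1).+1%:R^-1 by exact: lt_le_trans nl.
  split => //; apply: le_trans Fl; apply: modular_mono => // y Dy.
  rewrite !abseZl ?invr_ge0 ?(ltW l0) ?(ltW rn)// lee_wpmul2r// lee_fin.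
  by rewrite lef_pV2.
rewrite in_itv/=; apply: le_lt_trans (luxnorm_le rn Fn) _.
by rewrite lte_fin ltrBlDr ltrDl invr_gt0.
Qed.

(** * Tonelli's theorem on product sets *)

Section tonelli_on_sets.
Local Open Scope ereal_scope.
Context d1 d2 (X : measurableType d1) (Y : measurableType d2) (R : realType).
Variables (m1 : {sigma_finite_measure set X -> \bar R}).
Variables (m2 : {sigma_finite_measure set Y -> \bar R}).
Variables (A : set X) (B : set Y) (f : X * Y -> \bar R).
Hypotheses (mA : measurable A) (mB : measurable B).
Hypothesis mf : measurable_fun (A `*` B) f.
Hypothesis f0 : forall x y, A x -> B y -> 0 <= f (x, y).

Let F := f \_ (A `*` B).

Let mF : measurable_fun setT F.
Proof. by apply/(measurable_restrictT _ _).1 => //; exact: measurableX. Qed.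

Let F0 p : 0 <= F p.
Proof. by apply: erestrict_ge0 => -[x y] [/= Ax By]; exact: f0. Qed.

Let FE x y : F (x, y) = if (x \in A) && (y \in B) then f (x, y) else 0.
Proof. by rewrite /F patchE in_setX. Qed.

Lemma measurable_integral_on : measurable_fun A (fun x => \int[m2]_(y in B) f (x, y)).
Proof.
apply: (@eq_measurable_fun _ _ _ _ _ (fun x => \int[m2]_y F (x, y))).
  move=> x xA; rewrite [RHS]integral_mkcond; apply: eq_integral => y _.
  by rewrite FE xA patchE.
by apply: measurable_funTS; exact: measurable_fun_fubini_tonelli_F.
Qed.

Lemma tonelli_on : \int[m1]_(x in A) \int[m2]_(y in B) f (x, y) =
  \int[m2]_(y in B) \int[m1]_(x in A) f (x, y).
Proof.
have -> : \int[m1]_(x in A) \int[m2]_(y in B) f (x, y) =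
    \int[m1]_x \int[m2]_y F (x, y).
  rewrite integral_mkcond; apply: eq_integral => x _; rewrite patchE.
  case: ifPn => xA.
    by rewrite integral_mkcond; apply: eq_integral => y _; rewrite FE xA patchE.
  by rewrite integral0_eq// => y _; rewrite FE (negbTE xA).
rewrite fubini_tonelli//.
rewrite [RHS]integral_mkcond; apply: eq_integral => y _; rewrite patchE.
case: ifPn => yB.
  by rewrite [RHS]integral_mkcond; apply: eq_integral => x _; rewrite FE yB andbT patchE.
by rewrite integral0_eq// => x _; rewrite FE (negbTE yB) andbF.
Qed.

End tonelli_on_sets.
Arguments tonelli_on {d1 d2 X Y R} m1 m2 {A B} f.
Arguments measurable_integral_on {d1 d2 X Y R} m2 {A B} f.

(** * Translations and integrals of powers on the line *)

Section line_integrals.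
Context {R : realType}.
Local Notation mu := (@lebesgue_measure R).

Lemma ge0_integral_shift (c : R) (f : R -> \bar R) : measurable_fun setT f ->
  (forall x, 0 <= f x)%E -> (\int[mu]_x f (c + x)%R = \int[mu]_x f x)%E.
Proof.
move=> mf f0; pose phi0 : measurableTypeR R -> measurableTypeR R := fun x => c + x.
have mphi : measurable_fun setT phi0 by exact: measurable_funD.
pose phi : {mfun measurableTypeR R >-> measurableTypeR R} :=
  HB.pack phi0 (isMeasurableFun.Build _ _ _ _ phi0 mphi).
transitivity (\int[pushforward mu phi]_x f x)%E.
  by rewrite (ge0_integral_pushforward mphi)// => x _; exact: f0.
apply: eq_measure_integral => //= A mA _; apply/esym.
apply: (@lebesgue_measure_unique _ (pushforward mu phi)) => //= _ [[a b]] _ <-.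
rewrite /pushforward (_ : _ @^-1` _ = `]a - c, b - c]%classic); last first.
  by apply/seteqP; split => x /=; rewrite !in_itv/= /phi0 ltrBlDl lerBrDl.
rewrite [X in X = _]lebesgue_measure_itv [X in _ = X]lebesgue_measure_itv/=.
by rewrite !lte_fin ltrD2r -!EFinB opprB addrA subrK.
Qed.

Lemma ge0_integral_itv_shift (c a b : R) (f : R -> \bar R) : measurable_fun setT f ->
  (forall x, 0 <= f x)%E ->
  (\int[mu]_(x in `]a, b]) f (c + x)%R = \int[mu]_(x in `](c + a)%R, (c + b)%R]) f x)%E.
Proof.
move=> mf f0; rewrite [RHS]integral_mkcond -(ge0_integral_shift c); last 2 first.
- exact/(measurable_restrictT _ _).1/measurable_funTS.
- by apply: erestrict_ge0.
rewrite [LHS]integral_mkcond; apply: eq_integral => x _; rewrite !patchE.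
by rewrite !mem_setE/= !in_itv/= ltrD2l lerD2l.
Qed.

Lemma is_derive_powR (e t : R) : 0 < t ->
  is_derive t (1 : R) (fun x : R => x `^ e) (e * t `^ (e - 1)).
Proof.
move=> t0; have tin : t \in `]0, +oo[%R by rewrite in_itv/= t0.
by apply: DeriveDef; [exact: derivable_powR|rewrite -derive1E powR_derive1].
Qed.

Lemma continuous_powR (e t : R) : 0 < t -> {for t, continuous (fun x : R => x `^ e)}.
Proof.
move=> t0; apply/differentiable_continuous/derivable1_diffP.
by have [] := is_derive_powR e t0.
Qed.

Lemma is_derive_powRZ (c e t : R) : 0 < t ->
  is_derive t (1 : R) (fun x : R => c * x `^ e) (c * (e * t `^ (e - 1))).
Proof.
move=> t0; have := @is_deriveZ R R^o R^o (fun x => x `^ e) c t 1 _ (is_derive_powR e t0).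
by [].
Qed.

Lemma cvg_powRN (c : R) : 0 < c -> x `^ (- c) @[x --> +oo] --> (0 : R).
Proof.
move=> c0; apply/cvgrPdist_le => e e0; near=> x.
have x0 : 0 < x by near: x; exact: nbhs_pinfty_gt.
rewrite sub0r normrN ger0_norm ?powR_ge0// powRN invf_ple ?posrE ?powR_gt0//.
have -> : e^-1 = (e^-1 `^ c^-1) `^ c.
  by rewrite -powRrM mulVf ?gt_eqF// powRr1// invr_ge0 ltW.
rewrite ge0_ler_powR ?nnegrE ?powR_ge0 ?(ltW c0) ?(ltW x0)//.
Unshelve. all: end_near. Qed.

Lemma continuous_powRZ (c e t : R) : 0 < t ->
  {for t, continuous (fun x : R => c * x `^ e)}.
Proof.
move=> t0; apply/differentiable_continuous/derivable1_diffP.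
by have [] := is_derive_powRZ c e t0.
Qed.

Lemma integral_powR_bounded (c a b : R) : c != 0 -> 0 < a -> a <= b ->
  (\int[mu]_(t in `[a, b]) (t `^ (c - 1))%:E = ((b `^ c - a `^ c) / c)%:E)%E.
Proof.
move=> c0 a0; rewrite le_eqVlt => /predU1P[<-|ab].
  by rewrite set_itv1 integral_set1 subrr mul0r.
rewrite (@continuous_FTC2 _ _ (fun x : R => c^-1 * x `^ c))//.
- by rewrite -EFinB; congr EFin; field.
- apply: continuous_in_subspaceT => x /[!inE]/=; rewrite in_itv/= => /andP[ax _].
  by apply: continuous_powR; exact: lt_le_trans ax.
- split.
  + move=> x; rewrite in_itv/= => /andP[ax _].
    by have [] := is_derive_powRZ c^-1 c (lt_trans a0 ax).
  + by apply: cvg_at_right_filter; exact: continuous_powRZ.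
  + by apply: cvg_at_left_filter; apply: continuous_powRZ; exact: lt_trans ab.
- move=> x; rewrite in_itv/= => /andP[ax _].
  have [_ dE] := is_derive_powRZ c^-1 c (lt_trans a0 ax).
  by rewrite derive1E dE mulKf.
Qed.

Lemma integral_powR_near0 (c b : R) : 0 < c -> 0 <= b ->
  (\int[mu]_(t in `]0%R, b]) (t `^ (c - 1))%:E = (b `^ c / c)%:E)%E.
Proof.
move=> c0; rewrite le_eqVlt => /predU1P[<-|b0].
  by rewrite set_itv_ge ?bnd_simp ?ltxx// integral_set0 powR0 ?mul0r// gt_eqF.
have cnz : c != 0 by rewrite gt_eqF.
pose F n := `[b / n.+1%:R, b]%classic : set R.
have UF : \bigcup_n F n = `]0, b]%classic.
  apply/seteqP; split => [x [n _]|x]; rewrite /F/= !in_itv/=.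
    by move=> /andP[nx ->]; rewrite (lt_le_trans _ nx)// divr_gt0.
  move=> /andP[x0 xb]; exists (Num.truncn (b / x)) => //=; rewrite in_itv/= xb andbT.
  by rewrite ler_pdivrMr// mulrC -ler_pdivrMr// ltW// truncnS_gt.
have ndF : {homo F : n m / (n <= m)%N >-> (n <= m)%O}.
  move=> n m nm; apply/subsetPset; apply: subset_itvr; rewrite bnd_simp.
  by rewrite ler_pM2l// lef_pV2 ?posrE ?ltr0n// ler_nat ltnS.
have mp D : measurable_fun D (fun t : R => (t `^ (c - 1))%:E).
  by apply/measurable_EFinP; apply: measurable_funTS; exact: measurable_powR.
have H : (\int[mu]_(x in F n) (x `^ (c - 1))%:E)%E @[n --> \oo] -->
    (\int[mu]_(x in \bigcup_n F n) (x `^ (c - 1))%:E)%E.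
  apply: ge0_nondecreasing_set_cvg_integral => //.
  - by move=> n; exact: measurable_itv.
  - by move=> n; exact: mp.
  - by move=> n x _; rewrite lee_fin powR_ge0.
rewrite -UF -(cvg_lim _ H)//; apply/cvg_lim => //.
rewrite (_ : (fun n => _) = (fun n => ((b `^ c - b `^ c * n.+1%:R `^ (- c)) / c)%:E)).
  apply: cvg_EFin; first exact: nearW.
  rewrite /= -[X in _ --> X / c]subr0 -[in X in _ --> X](mulr0 (b `^ c)).
  apply: cvgMl; apply: cvgB; first exact: cvg_cst.
  apply: cvgMr; apply: (cvg_comp (fun n => n.+1%:R : R) (fun x => x `^ (- c))) (cvg_powRN c0).
  by have := @cvgr_idn R; rewrite -(cvg_shiftS _ _).
apply/funext => n; rewrite integral_powR_bounded//; last 2 first.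
- by rewrite divr_gt0.
- by rewrite ler_pdivrMr// ler_peMr ?ler1n// ltW.
congr ((_ - _) / _)%:E; rewrite powRM ?invr_ge0 ?(ltW b0)//.
by rewrite -powR_inv1// -powRrM mulN1r.
Qed.

Lemma integral_powR_infty (c a : R) : 0 < c -> 0 < a ->
  (\int[mu]_(t in `[a, +oo[) (t `^ (- c - 1))%:E = (a `^ (- c) / c)%:E)%E.
Proof.
move=> c0 a0; have cnz : c != 0 by rewrite gt_eqF.
rewrite (@ge0_continuous_FTC2y _ _ (fun t : R => - c^-1 * t `^ (- c)) a 0).
- by rewrite sub0e -EFinN; congr EFin; field.
- by move=> x _; exact: powR_ge0.
- apply: continuous_in_subspaceT => x /[!inE]/=; rewrite in_itv/= andbT => ax.
  by apply: continuous_powR; exact: lt_le_trans ax.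
- by rewrite -(mulr0 (- c^-1)); apply: cvgMr; exact: cvg_powRN.
- by move=> x ax; have [] := is_derive_powRZ (- c^-1) (- c) (lt_trans a0 ax).
- by apply: cvg_at_right_filter; exact: continuous_powRZ.
- move=> x; rewrite in_itv/= andbT => ax.
  have [_ dE] := is_derive_powRZ (- c^-1) (- c) (lt_trans a0 ax).
  by rewrite derive1E dE mulrA mulrNN mulVf// mul1r.
Qed.

End line_integrals.

(** * The Mehler kernel *)

Section gauss_line.
Context {R : realType}.
Implicit Types a b c : R.

(** Completing the square gives a multiple of the normal density of mean [b / a] and variance
    [1 / (2 a)]. *)
Lemma integral_expR_quadratic a b c : 0 < a ->
  (\int[lebesgue_measure]_x (expR (- (a * x ^+ 2 - 2 * b * x + c)))%:E =
   (Num.sqrt (pi / a) * expR (b ^+ 2 / a - c))%:E)%E.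
Proof.
move=> a0; set m := b / a; set s := Num.sqrt (2 * a)^-1.
have a20 : 0 < (2 * a)^-1 by rewrite invr_gt0 mulr_gt0.
have s0 : s != 0 by rewrite gt_eqF// sqrtr_gt0.
have s2 : s ^+ 2 = (2 * a)^-1 by rewrite sqr_sqrtr ?ltW.
have anz : a != 0 by rewrite gt_eqF.
have pia : 0 < pi / a by rewrite divr_gt0 ?pi_gt0.
have peak : normal_peak s = (Num.sqrt (pi / a))^-1.
  by rewrite /normal_peak s2; congr (Num.sqrt _)^-1; rewrite -mulr_natr; field.
have E x : (expR (- (a * x ^+ 2 - 2 * b * x + c)))%:E =
    ((Num.sqrt (pi / a) * expR (b ^+ 2 / a - c))%:E * (normal_pdf m s x)%:E)%E.
  rewrite normal_pdfE// /normal_fun peak -EFinM; congr EFin.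
  rewrite mulrACA mulfV ?mul1r; last by rewrite gt_eqF// sqrtr_gt0.
  rewrite -expRD; congr expR; rewrite s2 /m -mulr_natr; field.
  by rewrite anz.
under eq_integral do rewrite E.
rewrite ge0_integralZl_EFin//=; last 2 first.
- by move=> x _; rewrite lee_fin normal_pdf_ge0.
- by apply/measurable_EFinP; exact: measurable_normal_pdf.
by rewrite integral_normal_pdf mule1.
Qed.

End gauss_line.

Section tuple_products.
Context {R : realType}.
Local Open Scope ereal_scope.

Lemma ge0_integral_lebesgue_tupleS n (f : n.+1.-tuple R -> \bar R) :
  measurable_fun setT f -> (forall x, 0 <= f x) ->
  \int[lebesgue_tuple n.+1]_x f x =
  \int[lebesgue_measure]_a \int[lebesgue_tuple n]_y f (tcons (a, y)).
Proof.
move=> mf f0.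
rewrite [LHS](_ : _ = \int[pushforward (lebesgue_measure \x lebesgue_tuple n)
  (@tcons R n)]_x f x)//.
rewrite ge0_integral_pushforward//; last exact: measurable_tcons.
rewrite preimage_setT fubini_tonelli1//; last by move=> x; exact: f0.
by apply: measurableT_comp => //; exact: measurable_tcons.
Qed.

Lemma integral_lebesgue_tuple_prod n (f : 'I_n -> R -> R) (c : 'I_n -> R) :
  (forall i, measurable_fun setT (f i)) -> (forall i x, 0 <= f i x)%R ->
  (forall i, \int[lebesgue_measure]_x (f i x)%:E = (c i)%:E) ->
  \int[lebesgue_tuple n]_x (\prod_i f i (tnth x i))%:E = (\prod_i c i)%:E.
Proof.
elim: n f c => [|n IH] f c mf f0 fc.
  under eq_integral do rewrite big_ord0.
  by rewrite big_ord0 integral_cst// mul1e/= diracT.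
rewrite ge0_integral_lebesgue_tupleS; last 2 first.
- apply/measurable_EFinP; apply: measurable_prod => i _.
  by apply: measurableT_comp => //; exact: measurable_tnth.
- by move=> x; rewrite lee_fin prodr_ge0.
have E a y : (\prod_(i < n.+1) f i (tnth (tcons (a, y)) i))%:E =
    (f ord0 a)%:E * (\prod_(i < n) f (lift ord0 i) (tnth y i))%:E.
  rewrite -EFinM big_ord_recl; congr (_ * _)%:E.
  apply: eq_bigr => i _; congr (f _ _).
  by rewrite (tnth_nth 0%R)/= (tnth_nth 0%R).
transitivity (\int[lebesgue_measure]_a ((\prod_(i < n) c (lift ord0 i))%:E * (f ord0 a)%:E)).
  apply: eq_integral => a _; under eq_integral do rewrite E.
  rewrite ge0_integralZl_EFin ?f0//; last 2 first.
  - by move=> y _; rewrite lee_fin prodr_ge0.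
  - apply/measurable_EFinP; apply: measurable_prod => i _.
    by apply: measurableT_comp => //; exact: measurable_tnth.
  by rewrite (IH (fun i => f (lift ord0 i)) (fun i => c (lift ord0 i)))// muleC.
have c0 i : (0 <= c i)%R.
  by rewrite -lee_fin -fc; apply: integral_ge0 => x _; rewrite lee_fin.
rewrite ge0_integralZl_EFin ?prodr_ge0//; last 2 first.
- by move=> y _; rewrite lee_fin.
- by apply/measurable_EFinP; exact: mf.
by rewrite fc -EFinM mulrC big_ord_recl.
Qed.

End tuple_products.

(** * Gaussian integrals and the Mehler kernel *)

Section gaussian.
Context {R : realType} {d : nat}.
Implicit Types x y z : d.-tuple R.

Lemma innerC x y : inner x y = inner y x.
Proof. by apply: eq_bigr => i _; rewrite mulrC. Qed.

Lemma inner_ge0 x : 0 <= inner x x.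
Proof. by apply: sumr_ge0 => i _; rewrite -expr2 sqr_ge0. Qed.

Lemma enormX2 x : enorm x ^+ 2 = inner x x.
Proof. by rewrite sqr_sqrtr// inner_ge0. Qed.

Lemma gauss_density_prod x :
  gauss_density x = \prod_i (Num.sqrt pi^-1 * expR (- tnth x i ^+ 2)).
Proof.
rewrite /gauss_density big_split/= -expR_sum sumrN enormX2; congr (_ * expR (- _)).
  rewrite big_const_ord iter_mulr_1 -powR12_sqrt ?invr_ge0 ?pi_ge0//.
  by rewrite -powR_mulrn ?powR_ge0// -powRrM -[pi^-1]powR_inv1 ?pi_ge0// -powRrM; congr powR; lra.
Qed.

Lemma ge0_integral_gauss (f : d.-tuple R -> \bar R) : measurable_fun setT f ->
  (forall x, 0 <= f x)%E ->
  (\int[gauss_measure d]_x f x =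
   \int[lebesgue_tuple d]_x ((gauss_density x)%:E * f x))%E.
Proof.
move=> mf f0; apply: ge0_integral_density => //.
- by apply/measurable_EFinP; exact: measurable_gauss_density.
- by move=> x; rewrite lee_fin gauss_density_ge0.
Qed.

(** The Gaussian density adds [1] to the quadratic coefficient, which is why [a i - 1] appears in
    the integrand. The total mass, the exponential moments, the mass of the Mehler kernel and its
    semigroup law are all instances. *)
Lemma integral_gauss_quadratic (k a b c : 'I_d -> R) (f : d.-tuple R -> R) :
  (forall i, 0 <= k i) -> (forall i, 0 < a i) ->
  (forall x, f x = \prod_i (k i *
    expR (- ((a i - 1) * tnth x i ^+ 2 - 2 * b i * tnth x i + c i)))) ->
  (\int[gauss_measure d]_x (f x)%:E =
   (\prod_i (k i * (Num.sqrt (a i))^-1 * expR (b i ^+ 2 / a i - c i)))%:E)%E.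
Proof.
move=> k0 a0 fE.
have mq (i : 'I_d) (e : R) : measurable_fun setT
    (fun t : R => expR (- (e * t ^+ 2 - 2 * b i * t + c i))).
  apply: measurableT_comp => //; apply: measurableT_comp => //.
  apply: measurable_funD => //; apply: measurable_funB => //.
  by apply: measurable_funM => //; exact: measurable_funX.
have mf : measurable_fun setT f.
  rewrite (funext fE); apply: measurable_prod => i _.
  apply: (@measurableT_comp _ _ _ _ _ _
    (fun t : R => k i * expR (- ((a i - 1) * t ^+ 2 - 2 * b i * t + c i)))) => //; last exact: measurable_tnth.
  exact: measurable_funM.
rewrite ge0_integral_gauss; last 2 first.
- exact/measurable_EFinP.
- by move=> x; rewrite lee_fin fE prodr_ge0// => i _; rewrite mulr_ge0 ?expR_ge0.
rewrite -(@integral_lebesgue_tuple_prod _ _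
   (fun i (t : R) => k i * Num.sqrt pi^-1 * expR (- (a i * t ^+ 2 - 2 * b i * t + c i)))).
- apply: eq_integral => x _; rewrite -EFinM; congr EFin.
  rewrite gauss_density_prod fE -big_split/=; apply: eq_bigr => i _.
  rewrite mulrACA (mulrC (Num.sqrt _)) -expRD.
  by congr (_ * expR _); ring.
- by move=> i; apply: measurable_funM.
- by move=> i x; rewrite !mulr_ge0 ?sqrtr_ge0 ?expR_ge0.
- move=> i; under eq_integral do rewrite EFinM.
  rewrite ge0_integralZl_EFin ?mulr_ge0 ?sqrtr_ge0//; last first.
  + by apply/measurable_EFinP; exact: mq.
  rewrite integral_expR_quadratic// -EFinM; congr EFin; rewrite mulrA; congr (_ * _).
  rewrite -mulrA; congr (_ * _).
  rewrite -sqrtrM ?invr_ge0 ?pi_ge0// mulrA mulVf ?gt_eqF ?pi_gt0// mul1r.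
  by rewrite sqrtrV// ltW.
Qed.

Lemma gauss_measureT : gauss_measure d [set: d.-tuple R] = 1%E.
Proof.
rewrite -[LHS]mul1e -integral_cst//.
rewrite (@integral_gauss_quadratic (fun=> 1) (fun=> 1) (fun=> 0) (fun=> 0) (cst 1))//.
  rewrite big1// => i _.
  by rewrite sqrtr1 invr1 expr0n/= mul0r subr0 expR0 !mulr1.
move=> x; rewrite big1// => i _.
by rewrite subrr !mulr0 !mul0r subr0 addr0 oppr0 expR0 mulr1.
Qed.

HB.instance Definition _ := Measure_isProbability.Build _ _ _
  (gauss_measure d) gauss_measureT.

Lemma integral_gauss_expR (k : R) : k < 1 ->
  (\int[gauss_measure d]_x (expR (k * enorm x ^+ 2))%:E =
   ((Num.sqrt (1 - k))^-1 ^+ d)%:E)%E.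
Proof.
move=> k1.
rewrite (@integral_gauss_quadratic (fun=> 1) (fun=> 1 - k) (fun=> 0) (fun=> 0))//.
- congr EFin; rewrite (eq_bigr (fun=> (Num.sqrt (1 - k))^-1)).
    by rewrite big_const_ord iter_mulr_1.
  by move=> i _; rewrite expr0n/= mul0r subr0 expR0 mulr1 mul1r.
- by move=> _; rewrite subr_gt0.
- move=> x; rewrite enormX2 mulr_sumr expR_sum; apply: eq_bigr => i _.
  by rewrite mul1r; congr expR; ring.
Qed.

(** The kernel of the Ornstein-Uhlenbeck semigroup relative to the Gaussian measure, normalising
    factor included; relative to this measure it is symmetric. *)
Definition mehler (r : R) x y : R :=
  (1 - expR (- (2 * r))) `^ (- (d%:R / 2)) *
  expR (- ((expR (- (2 * r)) * (enorm x ^+ 2 + enorm y ^+ 2)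
             - 2 * expR (- r) * inner x y) / (1 - expR (- (2 * r))))).

Lemma mehler_ge0 r x y : 0 <= mehler r x y.
Proof. by rewrite mulr_ge0 ?powR_ge0 ?expR_ge0. Qed.

Lemma mehlerC r x y : mehler r x y = mehler r y x.
Proof. by rewrite /mehler (addrC (enorm x ^+ 2)) innerC. Qed.

Lemma expR2N (r : R) : expR (- (2 * r)) = expR (- r) ^+ 2.
Proof. by rewrite expr2 -expRD; congr expR; ring. Qed.

Lemma expRN_lt1 (r : R) : 0 < r -> 0 < 1 - expR (- r) ^+ 2.
Proof.
by move=> r0; rewrite subr_gt0 -expR2N expR_lt1 oppr_lt0 mulr_gt0.
Qed.

Lemma mehler_prod r x y : 0 < r -> mehler r x y =
  \prod_i ((Num.sqrt (1 - expR (- r) ^+ 2))^-1 *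
    expR (- ((expR (- r) ^+ 2 * (tnth x i ^+ 2 + tnth y i ^+ 2)
       - 2 * expR (- r) * (tnth x i * tnth y i)) / (1 - expR (- r) ^+ 2)))).
Proof.
move=> r0; rewrite /mehler !expR2N big_split/= -expR_sum; congr (_ * expR _).
  have s0 := ltW (expRN_lt1 r0).
  rewrite big_const_ord iter_mulr_1 -powR12_sqrt// -powRN.
  by rewrite -[RHS]powR_mulrn ?powR_ge0// -powRrM; congr powR; lra.
rewrite sumrN -mulr_suml sumrB -!mulr_sumr big_split/= !enormX2 /inner.
by congr (- ((_ * (_ + _) - _) / _)); apply: eq_bigr => i _; rewrite expr2.
Qed.

Lemma measurable_inner dZ (Z : measurableType dZ) (g h : Z -> d.-tuple R) :
  measurable_fun setT g -> measurable_fun setT h ->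
  measurable_fun setT (fun w => inner (g w) (h w)).
Proof.
move=> mg mh; apply: measurable_sum => i; apply: measurable_funM.
- by apply: (@measurableT_comp _ _ _ _ _ _ (fun t => tnth t i)) => //; exact: measurable_tnth.
- by apply: (@measurableT_comp _ _ _ _ _ _ (fun t => tnth t i)) => //; exact: measurable_tnth.
Qed.

Lemma measurable_invr dZ (Z : measurableType dZ) (f : Z -> R) :
  measurable_fun setT f -> measurable_fun setT (fun w => (f w)^-1).
Proof.
move=> mf; rewrite (_ : (fun _ => _) = (fun w => if f w < 0
    then - ((- f w) `^ (-1)) else f w `^ (-1))).
  apply: measurable_fun_ifT; first exact: measurable_fun_ltr.
    apply: measurableT_comp => //.
    by apply: (measurableT_comp (measurable_powR _)); exact: measurableT_comp.
  exact: (measurableT_comp (measurable_powR _)).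
apply/funext => w; case: ltP => [f0|f0]; last by rewrite powR_inv1.
by rewrite powR_inv1 ?oppr_ge0 ?(ltW f0)// invrN opprK.
Qed.

Lemma measurable_mehler dZ (Z : measurableType dZ) (f : Z -> R)
    (g h : Z -> d.-tuple R) : measurable_fun setT f ->
  measurable_fun setT g -> measurable_fun setT h ->
  measurable_fun setT (fun w => mehler (f w) (g w) (h w)).
Proof.
move=> mf mg mh; have me (c : R) : measurable_fun setT (fun w => expR (- (c * f w))).
  by apply: measurableT_comp => //; apply: measurableT_comp => //; exact: measurable_funM.
have me1 : measurable_fun setT (fun w => expR (- f w)).
  by apply: measurableT_comp => //; exact: measurableT_comp.
have m1 : measurable_fun setT (fun w => 1 - expR (- (2 * f w))).
  exact: measurable_funB.
apply: measurable_funM.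
  exact: (measurableT_comp (measurable_powR _)).
apply: measurableT_comp => //; apply: measurableT_comp => //.
apply: measurable_funM; last exact: measurable_invr.
under eq_fun do rewrite !enormX2.
apply: measurable_funB; apply: measurable_funM => //.
- by apply: measurable_funD; exact: measurable_inner.
- exact: measurable_funM.
- exact: measurable_inner.
Qed.

Lemma mehler_mass r x : 0 < r ->
  (\int[gauss_measure d]_y (mehler r x y)%:E = 1)%E.
Proof.
move=> r0; have s0 := expRN_lt1 r0; set u := expR (- r) in s0 *.
have snz : 1 - u ^+ 2 != 0 by rewrite gt_eqF.
rewrite (@integral_gauss_quadratic (fun=> (Num.sqrt (1 - u ^+ 2))^-1)
  (fun=> (1 - u ^+ 2)^-1) (fun i => u * tnth x i / (1 - u ^+ 2))
  (fun i => u ^+ 2 * tnth x i ^+ 2 / (1 - u ^+ 2))).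
- rewrite big1// => i _.
  rewrite sqrtrV ?(ltW s0)// invrK mulVf ?gt_eqF ?sqrtr_gt0// mul1r.
  by rewrite -[RHS]expR0; congr expR; field.
- by move=> i; rewrite invr_ge0 sqrtr_ge0.
- by move=> i; rewrite invr_gt0.
- move=> y; rewrite mehler_prod//; apply: eq_bigr => i _; congr (_ * expR (- _)).
  by rewrite -/u; field.
Qed.

Lemma mehler_comp r s x y : 0 < r -> 0 < s ->
  (\int[gauss_measure d]_z (mehler r x z * mehler s z y)%:E =
   (mehler (r + s) x y)%:E)%E.
Proof.
move=> r0 s0; have u0 := expRN_lt1 r0; have v0 := expRN_lt1 s0.
have uv0 := expRN_lt1 (addr_gt0 r0 s0).
have uvE : expR (- (r + s)) = expR (- r) * expR (- s) by rewrite opprD expRD.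
rewrite uvE in uv0.
(* With [u = exp (- r)] and [v = exp (- s)], the quadratic coefficient in [z] is
   [1 + u^2 / (1 - u^2) + v^2 / (1 - v^2)], which equals [(1 - (u v)^2) / ((1 - u^2) (1 - v^2))];
   the linear coefficients collect the two cross terms. *)
rewrite (@integral_gauss_quadratic
  (fun=> (Num.sqrt (1 - expR (- r) ^+ 2))^-1 * (Num.sqrt (1 - expR (- s) ^+ 2))^-1)
  (fun=> (1 - (expR (- r) * expR (- s)) ^+ 2) /
      ((1 - expR (- r) ^+ 2) * (1 - expR (- s) ^+ 2)))
  (fun i => expR (- r) * tnth x i / (1 - expR (- r) ^+ 2) +
      expR (- s) * tnth y i / (1 - expR (- s) ^+ 2))
  (fun i => expR (- r) ^+ 2 * tnth x i ^+ 2 / (1 - expR (- r) ^+ 2) +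
      expR (- s) ^+ 2 * tnth y i ^+ 2 / (1 - expR (- s) ^+ 2))).
- congr EFin; rewrite mehler_prod ?addr_gt0// uvE; apply: eq_bigr => i _.
  set u := expR (- r) in u0 uv0 *; set v := expR (- s) in v0 uv0 *.
  have unz : 1 - u ^+ 2 != 0 by rewrite gt_eqF.
  have vnz : 1 - v ^+ 2 != 0 by rewrite gt_eqF.
  have uvnz : 1 - (u * v) ^+ 2 != 0 by rewrite gt_eqF.
  congr (_ * expR _).
    rewrite -invfM -sqrtrM ?(ltW u0)// -invfM -sqrtrM ?mulr_ge0 ?(ltW u0) ?(ltW v0)//.
    by congr (Num.sqrt _)^-1; field; rewrite unz vnz.
  by field; rewrite unz vnz uvnz.
- by move=> i; rewrite mulr_ge0 ?invr_ge0 ?sqrtr_ge0.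
- by move=> i; rewrite divr_gt0 ?mulr_gt0.
- move=> z; rewrite !mehler_prod// -big_split/=; apply: eq_bigr => i _.
  rewrite mulrACA; congr (_ * _); rewrite -[LHS]expRD; congr expR.
  set u := expR (- r) in u0 *; set v := expR (- s) in v0 *.
  have unz : 1 - u ^+ 2 != 0 by rewrite gt_eqF.
  have vnz : 1 - v ^+ 2 != 0 by rewrite gt_eqF.
  by rewrite expr2; field; rewrite unz vnz.
Qed.

End gaussian.

(** * Decreasing changes of variables on the half-line *)

Section substitution.
Context {R : realType}.
Local Notation mu := (@lebesgue_measure R).
Implicit Types (F dF G : R -> R) (E : set R).

(** On each [[1 / (n + 1), n + 1]] this is the substitution rule for compact intervals; both sides
    then increase to the full integrals. The image [E] may be a half-line, a line or a bounded
    interval, as the three uses below require. *)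
Lemma substitution_posline F dF G E : measurable E ->
  (forall u : R, 0 < u -> derivable F u (1 : R) /\ 'D_1 F u = dF u) ->
  (forall u : R, 0 < u -> dF u < 0) ->
  (forall u : R, 0 < u -> {for u, continuous dF}) ->
  (forall z, E z <-> exists2 u : R, 0 < u & F u = z) ->
  (forall a b z, E a -> E b -> a <= z <= b -> E z) ->
  (forall z, E z -> 0 <= G z) -> (forall z, E z -> {for z, continuous G}) ->
  (\int[mu]_(z in E) (G z)%:E = \int[mu]_(u in posline) (G (F u) * - dF u)%:E)%E.
Proof.
move=> mE FdF dF0 cdF EF Eitv G0 cG.
have derF (u : R) : 0 < u -> derivable F u 1 by move=> u0; have [] := FdF _ u0.
have F'E (u : R) : 0 < u -> derive1 F u = dF u.
  by move=> u0; have [_ H] := FdF _ u0; rewrite derive1E H.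
have cF (u : R) : 0 < u -> {for u, continuous F}.
  by move=> u0; exact/differentiable_continuous/derivable1_diffP/derF.
pose a n : R := n.+1%:R^-1; pose b n : R := n.+1%:R.
have a0 n : 0 < a n by rewrite invr_gt0.
have b0 n : 0 < b n by rewrite /b ltr0n.
have ab n : a n <= b n by rewrite (@le_trans _ _ 1)// ?invf_le1 ?ler1n.
have posP u : posline u = (0 < u) :> Prop by rewrite /posline/= in_itv/= andbT.
pose A n := `[a n, b n]%classic : set R; pose B n := `[F (b n), F (a n)]%classic : set R.
have Fdec u v : 0 < u -> u < v -> F v < F u.
  move=> u0 uv; apply: (@ltr0_derive1_lt_cc _ F u v); rewrite ?in_itv/= ?lexx ?(ltW uv)//.
  - by move=> x; rewrite in_itv/= => /andP[ux _]; apply: derF; exact: lt_trans ux.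
  - by move=> x; rewrite in_itv/= => /andP[ux _]; have x0 := lt_trans u0 ux; rewrite F'E ?dF0.
  - apply: continuous_in_subspaceT => x /[!inE]/=; rewrite in_itv/= => /andP[ux _].
    by apply: cF; exact: lt_le_trans ux.
have Fle u v : 0 < u -> u <= v -> F v <= F u.
  by move=> u0; rewrite le_eqVlt => /predU1P[->//|uv]; rewrite ltW// Fdec.
have UA : \bigcup_n A n = posline.
  apply/seteqP; split => [x [n _]|x].
    by rewrite posP /A/= in_itv/= => /andP[ax _]; exact: lt_le_trans ax.
  rewrite posP => x0; exists (maxn (Num.truncn x) (Num.truncn x^-1)) => //.
  rewrite /A/= in_itv/=; apply/andP; split.
    rewrite /a invf_ple ?posrE//; apply/ltW/(lt_le_trans (truncnS_gt _)).
    by rewrite ler_nat ltnS leq_maxr.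
  by apply/ltW/(lt_le_trans (truncnS_gt _)); rewrite ler_nat ltnS leq_maxl.
have EFu u : 0 < u -> E (F u) by move=> u0; apply/EF; exists u.
have BE n z : B n z -> E z.
  rewrite /B/= in_itv/= => zn; apply: (Eitv _ _ _ _ _ zn); exact: EFu.
have UB : \bigcup_n B n = E.
  apply/seteqP; split => [z [n _]|z]; first exact: BE.
  move=> /EF[u u0 <-]; have : posline u by rewrite posP.
  rewrite -UA => -[n _]; rewrite /A/= in_itv/= => /andP[au ub]; exists n => //.
  by rewrite /B/= in_itv/= !Fle.
have abS n m : (n <= m)%N -> a m <= a n /\ b n <= b m.
  by move=> nm; rewrite /a /b lef_pV2 ?posrE// ler_nat ltnS.
have ndA : {homo A : n m / (n <= m)%N >-> (n <= m)%O}.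
  by move=> n m /abS[? ?]; apply/subsetPset; apply: subset_itv; rewrite bnd_simp.
have ndB : {homo B : n m / (n <= m)%N >-> (n <= m)%O}.
  move=> n m /abS[? ?]; apply/subsetPset; apply: subset_itv; rewrite bnd_simp.
    by apply: Fle.
  by apply: Fle.
have mG : measurable_fun E G.
  rewrite -UB; apply/measurable_fun_bigcup => [n|n]; first exact: measurable_itv.
  apply: subspace_continuous_measurable_fun; first exact: measurable_itv.
  by apply: continuous_in_subspaceT => z /[!inE] /BE; exact: cG.
have cGF (u : R) : 0 < u -> {for u, continuous (fun u => G (F u) * - dF u)}.
  move=> u0; apply: cvgM; last by apply: cvgN; exact: cdF.
  by apply: continuous_comp; [exact: cF|apply: cG; exact: EFu].
have mGF : measurable_fun posline (fun u => G (F u) * - dF u).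
  rewrite -UA; apply/measurable_fun_bigcup => [n|n]; first exact: measurable_itv.
  apply: subspace_continuous_measurable_fun; first exact: measurable_itv.
  apply: continuous_in_subspaceT => u /[!inE]; rewrite /A/= in_itv/= => /andP[au _].
  by apply: cGF; exact: lt_le_trans au.
have HB : (\int[mu]_(x in B n) (G x)%:E)%E @[n --> \oo] -->
    (\int[mu]_(x in E) (G x)%:E)%E.
  rewrite -UB; apply: ge0_nondecreasing_set_cvg_integral => //.
  - by move=> n; exact: measurable_itv.
  - by move=> n; apply/measurable_EFinP; apply: measurable_funS mG => // z; exact: BE.
  - by move=> n x /BE Ex; rewrite lee_fin G0.
have HA : (\int[mu]_(u in A n) (G (F u) * - dF u)%:E)%E @[n --> \oo] -->
    (\int[mu]_(u in posline) (G (F u) * - dF u)%:E)%E.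
  rewrite -UA; apply: ge0_nondecreasing_set_cvg_integral => //.
  - by move=> n; exact: measurable_itv.
  - move=> n; apply/measurable_EFinP; apply: measurable_funS mGF => //.
      exact: measurable_posline.
    by rewrite -UA => z; exists n.
  - move=> n u; rewrite /A/= in_itv/= => /andP[au _].
    have u0 : 0 < u by exact: lt_le_trans au.
    by rewrite lee_fin mulr_ge0 ?G0 ?oppr_ge0 ?(ltW (dF0 _ u0))//; exact: EFu.
rewrite -(cvg_lim _ HB)// -(cvg_lim _ HA)//; congr (limn _); apply/funext => n.
have dFc (u : R) : 0 < u -> derive1 F x @[x --> u] --> dF u.
  move=> u0; apply: cvg_trans (cdF u u0); apply: near_eq_cvg.
  near=> x; rewrite F'E//; near: x; exact: lt_nbhsr.
rewrite /B /A (integration_by_substitution_decreasing (ab n)).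
- apply: eq_integral => u; rewrite inE/= in_itv/= => /andP[au _].
  by rewrite -[LHS]/(G (F u) * - derive1 F u)%:E F'E// (lt_le_trans _ au).
- move=> u v; rewrite !in_itv/= => /andP[au _] /andP[av _] uv.
  by apply: Fdec => //; exact: lt_le_trans av.
- move=> u; rewrite in_itv/= => /andP[au _].
  have u0 : 0 < u by exact: lt_trans au.
  by rewrite /continuous_at F'E//; exact: dFc.
- by apply: cvgP; apply: cvg_at_right_filter; apply: dFc.
- by apply: cvgP; apply: cvg_at_left_filter; apply: dFc; rewrite ltr0n.
- split.
  + by move=> u; rewrite in_itv/= => /andP[au _]; apply: derF; exact: lt_trans au.
  + by apply: cvg_at_right_filter; exact: cF.
  + by apply: cvg_at_left_filter; apply: cF; rewrite ltr0n.
- by apply: continuous_in_subspaceT => z /[!inE] /BE; exact: cG.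
Unshelve. all: end_near. Qed.

End substitution.

(** * The subordinating density and its convolution law *)

Section subordinator.
Context {R : realType}.
Local Notation mu := (@lebesgue_measure R).
Implicit Types t s r u y rho : R.

(* The 1/2-stable density given by the substitution [r = t^2 / (4 u)] in the definition of
   the Poisson-Hermite semigroup: [P_t] is the integral of [psub t r * T_r] over [r > 0]. *)
Definition psub t r : R :=
  t / (2 * Num.sqrt pi) / (r * Num.sqrt r) * expR (- (t ^+ 2 / (4 * r))).

Lemma psub_ge0 t r : 0 <= t -> 0 <= psub t r.
Proof.
move=> t0; have [r0|r0] := lerP 0 r.
  by rewrite /psub mulr_ge0 ?expR_ge0// !divr_ge0 ?mulr_ge0 ?sqrtr_ge0.
by rewrite /psub (ler0_sqrtr (ltW r0)) mulr0 invr0 mulr0 mul0r.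
Qed.

Lemma measurable_psub dZ (Z : measurableType dZ) (f g : Z -> R) :
  measurable_fun setT f -> measurable_fun setT g ->
  measurable_fun setT (fun z => psub (f z) (g z)).
Proof.
move=> mf mg; have msq : measurable_fun setT (fun z => Num.sqrt (g z)).
  apply: (eq_measurable_fun (fun z => Num.max (g z) 0 `^ 2^-1)).
    move=> z _; have [g0|g0] := lerP 0 (g z).
      by rewrite powR12_sqrt.
    by rewrite powR0// ler0_sqrtr// ltW.
  apply: (measurableT_comp (measurable_powR _)).
  by apply: measurable_maxr => //; exact: measurable_cst.
apply: measurable_funM.
  apply: measurable_funM; first by apply: measurable_funM => //; exact: measurable_cst.
  by apply: measurable_invr; exact: measurable_funM.
apply: measurableT_comp => //; apply: measurableT_comp => //; apply: measurable_funM.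
  exact: measurable_funX.
by apply: measurable_invr; exact: measurable_funM.
Qed.

Lemma is_derive_inv (c u : R) : 0 < u ->
  is_derive u (1 : R) (fun y : R => c / y) (- (c / u ^+ 2)).
Proof.
move=> u0.
have H : is_derive u (1 : R) (fun y : R => y^-1) (- u ^- 2 *: 1).
  by apply: (@is_deriveV R id); rewrite ?gt_eqF.
have := @is_deriveZ R R^o R^o (fun y : R => y^-1) c u 1 _ H.
by move/is_derive_eq; apply; rewrite /GRing.scale/= mulr1 mulrN.
Qed.

Lemma continuous_inv_sqr (c u : R) : 0 < u -> {for u, continuous (fun y : R => c / y ^+ 2)}.
Proof.
move=> u0; apply: cvgMr; apply: cvgV; first by rewrite sqrf_eq0 gt_eqF.
exact: exprn_continuous.
Qed.

Lemma continuous_psub t r : 0 < r -> {for r, continuous (psub t)}.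
Proof.
move=> r0; have cid : {for r, continuous (fun r : R => r)} by [].
apply: cvgM.
  apply: cvgMr; apply: cvgV; first by rewrite mulf_neq0 ?gt_eqF// sqrtr_gt0.
  by apply: cvgM => //; exact: sqrt_continuous.
apply: continuous_comp; last exact: continuous_expR.
apply: cvgN; apply: cvgMr; apply: cvgV; first by rewrite mulf_neq0 ?gt_eqF.
by apply: cvgMr.
Qed.

Lemma psub_substitution t (G : R -> R) : 0 < t -> (forall r, 0 <= G r) ->
  (forall r, 0 < r -> {for r, continuous G}) ->
  (\int[mu]_(r in posline) (psub t r * G r)%:E =
   \int[mu]_(u in posline) ((Num.sqrt pi)^-1 * (expR (- u) / Num.sqrt u * G (t ^+ 2 / (4 * u))))%:E)%E.
Proof.
move=> t0 G0 cG.
have posP u : posline u = (0 < u) :> Prop by rewrite /posline/= in_itv/= andbT.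
have tt : 0 < t ^+ 2 / 4 by rewrite divr_gt0 ?exprn_gt0.
rewrite (@substitution_posline _ (fun u => t ^+ 2 / 4 / u)
   (fun u => - (t ^+ 2 / 4 / u ^+ 2)) (fun r => psub t r * G r)).
- apply: eq_integral => u; rewrite inE posP => u0; congr EFin.
  have -> : t ^+ 2 / (4 * u) = t ^+ 2 / 4 / u by rewrite invfM mulrA.
  rewrite mulrAC !mulrA; congr (_ * _); rewrite /psub.
  have spi : 0 < Num.sqrt pi :> R by rewrite sqrtr_gt0 pi_gt0.
  have su : 0 < Num.sqrt u by rewrite sqrtr_gt0.
  have -> : Num.sqrt (t ^+ 2 / 4 / u) = t / 2 / Num.sqrt u.
    rewrite sqrtrM ?(ltW tt)// sqrtrV ?(ltW u0)//.
    have -> : t ^+ 2 / 4 = (t / 2) ^+ 2 by field.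
    by rewrite sqrtr_sqr ger0_norm// divr_ge0// ltW.
  have -> : t ^+ 2 / (4 * (t ^+ 2 / 4 / u)) = u by field; rewrite !gt_eqF.
  have uE : u = Num.sqrt u ^+ 2 by rewrite sqr_sqrtr// ltW.
  set w := Num.sqrt u in su uE *; set e := expR _; rewrite {}uE.
  by field; rewrite !gt_eqF.
- exact: measurable_posline.
- by move=> u u0; have [] := is_derive_inv (t ^+ 2 / 4) u0.
- by move=> u u0; rewrite oppr_lt0 divr_gt0// exprn_gt0.
- by move=> u u0; apply: cvgN; exact: continuous_inv_sqr.
- move=> z; rewrite posP; split => [z0|[u u0 <-]]; last by rewrite divr_gt0.
  exists (t ^+ 2 / 4 / z); first by rewrite divr_gt0.
  by field; rewrite !gt_eqF.
- by move=> a b z; rewrite !posP => a0 b0 /andP[az _]; exact: lt_le_trans az.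
- by move=> z; rewrite posP => z0; rewrite mulr_ge0// psub_ge0// ltW.
- by move=> z; rewrite posP => z0; apply: cvgM; [exact: continuous_psub|exact: cG].
Qed.

Section convolution.
Variables t s rho : R.
Hypotheses (t0 : 0 < t) (s0 : 0 < s) (rho0 : 0 < rho).

Let h y := expR (- ((s / y - t * y) ^+ 2 / (4 * rho))).

Let h0 y : 0 <= h y. Proof. exact: expR_ge0. Qed.

Let posP u : posline u = (0 < u) :> Prop.
Proof. by rewrite /posline/= in_itv/= andbT. Qed.

Let cdiv (c u : R) : 0 < u -> {for u, continuous (fun y : R => c / y)}.
Proof. by move=> u0; apply: cvgMr; apply: cvgV => //; rewrite gt_eqF. Qed.

Let ch u : 0 < u -> {for u, continuous h}.
Proof.
move=> u0; apply: continuous_comp; last exact: continuous_expR.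
apply: cvgN; apply: cvgMl.
apply: (@continuous_comp _ _ _ (fun y => s / y - t * y) (fun z => z ^+ 2)); last first.
  exact: exprn_continuous.
by apply: cvgB; [exact: cdiv|apply: cvgMr].
Qed.

Let mh (c e : R) : measurable_fun posline (fun y => ((c + e / y ^+ 2) * h y)%:E).
Proof.
apply/measurable_EFinP; apply: (@open_continuous_measurable_fun R).
  by rewrite /posline; exact: interval_open.
move=> y; rewrite inE posP => y0; apply: cvgM; last exact: ch.
by apply: cvgD; [exact: cvg_cst|exact: continuous_inv_sqr].
Qed.

(** The map [y -> s / y - t y] decreases from the half-line onto the line with derivative
    [- (t + s / y^2)], so the integral is Gaussian. *)
Let int_sum : (\int[mu]_(y in posline) ((t + s / y ^+ 2) * h y)%:E =
   (Num.sqrt (4 * pi * rho))%:E)%E.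
Proof.
transitivity (\int[mu]_z (expR (- (z ^+ 2 / (4 * rho))))%:E)%E; last first.
  have r4 : 0 < (4 * rho)^-1 by rewrite invr_gt0 mulr_gt0.
  have := integral_expR_quadratic 0 0 r4.
  rewrite invrK mulrCA mulrA => H.
  rewrite -[RHS]mule1 -[X in _ = (_ * X)%E]/((1 : R)%:E) -EFinM mulr1.
  transitivity (\int[mu]_z (expR (- ((4 * rho)^-1 * z ^+ 2 - 2 * 0 * z + 0)))%:E)%E.
    by apply: eq_integral => z _; rewrite mulr0 mul0r subr0 addr0 mulrC.
  by rewrite H expr0n/= mul0r subrr expR0 mulr1.
rewrite (@substitution_posline _ (fun u => s / u - t * u) (fun u => - (s / u ^+ 2) - t)
  (fun z => expR (- (z ^+ 2 / (4 * rho)))))//.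
- apply: eq_integral => u _; congr EFin; rewrite /h.
  by rewrite mulrC; congr (_ * _); ring.
- move=> u u0; have H : is_derive u (1 : R) (fun u => t * u) t.
    have := @is_deriveZ R R^o R^o id t u 1 _ (is_derive_id _ _).
    by move/is_derive_eq; apply; rewrite /GRing.scale/= mulr1.
  by have [] := is_deriveB (is_derive_inv s u0) H.
- move=> u u0; have su : 0 < s / u ^+ 2 by rewrite divr_gt0// exprn_gt0.
  by rewrite -opprD oppr_lt0 addr_gt0.
- move=> u u0; apply: cvgB; last exact: cvg_cst.
  by apply: cvgN; exact: continuous_inv_sqr.
- move=> z; split => // _.
  (* Solving [s / y - t y = z] means taking the positive root of [t y^2 + z y - s], and [D^2] is its
     discriminant. *)
  pose D := Num.sqrt (z ^+ 2 + 4 * t * s).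
  have D2 : D ^+ 2 = z ^+ 2 + 4 * t * s.
    by rewrite sqr_sqrtr// addr_ge0 ?sqr_ge0// !mulr_ge0// ltW.
  have ts : 0 < 4 * t * s by rewrite !mulr_gt0.
  have D0 : 0 <= D by exact: sqrtr_ge0.
  have Dz : 0 < D - z by nra.
  exists ((D - z) / (2 * t)); first by rewrite divr_gt0// mulr_gt0.
  have -> : s = (D ^+ 2 - z ^+ 2) / (4 * t) by rewrite D2; field; rewrite gt_eqF.
  by field; rewrite !gt_eqF.
- move=> z _; apply: continuous_comp; last exact: continuous_expR.
  by apply: cvgN; apply: cvgMl; exact: exprn_continuous.
Qed.

(** The involution [y -> s / (t y)] changes the sign of [s / y - t y], hence preserves [h], and
    exchanges the two halves of [int_sum]. *)
Let int_sym : (\int[mu]_(y in posline) ((t + 0 / y ^+ 2) * h y)%:E =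
  \int[mu]_(y in posline) ((0 + s / y ^+ 2) * h y)%:E)%E.
Proof.
under eq_integral do rewrite mul0r addr0.
rewrite (@substitution_posline _ (fun u => s / t / u) (fun u => - (s / t / u ^+ 2))
  (fun y => t * h y))//.
- apply: eq_integral => u; rewrite inE posP => u0; congr EFin.
  rewrite opprK add0r.
  have -> : h (s / t / u) = h u.
    rewrite /h; congr expR; congr (- (_ / _)).
    have -> : s / (s / t / u) - t * (s / t / u) = - (s / u - t * u).
      by field; rewrite !gt_eqF.
    by rewrite sqrrN.
  by field; rewrite !gt_eqF.
- exact: measurable_posline.
- by move=> u u0; have [] := is_derive_inv (s / t) u0.
- by move=> u u0; rewrite oppr_lt0 !divr_gt0// exprn_gt0.
- by move=> u u0; apply: cvgN; exact: continuous_inv_sqr.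
- move=> z; rewrite posP; split => [z0|[u u0 <-]]; last by rewrite !divr_gt0.
  exists (s / t / z); first by rewrite !divr_gt0.
  by field; rewrite !gt_eqF.
- by move=> a b z; rewrite !posP => a0 b0 /andP[az _]; exact: lt_le_trans az.
- by move=> z _; rewrite mulr_ge0// ltW.
- by move=> z; rewrite posP => z0; apply: cvgMr; exact: ch.
Qed.

(** By symmetry each half of [int_sum] is half its value; the halves are recombined with the weights
    [1 / t] and [1 / s]. *)
Let int_one : (\int[mu]_(y in posline) ((1 + 1 / y ^+ 2) * h y)%:E =
   (Num.sqrt (pi * rho) * (t + s) / (t * s))%:E)%E.
Proof.
have S4 : Num.sqrt (4 * pi * rho) = 2 * Num.sqrt (pi * rho).
  rewrite -mulrA sqrtrM//; congr (_ * _).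
  by rewrite (_ : 4 = 2 ^+ 2) ?sqrtr_sqr ?ger0_norm//; ring.
set J := Num.sqrt (pi * rho) in S4 *.
pose X := (\int[mu]_(y in posline) ((t + 0 / y ^+ 2) * h y)%:E)%E.
have ge0f (c e : R) y : 0 <= c -> 0 <= e -> (0 <= ((c + e / y ^+ 2) * h y)%:E)%E.
  by move=> c0 e0; rewrite lee_fin mulr_ge0// addr_ge0// divr_ge0// sqr_ge0.
have mpos := @measurable_posline R.
have XX : (X + X = (2 * J)%:E)%E.
  rewrite -S4 -int_sum {2}/X int_sym -ge0_integralD//; last 4 first.
  - by move=> y _; apply: ge0f => //; exact: ltW.
  - exact: mh.
  - by move=> y _; apply: ge0f => //; exact: ltW.
  - exact: mh.
  by apply: eq_integral => y _; rewrite -EFinD mul0r addr0 add0r -mulrDl.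
have XJ : X = J%:E.
  have : (0 <= X)%E by apply: integral_ge0 => y _; apply: ge0f => //; exact: ltW.
  by move: XX; case: X => [v| |]//; rewrite -EFinD => -[] H _; congr EFin; lra.
transitivity (\int[mu]_(y in posline) ((t^-1)%:E * ((t + 0 / y ^+ 2) * h y)%:E +
   (s^-1)%:E * ((0 + s / y ^+ 2) * h y)%:E))%E.
  apply: eq_integral => y; rewrite inE posP => y0; rewrite -!EFinM -EFinD; congr EFin.
  by field; rewrite !gt_eqF.
have ti : (0 <= (t^-1)%:E)%E by rewrite lee_fin invr_ge0 ltW.
have si : (0 <= (s^-1)%:E)%E by rewrite lee_fin invr_ge0 ltW.
rewrite ge0_integralD//; last 4 first.
- by move=> y _; rewrite mule_ge0//; apply: ge0f => //; exact: ltW.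
- by apply: emeasurable_funM => //; exact: mh.
- by move=> y _; rewrite mule_ge0//; apply: ge0f => //; exact: ltW.
- by apply: emeasurable_funM => //; exact: mh.
rewrite ge0_integralZl//; last 2 first.
- exact: mh.
- by move=> y _; apply: ge0f => //; exact: ltW.
rewrite ge0_integralZl//; last 2 first.
- exact: mh.
- by move=> y _; apply: ge0f => //; exact: ltW.
rewrite -int_sym -/X XJ -!EFinM -EFinD; congr EFin.
by field; rewrite !gt_eqF.
Qed.

(** Put [r = rho / (1 + y^2)]. The exponents then add up to
    [((t + s)^2 + (s / y - t y)^2) / (4 rho)]: the first square is the exponent of the result, and
    the second leaves the integral [int_one]. *)
Lemma psub_convolution :
  (\int[mu]_(r in `]0%R, rho[) (psub t r * psub s (rho - r)%R)%:E = (psub (t + s) rho)%:E)%E.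
Proof.
have spi : 0 < Num.sqrt pi :> R by rewrite sqrtr_gt0 pi_gt0.
have sr : 0 < Num.sqrt rho by rewrite sqrtr_gt0.
have y1 y : 0 < 1 + y ^+ 2 by rewrite ltr_pwDl// sqr_ge0.
have rE : rho = Num.sqrt rho ^+ 2 by rewrite sqr_sqrtr// ltW.
have Fpos y : 0 < y -> 0 < rho / (1 + y ^+ 2) < rho.
  move=> yp; rewrite divr_gt0//= ltr_pdivrMr// ltr_pMr// ltrDl exprn_gt0//.
rewrite (@substitution_posline _ (fun y => rho / (1 + y ^+ 2))
  (fun y => - (rho * (2 * y) / (1 + y ^+ 2) ^+ 2))
  (fun r => psub t r * psub s (rho - r)))//.
- pose K := t * s / (2 * pi * rho ^+ 2) * expR (- ((t + s) ^+ 2 / (4 * rho))).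
  have K0 : 0 <= K by rewrite mulr_ge0 ?expR_ge0// divr_ge0 ?mulr_ge0 ?pi_ge0 ?sqr_ge0// ltW.
  transitivity (\int[mu]_(y in posline) (K%:E * ((1 + 1 / y ^+ 2) * h y)%:E))%E.
    apply: eq_integral => y; rewrite inE posP => yp; rewrite -EFinM; congr EFin.
    have w0 := y1 y; set w := 1 + y ^+ 2 in w0 *.
    have sw : 0 < Num.sqrt w by rewrite sqrtr_gt0.
    have wE : w = Num.sqrt w ^+ 2 by rewrite sqr_sqrtr// ltW.
    have y2 : y ^+ 2 = w - 1 by rewrite /w addrC addKr.
    have aE : rho - rho / w = rho * y ^+ 2 / w by rewrite y2; field; rewrite gt_eqF.
    have sq1 : Num.sqrt (rho / w) = Num.sqrt rho / Num.sqrt w.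
      by rewrite sqrtrM ?(ltW rho0)// sqrtrV// ltW.
    have sq2 : Num.sqrt (rho * y ^+ 2 / w) = Num.sqrt rho * y / Num.sqrt w.
      have ry0 : 0 <= rho * y ^+ 2 by rewrite mulr_ge0 ?(ltW rho0)// sqr_ge0.
      rewrite (@sqrtrM _ (rho * y ^+ 2) w^-1)//.
      rewrite sqrtrV ?(ltW w0)//.
      by rewrite sqrtrM ?(ltW rho0)// sqrtr_sqr ger0_norm// ltW.
    rewrite aE /psub sq1 sq2 /K /h opprK.
    set e1 := expR (- (t ^+ 2 / _)); set e2 := expR (- (s ^+ 2 / _)).
    set e3 := expR (- ((t + s) ^+ 2 / _)); set e4 := expR (- ((s / y - _) ^+ 2 / _)).
    have E : e1 * e2 = e3 * e4.
      rewrite /e1 /e2 /e3 /e4 -!expRD; congr expR.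
      by rewrite /w; field; rewrite !gt_eqF//= ?y1//.
    have piE : pi = Num.sqrt pi ^+ 2 :> R by rewrite sqr_sqrtr// pi_ge0.
    rewrite [in RHS]piE.
    transitivity (t * s / (2 * Num.sqrt pi ^+ 2 * rho ^+ 2) * (1 + 1 / y ^+ 2) * (e1 * e2));
      last by rewrite E; ring.
    have -> : 1 + 1 / y ^+ 2 = w / y ^+ 2 by rewrite /w; field; rewrite gt_eqF.
    move: sr rE sw wE; set a := Num.sqrt rho; set b := Num.sqrt w => a0 rE b0 wE.
    rewrite rE wE.
    by field; rewrite !gt_eqF.
  rewrite ge0_integralZl//; last 3 first.
  - exact: measurable_posline.
  - exact: mh.
  - by move=> y _; rewrite lee_fin mulr_ge0// addr_ge0// divr_ge0// sqr_ge0.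
  rewrite int_one -EFinM; congr EFin; rewrite /K /psub sqrtrM ?pi_ge0//.
  have piE : pi = Num.sqrt pi ^+ 2 :> R by rewrite sqr_sqrtr// pi_ge0.
  rewrite [X in 2 * X * _]piE; set e := expR _.
  rewrite [X in 2 * _ * X ^+ 2]rE [X in _ = _ / (X * _) * _]rE.
  by field; rewrite !gt_eqF.
- move=> y yp.
  have H : is_derive y (1 : R) (fun y : R => (1 + y ^+ 2)) (2 * y).
    have H2 := @is_deriveX R R^o id 2 y 1 1 (is_derive_id _ _).
    have := is_deriveD (is_derive_cst (1 : R^o) y (1 : R^o)) H2.
    by move/is_derive_eq; apply; rewrite /= add0r expr1 /GRing.scale/= mulr1.
  have HV := @is_deriveV R (fun y => 1 + y ^+ 2) y _ 1 (lt0r_neq0 (y1 y)) H.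
  have [D1 D2] := @is_deriveZ R R^o R^o _ rho y 1 _ HV.
  by split => //; rewrite D2 /GRing.scale/=; field; rewrite gt_eqF.
- by move=> y yp; rewrite oppr_lt0 divr_gt0 ?exprn_gt0// !mulr_gt0.
- move=> y yp; apply: cvgN; apply: cvgM; first by apply: cvgMr; apply: cvgMr.
  apply: cvgV; first by rewrite expf_eq0/= gt_eqF.
  apply: (@continuous_comp _ _ _ (fun y => 1 + y ^+ 2) (fun z => z ^+ 2)); last first.
    exact: exprn_continuous.
  by apply: cvgD; [exact: cvg_cst|exact: exprn_continuous].
- move=> z; rewrite /= in_itv/=; split => [/andP[z0 zr]|[y yp <-]]; last exact: Fpos.
  exists (Num.sqrt (rho / z - 1)).
    by rewrite sqrtr_gt0 subr_gt0 ltr_pdivlMr// mul1r.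
  rewrite sqr_sqrtr; first by rewrite subrKC invf_div mulrCA mulfV ?mulr1// gt_eqF.
  by rewrite subr_ge0 ler_pdivlMr// mul1r ltW.
- move=> a b z; rewrite /= !in_itv/= => /andP[a0 _] /andP[_ br] /andP[az zb].
  by rewrite (lt_le_trans a0 az) (le_lt_trans zb br).
- by move=> z; rewrite /= in_itv/= => _; rewrite mulr_ge0 ?psub_ge0 ?(ltW t0) ?(ltW s0).
- move=> z; rewrite /= in_itv/= => /andP[z0 zr]; apply: cvgM; first exact: continuous_psub.
  apply: (@continuous_comp _ _ _ (fun r => rho - r) (psub s)).
    by apply: cvgB => //; exact: cvg_cst.
  by apply: continuous_psub; rewrite subr_gt0.
Qed.

End convolution.
End subordinator.

(** * Ornstein-Uhlenbeck operators on nonnegative functions *)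

Section mehler_operator.
Context {R : realType} {d : nat}.
Local Open Scope ereal_scope.
Local Notation E := (d.-tuple R).
Local Notation gam := (gauss_measure d).
Local Notation mu := (@lebesgue_measure R).
Implicit Types (g : E -> \bar R) (x y : E).

Definition ou r g x : \bar R := \int[gam]_y ((mehler r x y)%:E * g y).

Lemma measurable_ou_param dZ (Z : measurableType dZ) (f : Z -> R) (h : Z -> E)
    (G : Z * E -> \bar R) : measurable_fun setT f -> measurable_fun setT h ->
  measurable_fun setT G -> (forall w, 0 <= G w) ->
  measurable_fun setT (fun w => ou (f w) (fun y => G (w, y)) (h w)).
Proof.
move=> mf mh mG G0.
apply: (measurable_fun_fubini_tonelli_F
  (fun p : Z * E => (mehler (f p.1) (h p.1) p.2)%:E * G p)).
- apply: emeasurable_funM => //; apply/measurable_EFinP; apply: measurable_mehler => //;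
  exact: measurableT_comp.
- by case=> w y; rewrite mule_ge0 ?lee_fin ?mehler_ge0.
Qed.

Lemma measurable_ou r g : measurable_fun setT g -> (forall x, 0 <= g x) ->
  measurable_fun setT (ou r g).
Proof.
move=> mg g0; apply: (@measurable_ou_param _ E (cst r) id (fun p => g p.2)) => //.
exact: measurableT_comp.
Qed.

Lemma measurable_ou_time g x : measurable_fun setT g -> (forall x, 0 <= g x) ->
  measurable_fun setT (fun r => ou r g x).
Proof.
move=> mg g0; apply: (@measurable_ou_param _ R id (cst x) (fun p => g p.2)) => //.
exact: measurableT_comp.
Qed.

Lemma ou_ge0 r g x : (forall x, 0 <= g x) -> 0 <= ou r g x.
Proof. by move=> g0; apply: integral_ge0 => y _; rewrite mule_ge0 ?lee_fin ?mehler_ge0. Qed.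

Lemma ou_mono r g g' x : (forall x, 0 <= g x) -> (forall x, g x <= g' x) ->
  ou r g x <= ou r g' x.
Proof.
move=> g0 gg'; apply: ge0_integral_mono => y _.
  by rewrite mule_ge0 ?lee_fin ?mehler_ge0.
by rewrite lee_wpmul2l ?lee_fin ?mehler_ge0.
Qed.

Lemma measurable_mehlerr r x : measurable_fun setT (fun y => (mehler r x y)%:E).
Proof. by apply/measurable_EFinP; exact: measurable_mehler. Qed.

Lemma ouD r g g' x : measurable_fun setT g -> measurable_fun setT g' ->
  (forall x, 0 <= g x) -> (forall x, 0 <= g' x) ->
  ou r (fun y => g y + g' y) x = ou r g x + ou r g' x.
Proof.
move=> mg mg' g0 g0'; rewrite -ge0_integralD//.
- by apply: eq_integral => y _; rewrite ge0_muleDr.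
- by move=> y _; rewrite mule_ge0 ?lee_fin ?mehler_ge0.
- by apply: emeasurable_funM => //; exact: measurable_mehlerr.
- by move=> y _; rewrite mule_ge0 ?lee_fin ?mehler_ge0.
- by apply: emeasurable_funM => //; exact: measurable_mehlerr.
Qed.

Lemma ouZ r g (c : R) x : measurable_fun setT g -> (forall x, 0 <= g x) -> (0 <= c)%R ->
  ou r (fun y => c%:E * g y) x = c%:E * ou r g x.
Proof.
move=> mg g0 c0; rewrite -ge0_integralZl_EFin//.
- by apply: eq_integral => y _; rewrite muleCA.
- by move=> y _; rewrite mule_ge0 ?lee_fin ?mehler_ge0.
- by apply: emeasurable_funM => //; exact: measurable_mehlerr.
Qed.

Lemma ou_cst r (c : R) x : (0 < r)%R -> (0 <= c)%R -> ou r (cst c%:E) x = c%:E.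
Proof.
move=> r0 c0; rewrite /ou; under eq_integral do rewrite muleC.
rewrite ge0_integralZl_EFin ?mehler_mass ?mule1//.
  by move=> y _; rewrite lee_fin mehler_ge0.
exact: measurable_mehlerr.
Qed.

Lemma ge0_integral_ou r g : (0 < r)%R -> measurable_fun setT g -> (forall x, 0 <= g x) ->
  \int[gam]_x ou r g x = \int[gam]_x g x.
Proof.
move=> r0 mg g0.
rewrite (fubini_tonelli (m1 := gam) (m2 := gam)
   (fun p : E * E => (mehler r p.1 p.2)%:E * g p.2))/=; last 2 first.
- apply: emeasurable_funM; last exact: measurableT_comp.
  by apply/measurable_EFinP; exact: measurable_mehler.
- by move=> p; rewrite mule_ge0 ?lee_fin ?mehler_ge0.
apply: eq_integral => y _.
under eq_integral do rewrite mehlerC.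
rewrite ge0_integralZr//.
- by rewrite mehler_mass// mul1e.
- exact: measurable_mehlerr.
- by move=> x _; rewrite lee_fin mehler_ge0.
Qed.

Lemma ou_comp r s g x : (0 < r)%R -> (0 < s)%R -> measurable_fun setT g ->
  (forall x, 0 <= g x) -> ou r (ou s g) x = ou (r + s) g x.
Proof.
move=> r0 s0 mg g0.
transitivity (\int[gam]_z \int[gam]_y ((mehler r x z * mehler s z y)%:E * g y)).
  apply: eq_integral => z _; rewrite -ge0_integralZl_EFin ?mehler_ge0//.
  - by apply: eq_integral => y _; rewrite muleA -EFinM.
  - by move=> y _; rewrite mule_ge0 ?lee_fin ?mehler_ge0.
  - by apply: emeasurable_funM => //; exact: measurable_mehlerr.
rewrite (fubini_tonelli (m1 := gam) (m2 := gam)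
   (fun p : E * E => (mehler r x p.1 * mehler s p.1 p.2)%:E * g p.2))/=; last 2 first.
- apply: emeasurable_funM; last exact: measurableT_comp.
  by apply/measurable_EFinP; apply: measurable_funM; exact: measurable_mehler.
- by move=> p; rewrite mule_ge0 ?lee_fin// mulr_ge0 ?mehler_ge0.
apply: eq_integral => y _; rewrite -mehler_comp// ge0_integralZr//.
- by apply/measurable_EFinP; apply: measurable_funM; exact: measurable_mehler.
- by move=> z _; rewrite lee_fin mulr_ge0 ?mehler_ge0.
Qed.

Definition ouavg (s : R) g x : \bar R := (s^-1)%:E * \int[mu]_(r in `]0%R, s]) ou r g x.

Lemma ouavg_ge0 s g x : (0 <= s)%R -> (forall x, 0 <= g x) -> 0 <= ouavg s g x.
Proof.
move=> s0 g0; rewrite mule_ge0 ?lee_fin ?invr_ge0//.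
by apply: integral_ge0 => r _; exact: ou_ge0.
Qed.

Lemma measurable_ou_swap g : measurable_fun setT g -> (forall x, 0 <= g x) ->
  measurable_fun setT (fun p : E * measurableTypeR R => ou p.2 g p.1).
Proof.
move=> mg g0.
apply: (@measurable_ou_param _ (E * measurableTypeR R)%type _ _ (fun p => g p.2)) => //.
exact: measurableT_comp.
Qed.

Lemma measurable_int_ou (A : set R) g : measurable A -> measurable_fun setT g ->
  (forall x, 0 <= g x) -> measurable_fun setT (fun x => \int[mu]_(r in A) ou r g x).
Proof.
move=> mA mg g0.
apply: (measurable_integral_on mu (fun p : E * measurableTypeR R => ou p.2 g p.1)) => //.
  by apply: measurable_funTS; exact: measurable_ou_swap.
by move=> x r _ _; exact: ou_ge0.
Qed.

Lemma measurable_ouavg s g : measurable_fun setT g ->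
  (forall x, 0 <= g x) -> measurable_fun setT (ouavg s g).
Proof.
move=> mg g0; apply: emeasurable_funM => //; exact: measurable_int_ou.
Qed.

(** By Tonelli and the semigroup law, [T_h] translates the window of times by [h]. Integrals over
    [n] steps thus become sums of iterates of [T_h], the form in which Garsia's argument applies. *)
Lemma ou_int_ou (h a b : R) g x : (0 < h)%R -> (0 <= a)%R -> measurable_fun setT g ->
  (forall x, 0 <= g x) ->
  ou h (fun y => \int[mu]_(r in `]a, b]) ou r g y) x =
  \int[mu]_(r in `](h + a)%R, (h + b)%R]) ou r g x.
Proof.
move=> h0 a0 mg g0.
rewrite -(ge0_integral_itv_shift h a b); last 2 first.
- exact: measurable_ou_time.
- by move=> r; exact: ou_ge0.
transitivity (\int[gam]_y \int[mu]_(r in `]a, b]) ((mehler h x y)%:E * ou r g y)).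
  apply: eq_integral => y _; rewrite ge0_integralZl_EFin ?mehler_ge0//.
  - by move=> r _; exact: ou_ge0.
  - by apply: measurable_funTS; exact: measurable_ou_time.
rewrite (tonelli_on gam mu (A := setT) (B := `]a, b]%classic)
   (fun p : E * measurableTypeR R => (mehler h x p.1)%:E * ou p.2 g p.1)
   measurableT (measurable_itv _)).
- apply: eq_integral => r; rewrite inE/= in_itv/= => /andP[ar _].
  by rewrite -ou_comp// (le_lt_trans a0).
- apply: measurable_funTS; apply: emeasurable_funM; last exact: measurable_ou_swap.
  by apply/measurable_EFinP; apply: measurable_mehler.
- by move=> y r _ _; rewrite mule_ge0 ?lee_fin ?mehler_ge0 ?ou_ge0.
Qed.

Lemma ge0_integral_ouavg s g : (0 < s)%R -> measurable_fun setT g ->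
  (forall x, 0 <= g x) -> \int[gam]_x ouavg s g x = \int[gam]_x g x.
Proof.
move=> s0 mg g0; rewrite ge0_integralZl_EFin ?invr_ge0 ?(ltW s0)//; last 2 first.
- by move=> x _; apply: integral_ge0 => r _; exact: ou_ge0.
- exact: measurable_int_ou.
rewrite (tonelli_on gam mu (A := setT) (B := `]0%R, s]%classic)
  (fun p : E * measurableTypeR R => ou p.2 g p.1) measurableT (measurable_itv _)); last 2 first.
- by apply: measurable_funTS; exact: measurable_ou_swap.
- by move=> y r _ _; exact: ou_ge0.
transitivity ((s^-1)%:E * \int[mu]_(r in `]0%R, s]) (cst (\int[gam]_x g x) r)).
  congr (_ * _); apply: eq_integral => r; rewrite inE/= in_itv/= => /andP[r0 _].
  by rewrite ge0_integral_ou.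
rewrite integral_cst//= lebesgue_measure_itv/= lte_fin s0 sube0.
by rewrite muleCA -EFinM mulVf ?gt_eqF// mule1.
Qed.

(* Hopf's maximal inequality, by Garsia's argument: [garsia N] dominates all the
   partial sums of length at most [N] of [g' - lam] under [ou h], where [g'] is
   the average of [g] over times in ]0, h]. *)
Section garsia.
Variables (h lam : R) (g : E -> \bar R).
Hypotheses (h0 : (0 < h)%R) (lam0 : (0 < lam)%R).
Hypotheses (mg : measurable_fun setT g) (g0 : forall x, 0 <= g x).

Fixpoint garsia n : E -> \bar R := if n is n'.+1 then
  fun x => maxe (ouavg h g x + ou h (garsia n') x - lam%:E) 0 else cst 0.

Lemma garsia_ge0 n x : 0 <= garsia n x.
Proof. by case: n => //= n; rewrite le_max lexx orbT. Qed.

Lemma measurable_garsia n : measurable_fun setT (garsia n).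
Proof.
elim: n => [|n IH] //=; apply: measurable_maxe => //.
apply: emeasurable_funD => //; apply: emeasurable_funD.
  exact: measurable_ouavg.
by apply: measurable_ou => //; exact: garsia_ge0.
Qed.

Lemma garsia_nd n x : garsia n x <= garsia n.+1 x.
Proof.
elim: n x => [|n IH] x; first exact: garsia_ge0.
rewrite [leRHS]/= ge_max; apply/andP; split; last by rewrite le_max lexx orbT.
rewrite le_max; apply/orP; left; rewrite leeD2r// leeD2l//.
by apply: ou_mono => //; exact: garsia_ge0.
Qed.

(** Induction on [n]: the window []0, (n + 1) h]] is cut at [h], the first piece is the average over
    one step and the rest is [T_h] of the window of length [n h]. *)
Lemma garsia_ge n x : (h^-1)%:E * \int[mu]_(r in `]0%R, (n%:R * h)%R]) ou r g x <=
  garsia n x + (n%:R * lam)%:E.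
Proof.
have h1 : (0 <= h^-1)%R by rewrite invr_ge0 ltW.
elim: n x => [|n IH] x.
  by rewrite !mul0r adde0 set_itv_ge ?bnd_simp ?ltxx// integral_set0 mule0.
have nh : (0 <= n%:R * h)%R by rewrite mulr_ge0// ltW.
have -> : `]0%R, (n.+1%:R * h)%R]%classic = `]0%R, h]%classic `|` `]h, (h + n%:R * h)%R]%classic.
  rewrite -itv_bndbnd_setU ?bnd_simp ?(ltW h0)//; last by rewrite lerDl.
  by rewrite -natr1 mulrDl mul1r addrC.
rewrite ge0_integral_setU//; last 3 first.
- by apply: measurable_funTS; exact: measurable_ou_time.
- by move=> r _; exact: ou_ge0.
- apply/disj_setPS => r [] /=; rewrite !in_itv/= => /andP[_ rh] /andP[hr _].
  by have := le_lt_trans rh hr; rewrite ltxx.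
rewrite ge0_muleDr; last 2 first.
- by apply: integral_ge0 => r _; exact: ou_ge0.
- by apply: integral_ge0 => r _; exact: ou_ge0.
have : ou h (fun y => (h^-1)%:E * \int[mu]_(r in `]0%R, (n%:R * h)%R]) ou r g y) x <=
    ou h (fun y => garsia n y + cst (n%:R * lam)%:E y) x.
  apply: ou_mono => y; last exact: IH.
  by rewrite mule_ge0 ?lee_fin//; apply: integral_ge0 => r _; exact: ou_ge0.
rewrite ouZ//; last 2 first.
- exact: measurable_int_ou.
- by move=> y; apply: integral_ge0 => r _; exact: ou_ge0.
rewrite ou_int_ou// addr0 ouD//; last 3 first.
- exact: measurable_garsia.
- exact: garsia_ge0.
- by move=> y; rewrite lee_fin mulr_ge0// ltW.
rewrite ou_cst ?mulr_ge0 ?(ltW lam0)// => H.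
apply: le_trans (leeD2l _ H) _; rewrite -natr1 mulrDl mul1r EFinD addeA.
have -> : garsia n.+1 x + ((n%:R * lam)%:E + lam%:E) =
    (garsia n.+1 x + lam%:E) + (n%:R * lam)%:E by rewrite addeA addeAC.
apply: leeD => //.
by rewrite -leeBlDr// le_max lexx.
Qed.

Hypothesis gfin : \int[gam]_x g x < +oo.

(** Finiteness of this integral permits the cancellation in [garsia_weak]. *)
Lemma garsia_fin n : \int[gam]_x garsia n x < +oo.
Proof.
elim: n => [|n IH]; first by rewrite integral0.
apply: (@le_lt_trans _ _ (\int[gam]_x (ouavg h g x + ou h (garsia n) x))).
  apply: ge0_integral_mono => x _; first exact: garsia_ge0.
  rewrite /= ge_max; apply/andP; split; last first.
    by rewrite adde_ge0 ?ouavg_ge0 ?ou_ge0 ?(ltW h0)//; exact: garsia_ge0.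
  by rewrite EFinN leeBlDr// leeDl// lee_fin ltW.
rewrite ge0_integralD//; last 4 first.
- by move=> x _; rewrite ouavg_ge0// ltW.
- exact: measurable_ouavg.
- by move=> x _; rewrite ou_ge0//; exact: garsia_ge0.
- by apply: measurable_ou; [exact: measurable_garsia|exact: garsia_ge0].
rewrite ge0_integral_ouavg// ge0_integral_ou//; last 2 first.
- exact: measurable_garsia.
- exact: garsia_ge0.
by rewrite lte_add_pinfty.
Qed.

(** Where [garsia n.+1] is positive, adding [lam] to it gives exactly the average of [g] plus
    [T_h (garsia n)]; elsewhere it vanishes. Integrating, [T_h] preserves mass, and
    [garsia n <= garsia n.+1] lets the integral of [garsia n] be subtracted. *)
Lemma garsia_weak n : lam%:E * gam [set x | 0 < garsia n x] <= \int[gam]_x g x.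
Proof.
have mpos k : measurable [set x | 0 < garsia k x].
  have := emeasurable_fun_o_infty measurableT (measurable_garsia k) 0.
  by rewrite setTI.
case: n => [|n].
  rewrite (_ : [set x | _] = set0) ?measure0 ?mule0 ?integral_ge0//.
  by apply/seteqP; split => x //=; rewrite ltxx.
have H : \int[gam]_x garsia n.+1 x + lam%:E * gam [set x | 0 < garsia n.+1 x] <=
    \int[gam]_x g x + \int[gam]_x garsia n x.
  rewrite -(@ge0_integral_ouavg h g)// -(@ge0_integral_ou h (garsia n))//; last 2 first.
  - exact: measurable_garsia.
  - exact: garsia_ge0.
  rewrite -ge0_integralD//; last 4 first.
  - by move=> x _; rewrite ouavg_ge0// ltW.
  - exact: measurable_ouavg.
  - by move=> x _; rewrite ou_ge0//; exact: garsia_ge0.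
  - by apply: measurable_ou; [exact: measurable_garsia|exact: garsia_ge0].
  rewrite -(setIT [set x | 0 < garsia n.+1 x]) -integral_indic//.
  rewrite -ge0_integralZl_EFin ?(ltW lam0)//; last first.
  - by apply/measurable_EFinP.
  rewrite -ge0_integralD//; last 4 first.
  - by move=> x _; exact: garsia_ge0.
  - exact: measurable_garsia.
  - by move=> x _; rewrite mule_ge0 ?lee_fin// ltW.
  - by apply: emeasurable_funM => //; apply/measurable_EFinP.
  apply: ge0_integral_mono => x _.
    by rewrite adde_ge0 ?garsia_ge0// mule_ge0 ?lee_fin// ltW.
  have S0 : 0 <= ouavg h g x + ou h (garsia n) x.
    by rewrite adde_ge0 ?ouavg_ge0 ?ou_ge0 ?(ltW h0)//; exact: garsia_ge0.
  rewrite indicE; have [xin|] := boolP (x \in _).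
    rewrite mule1; move: xin; rewrite inE/= lt_max ltxx orbF => p.
    by rewrite max_l ?(ltW p)// EFinN subeK.
  rewrite mule0 adde0 notin_setE/= => /negP; rewrite -leNgt => /le_trans; exact.
have nd : \int[gam]_x garsia n x <= \int[gam]_x garsia n.+1 x.
  by apply: ge0_integral_mono => x _; [exact: garsia_ge0|exact: garsia_nd].
have fin : \int[gam]_x garsia n x \is a fin_num.
  by rewrite ge0_fin_numE ?garsia_fin// integral_ge0// => x _; exact: garsia_ge0.
rewrite -(@leeD2lE _ (\int[gam]_x garsia n x))//.
rewrite [leRHS]addeC; apply: le_trans H; exact: leeD2r.
Qed.

End garsia.

End mehler_operator.

(** * The ergodic maximal function *)

Section layer_cake.
Context {R : realType}.
Local Open Scope ereal_scope.
Local Notation mu := (@lebesgue_measure R).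

Lemma integral_powR_layer (c : R) (v : \bar R) : (0 < c)%R -> 0 <= v ->
  \int[mu]_(l in `]0%R, +oo[) ((l `^ (c - 1))%:E * ((l%:E < v)%E%:R : R)%:E) =
  v `^ c * (c^-1)%:E.
Proof.
move=> c0; have cnz : c != 0%R by rewrite gt_eqF.
have mp D : measurable_fun D (fun t : R => (t `^ (c - 1))%:E).
  by apply/measurable_EFinP; apply: measurable_funTS; exact: measurable_powR.
have fin (r : R) : (0 <= r)%R ->
  \int[mu]_(l in `]0%R, +oo[) ((l `^ (c - 1))%:E * ((l%:E < r%:E)%E%:R : R)%:E) =
    (r `^ c / c)%:E.
  move=> r0; rewrite -integral_powR_near0// -integral_itv_bndo_bndc; last exact: mp.
  rewrite integral_mkcond [RHS]integral_mkcond; apply: eq_integral => x _.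
  rewrite !patchE !mem_setE !in_itv/= lte_fin andbT.
  by case: (0 < x)%R => //=; case: (x < r)%R; rewrite ?mule1 ?mule0.
case: v => [r| |]//; first by rewrite lee_fin => r0; rewrite fin// poweR_EFin -EFinM.
move=> _; rewrite poweRyr// gt0_mulye ?lte_fin ?invr_gt0//.
apply/eqyP => A A0.
(* Truncating the infinite value at the level [(A c)^(1 / c)] produces an integral equal to the
   given [A]. *)
have rE : ((A * c) `^ c^-1 `^ c / c = A)%R.
  by rewrite -powRrM mulVf// powRr1 ?mulfK// mulr_ge0// ltW.
rewrite -rE -fin ?powR_ge0//; apply: ge0_integral_mono => x _.
  by rewrite mule_ge0 ?lee_fin ?powR_ge0.
rewrite lee_wpmul2l ?lee_fin ?powR_ge0// ltry.
by case: (_ < _)%E.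
Qed.

End layer_cake.

Section maximal.
Context {R : realType} {d : nat}.
Local Open Scope ereal_scope.
Local Notation E := (d.-tuple R).
Local Notation gam := (gauss_measure d).
Local Notation mu := (@lebesgue_measure R).
Implicit Types (g : E -> \bar R) (x y : E).

(* The averaging times are dyadic, to make the supremum countable; every other time is
   within a factor 2 of such a time. *)
Definition oumax g x : \bar R :=
  ereal_sup (range (fun p : nat * nat => ouavg (p.2.+1%:R / 2 ^+ p.1) g x)).

Lemma oumax_ge0 g x : (forall x, 0 <= g x) -> 0 <= oumax g x.
Proof.
move=> g0; apply: le_trans (ereal_sup_ubound _); last by exists (0%N, 0%N).
by apply: ouavg_ge0.
Qed.

Lemma oumax_ge g x n N : ouavg (N.+1%:R / 2 ^+ n) g x <= oumax g x.
Proof. by apply: ereal_sup_ubound; exists (n, N). Qed.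

Let lev g (l : \bar R) n := \bigcup_N [set x | l < ouavg (N.+1%:R / 2 ^+ n) g x].

Let mlev g l n : measurable_fun setT g -> (forall x, 0 <= g x) -> measurable (lev g l n).
Proof.
move=> mg g0; apply: bigcup_measurable => N _.
have := emeasurable_fun_o_infty measurableT (measurable_ouavg (N.+1%:R / 2 ^+ n) mg g0) l.
by rewrite setTI.
Qed.

Let oumax_lev g l : [set x | l < oumax g x] = \bigcup_n lev g l n.
Proof.
apply/seteqP; split => [x /= /ereal_sup_gt[_ [[n N] _ <-]] H|x [n _ [N _ /= H]]].
  by exists n => //; exists N.
by apply: lt_le_trans H _; exact: oumax_ge.
Qed.

Let lev_nd g l : nondecreasing_seq (lev g l).
Proof.
apply/nondecreasing_seqP => n; apply/subsetPset => x [N _ /= H].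
(* The index [N] stands for the time [(N + 1) / 2^n], so doubling the numerator leads to the index
   [2 N + 1]. *)
exists (2 * N).+1 => //=; rewrite (_ : _ / _ = N.+1%:R / 2 ^+ n :> R)%R//.
rewrite exprS invfM mulrA; congr (_ / _)%R.
by rewrite -[(2 * N).+2]/(2 + 2 * N)%N -{1}(muln1 2%N) -mulnDr add1n natrM mulrAC mulfV ?mul1r.
Qed.

Lemma measurable_oumax g : measurable_fun setT g -> (forall x, 0 <= g x) ->
  measurable_fun setT (oumax g).
Proof.
move=> mg g0; apply: (measurability _ (ErealGenOInfty.measurableE R)) => //.
move=> /= _ [_ [r ->] <-]; rewrite setTI.
rewrite (_ : _ @^-1` _ = [set x | r%:E < oumax g x]); last first.
  by apply/seteqP; split => x /=; rewrite in_itv/= andbT.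
by rewrite oumax_lev; apply: bigcup_measurable => n _; exact: mlev.
Qed.

(** Garsia's inequality with step [2^-n] controls the averages over multiples of that step.
    Continuity of the measure from below is used twice, for the number of steps and then for the
    refinement of the mesh; the bound depends on neither. *)
Lemma oumax_weak g (l : R) : measurable_fun setT g -> (forall x, 0 <= g x) ->
  (0 < l)%R -> l%:E * gam [set x | l%:E < oumax g x] <= \int[gam]_x g x.
Proof.
move=> mg g0 l0.
have [goo|] := eqVneq (\int[gam]_x g x) +oo; first by rewrite goo leey.
rewrite -ltey => gfin; rewrite -lee_pdivlMl// oumax_lev.
apply: (cvge_to_le (nondecreasing_cvg_mu _ _ (@lev_nd g l%:E))).
- by move=> n; exact: mlev.
- by apply: bigcup_measurable => n _; exact: mlev.
apply: nearW => n /=.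
have h0 : (0 < (2 ^+ n)^-1 :> R)%R by rewrite invr_gt0.
pose W N := [set x : E | 0 < garsia (2 ^+ n)^-1 l g N x].
have mW N : measurable (W N).
  have := emeasurable_fun_o_infty measurableT (measurable_garsia (2 ^+ n)^-1 l mg g0 N) 0.
  by rewrite setTI.
have ndW : nondecreasing_seq W.
  apply/nondecreasing_seqP => N; apply/subsetPset => x /= Wx.
  by apply: lt_le_trans Wx _; exact: garsia_nd.
apply: (@le_trans _ _ (gam (\bigcup_N W N))).
  apply: le_measure; rewrite ?inE; [exact: mlev|exact: bigcup_measurable|].
  move=> x [N _ /= H]; exists N.+1 => //; rewrite /W/=.
  have := garsia_ge h0 l0 mg g0 N.+1 x.
  rewrite ltNge; apply: contraL => garsia_le0; rewrite -ltNge.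
  have {}garsia_le0 : garsia (2 ^+ n)^-1 l g N.+1 x = 0.
    by apply/eqP; rewrite eq_le garsia_le0 garsia_ge0.
  rewrite garsia_le0 add0e; move: H; rewrite /ouavg invfM invrK mulrC EFinM -muleA.
  by rewrite muleCA lte_pdivlMl// -EFinM.
apply: (cvge_to_le (nondecreasing_cvg_mu mW _ ndW)); first exact: bigcup_measurable.
apply: nearW => N /=; rewrite lee_pdivlMl//; exact: garsia_weak.
Qed.

(** The part of [g] below [l] has averages at most [l], since [T_r] fixes constants. *)
Lemma oumax_split g (l : R) x : measurable_fun setT g -> (forall x, 0 <= g x) ->
  (0 < l)%R -> oumax g x <= l%:E + oumax (fun y => g y * ((l%:E < g y)%E%:R : R)%:E) x.
Proof.
move=> mg g0 l0; set g1 := fun y => g y * _.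
have g10 y : 0 <= g1 y by rewrite mule_ge0// lee_fin.
have mg1 : measurable_fun setT g1.
  apply: emeasurable_funM => //; apply/measurable_EFinP.
  apply: (@measurableT_comp _ _ _ _ _ _ (fun b : bool => b%:R : R)) => //.
  exact: measurable_fun_lte.
apply: ge_ereal_sup => _ [[n N] _ <-].
apply: le_trans (leeD2l _ (oumax_ge _ _ n N)) => /=.
set s := (_ / _)%R; have s0 : (0 < s)%R by rewrite divr_gt0.
rewrite /ouavg -[X in X%:E + _](mulKf (lt0r_neq0 s0)).
rewrite EFinM -ge0_muleDr; last 2 first.
- by rewrite lee_fin mulr_ge0// ltW.
- by apply: integral_ge0 => r _; exact: ou_ge0.
rewrite lee_wpmul2l ?lee_fin ?invr_ge0 ?(ltW s0)//.
have -> : (s * l)%:E = \int[mu]_(r in `]0%R, s]) (cst l%:E r).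
  by rewrite integral_cst//= lebesgue_measure_itv/= lte_fin s0 sube0 -EFinM mulrC.
rewrite -ge0_integralD//; last 3 first.
- by move=> r _; rewrite lee_fin ltW.
- by move=> r _; exact: ou_ge0.
- by apply: measurable_funTS; exact: measurable_ou_time.
apply: ge0_integral_mono => r; first by move=> _; exact: ou_ge0.
rewrite /= in_itv/= => /andP[r0 _].
rewrite -[X in X + _](ou_cst x r0 (ltW l0)) -ouD//; last by move=> y; rewrite lee_fin ltW.
apply: ou_mono => // y; rewrite /g1; case: ltP => H; first by rewrite mule1 leeDr// lee_fin ltW.
by rewrite mule0 adde0.
Qed.

(** Marcinkiewicz interpolation: the level [l] of the maximal function is governed by the part of
    [g] above [l / 2], to which the weak bound applies, and the layers are then summed by
    Tonelli. *)
Lemma oumax_strong (m : R) : (1 < m)%R -> exists2 C : R, (0 < C)%R &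
  forall g, measurable_fun setT g -> (forall x, 0 <= g x) ->
  \int[gam]_x (oumax g x `^ m) <= C%:E * \int[gam]_x (g x `^ m).
Proof.
move=> m1; have m0 : (0 < m)%R by lra.
(* The factor [m] comes from the layer-cake formula, [2] from the weak bound at level [l / 2], and
   the last factor from the layers [l < 2 g] integrated with exponent [m - 1]. *)
exists (m * (2 * (2 `^ (m - 1) / (m - 1))))%R.
  by rewrite !mulr_gt0 ?invr_gt0 ?powR_gt0// subr_gt0.
move=> g mg g0.
have mind (f1 f2 : E * measurableTypeR R -> \bar R) :
    measurable_fun setT f1 -> measurable_fun setT f2 ->
    measurable_fun setT (fun p => ((f1 p < f2 p)%E%:R : R)%:E).
  move=> mf1 mf2; apply/measurable_EFinP.
  apply: (@measurableT_comp _ _ _ _ _ _ (fun b : bool => b%:R : R)) => //.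
  exact: measurable_fun_lte.
have mM := measurable_oumax mg g0.
pose I := `]0%R, +oo[%classic : set R.
have mI : measurable I by exact: measurable_itv.
have mpow e : measurable_fun setT (fun p : E * measurableTypeR R => (p.2 `^ e)%:E).
  apply/measurable_EFinP; apply: (measurableT_comp (measurable_powR e)).
  exact: measurable_snd.
have m2E : measurable_fun setT (fun p : E * measurableTypeR R => p.2%:E).
  by apply/measurable_EFinP; exact: measurable_snd.
have mM1 : measurable_fun setT (fun p : E * measurableTypeR R => oumax g p.1).
  exact: measurableT_comp.
have mg1 : measurable_fun setT (fun p : E * measurableTypeR R => g p.1).
  exact: measurableT_comp.
rewrite (eq_integral (fun x => m%:E *
    \int[mu]_(l in I) ((l `^ (m - 1))%:E * ((l%:E < oumax g x)%E%:R : R)%:E))); last first.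
  move=> x _; rewrite integral_powR_layer ?oumax_ge0// muleCA -EFinM mulfV ?mule1//.
  by rewrite gt_eqF.
rewrite ge0_integralZl_EFin ?(ltW m0)//; last 2 first.
- by move=> x _; apply: integral_ge0 => l _; rewrite mule_ge0 ?lee_fin ?powR_ge0.
- apply: (measurable_integral_on mu (A := setT) (B := I) (fun p : E * measurableTypeR R =>
    (p.2 `^ (m - 1))%:E * ((p.2%:E < oumax g p.1)%E%:R : R)%:E)) => //.
  + by apply: measurable_funTS; apply: emeasurable_funM => //; exact: mind.
  + by move=> x l _ _; rewrite mule_ge0 ?lee_fin ?powR_ge0.
rewrite EFinM -muleA lee_wpmul2l ?lee_fin ?(ltW m0)//.
rewrite (tonelli_on gam mu (A := setT) (B := I) (fun p : E * measurableTypeR R =>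
    (p.2 `^ (m - 1))%:E * ((p.2%:E < oumax g p.1)%E%:R : R)%:E) measurableT mI); last 2 first.
- by apply: measurable_funTS; apply: emeasurable_funM => //; exact: mind.
- by move=> x l _ _; rewrite mule_ge0 ?lee_fin ?powR_ge0.
apply: (@le_trans _ _ (\int[mu]_(l in I) \int[gam]_x
   ((2 * l `^ (m - 1 - 1))%:E * (g x * ((l%:E < 2%:E * g x)%E%:R : R)%:E)))).
  apply: ge0_integral_mono => l.
    by move=> _; apply: integral_ge0 => x _; rewrite mule_ge0 ?lee_fin ?powR_ge0.
  rewrite /I/= in_itv/= andbT => l0.
  have l20 : (0 < l / 2)%R by rewrite divr_gt0.
  pose g1 := fun y => g y * (((l / 2)%:E < g y)%E%:R : R)%:E.
  have g10 y : 0 <= g1 y by rewrite mule_ge0// lee_fin.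
  have mi (f1 f2 : E -> \bar R) : measurable_fun setT f1 -> measurable_fun setT f2 ->
      measurable_fun setT (fun p => ((f1 p < f2 p)%E%:R : R)%:E).
    move=> mf1 mf2; apply/measurable_EFinP.
    apply: (@measurableT_comp _ _ _ _ _ _ (fun b : bool => b%:R : R)) => //.
    exact: measurable_fun_lte.
  have mg1' : measurable_fun setT g1 by apply: emeasurable_funM => //; exact: mi.
  have E1 : (l `^ (m - 1) = 2 * l `^ (m - 1 - 1) * (l / 2))%R.
    rewrite [in RHS]powRB; last by apply/implyP => _; rewrite gt_eqF.
    by rewrite powRr1 ?(ltW l0)//; field; rewrite gt_eqF.
  apply: (@le_trans _ _ ((l `^ (m - 1))%:E * gam [set x | (l / 2)%:E < oumax g1 x])).
    have mS : measurable [set x | (l / 2)%:E < oumax g1 x].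
      have := emeasurable_fun_o_infty measurableT (measurable_oumax mg1' g10) (l / 2)%:E.
      by rewrite setTI.
    rewrite -(setIT [set x | _]) -integral_indic// -ge0_integralZl_EFin ?powR_ge0//; last first.
      by apply/measurable_EFinP.
    apply: ge0_integral_mono => x _; first by rewrite mule_ge0 ?lee_fin ?powR_ge0.
    rewrite lee_wpmul2l ?lee_fin ?powR_ge0// indicE.
    have [lM|_] := ltP l%:E (oumax g x); last by rewrite ler0n.
    rewrite mem_set; first by rewrite lexx.
    rewrite /= ltNge; apply/negP => H.
    have := lt_le_trans lM (oumax_split x mg g0 l20); rewrite ltNge => /negP; apply.
    by apply: le_trans (leeD2l _ H) _; rewrite -EFinD lee_fin; lra.
  apply: (@le_trans _ _ ((2 * l `^ (m - 1 - 1))%:E * \int[gam]_x g1 x)).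
    rewrite E1 EFinM -muleA lee_wpmul2l ?lee_fin ?mulr_ge0 ?powR_ge0//.
    exact: oumax_weak.
  rewrite -ge0_integralZl_EFin ?mulr_ge0 ?powR_ge0//.
  rewrite le_eqVlt; apply/orP; left; apply/eqP; apply: eq_integral => x _.
  congr (_ * (_ * _)); congr (_%:R)%:E; congr nat_of_bool.
  by rewrite EFinM muleC lte_pdivrMl.
rewrite -(tonelli_on gam mu (A := setT) (B := I) (fun p : E * measurableTypeR R =>
    (2 * p.2 `^ (m - 1 - 1))%:E * (g p.1 * ((p.2%:E < 2%:E * g p.1)%E%:R : R)%:E))
    measurableT mI); last 2 first.
- apply: measurable_funTS; apply: emeasurable_funM.
    apply/measurable_EFinP; apply: measurable_funM => //.
    apply: (measurableT_comp (measurable_powR _)); exact: measurable_snd.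
  apply: emeasurable_funM => //; apply: mind => //; exact: emeasurable_funM.
- by move=> x l _ _; rewrite !mule_ge0 ?lee_fin ?mulr_ge0 ?powR_ge0.
have m10 : (0 < m - 1)%R by rewrite subr_gt0.
rewrite -ge0_integralZl_EFin; last 3 first.
- by move=> x _; exact: poweR_ge0.
- exact: (measurableT_comp (measurable_poweR m)).
- by rewrite mulr_ge0// divr_ge0 ?powR_ge0 ?(ltW m10).
apply: ge0_integral_mono => x _.
  by apply: integral_ge0 => l _; rewrite !mule_ge0 ?lee_fin ?mulr_ge0 ?powR_ge0.
have gx := g0 x.
rewrite /= (eq_integral (fun l : measurableTypeR R => (2%:E * g x) *
   ((l `^ (m - 1 - 1))%:E * ((l%:E < 2%:E * g x)%E%:R : R)%:E))); last first.
  by move=> l _; rewrite EFinM -!muleA; congr (_ * _); rewrite !muleA; congr (_ * _); rewrite muleC.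
rewrite ge0_integralZl//; last 3 first.
- apply: measurable_funTS; apply: emeasurable_funM.
    by apply/measurable_EFinP; exact: measurable_powR.
  apply/measurable_EFinP.
  apply: (@measurableT_comp _ _ _ _ _ _ (fun b : bool => b%:R : R)) => //.
  by apply: measurable_fun_lte => //.
- by move=> l _; rewrite mule_ge0 ?lee_fin ?powR_ge0.
- by rewrite mule_ge0.
rewrite integral_powR_layer ?mule_ge0//.
rewrite poweRM ?lee_fin// -!muleA.
case: (g x) gx => [r| |]// => [|_].
  rewrite lee_fin => r0; rewrite !poweR_EFin -!EFinM lee_fin.
  by rewrite -(mulr_powRB1 r0 m0) le_eqVlt; apply/orP; left; apply/eqP; ring.
rewrite [X in _ <= _ * X]poweRyr ?gt_eqF//.
by rewrite gt0_muley ?leey// lte_fin !mulr_gt0 ?invr_gt0 ?powR_gt0.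
exact: measurableT.
Qed.

End maximal.

(** * Variable exponents and the maximal function *)

Section mehler_bounds.
Context {R : realType} {d : nat}.
Local Notation E := (d.-tuple R).
Implicit Types x y : E.

Lemma exprn_le_expR (n : nat) (c z : R) : 0 < c -> 0 <= z ->
  z ^+ n <= (n.+1%:R / c) ^+ n * expR (c * z).
Proof.
move=> c0 z0; have nc : 0 < n.+1%:R / c by rewrite divr_gt0.
rewrite -ler_pdivrMl ?exprn_gt0// -exprVn -exprMn invf_div.
have k0 : 0 <= c / n.+1%:R * z by rewrite mulr_ge0 ?divr_ge0 ?(ltW c0).
apply: (@le_trans _ _ (expR (c / n.+1%:R * z) ^+ n)).
  by rewrite lerXn2r ?nnegrE ?expR_ge0// (le_trans _ (expR_ge1Dx _))// lerDr.
rewrite -expRM_natl ler_expR mulrCA mulrA; apply: ler_wpM2r => //.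
by rewrite -mulrA ler_piMr ?(ltW c0)// mulrC ler_pdivrMr// mul1r ler_nat.
Qed.

(** The square is completed around [exp (- r) x]; the remaining [|y|^2] compensates the Gaussian
    weight of the measure. *)
Lemma mehler_exponent (r : R) x y : 0 < r ->
  - ((expR (- (2 * r)) * (enorm x ^+ 2 + enorm y ^+ 2) - 2 * expR (- r) * inner x y)
     / (1 - expR (- (2 * r)))) =
  inner y y - inner (vsub y [tuple expR (- r) * tnth x i | i < d])
     (vsub y [tuple expR (- r) * tnth x i | i < d]) / (1 - expR (- r) ^+ 2).
Proof.
move=> r0; have s0 := expRN_lt1 r0; rewrite expR2N !enormX2; set u := expR (- r) in s0 *.
have -> : inner (vsub y [tuple u * tnth x i | i < d]) (vsub y [tuple u * tnth x i | i < d]) =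
    inner y y - 2 * u * inner x y + u ^+ 2 * inner x x.
  rewrite /inner !mulr_sumr -sumrB -big_split/=; apply: eq_bigr => i _.
  by rewrite !tnth_mktuple; ring.
by field; rewrite gt_eqF.
Qed.

Let sq x : R := inner x x.
Let scal (u : R) x : E := [tuple u * tnth x i | i < d].

(** Write [u (x - y) = (x - u y) - (1 - u) x] and use [|a - b|^2 <= 2 |a|^2 + 2 |b|^2] in each
    coordinate. *)
Lemma sq_sub_scal_ge1 (u : R) x y :
  u ^+ 2 * sq (vsub x y) / 2 - (1 - u) ^+ 2 * sq x <= sq (vsub x (scal u y)).
Proof.
rewrite /sq /inner mulr_sumr mulr_suml mulr_sumr -sumrB; apply: ler_sum => i _.
rewrite !tnth_mktuple; set a := tnth x i; set b := tnth y i.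
have := sqr_ge0 ((a - u * b) + (1 - u) * a); nra.
Qed.

Lemma sq_sub_scal_ge2 (u : R) x y :
  u ^+ 2 * sq x / 2 - sq y <= sq (vsub y (scal u x)).
Proof.
rewrite /sq /inner mulr_sumr mulr_suml -sumrB; apply: ler_sum => i _.
rewrite !tnth_mktuple; set a := tnth x i; set b := tnth y i.
have := sqr_ge0 ((b - u * a) + b); nra.
Qed.

Lemma sq_sub_ge x y : sq x / 2 - sq (vsub x y) <= sq y.
Proof.
rewrite /sq /inner mulr_suml -sumrB; apply: ler_sum => i _.
rewrite !tnth_mktuple; set a := tnth x i; set b := tnth y i.
have := sqr_ge0 (a - 2 * b); nra.
Qed.

Lemma sq_vsubC x y : sq (vsub x y) = sq (vsub y x).
Proof. by apply: eq_bigr => i _; rewrite !tnth_mktuple; ring. Qed.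

Lemma sq_vsub0 x y : sq (vsub x y) = 0 -> x = y.
Proof.
move=> /eqP; rewrite psumr_eq0; last by move=> i _; rewrite -expr2 sqr_ge0.
move=> /allP H; apply: eq_from_tnth => i; have := H i (mem_index_enum i).
by rewrite /= -expr2 sqrf_eq0 tnth_mktuple subr_eq0 => /eqP.
Qed.

(** The length scale of the kernel: its size is at most this to the power [- d], up to a factor
    depending on [x]. *)
Definition mehler_std (r : R) : R := Num.sqrt (1 - expR (- r) ^+ 2).

Lemma mehler_std_gt0 r : 0 < r -> 0 < mehler_std r.
Proof. by move=> r0; rewrite sqrtr_gt0 expRN_lt1. Qed.

Lemma mehler_std_lt1 r : 0 < r -> mehler_std r < 1.
Proof.
by move=> r0; rewrite -[ltRHS]sqrtr1 ltr_sqrt// ltrBlDr ltrDl exprn_gt0// expR_gt0.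
Qed.

Lemma mehlerE (r : R) x y : 0 < r -> mehler r x y =
  (mehler_std r)^-1 ^+ d *
  expR (sq y - sq (vsub y (scal (expR (- r)) x)) / mehler_std r ^+ 2).
Proof.
move=> r0; rewrite /mehler mehler_exponent// sqr_sqrtr ?(ltW (expRN_lt1 r0))//.
congr (_ * _); rewrite /mehler_std -powR12_sqrt ?(ltW (expRN_lt1 r0))// expR2N.
by rewrite -powRN -[RHS]powR_mulrn ?powR_ge0// -powRrM; congr powR; lra.
Qed.

Lemma mehlerE' (r : R) x y : 0 < r -> mehler r x y =
  (mehler_std r)^-1 ^+ d *
  expR (sq x - sq (vsub x (scal (expR (- r)) y)) / mehler_std r ^+ 2).
Proof. by move=> r0; rewrite mehlerC mehlerE. Qed.

Lemma mehler_le (r : R) x y : 0 < r ->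
  mehler r x y <= (mehler_std r)^-1 ^+ d * expR (enorm x ^+ 2).
Proof.
move=> r0; have s0 := mehler_std_gt0 r0.
rewrite enormX2 mehlerE'// ler_wpM2l ?exprn_ge0 ?invr_ge0 ?(ltW s0)// ler_expR.
by rewrite gerBl divr_ge0 ?inner_ge0// sqr_ge0.
Qed.

Variables (e : E -> R) (P A B einf kap : R).
Hypothesis eP : forall x, 1 <= e x <= P.
Hypothesis A0 : 0 < A.
Hypothesis eA : forall x y, `|e x - e y| <= A / ln (expR 1 + (enorm (vsub x y))^-1).
Hypothesis B0 : 0 < B.
Hypothesis eB : forall x, x != vzero -> `|e x - einf| <= B / enorm x ^+ 2.
Hypotheses (kap0 : 0 < kap) (kap8 : kap <= 8^-1).

Let P0 : 0 < P.
Proof. by have /andP[h1 h2] := eP vzero; lra. Qed.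

Let e_osc x y : `|e x - e y| <= P.
Proof.
have /andP[a1 a2] := eP x; have /andP[b1 b2] := eP y.
by rewrite ler_norml; apply/andP; split; lra.
Qed.

Let sq_gt0_neq0 x : 0 < sq x -> x != vzero.
Proof.
apply: contraTneq => ->; rewrite -leNgt /sq /inner big1// => i _.
by rewrite tnth_mktuple mul0r.
Qed.

Let e_decay x y t : 0 < t -> t <= sq x -> t <= sq y -> `|e x - e y| <= 2 * B / t.
Proof.
move=> t0 tx ty; have x0 := lt_le_trans t0 tx; have y0 := lt_le_trans t0 ty.
have dist w : 0 < sq w -> t <= sq w -> `|e w - einf| <= B / t.
  move=> w0 tw; apply: le_trans (eB (sq_gt0_neq0 w0)) _.
  by rewrite enormX2 ler_pM2l// lef_pV2.
have -> : e x - e y = (e x - einf) - (e y - einf) by ring.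
apply: le_trans (ler_normB _ _) _.
by rewrite -mulrA mulr_natl mulr2n lerD ?dist.
Qed.

(* Either [e x] may be traded for [e y] at a bounded cost, or the kernel is small. *)
Lemma mehler_dichotomy : exists2 C : R, 0 < C & forall r x y, 0 < r ->
  (2 + d%:R * ln (mehler_std r)^-1 + sq x) * `|e x - e y| <= C \/
  mehler r x y <= C * expR (kap * sq x).
Proof.
set dd : R := d%:R; have dd0 : 0 <= dd by exact: ler0n.
pose w := 2 * B / kap.
(* The sum of the trading costs in all favourable cases: nearby points, both points large, and large
   times. The terms [k8] and [k2] serve the cases of a small kernel. *)
pose G := 2 * P + 2 * A * dd + 4 * P + 8 * B + 32 * B * dd + w +
   (3 + 2 * dd) * P + (3 + 2 * dd) * w.
have w0 : 0 < w by rewrite divr_gt0// mulr_gt0.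
have PP := P0; have AA := A0; have BB := B0; have kk := kap0; have kk8 := kap8.
have AD0 : 0 <= A * dd by rewrite mulr_ge0// ltW.
have BD0 : 0 <= B * dd by rewrite mulr_ge0// ltW.
have PD0 : 0 <= P * dd by rewrite mulr_ge0// ltW.
have wD0 : 0 <= w * dd by rewrite mulr_ge0// ltW.
pose k8 := (d.+1%:R / 8^-1 : R) ^+ d; pose k2 := (2 : R) ^+ d.
have k80 : 0 <= k8 by rewrite exprn_ge0.
have k20 : 0 <= k2 by rewrite exprn_ge0.
exists (G + 1 + k8 + k2); first by rewrite /G; lra.
move=> r x y r0; set C := G + 1 + _ + _.
have CG : G <= C by rewrite /C; lra.
have s0 := mehler_std_gt0 r0; have s1 := mehler_std_lt1 r0.
set s := mehler_std r in s0 s1 *; set z := s^-1.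
have z1 : 1 < z by rewrite invf_gt1.
have z0 : 0 < z by lra.
have lz0 : 0 <= ln z by rewrite ln_ge0// ltW.
have lzz : ln z <= z by have := @le_ln1Dx _ (z - 1); rewrite subrKC => H; have := H ltac:(lra); lra.
have X0 : 0 <= sq x by exact: inner_ge0.
have Y0 : 0 <= sq y by exact: inner_ge0.
set u := expR (- r); have u0 : 0 < u by exact: expR_gt0.
have s2 : s ^+ 2 = 1 - u ^+ 2 by rewrite sqr_sqrtr ?(ltW (expRN_lt1 r0)).
have dx0 := normr_ge0 (e x - e y); set D := `|e x - e y| in dx0 *.
(* The factor [exp (- z / 8)] absorbs the singular [z ^ d], at the cost of the constant [k8]. *)
have bad (q : R) : mehler r x y <= z ^+ d * expR (- (8^-1 * z) + q) ->
    q <= kap * sq x -> mehler r x y <= C * expR (kap * sq x).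
  move=> H qk; apply: (le_trans H); rewrite expRD mulrA; apply: ler_pM => //.
  - by rewrite mulr_ge0 ?exprn_ge0 ?expR_ge0// ltW.
  - rewrite expRN -ler_pdivlMr ?invr_gt0 ?expR_gt0// invrK.
    apply: le_trans (@exprn_le_expR d 8^-1 z _ _) _ => //; first exact: ltW.
    by rewrite ler_wpM2r ?expR_ge0// -/k8 /C /G; lra.
  - by rewrite ler_expR.
(* Large times: [z] is at most [2], so harm can only come from a large [|x|] with
   [|y|^2 < kap |x|^2]; the kernel is then at most [2^d exp (|y|^2)]. *)
have [sL|sS] := lerP (2^-1) (s ^+ 2).
  have z2 : z <= 2.
    rewrite /z; rewrite -[leRHS]invrK lef_pV2 ?posrE//. nra.
  have [x1|x1] := lerP (sq x) 1.
    left; apply: le_trans CG; have := e_osc x y; rewrite -/D => DP.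
    apply: (@le_trans _ _ ((3 + 2 * dd) * P)); last by rewrite /G; lra.
    by apply: ler_pM => //; rewrite ?addr_ge0 ?mulr_ge0//; nra.
  have [yk|yk] := lerP (kap * sq x) (sq y).
    left; apply: le_trans CG.
    have kx0 : 0 < kap * sq x by rewrite mulr_gt0//; lra.
    have kxx : kap * sq x <= sq x by nra.
    have := e_decay kx0 kxx yk; rewrite -/D => DB.
    apply: (@le_trans _ _ ((3 + 2 * dd) * w)); last by rewrite /G; lra.
    apply: (@le_trans _ _ ((2 + dd * ln z + sq x) * (2 * B / (kap * sq x)))).
      by rewrite ler_wpM2l// !addr_ge0 ?mulr_ge0.
    have -> : 2 * B / (kap * sq x) = w / sq x by rewrite invfM mulrA.
    rewrite mulrCA mulrA (mulrC _ w) -mulrA ler_pM2l// ler_pdivrMr; last by lra.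
    have H1 : dd * ln z <= dd * 2 by rewrite ler_wpM2l//; lra.
    have : (dd * 2 + 2) * 1 <= (dd * 2 + 2) * sq x by rewrite ler_wpM2l//; lra.
    lra.
  right; rewrite mehlerE// -/s -/z; apply: ler_pM.
  - by rewrite exprn_ge0// ltW.
  - exact: expR_ge0.
  - apply: (@le_trans _ _ k2); last by rewrite /C /G; lra.
    by rewrite lerXn2r ?nnegrE// ltW.
  - rewrite ler_expR; have : 0 <= sq (vsub y (scal u x)) / s ^+ 2.
      by rewrite divr_ge0 ?inner_ge0// sqr_ge0.
    rewrite -/u; lra.
have u2 : 2^-1 < u ^+ 2 by lra.
have ule : 1 - u <= s ^+ 2.
  have u1 : u < 1 by rewrite /u expR_lt1 oppr_lt0.
  rewrite s2 expr2; nra.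
have s2z : s ^+ 2 = (z ^+ 2)^-1 by rewrite /z exprVn invrK.
have sz : s * z = 1 by rewrite mulfV// gt_eqF.
(* Here [|x - y| <= sqrt s]: the log-Hoelder condition controls [ln z] times the oscillation, and
   the decay condition controls [|x|^2] times it, because [|y|] is comparable with a large [|x|]. *)
have [Da|Da] := lerP (sq (vsub x y)) s.
  left; apply: le_trans CG.
  have [xy|xy] := eqVneq x y; first by rewrite /D xy subrr normr0 mulr0 /G; lra.
  have DP := e_osc x y; rewrite -/D in DP.
  have sq0 : 0 < sq (vsub x y).
    by rewrite lt_neqAle inner_ge0 andbT; apply: contra xy => /eqP/esym/sq_vsub0 ->.
  have T1 : 2 * D <= 2 * P by lra.
  have T2 : dd * ln z * D <= 2 * A * dd.
    have [lz|lzn] := ltP 0 (ln z); last first.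
      have -> : ln z = 0 by lra.
      by rewrite mulr0 mul0r; lra.
    have H : ln z / 2 <= ln (expR 1 + (enorm (vsub x y))^-1).
      have -> : ln z / 2 = ln (Num.sqrt z) by rewrite -powR12_sqrt ?(ltW z0)// ln_powR mulrC.
      have sz0 : 0 < Num.sqrt z by rewrite sqrtr_gt0.
      have e0 : 0 < enorm (vsub x y) by rewrite sqrtr_gt0.
      rewrite ler_ln ?posrE ?addr_gt0 ?expR_gt0 ?invr_gt0//.
      apply: (@le_trans _ _ (enorm (vsub x y))^-1); last by rewrite lerDr expR_ge0.
      rewrite -[leLHS]invrK lef_pV2 ?posrE ?invr_gt0//.
      have s0' : 0 <= s by rewrite -[s]invrK invr_ge0 ltW.
      have -> : (Num.sqrt z)^-1 = Num.sqrt s by rewrite -sqrtrV ?(ltW z0)// /z invrK.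
      by rewrite /enorm ler_sqrt.
    have DA : D <= A / (ln z / 2).
      have l2 : 0 < ln z / 2 by rewrite divr_gt0.
      by apply: le_trans (eA x y) _; rewrite ler_pM2l// lef_pV2 ?posrE// (lt_le_trans _ H).
    have -> : 2 * A * dd = dd * ln z * (A / (ln z / 2)) by field; rewrite gt_eqF.
    by rewrite ler_wpM2l// mulr_ge0.
  have T3 : sq x * D <= 4 * P + 8 * B.
    have [x4|x4] := lerP (sq x) 4.
      have : sq x * D <= 4 * P by apply: ler_pM.
      lra.
    have yx : sq x / 4 <= sq y by have := sq_sub_ge x y; lra.
    have := @e_decay x y (sq x / 4) _ _ yx; rewrite -/D => /(_ ltac:(lra) ltac:(lra)) H.
    apply: (@le_trans _ _ (sq x * (2 * B / (sq x / 4)))); first by rewrite ler_wpM2l.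
    have -> : sq x * (2 * B / (sq x / 4)) = 8 * B by field; lra.
    lra.
  rewrite !mulrDl /G; lra.
have zs2 : z = (z ^+ 2) * s by rewrite expr2 -mulrA (mulrC z s) sz mulr1.
(* From here on [|x - y|^2 > s], so the squared distance divided by [s ^ 2] is at least a multiple
   of [z]. The growth [exp X] can compensate this only if [X] is at least [z / 16]. *)
have bad1 (X W : R) : mehler r x y = z ^+ d * expR (X - W / s ^+ 2) ->
    X < z / 16 -> s / 4 - s ^+ 4 * X <= W -> mehler r x y <= C * expR (kap * sq x).
  move=> ME Xz XW; apply: (bad 0); last by rewrite mulr_ge0// ltW.
  rewrite ME ler_wpM2l ?exprn_ge0 ?(ltW z0)// ler_expR addr0.
  have : (s / 4 - s ^+ 4 * X) / s ^+ 2 <= W / s ^+ 2 by rewrite ler_wpM2r// invr_ge0 sqr_ge0.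
  have -> : (s / 4 - s ^+ 4 * X) / s ^+ 2 = z / 4 - s ^+ 2 * X by rewrite /z; field; rewrite gt_eqF.
  have : s ^+ 2 * X <= 2^-1 * (z / 16).
    have [XX|XX] := lerP 0 X; first by apply: ler_pM; rewrite ?sqr_ge0//; lra.
    by apply: (@le_trans _ _ 0); [rewrite mulr_ge0_le0 ?sqr_ge0//; lra|lra].
  lra.
have W12 (a b : E) : s < sq (vsub a b) ->
    s / 4 - s ^+ 4 * sq a <= sq (vsub a (scal u b)).
  move=> sab; apply: le_trans (sq_sub_scal_ge1 u a b).
  have H1 : 2^-1 * s <= u ^+ 2 * sq (vsub a b) by apply: ler_pM; lra.
  have H2 : (1 - u) ^+ 2 * sq a <= s ^+ 4 * sq a.
    apply: ler_wpM2r; first exact: inner_ge0.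
    have -> : s ^+ 4 = (s ^+ 2) ^+ 2 by rewrite -exprM.
    rewrite lerXn2r ?nnegrE ?sqr_ge0//.
    have u1 : u < 1 by rewrite /u expR_lt1 oppr_lt0.
    lra.
  lra.
have [xz|xz] := ltP (sq x) (z / 16).
  by right; apply: (bad1 (sq x) (sq (vsub x (scal u y)))) => //; [exact: mehlerE'|exact: W12].
have [yz|yz] := ltP (sq y) (z / 16).
  right; apply: (bad1 (sq y) (sq (vsub y (scal u x)))) => //; first exact: mehlerE.
  by apply: W12; rewrite sq_vsubC.
(* Both squares are at least [z / 16]. The decay condition at level [z / 16] absorbs [ln z <= z]; at
   level [kap |x|^2] it absorbs [|x|^2]. *)
have [yk|yk] := lerP (kap * sq x) (sq y).
  left; apply: le_trans CG.
  have DP := e_osc x y; rewrite -/D in DP.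
  have x0 : 0 < sq x by lra.
  have kx0 : 0 < kap * sq x by rewrite mulr_gt0.
  have kxx : kap * sq x <= sq x by rewrite ler_piMl//; lra.
  have D1 := @e_decay x y (z / 16) ltac:(lra) xz yz; rewrite -/D in D1.
  have D2 := @e_decay x y _ kx0 kxx yk; rewrite -/D in D2.
  have T2 : dd * ln z * D <= 32 * B * dd.
    apply: (@le_trans _ _ (dd * z * (2 * B / (z / 16)))).
      by apply: ler_pM => //; rewrite ?mulr_ge0// ler_wpM2l.
    by rewrite le_eqVlt; apply/orP; left; apply/eqP; field; rewrite gt_eqF.
  have T3 : sq x * D <= w.
    apply: (@le_trans _ _ (sq x * (2 * B / (kap * sq x)))); first by rewrite ler_wpM2l.
    by rewrite /w le_eqVlt; apply/orP; left; apply/eqP; field; rewrite !gt_eqF.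
  rewrite !mulrDl /G; lra.
(* Now [z / 16 <= |y|^2 < kap |x|^2] forces [|x|^2 >= z / 2] and keeps [y] away from [u x], so the
   exponent gains [- z / 8]. *)
right; apply: (bad (sq y)); last exact: ltW.
rewrite mehlerE// -/s -/z ler_wpM2l ?exprn_ge0 ?(ltW z0)// ler_expR.
have H1 : sq x / 8 <= sq (vsub y (scal u x)).
  apply: le_trans (sq_sub_scal_ge2 u x y).
  have : 2^-1 * sq x <= u ^+ 2 * sq x by rewrite ler_wpM2r//; lra.
  have : kap * sq x <= 8^-1 * sq x by rewrite ler_wpM2r.
  lra.
have H2 : z / 2 <= sq x.
  have : kap * sq x <= 8^-1 * sq x by rewrite ler_wpM2r.
  lra.
have H3 : z / 8 <= sq (vsub y (scal (expR (- r)) x)) / s ^+ 2.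
  rewrite ler_pdivlMr ?exprn_gt0//.
  have : z / 8 * s ^+ 2 <= z / 8 * 2^-1 by rewrite ler_wpM2l//; lra.
  rewrite -/u; lra.
lra.
Qed.

End mehler_bounds.

Lemma powRV (R : realType) (x r : R) : 0 < x -> x^-1 `^ r = (x `^ r)^-1.
Proof. by move=> x0; rewrite -powR_inv1 ?(ltW x0)// -powRrM mulN1r powRN. Qed.

Section variable_maximal.
Context {R : realType}.
Implicit Types F a b v : R.

(* [v <= L] or [v = v^b v^(1-b) <= v^b L^(1-b)], with [L = F^(1/a)]. *)
Lemma exponent_trade (F a b v K : R) : (0 < F) -> (1 <= a) -> (1 <= b) -> (0 <= v) ->
  (F `^ `|a - b| <= K) -> (F `^ (- `|a - b|) <= K) ->
  (v <= F `^ a^-1 + K * (F `^ a^-1 / F) * v `^ b).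
Proof.
move=> F0 a1 b1 v0 HK HK'.
have a0 : (0 < a) by lra.
have K0 : (0 <= K) by apply: le_trans HK; exact: powR_ge0.
set L := (F `^ a^-1).
have L0 : (0 < L) by rewrite powR_gt0.
have [vL|Lv] := lerP v L.
  rewrite -[leLHS]addr0 lerD// mulr_ge0 ?powR_ge0// mulr_ge0// divr_ge0// ltW//.
have vp : (0 < v) by apply: lt_trans Lv.
rewrite -[leLHS]add0r lerD ?(ltW L0)//.
have vb : (v `^ b = v * v `^ (b - 1)).
  rewrite -{2}[v]powRr1 ?(ltW vp)// -powRD ?subrKC//.
  by apply/implyP => _; rewrite gt_eqF.
have Lb : (L * L `^ (b - 1) = F `^ (b / a)).
  rewrite -{1}[L]powRr1 ?(ltW L0)// -powRD ?subrKC; last first.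
    by apply/implyP => _; rewrite gt_eqF.
  by rewrite /L -powRrM mulrC.
have LV : (L `^ (b - 1) <= v `^ (b - 1)).
  by apply: ge0_ler_powR; rewrite ?nnegrE ?(ltW vp) ?(ltW L0) ?(ltW Lv) ?subr_ge0.
have FD : (F `^ ((a - b) / a) <= K).
  have n0 := normr_ge0 (a - b).
  have ab1 : ((a - b) / a <= `|a - b|).
    by rewrite ler_pdivrMr//; have := ler_norm (a - b); nra.
  have ab2 : (- `|a - b| <= (a - b) / a).
    by rewrite ler_pdivlMr//; have := ler_norm (- (a - b)); rewrite normrN; nra.
  have [F1|F1] := lerP 1 F; first by apply: le_trans HK; apply: ler_powR.
  apply: le_trans HK'; rewrite -[F]invrK !(powRV _ (_ : 0 < F^-1)) ?invr_gt0//.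
  rewrite -!powRN; apply: ler_powR; first by rewrite invf_ge1// ltW.
  by rewrite lerNl opprK.
have E1 : (F <= K * F `^ (b / a)).
  rewrite -[leLHS]powRr1 ?(ltW F0)//.
  rewrite {1}(_ : 1 = (a - b) / a + b / a); last by field; rewrite gt_eqF.
  rewrite powRD; last by apply/implyP => _; rewrite gt_eqF.
  by rewrite ler_wpM2r ?powR_ge0.
rewrite vb mulrCA -[leLHS]mulr1 ler_pM2l//.
have -> : (K * (L / F) * v `^ (b - 1) = K * (L * v `^ (b - 1)) / F).
  by field; rewrite gt_eqF.
rewrite ler_pdivlMr// mul1r; apply: le_trans E1 _.
by rewrite -Lb !ler_wpM2l// ltW.
Qed.

Lemma powR_add_le a b p P : 0 <= a -> 0 <= b -> 1 <= p <= P ->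
  (a + b) `^ p <= 2 `^ P * (a `^ p + b `^ p).
Proof.
move=> a0 b0 /andP[p1 pP].
have H (u w : R) : 0 <= u -> u <= w -> (u + w) `^ p <= 2 `^ P * w `^ p.
  move=> u0 uw; have w0 : 0 <= w by exact: le_trans uw.
  apply: (@le_trans _ _ ((2 * w) `^ p)).
    by apply: ge0_ler_powR; rewrite ?nnegrE; lra.
  by rewrite powRM// ler_wpM2r ?powR_ge0// ler_powR//; lra.
have [ab|ba] := lerP a b.
  apply: le_trans (H _ _ a0 ab) _.
  by rewrite ler_wpM2l ?powR_ge0// lerDr powR_ge0.
rewrite addrC; apply: le_trans (H _ _ b0 (ltW ba)) _.
by rewrite ler_wpM2l ?powR_ge0// lerDl powR_ge0.
Qed.

Lemma le_poweR (r : R) (x y : \bar R) : 0 <= r -> (0 <= x -> x <= y -> x `^ r <= y `^ r)%E.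
Proof.
move=> r0 x0 xy; apply: gt0_ler_poweR => //; rewrite in_itv/= leey andbT//.
exact: le_trans xy.
Qed.

End variable_maximal.

Lemma integral_gauss_cst {R : realType} d (c : \bar R) :
  (\int[gauss_measure d]_x c = c)%E.
Proof.
rewrite integral_cst//.
by rewrite [X in (_ * X)%E](_ : _ = 1%E) ?mule1//; exact: gauss_measureT.
Qed.

(** * Jensen-type pointwise bounds with variable exponent *)

Section pointwise_bound.
Context {R : realType} {d : nat}.
Local Notation E := (d.-tuple R).
Local Notation gam := (gauss_measure d).
Local Notation mu := (@lebesgue_measure R).
Variables (e : E -> R) (P A B einf kap : R).
Hypothesis me : measurable_fun setT e.
Hypothesis eP : forall x, 1 <= e x <= P.
Hypothesis A0 : 0 < A.
Hypothesis eA : forall x y, `|e x - e y| <= A / ln (expR 1 + (enorm (vsub x y))^-1).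
Hypothesis B0 : 0 < B.
Hypothesis eB : forall x, x != vzero -> `|e x - einf| <= B / enorm x ^+ 2.
Hypotheses (kap0 : 0 < kap) (kap8 : kap <= 8^-1).

Local Open Scope ereal_scope.

Let G (g : E -> \bar R) (y : E) : \bar R := g y `^ e y.

Let mG g : measurable_fun setT g -> (forall x, 0 <= g x) -> measurable_fun setT (G g).
Proof. by move=> mg g0; apply: measurable_fun_poweR. Qed.

Let e0 x : (0 < e x)%R.
Proof. by have /andP[? ?] := eP x; lra. Qed.

Let g_leG g x : (forall x, 0 <= g x) -> g x <= 1 + G g x.
Proof.
move=> g0; have /andP[e1 _] := eP x.
rewrite /G; case: (g x) (g0 x) => [v| |]//; last by rewrite poweRyr ?gt_eqF.
rewrite lee_fin poweR_EFin -EFinD lee_fin => v0.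
have [v1|v1] := lerP v 1; first by have := powR_ge0 v (e x); lra.
have : (v `^ 1 <= v `^ e x)%R by apply: ler_powR => //; rewrite ltW.
by rewrite powRr1//; lra.
Qed.

Let ou_G_le r g x : (0 < r)%R -> measurable_fun setT g -> (forall x, 0 <= g x) ->
  \int[gam]_y G g y <= 1 ->
  ou r (G g) x <= ((mehler_std r)^-1 ^+ d * expR (enorm x ^+ 2))%:E.
Proof.
move=> r0 mg g0 G1.
apply: (@le_trans _ _ (\int[gam]_y
    (((mehler_std r)^-1 ^+ d * expR (enorm x ^+ 2))%:E * G g y))).
  apply: ge0_integral_mono => y _; first by rewrite mule_ge0 ?lee_fin ?mehler_ge0 ?poweR_ge0.
  by rewrite lee_wpmul2r ?poweR_ge0// lee_fin mehler_le.
have s0 := mehler_std_gt0 r0.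
have c0 : (0 <= (mehler_std r)^-1 ^+ d * expR (enorm x ^+ 2))%R.
  by rewrite mulr_ge0 ?expR_ge0// exprn_ge0// invr_ge0 ltW.
rewrite ge0_integralZl_EFin//; last 2 first.
- by move=> y _; exact: poweR_ge0.
- exact: mG.
by rewrite -[leRHS]mule1 lee_wpmul2l// lee_fin.
Qed.

(** The dichotomy is integrated over [y]. For [F = T_r (g ^ e)] the size of the kernel gives
    [1 + F <= 2 std^-d exp (|x|^2)], whose logarithm is at most the bracket of [mehler_dichotomy]:
    this is the origin of that bracket and bounds the cost of trading [e y] for [e x]. The points
    with a small kernel contribute [exp (kap |x|^2)] times the integral of [g], which is at most
    [2]. *)
Lemma ou_pointwise : exists2 C : R, (0 < C)%R & forall g r x,
  measurable_fun setT g -> (forall x, 0 <= g x) -> \int[gam]_y (g y `^ e y)%E <= 1 ->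
  (0 < r)%R ->
  ou r g x <= (C * ((1 + fine (ou r (fun y => g y `^ e y)%E x)) `^ (e x)^-1 +
                    expR (kap * inner x x)))%:E.
Proof.
have [C C0 HC] := mehler_dichotomy eP A0 eA B0 eB kap0 kap8.
exists (1 + expR C + 2 * C)%R; first by have := expR_gt0 C; lra.
move=> g r x mg g0 G1 r0.
have FE := ou_G_le x r0 mg g0 G1; rewrite -/(G g).
set F := fine (ou r (G g) x).
have G0 y : 0 <= G g y by exact: poweR_ge0.
have ou0 : 0 <= ou r (G g) x by exact: ou_ge0.
have ouE : ou r (G g) x = F%:E.
  by rewrite /F fineK// ge0_fin_numE//; apply: le_lt_trans FE _; exact: ltry.
have F0 : (0 <= F)%R by rewrite -lee_fin -ouE.
have /andP[ex1 _] := eP x.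
set L := ((1 + F) `^ (e x)^-1)%R.
have L0 : (0 <= L)%R by exact: powR_ge0.
set K := expR C; have K0 : (0 < K)%R by exact: expR_gt0.
set w := (K * (L / (1 + F)))%R.
have w0 : (0 <= w)%R by rewrite mulr_ge0 ?(ltW K0)// divr_ge0//; lra.
set b := (C * expR (kap * inner x x))%R.
have b0 : (0 <= b)%R by rewrite mulr_ge0 ?expR_ge0// ltW.
have step y : (mehler r x y)%:E * g y <=
    ((mehler r x y)%:E * L%:E + w%:E * ((mehler r x y)%:E * G g y)) + b%:E * g y.
  have m0 := mehler_ge0 r x y.
  have [good|bad] := HC r x y r0; last first.
    rewrite -[leLHS]add0e leeD//; last by rewrite lee_wpmul2r// lee_fin.
    by rewrite adde_ge0// ?mule_ge0 ?lee_fin.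
  rewrite -[leLHS]adde0 leeD//; last by rewrite mule_ge0 ?lee_fin.
  rewrite muleCA -ge0_muleDr ?mule_ge0 ?lee_fin//.
  rewrite lee_wpmul2l// ?lee_fin//.
  have ey := eP y; have /andP[ey1 _] := ey.
  rewrite /G; case: (g y) (g0 y) => [v| |]//; last first.
    rewrite poweRyr ?gt_eqF// => _; rewrite gt0_muley ?lee_fin ?leey//.
    by rewrite lte_fin /w mulr_gt0// divr_gt0 ?powR_gt0//; lra.
  rewrite lee_fin => v0; rewrite poweR_EFin -EFinM -EFinD lee_fin.
  have F1p : (0 < 1 + F)%R by lra.
  (* As [1 + F >= 1], the negative power asked for by [exponent_trade] lies below the positive
     one. *)
  suff HK : ((1 + F) `^ `|e x - e y| <= expR C)%R.
    apply: exponent_trade => //; apply: le_trans HK; apply: ler_powR; first by rewrite lerDl.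
    by rewrite (le_trans _ (normr_ge0 _))// oppr_le0.
  rewrite /powR gt_eqF// ler_expR; apply: le_trans good.
  rewrite mulrC ler_wpM2r//.
  move: FE; rewrite ouE lee_fin enormX2 => FE.
  set z := ((mehler_std r)^-1)%R in FE *.
  have z1 : (1 <= z)%R.
    by rewrite /z invf_ge1 ?mehler_std_gt0// ltW// mehler_std_lt1.
  have zd : (1 <= z ^+ d)%R by rewrite exprn_ege1.
  have sx : (1 <= expR (inner x x))%R by rewrite -expR0 ler_expR inner_ge0.
  have : (1 + F <= 2 * (z ^+ d * expR (inner x x)))%R.
    have : (1 * 1 <= z ^+ d * expR (inner x x))%R by apply: ler_pM.
    lra.
  rewrite -ler_ln ?posrE ?mulr_gt0 ?expR_gt0 ?exprn_gt0//; last by lra.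
  move=> /le_trans; apply.
  have z0 : (0 < z)%R by lra.
  rewrite lnM ?posrE ?mulr_gt0 ?expR_gt0 ?exprn_gt0//.
  rewrite lnM ?posrE ?expR_gt0 ?exprn_gt0//.
  rewrite expRK lnXn// -(mulr_natl (ln z)) addrA !lerD2r.
  have := @le_ln1Dx R 1 ltac:(lra); rewrite (_ : 1 + 1 = 2)%R//; lra.
have mm := @measurable_mehlerr R d r x.
have mGg := mG mg g0.
apply: (@le_trans _ _ (\int[gam]_y (((mehler r x y)%:E * L%:E +
    w%:E * ((mehler r x y)%:E * G g y)) + b%:E * g y))).
  apply: ge0_integral_mono => y _; last exact: step.
  by rewrite mule_ge0 ?lee_fin ?mehler_ge0.
have mMG : measurable_fun setT (fun y => (mehler r x y)%:E * G g y).
  exact: emeasurable_funM.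
have mML : measurable_fun setT (fun y => (mehler r x y)%:E * L%:E).
  exact: emeasurable_funM.
have MG0 y : 0 <= (mehler r x y)%:E * G g y by rewrite mule_ge0 ?lee_fin ?mehler_ge0.
have ML0 y : 0 <= (mehler r x y)%:E * L%:E by rewrite mule_ge0 ?lee_fin ?mehler_ge0.
rewrite ge0_integralD//; last 4 first.
- by move=> y _; rewrite adde_ge0// mule_ge0.
- by apply: emeasurable_funD => //; exact: emeasurable_funM.
- by move=> y _; rewrite mule_ge0 ?lee_fin.
- exact: emeasurable_funM.
rewrite ge0_integralD//; last 2 first.
- by move=> y _; rewrite mule_ge0 ?lee_fin.
- exact: emeasurable_funM.
rewrite (ge0_integralZl_EFin _ _ _ mMG)// -/(ou r (G g) x) ouE.
rewrite (ge0_integralZl_EFin _ _ _ mg)//.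
have -> : \int[gam]_y ((mehler r x y)%:E * L%:E) = L%:E.
  by rewrite -[LHS]/(ou r (cst L%:E) x) ou_cst.
have g2 : \int[gam]_y g y <= 2%:E.
  apply: (@le_trans _ _ (\int[gam]_y (1 + G g y))).
    by apply: ge0_integral_mono => y _ //; exact: g_leG.
  rewrite ge0_integralD//.
  rewrite integral_gauss_cst.
  by rewrite -[X in _ <= X%:E]/(1 + 1)%R EFinD leeD.
apply: (@le_trans _ _ (L%:E + w%:E * F%:E + b%:E * 2%:E)).
  by rewrite leeD2l// lee_wpmul2l ?lee_fin.
rewrite -!EFinM -!EFinD lee_fin.
have wF : (w * F <= K * L)%R.
  rewrite /w -mulrA ler_pM2l// mulrAC -mulrA ler_piMr// ler_pdivrMr; lra.
rewrite !mulrDl !mulrDr.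
have := expR_ge0 (kap * inner x x); set X := expR (kap * _).
move=> X0.
have KX : (0 <= K * X)%R by rewrite mulr_ge0// ltW.
have CL : (0 <= C * L)%R by rewrite mulr_ge0// ltW.
rewrite /b -/X; lra.
Qed.

Lemma ou_pointwise_power : exists2 C : R, (0 < C)%R & forall g r x,
  measurable_fun setT g -> (forall x, 0 <= g x) -> \int[gam]_y (g y `^ e y)%E <= 1 ->
  (0 < r)%R ->
  ou r g x `^ e x <= C%:E * (ou r (fun y => g y `^ e y)%E x +
                             (1 + expR (kap * P * inner x x))%:E).
Proof.
have [C C0 HC] := ou_pointwise.
exists ((1 + C) `^ P * 2 `^ P)%R; first by rewrite mulr_gt0// powR_gt0//; lra.
move=> g r x mg g0 G1 r0; have := HC g r x mg g0 G1 r0.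
have := ou_G_le x r0 mg g0 G1; rewrite -/(G g) => Ffin.
have ou0 : 0 <= ou r (G g) x by apply: ou_ge0 => y; exact: poweR_ge0.
have := ou_ge0 r x g0.
have : (0 <= fine (ou r (G g) x))%R by exact: fine_ge0.
have : ou r (G g) x = (fine (ou r (G g) x))%:E.
  by rewrite fineK// ge0_fin_numE//; apply: le_lt_trans Ffin _; exact: ltry.
set F := fine _ => -> F0; set X := expR _; set Y := expR _.
case: (ou r g x) => [v| |]//; rewrite !lee_fin => v0 vle.
have /andP[ex1 exP] := eP x.
have P1 : (1 <= P)%R by exact: le_trans exP.
set L := ((1 + F) `^ (e x)^-1)%R in vle *.
have L0 : (0 <= L)%R by exact: powR_ge0.
have X0 : (0 <= X)%R by exact: expR_ge0.
have XY : (X `^ e x <= Y)%R.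
  rewrite /X /Y -expRM ler_expR mulrAC ler_wpM2r ?inner_ge0//.
  by rewrite ler_wpM2l// ltW.
apply: (@le_trans _ _ (((1 + C) * (L + X)) `^ e x)%R).
  apply: ge0_ler_powR; rewrite ?nnegrE ?(ltW (e0 x))//.
    by rewrite mulr_ge0 ?addr_ge0//; lra.
  by apply: le_trans vle _; rewrite ler_wpM2r ?addr_ge0//; lra.
rewrite powRM ?addr_ge0//; last by lra.
rewrite -mulrA; apply: ler_pM; rewrite ?powR_ge0//.
  by apply: ler_powR => //; lra.
apply: le_trans (powR_add_le L0 X0 (eP x)) _.
rewrite ler_wpM2l ?powR_ge0// /L -powRrM mulVf ?gt_eqF// powRr1; lra.
Qed.

(** The exponent [e x] does not depend on the time, so Jensen's inequality over []0, S]] carries the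
    bound from each [T_r] to the averages, uniformly in [S]. *)
Lemma oumax_pointwise_power : exists2 C : R, (0 < C)%R & forall g x,
  measurable_fun setT g -> (forall x, 0 <= g x) -> \int[gam]_y (g y `^ e y)%E <= 1 ->
  oumax g x `^ e x <= C%:E * (oumax (fun y => g y `^ e y)%E x +
                             (1 + expR (kap * P * inner x x))%:E).
Proof.
have [C C0 HC] := ou_pointwise_power.
exists C => // g x mg g0 G1.
have mGg := mG mg g0; have Gg0 y : 0 <= G g y by exact: poweR_ge0.
set H := (1 + expR _)%R; have H0 : (0 <= H)%R by rewrite addr_ge0// expR_ge0.
set K := C%:E * _.
have K0 : 0 <= K by rewrite mule_ge0 ?adde_ge0 ?lee_fin ?oumax_ge0// ltW.
suff : oumax g x <= K `^ (e x)^-1.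
  move=> HK; have -> : K = (K `^ (e x)^-1) `^ e x.
    by rewrite -poweRrM mulVf ?gt_eqF// poweRe1.
  by apply: le_poweR => //; rewrite ?oumax_ge0// ltW.
apply/ereal_supP => _ [[n N] _ <-] /=.
set S := (N.+1%:R / 2 ^+ n)%R.
have S0 : (0 < S)%R by rewrite divr_gt0 ?ltr0n// exprn_gt0.
suff : ouavg S g x `^ e x <= K.
  move=> HK; rewrite -[leLHS](@poweRe1 R) ?ouavg_ge0 ?(ltW S0)//.
  rewrite -(@mulfV _ (e x)) ?gt_eqF// poweRrM.
  by apply: le_poweR => //; rewrite ?poweR_ge0// invr_ge0 ltW.
have mou : measurable_fun `]0%R, S] (fun r => ou r g x).
  by apply: measurable_funTS; exact: measurable_ou_time.
have mouG : measurable_fun `]0%R, S] (fun r => ou r (G g) x).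
  by apply: measurable_funTS; exact: measurable_ou_time.
have /andP[ex1 _] := eP x.
have Si0 : (0 <= S^-1)%R by rewrite invr_ge0 ltW.
have kint : \int[mu]_(r in `]0%R, S]) (S^-1)%:E = 1.
  rewrite integral_cst//= lebesgue_measure_itv/= lte_fin S0 EFinN sube0 -EFinM.
  by rewrite mulVf ?gt_eqF.
rewrite /ouavg -ge0_integralZl_EFin//; last by move=> r _; exact: ou_ge0.
apply: le_trans (ge0_poweR_jensen _ _ _ _ _ ex1 _) _ => //.
- by move=> r _; exact: ou_ge0.
- by rewrite kint.
apply: (@le_trans _ _ (\int[mu]_(r in `]0%R, S])
    ((S^-1)%:E * (C%:E * (ou r (G g) x + H%:E))))).
  apply: ge0_integral_mono => r; first by rewrite mule_ge0 ?poweR_ge0 ?lee_fin.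
  by rewrite /= in_itv/= => /andP[r0 _]; rewrite lee_wpmul2l ?lee_fin// HC.
rewrite ge0_integralZl_EFin//; last 2 first.
- by move=> r _; rewrite mule_ge0 ?lee_fin ?(ltW C0)// adde_ge0 ?lee_fin ?ou_ge0.
- by apply: emeasurable_funM => //; exact: emeasurable_funD.
rewrite ge0_integralZl_EFin ?(ltW C0)//; last 2 first.
- by move=> r _; rewrite adde_ge0 ?lee_fin ?ou_ge0.
- exact: emeasurable_funD.
rewrite muleCA lee_wpmul2l ?lee_fin ?(ltW C0)//.
rewrite ge0_integralD//; last by move=> r _; exact: ou_ge0.
rewrite ge0_muleDr ?integral_ge0//; last by move=> r _; exact: ou_ge0.
apply: leeD; first exact: (oumax_ge _ _ n N).
rewrite integral_cst//= lebesgue_measure_itv/= lte_fin S0 EFinN sube0 -!EFinM lee_fin.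
by rewrite mulrCA mulVf ?mulr1// gt_eqF.
Qed.

End pointwise_bound.

(** * The maximal function on variable Lebesgue spaces *)

Section variable_maximal_theorem.
Context {R : realType} {d : nat}.
Local Notation E := (d.-tuple R).
Local Notation gam := (gauss_measure d).
Local Open Scope ereal_scope.
Implicit Types (g : E -> \bar R) (x : E).

(** Meant for a Luxemburg norm [v]: admissible [l] exist arbitrarily close above it, but the infimum
    need not be attained. *)
Lemma le_mule_of_gt (v w : \bar R) (C : R) : (0 < C)%R -> 0 <= v ->
  (forall l : R, (0 < l)%R -> v < l%:E -> w <= (C * l)%:E) -> w <= C%:E * v.
Proof.
move=> C0; case: v => [v| |]//; last by rewrite gt0_muley ?leey.
rewrite lee_fin => v0 H; apply/lee_addgt0Pr => e e0.
have -> : C%:E * v%:E + e%:E = (C * (v + e / C))%:E.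
  by rewrite -EFinM -EFinD; congr EFin; field; rewrite gt_eqF.
have eC : (0 < e / C)%R by rewrite divr_gt0.
by apply: H; rewrite ?lte_fin; lra.
Qed.

Lemma ouavgZ (s c : R) g x : (0 <= s)%R -> (0 <= c)%R -> measurable_fun setT g ->
  (forall x, 0 <= g x) -> ouavg s (fun y => c%:E * g y) x = c%:E * ouavg s g x :> \bar R.
Proof.
move=> s0 c0 mg g0; rewrite /ouavg muleCA -(ge0_integralZl_EFin _ _ _ _ c0)//; last 2 first.
- by move=> r _; exact: ou_ge0.
- by apply: measurable_funTS; exact: measurable_ou_time.
by congr (_ * _); apply: eq_integral => r _; exact: ouZ.
Qed.

Lemma oumaxZ (c : R) g x : (0 <= c)%R -> measurable_fun setT g -> (forall x, 0 <= g x) ->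
  c%:E * oumax g x <= oumax (fun y => c%:E * g y) x :> \bar R.
Proof.
move=> c0 mg g0; have [->|cn] := eqVneq c 0%R.
  by rewrite mul0e oumax_ge0// => y; rewrite mule_ge0.
have cp : (0 < c)%R by rewrite lt_neqAle eq_sym cn.
rewrite -lee_pdivlMl//; apply/ereal_supP => _ [[n N] _ <-] /=.
rewrite lee_pdivlMl// -(ouavgZ x _ c0 mg g0) ?divr_ge0 ?exprn_ge0//.
exact: (oumax_ge _ _ n N).
Qed.

Lemma ge0_poweR_probability (g : E -> \bar R) (m : R) : (1 <= m)%R -> measurable_fun setT g ->
  (forall x, 0 <= g x) -> (\int[gam]_x g x) `^ m <= \int[gam]_x (g x `^ m).
Proof.
move=> m1 mg g0.
have := @ge0_poweR_jensen _ _ R gam setT (cst 1) g m measurableT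
  (measurable_cst _) mg (fun _ _ => lee01) (fun x _ => g0 x) m1.
rewrite integral_gauss_cst => /(_ (lexx _)).
by under eq_integral do rewrite mul1e; under [in X in _ <= X]eq_integral do rewrite mul1e.
Qed.

(** With [e = p / m] the pointwise bound for [e] is raised to the power [m]; the main term becomes
    the maximal function of [h ^ e] in [L^m], and [(h ^ e) ^ m = h ^ p] returns the given
    modular. *)
Lemma luxnorm_oumax_scaled (p : E -> R) (m P A B pinf : R) : (1 < m)%R ->
  measurable_fun setT p -> (forall x, m <= p x <= P)%R -> (0 < A)%R -> (0 < B)%R ->
  (forall x y, `|p x - p y| <= A / ln (expR 1 + (enorm (vsub x y))^-1))%R ->
  (forall x, x != vzero -> `|p x - pinf| <= B / enorm x ^+ 2)%R ->
  exists2 C : R, (0 < C)%R & forall g, measurable_fun setT g -> (forall x, 0 <= g x) ->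
  luxnorm gam setT p (oumax g) <= C%:E * luxnorm gam setT p g.
Proof.
move=> m1 mp mpP A0 B0 pA pB.
have m0 : (0 < m)%R by lra.
have mi0 : (0 < m^-1)%R by rewrite invr_gt0.
have mi1 : (m^-1 <= 1)%R by rewrite invf_le1// ltW.
pose e x := (p x / m)%R.
have me : measurable_fun setT e by exact: measurable_funM.
have eP x : (1 <= e x <= P / m)%R.
  have /andP[H1 H2] := mpP x.
  by rewrite ler_pdivlMr// mul1r H1 ler_pM2r.
have P1 : (1 <= P / m)%R by have /andP[H1 H2] := eP vzero; exact: le_trans H2.
have P0 : (0 < P)%R by move: P1; rewrite ler_pdivlMr//; lra.
have escale (a b : R) : (`|a / m - b / m| <= `|a - b|)%R.
  by rewrite -mulrBl normrM (gtr0_norm mi0) ler_piMr.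
have eA x y : (`|e x - e y| <= A / ln (expR 1 + (enorm (vsub x y))^-1))%R.
  exact: le_trans (escale _ _) (pA _ _).
have eB x : x != vzero -> (`|e x - pinf / m| <= B / enorm x ^+ 2)%R.
  by move=> x0; exact: le_trans (escale _ _) (pB _ x0).
(* The remainder [exp (kap (P / m) |x|^2)] will be raised to the power [m]; this choice turns it
   into [exp (|x|^2 / 8)], which is integrable for the Gaussian measure. *)
pose kap : R := (8^-1 / (P / m * m))%R.
have Pm0 : (1 <= P / m * m)%R by rewrite -[leLHS]mulr1 ler_pM// ltW.
have kap0 : (0 < kap)%R by rewrite divr_gt0//; lra.
have kap8 : (kap <= 8^-1)%R by rewrite ler_pdivrMr ?ler_peMr//; lra.
have [C C0 HC] := oumax_pointwise_power me eP A0 eA B0 eB kap0 kap8.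
have [D D0 HD] := @oumax_strong R d m m1.
pose K := (expR (8^-1 * enorm (_ : E) ^+ 2))%R.
pose I8 := ((Num.sqrt (1 - 8^-1 : R))^-1 ^+ d)%R.
have I80 : (0 <= I8)%R by rewrite exprn_ge0// invr_ge0 sqrtr_ge0.
pose C1 := (C `^ m * 2 `^ m * (D + 2 `^ m * (1 + I8)))%R.
have C10 : (0 < C1)%R.
  by rewrite !mulr_gt0 ?powR_gt0// ltr_wpDr// mulr_ge0 ?powR_ge0//; lra.
exists (1 + C1)%R; first by lra.
move=> g mg g0; apply: le_mule_of_gt; [by lra|exact: luxnorm_ge0|] => l l0 gl.
have p0 x : (0 <= p x)%R by have /andP[H1 H2] := mpP x; lra.
have p1 x : (1 <= p x)%R by have /andP[H1 H2] := mpP x; lra.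
have := luxnorm_gt_modular (fun x _ => p0 x) gl.
pose h x := (l^-1)%:E * g x.
have li0 : (0 <= l^-1)%R by rewrite invr_ge0 ltW.
have h0 x : 0 <= h x by rewrite mule_ge0 ?lee_fin.
have mh : measurable_fun setT h by exact: emeasurable_funM.
have eE (f : E -> \bar R) x : (f x `^ e x) `^ m = f x `^ p x.
  by rewrite -poweRrM mulfVK ?gt_eqF.
rewrite (eq_integral (fun x => (h x `^ e x) `^ m)); last first.
  by move=> x _; rewrite eE gee0_abs//; exact: h0.
move=> Gm1.
have mG : measurable_fun setT (fun x => h x `^ e x).
  by apply: measurable_fun_poweR.
have G0 x : 0 <= h x `^ e x by exact: poweR_ge0.
(* The pointwise bound wants [h ^ e] normalised, whereas the norm controls its [m]-th power;
   Jensen's inequality on a probability space links the two. *)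
have G1 : \int[gam]_x (h x `^ e x) <= 1.
  have I0 : 0 <= \int[gam]_x (h x `^ e x) by exact: integral_ge0.
  have : (\int[gam]_x (h x `^ e x)) `^ m <= 1.
    by apply: le_trans Gm1; apply: ge0_poweR_probability => //; exact: ltW.
  move=> /(@le_poweR _ m^-1 _ _ (ltW mi0) (poweR_ge0 _ _)).
  rewrite -poweRrM mulfV ?gt_eqF// poweRe1//.
  by rewrite poweR_EFin powR1.
rewrite mulrC; apply: luxnorm_le_modular => //; first exact: measurable_oumax.
- by lra.
apply: (@le_trans _ _ (\int[gam]_x ((C `^ m * 2 `^ m)%:E * (oumax (fun y => h y `^ e y) x `^ m
   + (2 `^ m)%:E * (1%:E + (expR (8^-1 * enorm x ^+ 2))%:E))))).
  apply: ge0_integral_mono => x _; first exact: poweR_ge0.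
  rewrite gee0_abs ?mule_ge0 ?lee_fin ?oumax_ge0//.
  apply: (@le_trans _ _ (oumax h x `^ p x)).
    by apply: le_poweR => //; rewrite ?mule_ge0 ?lee_fin ?oumax_ge0// oumaxZ.
  have EQ : (oumax h x `^ e x) `^ m = oumax h x `^ p x := eE (oumax h) x.
  apply: (@le_trans _ _ ((oumax h x `^ e x) `^ m)); first by rewrite EQ.
  apply: le_trans (le_poweR (ltW m0) (poweR_ge0 _ _) (HC h x mh h0 G1)) _.
  rewrite poweRM ?adde_ge0 ?lee_fin ?oumax_ge0 ?addr_ge0 ?expR_ge0 ?(ltW C0)//.
  rewrite poweR_EFin EFinM -muleA lee_wpmul2l ?lee_fin ?powR_ge0//.
  set X := expR (kap * _ * _).
  have XE : (X `^ m = expR (8^-1 * enorm x ^+ 2))%R.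
    by rewrite /X -expRM /kap enormX2; congr expR; field; rewrite !gt_eqF//.
  have X0 : (0 <= X)%R by exact: expR_ge0.
  have mm : (1 <= m <= m)%R by rewrite lexx ltW.
  case: (oumax _ x) (oumax_ge0 x G0) => [v| |]//; last first.
    by move=> _; rewrite poweRyr ?gt_eqF//= gt0_muley ?leey// lte_fin powR_gt0.
  rewrite lee_fin => v0; rewrite -EFinD !poweR_EFin.
  rewrite lee_fin.
  apply: le_trans (powR_add_le v0 (_ : 0 <= 1 + X)%R mm) _; first by rewrite addr_ge0.
  rewrite ler_wpM2l ?powR_ge0// lerD2l -XE.
  by apply: le_trans (powR_add_le ler01 X0 mm) _; rewrite powR1.
have mO : measurable_fun setT (fun x => oumax (fun y => h y `^ e y) x `^ m).
  exact: measurableT_comp (measurable_poweR _) (measurable_oumax mG G0).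
have mX : measurable_fun setT (fun x : E => (expR (8^-1 * enorm x ^+ 2))%:E).
  apply/measurable_EFinP; apply: measurableT_comp => //.
  by apply: measurable_funM => //; exact: measurable_enormX2.
have m1X : measurable_fun setT (fun x : E => 1%:E + (expR (8^-1 * enorm x ^+ 2))%:E).
  exact: emeasurable_funD.
have X0 x : 0 <= 1%:E + (expR (8^-1 * enorm (x : E) ^+ 2))%:E.
  by rewrite adde_ge0 ?lee_fin ?expR_ge0.
rewrite ge0_integralZl_EFin ?mulr_ge0 ?powR_ge0//; last 2 first.
- by move=> x _; rewrite adde_ge0 ?poweR_ge0// mule_ge0 ?lee_fin ?powR_ge0.
- by apply: emeasurable_funD => //; exact: emeasurable_funM.
rewrite ge0_integralD//; last 3 first.
- by move=> x _; exact: poweR_ge0.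
- by move=> x _; rewrite mule_ge0 ?lee_fin ?powR_ge0.
- exact: emeasurable_funM.
rewrite ge0_integralZl_EFin ?powR_ge0// ge0_integralD//.
rewrite integral_gauss_cst integral_gauss_expR -/I8; last by lra.
apply: (@le_trans _ _ ((C `^ m * 2 `^ m)%:E * (D%:E + (2 `^ m)%:E * (1 + I8%:E)))).
  rewrite lee_wpmul2l ?lee_fin ?mulr_ge0 ?powR_ge0// leeD2r//.
  apply: le_trans (HD _ mG G0) _.
  by rewrite -[leRHS]mule1 lee_wpmul2l ?lee_fin ?(ltW D0).
by rewrite lee_fin -/C1; lra.
Qed.

(** The essential infimum bounds [p] from below only almost everywhere. Taking the maximum with [m]
    changes [p] on a null set and, being a contraction, preserves both regularity conditions. *)
Lemma luxnorm_oumax (p : E -> R) : Pgamma p -> LH0 p ->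
  1 < ess_inf gam (EFin \o p) ->
  exists2 C : R, (0 < C)%R & forall g, measurable_fun setT g -> (forall x, 0 <= g x) ->
  luxnorm gam setT p (oumax g) <= C%:E * luxnorm gam setT p g.
Proof.
move=> [mp p1 [B [pinf [B0 _ pB]]]] [A A0 pA] pinf1.
have [m m1 Hm] : exists2 m : R, (1 < m)%R & m%:E <= ess_inf gam (EFin \o p).
  case: (ess_inf gam (EFin \o p)) pinf1 => [v| |]//; first by exists v.
  by exists 2%R => //; [lra|rewrite leey].
pose p' x := Num.max (p x) m.
have mp' : measurable_fun setT p' by exact: measurable_maxr.
have pp' : {ae gam, forall x, setT x -> p x = p' x}.
  have : \forall x \ae gam, m%:E <= (EFin \o p) x by exact/ess_infP.
  by apply: filterS => x; rewrite lee_fin => mx _; rewrite /p' max_l.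
have max_lip (a b c : R) : (`|Num.max a c - Num.max b c| <= `|a - b|)%R.
  have := ler_norm (a - b); have := ler_norm (b - a); rewrite distrC.
  by rewrite /Num.max; do 2 case: ltrP => ? //; rewrite ?subrr ?normr_ge0// ler_norml; lra.
(* The logarithm in [LH0] is at least [1], so [p] differs from its value at the origin by at most
   [A]. *)
pose P := (Num.max (p vzero) m + A)%R.
have p'P x : (m <= p' x <= P)%R.
  rewrite /p' le_max lexx orbT/= /P.
  have := le_trans (max_lip _ _ m) (pA x vzero).
  set w := ln _ => H.
  have w1 : (1 <= w)%R.
    rewrite /w -[leLHS]expRK ler_ln ?posrE ?expR_gt0//.
      by rewrite lerDl invr_ge0 sqrtr_ge0.
    by rewrite ltr_wpDr ?expR_gt0// invr_ge0 sqrtr_ge0.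
  have : (A / w <= A)%R by rewrite ler_pdivrMr ?ler_peMr ?(ltW A0)//; lra.
  have := ler_norm (Num.max (p x) m - Num.max (p vzero) m)%R.
  by move=> H1 H2; lra.
have [C C0 HC] := @luxnorm_oumax_scaled p' m P A B (Num.max pinf m) m1 mp' p'P A0 B0
  (fun x y => le_trans (max_lip _ _ m) (pA x y))
  (fun _ nz => le_trans (max_lip _ _ m) (pB _ nz)).
exists C => // g mg g0.
rewrite (@luxnorm_ae_eq _ _ _ _ setT p p' _)//; last exact: measurable_oumax.
by rewrite (@luxnorm_ae_eq _ _ _ _ setT p p' g)//; exact: HC.
Qed.

End variable_maximal_theorem.

(** * Poisson subordination *)

Section subordinator_bounds.
Context {R : realType}.
Local Notation mu := (@lebesgue_measure R).
Implicit Types t s r : R.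

Definition dpsub t r : R :=
  (2 * Num.sqrt pi)^-1 / (r * Num.sqrt r) * (1 - 2 * (t ^+ 2 / (4 * r))) *
  expR (- (t ^+ 2 / (4 * r))).

Lemma is_derive_psub t r : is_derive t (1 : R) (fun t => psub t r) (dpsub t r).
Proof.
pose c := (2 * Num.sqrt pi : R)^-1 / (r * Num.sqrt r).
pose a := (4 * r)^-1.
have HX : is_derive t (1 : R) (fun t : R => t ^+ 2) (2 * t).
  by have := @is_deriveX R R^o id 2 t 1 1 (is_derive_id _ _); move/is_derive_eq; apply;
     rewrite /= expr1 /GRing.scale/= mulr1.
have HN := is_deriveN (@is_deriveZ R R^o R^o _ a t 1 _ HX).
have HE := @is_derive1_comp R expR _ t _ _ (is_derive_expR _) HN.
have HM := @is_deriveM R R^o id _ t 1 _ _ (is_derive_id _ _) HE.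
have := @is_deriveZ R R^o R^o _ c t 1 _ HM.
rewrite (_ : c \*: _ = (fun t => psub t r)).
  move=> /is_derive_eq; apply; rewrite /GRing.scale/= /dpsub -/c !mulr1.
  rewrite (_ : t ^+ 2 / (4 * r) = a * t ^+ 2) 1?mulrC//; ring.
apply/funext => u; rewrite -[LHS]/(c * (u * expR (- (a * u ^+ 2)))) /psub /c.
by rewrite (_ : u ^+ 2 / (4 * r) = a * u ^+ 2) 1?mulrC//; ring.
Qed.

(* A majorant of [dpsub s] up to a constant which, unlike [dpsub s], is nonincreasing in [r]:
   it is therefore a superposition of averages over intervals [0, u] with [u >= s ^+ 2]. *)
Definition tailw s r : R := Num.max r (s ^+ 2) `^ (- (3 / 2)).

Lemma tailw_ge0 s r : 0 <= tailw s r. Proof. exact: powR_ge0. Qed.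

Lemma measurable_tailw dZ (Z : measurableType dZ) (f g : Z -> R) :
  measurable_fun setT f -> measurable_fun setT g ->
  measurable_fun setT (fun z => tailw (f z) (g z)).
Proof.
move=> mf mg; apply: (measurableT_comp (measurable_powR _)).
by apply: measurable_maxr => //; exact: measurable_funX.
Qed.

Lemma tailw_anti s t r : 0 <= s -> s <= t -> 0 < r -> tailw t r <= tailw s r.
Proof.
move=> s0 st r0; rewrite /tailw !powRN lef_pV2 ?posrE ?powR_gt0 ?lt_max ?r0//.
have m0 u : 0 <= Num.max r u by rewrite le_max ltW.
apply: ge0_ler_powR => //; rewrite ?nnegrE//.
by rewrite ge_max !le_max lexx/= lerXn2r ?orbT ?nnegrE//; exact: le_trans st.
Qed.

(** This is [max(r, t^2) <= r (1 + t^2 / r)] raised to the power [3 / 2], then rounded up to [2];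
    the polynomial loss in [t^2 / r] is paid by the exponential factor of [psub]. *)
Lemma inv_le_tailw t r : 0 < t -> 0 < r ->
  (r * Num.sqrt r)^-1 <= tailw t r * (1 + 4 * (t ^+ 2 / (4 * r))) ^+ 2.
Proof.
move=> t0 r0.
have t2 : 0 < t ^+ 2 by rewrite exprn_gt0.
have -> : 4 * (t ^+ 2 / (4 * r)) = t ^+ 2 / r by field; rewrite gt_eqF.
set m := Num.max r (t ^+ 2).
have m0 : 0 < m by rewrite lt_max r0.
have rE : r * Num.sqrt r = r `^ (3 / 2).
  rewrite (_ : 3 / 2 = 1 + 2^-1); last by field.
  rewrite powRD ?powRr1 ?(ltW r0) ?powR12_sqrt ?(ltW r0)//.
  by apply/implyP => _; rewrite gt_eqF.
rewrite rE -powRN.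
have mr : m <= r * (1 + t ^+ 2 / r).
  by rewrite mulrDr mulr1 mulrCA mulfV ?gt_eqF// mulr1 ge_max lerDl lerDr !ltW.
set w := 1 + t ^+ 2 / r in mr *.
have w1 : 1 <= w by rewrite lerDl divr_ge0// ltW.
have w0 : 0 < w by lra.
apply: (@le_trans _ _ (tailw t r * w `^ (3 / 2))); last first.
  rewrite ler_wpM2l ?powR_ge0// -powR_mulrn ?(ltW w0)// ler_powR//; lra.
rewrite /tailw -/m !powRN [leRHS]mulrC ler_pdivlMr ?powR_gt0// [leLHS]mulrC ler_pdivrMr ?powR_gt0//.
rewrite [leRHS]mulrC -powRM ?(ltW r0) ?(ltW w0)//.
by apply: ge0_ler_powR; rewrite ?nnegrE ?(ltW m0)// mulr_ge0// ltW.
Qed.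

Lemma polyexp_bounded (N : nat) : exists2 C : R, 0 < C &
  forall q, 0 <= q -> (1 + 4 * q) ^+ N * expR (- q) <= C.
Proof.
have c4 : 0 < 4^-1 :> R by lra.
exists ((N.+1%:R / 4^-1) ^+ N * expR 4^-1).
  by rewrite mulr_gt0 ?expR_gt0// exprn_gt0// divr_gt0.
move=> q q0; rewrite expRN ler_pdivrMr ?expR_gt0// -mulrA -expRD.
have -> : 4^-1 + q = 4^-1 * (1 + 4 * q) by lra.
by apply: exprn_le_expR => //; lra.
Qed.

Lemma dpsub_norm_le t r : 0 < r -> `|dpsub t r| <=
  (2 * Num.sqrt pi)^-1 * ((r * Num.sqrt r)^-1 *
    ((1 + 4 * (t ^+ 2 / (4 * r))) * expR (- (t ^+ 2 / (4 * r))))).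
Proof.
move=> r0; rewrite /dpsub; set q := t ^+ 2 / (4 * r).
have q0 : 0 <= q by rewrite divr_ge0 ?sqr_ge0// mulr_ge0// ltW.
have c0 : 0 <= (2 * Num.sqrt pi)^-1 :> R by rewrite invr_ge0 mulr_ge0 ?sqrtr_ge0.
have d0 : 0 <= (r * Num.sqrt r)^-1 by rewrite invr_ge0 mulr_ge0 ?sqrtr_ge0// ltW.
rewrite !normrM (ger0_norm c0) (ger0_norm d0) (ger0_norm (expR_ge0 _)) -!mulrA.
rewrite !ler_wpM2l// ler_wpM2r ?expR_ge0//.
by rewrite ler_norml; apply/andP; split; lra.
Qed.

Lemma dpsub_le : exists2 C : R, 0 < C & forall t r, 0 < t -> 0 < r ->
  `|dpsub t r| <= C * tailw t r.
Proof.
have [C C0 HC] := polyexp_bounded 3.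
have c0 : 0 < (2 * Num.sqrt pi)^-1 :> R by rewrite invr_gt0 mulr_gt0 ?sqrtr_gt0 ?pi_gt0.
exists ((2 * Num.sqrt pi)^-1 * C); first by rewrite mulr_gt0.
move=> t r t0 r0; apply: le_trans (dpsub_norm_le t r0) _.
rewrite -[leRHS]mulrA ler_wpM2l ?(ltW c0)//.
set q := t ^+ 2 / (4 * r).
have q0 : 0 <= q by rewrite divr_ge0 ?sqr_ge0// mulr_ge0// ltW.
apply: (@le_trans _ _ ((tailw t r * (1 + 4 * q) ^+ 2) * ((1 + 4 * q) * expR (- q)))).
  by rewrite ler_wpM2r ?inv_le_tailw// mulr_ge0 ?expR_ge0//; lra.
have -> : tailw t r * (1 + 4 * q) ^+ 2 * ((1 + 4 * q) * expR (- q)) =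
  ((1 + 4 * q) ^+ 3 * expR (- q)) * tailw t r by ring.
by rewrite ler_wpM2r ?powR_ge0// HC.
Qed.

(** The inverse of the scale is at most [1 + 1 / (2 r)], and [1 / r <= b^-2 t^2 / r] for [t >= b];
    so it too is a polynomial loss that the exponential factor can pay. *)
Lemma mehler_stdV_le (b t r : R) : 0 < b -> b <= t -> 0 < r ->
  (mehler_std r)^-1 <= (1 + b ^- 2) * (1 + 4 * (t ^+ 2 / (4 * r))).
Proof.
move=> b0 bt r0; have t0 : 0 < t by exact: lt_le_trans bt.
have s0 := mehler_std_gt0 r0; have s1 := mehler_std_lt1 r0.
set s := mehler_std r in s0 s1 *.
have s2 : s ^+ 2 = 1 - expR (- r) ^+ 2.
  by rewrite sqr_sqrtr// subr_ge0 exprn_ile1 ?expR_ge0// ltW// expR_lt1 oppr_lt0.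
have e2 : expR (- r) ^+ 2 <= (1 + 2 * r)^-1.
  rewrite -expRM_natl mulrN expRN lef_pV2 ?posrE ?expR_gt0 ?expR_ge1Dx//; lra.
apply: (@le_trans _ _ (s ^+ 2)^-1).
  by rewrite lef_pV2 ?posrE ?exprn_gt0// expr2 ler_piMr ?(ltW s0)// ltW.
have H : 2 * r / (1 + 2 * r) <= s ^+ 2.
  rewrite s2; have -> : 2 * r / (1 + 2 * r) = 1 - (1 + 2 * r)^-1 by field; lra.
  by rewrite lerB.
apply: (@le_trans _ _ (1 + (2 * r)^-1)).
  rewrite -[leRHS]invrK lef_pV2 ?posrE ?exprn_gt0//; last first.
    by rewrite invr_gt0 addr_gt0// invr_gt0 mulr_gt0.
  by apply: le_trans H; rewrite le_eqVlt; apply/orP; left; apply/eqP; field; lra.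
have bt2 : b ^+ 2 <= t ^+ 2 by rewrite lerXn2r ?nnegrE ?(ltW b0) ?(ltW t0).
have b2 : 0 < b ^+ 2 by rewrite exprn_gt0.
have -> : 4 * (t ^+ 2 / (4 * r)) = t ^+ 2 / r by field; rewrite gt_eqF.
have A1 : r^-1 <= b ^- 2 * (t ^+ 2 / r).
  by rewrite mulrA ler_peMl ?invr_ge0 ?(ltW r0)// mulrC ler_pdivlMr// mul1r.
have A2 : 0 <= t ^+ 2 / r by rewrite divr_ge0 ?sqr_ge0// ltW.
have A3 : 0 <= b ^- 2 by rewrite invr_ge0 ltW.
rewrite invfM mulrDl mul1r mulrDr mulr1.
have : 0 < r^-1 by rewrite invr_gt0.
lra.
Qed.

(** The factor [mehler_std r ^+ d] offsets the blow-up of the kernel as [r] tends to [0], so that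
    integrals against these weights converge at every point, uniformly for [t >= b]. *)
Lemma psub_std_le (d : nat) (b : R) : 0 < b -> exists2 C : R, 0 < C &
  forall t r, b <= t -> 0 < r ->
  psub t r <= C * t * (tailw t r * mehler_std r ^+ d) /\
  `|dpsub t r| <= C * (tailw t r * mehler_std r ^+ d).
Proof.
(* The degree counts [2] for [inv_le_tailw], [1] for the polynomial in [dpsub] and [d] for the
   inverse powers of the scale. *)
move=> b0; have [C C0 HC] := polyexp_bounded (d + 3).
have c0 : 0 < (2 * Num.sqrt pi)^-1 :> R by rewrite invr_gt0 mulr_gt0 ?sqrtr_gt0 ?pi_gt0.
set c := (2 * Num.sqrt pi)^-1 in c0.
pose K := (1 + b ^- 2) ^+ d.
have K0 : 0 < K by rewrite exprn_gt0// addr_gt0// invr_gt0 exprn_gt0.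
exists (c * (K * C)); first by rewrite !mulr_gt0.
move=> t r bt r0; have t0 : 0 < t by exact: lt_le_trans bt.
set q := t ^+ 2 / (4 * r).
have q0 : 0 <= q by rewrite divr_ge0 ?sqr_ge0// mulr_ge0// ltW.
have s0 := mehler_std_gt0 r0.
have sd : 0 < mehler_std r ^+ d by rewrite exprn_gt0.
have key : (r * Num.sqrt r)^-1 * ((1 + 4 * q) * expR (- q)) <=
    K * C * (tailw t r * mehler_std r ^+ d).
  rewrite [leRHS]mulrA -ler_pdivrMr//.
  apply: (@le_trans _ _ ((tailw t r * (1 + 4 * q) ^+ 2) * ((1 + 4 * q) * expR (- q)) *
     (K * (1 + 4 * q) ^+ d))).
    apply: ler_pM.
    - by rewrite !mulr_ge0 ?expR_ge0// ?invr_ge0 ?mulr_ge0 ?sqrtr_ge0 ?(ltW r0)//; lra.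
    - by rewrite invr_ge0 ltW.
    - by rewrite ler_wpM2r ?inv_le_tailw// mulr_ge0 ?expR_ge0//; lra.
    - rewrite -exprVn /K -exprMn lerXn2r ?nnegrE ?invr_ge0 ?(ltW s0)//.
        by rewrite mulr_ge0 ?addr_ge0 ?invr_ge0 ?exprn_ge0 ?(ltW b0)//; lra.
      exact: mehler_stdV_le.
  have -> : tailw t r * (1 + 4 * q) ^+ 2 * ((1 + 4 * q) * expR (- q)) *
     (K * (1 + 4 * q) ^+ d) = ((1 + 4 * q) ^+ (d + 3) * expR (- q)) * (K * tailw t r).
    by rewrite exprD; ring.
  rewrite [leRHS](_ : _ = C * (K * tailw t r)); last by ring.
  by rewrite ler_wpM2r ?HC// mulr_ge0 ?powR_ge0// ltW.
split; last first.
  by apply: le_trans (dpsub_norm_le t r0) _; rewrite -[leRHS]mulrA ler_wpM2l ?(ltW c0).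
rewrite /psub -/q -/c.
have -> : t * c / (r * Num.sqrt r) * expR (- q) = c * t * ((r * Num.sqrt r)^-1 * expR (- q)).
  by ring.
have -> : c * (K * C) * t * (tailw t r * mehler_std r ^+ d) =
  c * t * (K * C * (tailw t r * mehler_std r ^+ d)) by ring.
rewrite ler_wpM2l ?mulr_ge0 ?(ltW c0) ?(ltW t0)//; apply: le_trans key.
rewrite ler_wpM2l ?invr_ge0 ?mulr_ge0 ?sqrtr_ge0 ?(ltW r0)// ler_peMl ?expR_ge0//; lra.
Qed.

End subordinator_bounds.

(** * Layers of the monotone weight *)

Section tail_weight_layers.
Context {R : realType}.
Local Open Scope ereal_scope.
Local Notation mu := (@lebesgue_measure R).
Implicit Types (s r : R) (F : R -> \bar R).

Lemma poslineP r : posline r = (0 < r)%R :> Prop.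
Proof. by rewrite /posline/= in_itv/= andbT. Qed.

(** The power [- 3 / 2] of [max(r, s^2)] is the integral of minus its derivative over all [z] above
    both [r] and [s^2]. *)
Lemma tailw_layer s r : (0 < s)%R -> (0 < r)%R ->
  (tailw s r)%:E = \int[mu]_(z in `[(s ^+ 2)%R, +oo[)
    (3 / 2 * (z `^ (- (3 / 2) - 1) * (r <= z)%R%:R))%:E.
Proof.
move=> s0 r0.
have m0 : (0 < Num.max r (s ^+ 2))%R by rewrite lt_max r0.
have c0 : (0 < 3 / 2 :> R)%R by lra.
transitivity (\int[mu]_(z in `[(Num.max r (s ^+ 2))%R, +oo[)
    ((3 / 2)%:E * (z `^ (- (3 / 2) - 1))%:E)).
  rewrite ge0_integralZl_EFin ?(ltW c0)//; last 2 first.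
  - by move=> z _; rewrite lee_fin powR_ge0.
  - by apply/measurable_EFinP; apply: measurable_funTS; exact: measurable_powR.
  by rewrite integral_powR_infty// -EFinM /tailw; congr EFin; field.
rewrite integral_mkcond [RHS]integral_mkcond; apply: eq_integral => z _.
rewrite !patchE !mem_setE/= !in_itv/= !andbT ge_max.
case: ifPn => [/andP[rz sz]|]; first by rewrite sz rz mulr1 -EFinM.
by case: (s ^+ 2 <= z)%R; rewrite ?andbF ?andbT// => /negbTE ->; rewrite !mulr0.
Qed.

Lemma measurable_fun_leind dZ (Z : measurableType dZ) (f g : Z -> R) :
  measurable_fun setT f -> measurable_fun setT g ->
  measurable_fun setT (fun z => ((f z <= g z)%R%:R : R)).
Proof.
move=> mf mg; have mle := measurable_fun_ler mf mg.
have -> : (fun z => (f z <= g z)%R%:R) = (\1_[set z | (f z <= g z)%R] : Z -> R).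
  by apply/funext => z; rewrite indicE mem_setE.
apply: measurable_indic.
rewrite (_ : [set z | _] = setT `&` (fun z => (f z <= g z)%R) @^-1` [set true]).
  exact: mle.
by rewrite setTI; apply/seteqP; split.
Qed.

Lemma integral_tailw_layer s F : (0 < s)%R -> measurable_fun setT F ->
  (forall r, 0 <= F r) ->
  \int[mu]_(r in posline) ((tailw s r)%:E * F r) =
  \int[mu]_(z in `[(s ^+ 2)%R, +oo[)
    ((3 / 2 * z `^ (- (3 / 2) - 1))%:E * \int[mu]_(r in `]0%R, z]) F r).
Proof.
move=> s0 mF F0.
pose f (p : measurableTypeR R * measurableTypeR R) : \bar R :=
  (3 / 2 * (p.2 `^ (- (3 / 2) - 1) * (p.1 <= p.2)%R%:R))%:E * F p.1.
have mf : measurable_fun setT f.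
  apply: emeasurable_funM; last exact: (measurableT_comp mF).
  apply/measurable_EFinP; apply: measurable_funM => //; apply: measurable_funM => //.
    exact: (measurableT_comp (measurable_powR _)).
  by apply: measurable_fun_leind; [exact: measurable_fst|exact: measurable_snd].
have f0 r z : 0 <= f (r, z).
  by rewrite mule_ge0// lee_fin !mulr_ge0// powR_ge0.
transitivity (\int[mu]_(r in posline) \int[mu]_(z in `[(s ^+ 2)%R, +oo[) f (r, z)).
  apply: eq_integral => r; rewrite inE poslineP => r0.
  rewrite tailw_layer// -ge0_integralZr//.
  - apply/measurable_EFinP; apply: measurable_funM => //; apply: measurable_funM.
      by apply: measurable_funTS; exact: measurable_powR.
    by apply: measurable_funTS; apply: measurable_fun_leind.
  - by move=> z _; rewrite lee_fin !mulr_ge0// powR_ge0.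
rewrite (tonelli_on (A := posline) (B := `[(s ^+ 2)%R, +oo[%classic) mu mu f).
- apply: eq_integral => z; rewrite inE/= in_itv/= andbT => sz.
  have z0 : (0 < z)%R by apply: lt_le_trans sz; rewrite exprn_gt0.
  rewrite -ge0_integralZl_EFin ?mulr_ge0 ?powR_ge0//; last exact: measurable_funTS.
  rewrite [LHS]integral_mkcond [RHS]integral_mkcond; apply: eq_integral => r _.
  rewrite !patchE !mem_setE/= !in_itv/= andbT /f/=.
  by case: (0 < r)%R => //=; case: (r <= z)%R; rewrite ?mulr1// !mulr0 mul0e.
- exact: measurable_posline.
- exact: measurable_itv.
- exact: measurable_funTS.
- by move=> r z _ _.
Qed.

Lemma integral_tailw s : (0 < s)%R ->
  \int[mu]_(r in posline) (tailw s r)%:E = (3 / s)%:E.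
Proof.
move=> s0; under eq_integral do rewrite -[(tailw _ _)%:E]mule1.
rewrite (integral_tailw_layer (F := cst 1))//.
transitivity (\int[mu]_(z in `[(s ^+ 2)%R, +oo[) ((3 / 2)%:E * (z `^ (- 2^-1 - 1))%:E)).
  apply: eq_integral => z; rewrite inE/= in_itv/= andbT => sz.
  have z0 : (0 < z)%R by apply: lt_le_trans sz; rewrite exprn_gt0.
  rewrite integral_cst//= lebesgue_measure_itv/= lte_fin z0 EFinN sube0 mul1e -!EFinM.
  have -> : (z `^ (- 2^-1 - 1) = z `^ (- (3 / 2) - 1) * z)%R.
    rewrite -[X in (_ * X)%R](powRr1 (ltW z0)) -powRD; last by apply/implyP => _; rewrite gt_eqF.
    by congr (_ `^ _)%R; lra.
  by rewrite mulrA.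
rewrite ge0_integralZl_EFin//; last 2 first.
- by move=> z _; rewrite lee_fin powR_ge0.
- by apply/measurable_EFinP; apply: measurable_funTS; exact: measurable_powR.
rewrite (@integral_powR_infty R 2^-1) ?exprn_gt0 ?invr_gt0//.
rewrite -EFinM; congr EFin; rewrite powRN powR12_sqrt ?sqr_ge0// sqrtr_sqr ger0_norm ?ltW//.
by field; rewrite gt_eqF.
Qed.

End tail_weight_layers.

(** * Weighted superpositions of Ornstein-Uhlenbeck operators *)

Section weighted_mehler.
Context {R : realType} {d : nat}.
Local Open Scope ereal_scope.
Local Notation E := (d.-tuple R).
Local Notation gam := (gauss_measure d).
Local Notation mu := (@lebesgue_measure R).
Implicit Types (g : E -> \bar R) (x y : E) (w : R -> R).

Definition wou w g x : \bar R := \int[mu]_(r in posline) ((w r)%:E * ou r g x).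

Lemma wou_ge0 w g x : (forall r, (0 < r)%R -> (0 <= w r)%R) -> (forall y, 0 <= g y) ->
  0 <= wou w g x.
Proof.
move=> w0 g0; apply: integral_ge0 => r; rewrite poslineP => r0.
by rewrite mule_ge0 ?lee_fin ?w0 ?ou_ge0.
Qed.

Lemma wou_mono w w' g g' x : (forall r, (0 < r)%R -> (0 <= w r <= w' r)%R) ->
  (forall y, 0 <= g y <= g' y) -> wou w g x <= wou w' g' x.
Proof.
move=> ww gg; apply: ge0_integral_mono => r; rewrite poslineP => r0.
  have /andP[w0 _] := ww r r0.
  by rewrite mule_ge0 ?lee_fin ?ou_ge0// => y; have /andP[] := gg y.
have /andP[w0 wle] := ww r r0.
have g0 y : 0 <= g y by have /andP[] := gg y.
by apply: lee_pmul; rewrite ?lee_fin ?ou_ge0 ?ou_mono// => y; have /andP[] := gg y.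
Qed.

Lemma measurable_wou_param dZ (Z : measurableType dZ) (w : Z -> R -> R) (h : Z -> E)
    (G : Z * E -> \bar R) :
  measurable_fun setT (fun p : Z * measurableTypeR R => w p.1 p.2) ->
  measurable_fun setT h -> measurable_fun setT G -> (forall p, 0 <= G p) ->
  (forall z r, (0 < r)%R -> (0 <= w z r)%R) ->
  measurable_fun setT (fun z => wou (w z) (fun y => G (z, y)) (h z)).
Proof.
move=> mw mh mG G0 w0.
apply: (@measurable_integral_on _ _ Z (measurableTypeR R) R mu setT posline
  (fun p => (w p.1 p.2)%:E * ou p.2 (fun y => G (p.1, y)) (h p.1))).
- exact: measurableT.
- exact: measurable_posline.
- apply: measurable_funTS; apply: emeasurable_funM; first exact/measurable_EFinP.
  apply: (@measurable_ou_param R d _ (Z * measurableTypeR R)%type snd (fun p => h p.1)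
    (fun q => G (q.1.1, q.2))) => //.
  + exact: measurableT_comp.
  + apply: (measurableT_comp mG); apply/measurable_fun_pairP; split => /=.
      exact: (measurableT_comp measurable_fst measurable_fst).
    exact: measurable_snd.
- by move=> z r _; rewrite poslineP => r0; rewrite mule_ge0 ?lee_fin ?w0 ?ou_ge0.
Qed.

Lemma ge0_integral_wou w g : measurable_fun setT w -> measurable_fun setT g ->
  (forall y, 0 <= g y) -> (forall r, (0 < r)%R -> (0 <= w r)%R) ->
  \int[gam]_x wou w g x = \int[mu]_(r in posline) (w r)%:E * \int[gam]_x g x.
Proof.
move=> mw mg g0 w0.
rewrite (tonelli_on (A := setT) (B := posline) gam mu
  (fun p : E * measurableTypeR R => (w p.2)%:E * ou p.2 g p.1)).
- rewrite -ge0_integralZr//; last 4 first.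
  + exact: measurable_posline.
  + by apply/measurable_EFinP; apply: measurable_funTS.
  + by move=> r; rewrite poslineP lee_fin; exact: w0.
  + exact: integral_ge0.
  apply: eq_integral => r; rewrite inE poslineP => r0 /=.
  rewrite ge0_integralZl_EFin ?w0//; last 2 first.
  + by move=> x _; exact: ou_ge0.
  + exact: measurable_ou.
  by rewrite ge0_integral_ou.
- exact: measurableT.
- exact: measurable_posline.
- apply: measurable_funTS; apply: emeasurable_funM; last exact: measurable_ou_swap.
  by apply/measurable_EFinP; exact: (measurableT_comp mw).
- by move=> x r _; rewrite poslineP => r0; rewrite mule_ge0 ?lee_fin ?w0 ?ou_ge0.
Qed.

(** With [2^-n < s], rounding [s] up to the mesh [2^-n] at most doubles it; the larger window costs
    this factor in the normalisation. *)
Lemma ouavg_le_oumax s g x : (0 < s)%R -> measurable_fun setT g -> (forall y, 0 <= g y) ->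
  ouavg s g x <= 2%:E * oumax g x.
Proof.
move=> s0 mg g0; pose n := Num.truncn s^-1.
have n2 : (s^-1 < 2 ^+ n)%R.
  apply: lt_le_trans (truncnS_gt _) _; rewrite -/n.
  by rewrite -natrX ler_nat ltn_expl.
have p2 : (0 < 2 ^+ n :> R)%R by rewrite exprn_gt0.
pose N := Num.truncn (s * 2 ^+ n).
have s2 : (0 <= s * 2 ^+ n)%R by rewrite mulr_ge0 ?(ltW s0)// ltW.
have /andP[N1 N2] : (N%:R <= s * 2 ^+ n < N.+1%:R)%R by rewrite truncn_itv.
pose S := (N.+1%:R / 2 ^+ n : R)%R.
have sS : (s <= S)%R by rewrite ler_pdivlMr// ltW.
have S2s : (S <= 2 * s)%R.
  rewrite ler_pdivrMr// -natr1; have : (1 <= s * 2 ^+ n)%R by rewrite -ler_pdivrMl// mulr1 ltW.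
  lra.
have S0 : (0 < S)%R by exact: lt_le_trans sS.
apply: le_trans (lee_wpmul2l _ (oumax_ge g x n N)); last by rewrite lee_fin.
rewrite /ouavg -/S muleA -EFinM; apply: lee_pmul.
- by rewrite lee_fin invr_ge0 ltW.
- by apply: integral_ge0 => r _; exact: ou_ge0.
- by rewrite lee_fin ler_pdivlMr// mulrC ler_pdivrMr.
- apply: ge0_subset_integral => //.
  + by apply: measurable_funTS; exact: measurable_ou_time.
  + by move=> r _; exact: ou_ge0.
  + by apply: subset_itvl; rewrite bnd_simp.
Qed.

(** Each layer is a window []0, z]], on which the integral of [T_r g] is at most [2 z] times the
    maximal function. What remains is the integral of [3 z^(- 3 / 2)] from [s^2], which is [6 / s]:
    this is the source of the factor [1 / t] in the estimates of derivatives. *)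
Lemma wou_tailw_le s g x : (0 < s)%R -> measurable_fun setT g -> (forall y, 0 <= g y) ->
  wou (tailw s) g x <= (6 / s)%:E * oumax g x.
Proof.
move=> s0 mg g0; rewrite /wou integral_tailw_layer//; last 2 first.
- exact: measurable_ou_time.
- by move=> r; exact: ou_ge0.
have M0 := oumax_ge0 x g0.
apply: (@le_trans _ _ (\int[mu]_(z in `[(s ^+ 2)%R, +oo[)
   (3%:E * oumax g x * (z `^ (- 2^-1 - 1))%:E))).
  apply: ge0_integral_mono => z; rewrite /= in_itv/= andbT => sz.
    rewrite mule_ge0 ?lee_fin ?mulr_ge0 ?powR_ge0// integral_ge0// => r _.
    exact: ou_ge0.
  have z0 : (0 < z)%R by apply: lt_le_trans sz; rewrite exprn_gt0.
  have -> : \int[mu]_(r in `]0%R, z]) ou r g x = z%:E * ouavg z g x.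
    by rewrite /ouavg muleA -EFinM mulfV ?mul1e// gt_eqF.
  rewrite muleA -EFinM.
  have -> : (3 / 2 * z `^ (- (3 / 2) - 1) * z = 3 / 2 * z `^ (- 2^-1 - 1))%R.
    rewrite -mulrA; congr (_ * _)%R.
    rewrite -[X in (_ * X)%R](powRr1 (ltW z0)) -powRD; last by apply/implyP => _; rewrite gt_eqF.
    by congr (_ `^ _)%R; lra.
  apply: (@le_trans _ _ ((3 / 2 * z `^ (- 2^-1 - 1))%:E * (2%:E * oumax g x))).
    by rewrite lee_wpmul2l ?lee_fin ?mulr_ge0 ?powR_ge0// ouavg_le_oumax.
  rewrite muleA -EFinM muleAC -EFinM.
  by have -> : (3 / 2 * z `^ (- 2^-1 - 1) * 2 = 3 * z `^ (- 2^-1 - 1))%R by field.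
rewrite ge0_integralZl//; last 3 first.
- by apply/measurable_EFinP; apply: measurable_funTS; exact: measurable_powR.
- by move=> z _; rewrite lee_fin powR_ge0.
- by rewrite mule_ge0.
rewrite (@integral_powR_infty R 2^-1) ?exprn_gt0 ?invr_gt0//.
rewrite muleAC -EFinM powRN powR12_sqrt ?sqr_ge0// sqrtr_sqr ger0_norm ?(ltW s0)//.
by rewrite invrK (_ : 3 * (s^-1 * 2) = 6 / s)%R//; field; rewrite gt_eqF.
Qed.

Lemma ou_std_le r g x : (0 < r)%R -> measurable_fun setT g -> (forall y, 0 <= g y) ->
  (mehler_std r ^+ d)%:E * ou r g x <= (expR (enorm x ^+ 2))%:E * \int[gam]_y g y.
Proof.
move=> r0 mg g0; have s0 := mehler_std_gt0 r0.
rewrite -ge0_integralZl_EFin ?exprn_ge0 ?(ltW s0)//; last 2 first.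
- by move=> y _; rewrite mule_ge0 ?lee_fin ?mehler_ge0.
- by apply: emeasurable_funM => //; exact: measurable_mehlerr.
rewrite -ge0_integralZl_EFin ?expR_ge0//; apply: ge0_integral_mono => y _.
  by rewrite !mule_ge0 ?lee_fin ?mehler_ge0 ?exprn_ge0// ltW.
rewrite muleA -EFinM lee_wpmul2r// lee_fin.
rewrite -ler_pdivlMl ?exprn_gt0// -exprVn; exact: mehler_le.
Qed.

Lemma wou_tailw_std_le s g x : (0 < s)%R -> measurable_fun setT g -> (forall y, 0 <= g y) ->
  wou (fun r => tailw s r * mehler_std r ^+ d)%R g x <=
  (3 / s * expR (enorm x ^+ 2))%:E * \int[gam]_y g y.
Proof.
move=> s0 mg g0; have I0 : 0 <= \int[gam]_y g y by exact: integral_ge0.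
apply: (@le_trans _ _ (\int[mu]_(r in posline) ((tailw s r)%:E *
   ((expR (enorm x ^+ 2))%:E * \int[gam]_y g y)))).
  apply: ge0_integral_mono => r; rewrite poslineP => r0.
    by rewrite mule_ge0 ?ou_ge0// lee_fin mulr_ge0 ?powR_ge0 ?exprn_ge0 ?sqrtr_ge0.
  by rewrite EFinM -muleA lee_wpmul2l ?lee_fin ?powR_ge0 ?ou_std_le.
rewrite ge0_integralZr//; last 4 first.
- exact: measurable_posline.
- apply/measurable_EFinP; apply: measurable_funTS.
  by apply: measurable_tailw => //; exact: measurable_cst.
- by move=> r _; rewrite lee_fin powR_ge0.
- by rewrite mule_ge0 ?lee_fin ?expR_ge0.
by rewrite integral_tailw// muleA -EFinM.
Qed.

Lemma psub_eq0 (t r : R) : (r <= 0)%R -> psub t r = 0%R.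
Proof. by move=> r0; rewrite /psub (ler0_sqrtr r0) mulr0 invr0 mulr0 mul0r. Qed.

Lemma wou_psubE (t : R) g x : wou (psub t) g x = \int[mu]_r ((psub t r)%:E * ou r g x).
Proof.
rewrite /wou integral_mkcond; apply: eq_integral => r _.
rewrite patchE mem_setE /= in_itv/= andbT; case: ltrP => // r0.
by rewrite psub_eq0// mul0e.
Qed.

Lemma ou_wou h w g x : (0 < h)%R -> measurable_fun setT w -> measurable_fun setT g ->
  (forall y, 0 <= g y) -> (forall r, (0 < r)%R -> (0 <= w r)%R) ->
  ou h (wou w g) x = \int[mu]_(r in posline) ((w r)%:E * ou (h + r) g x).
Proof.
move=> h0 mw mg g0 w0.
pose f (p : E * measurableTypeR R) := (mehler h x p.1)%:E * ((w p.2)%:E * ou p.2 g p.1).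
have mf : measurable_fun setT f.
  apply: emeasurable_funM.
    exact: (measurableT_comp (measurable_mehlerr h x) measurable_fst).
  apply: emeasurable_funM; last exact: measurable_ou_swap.
  by apply/measurable_EFinP; exact: (measurableT_comp mw).
have m0 y : 0 <= (mehler h x y)%:E by rewrite lee_fin mehler_ge0.
have W0 y r : posline r -> 0 <= (w r)%:E * ou r g y.
  by rewrite poslineP => r0; rewrite mule_ge0 ?lee_fin ?w0 ?ou_ge0.
transitivity (\int[gam]_y \int[mu]_(r in posline) f (y, r)).
  apply: eq_integral => y _; rewrite /f/= ge0_integralZl_EFin ?mehler_ge0//.
  - exact: measurable_posline.
  - by move=> r; exact: W0.
  - apply: emeasurable_funM; first by apply/measurable_EFinP; exact: measurable_funTS.
    by apply: measurable_funTS; exact: measurable_ou_time.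
rewrite (tonelli_on (A := setT) (B := posline) gam mu f).
- apply: eq_integral => r; rewrite inE poslineP => r0.
  rewrite -(ou_comp _ h0 r0)// -ge0_integralZl_EFin ?w0//; last 2 first.
  + by move=> y _; rewrite mule_ge0 ?ou_ge0.
  + by apply: emeasurable_funM; [exact: measurable_mehlerr|exact: measurable_ou].
  by apply: eq_integral => y _; rewrite /f/= muleCA.
- exact: measurableT.
- exact: measurable_posline.
- exact: measurable_funTS.
- by move=> y r _ pr; rewrite mule_ge0 ?W0.
Qed.

(** The semigroup law of [T_r] reduces the claim to the convolution law of the weights. Since [psub]
    vanishes for nonpositive [r], all integrals may run over the line, where translation and Tonelli
    apply freely. *)
Lemma wou_psub_comp (t s : R) g x : (0 < t)%R -> (0 < s)%R -> measurable_fun setT g ->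
  (forall y, 0 <= g y) -> wou (psub t) (wou (psub s) g) x = wou (psub (t + s)) g x.
Proof.
move=> t0 s0 mg g0.
have p0 (u r : R) : (0 < u)%R -> (0 <= psub u r)%R by move=> u0; rewrite psub_ge0// ltW.
have mp u : measurable_fun [set: measurableTypeR R] (psub u).
  exact: (@measurable_psub R _ _ (cst u) id).
pose f (p : measurableTypeR R * measurableTypeR R) : \bar R :=
  (psub t p.1 * psub s (p.2 - p.1))%:E * ou p.2 g x.
have mf : measurable_fun setT f.
  apply: emeasurable_funM.
    apply/measurable_EFinP; apply: measurable_funM.
      exact: (measurableT_comp (mp t)).
    apply: (measurableT_comp (mp s)); apply: measurable_funB; first exact: measurable_snd.
    exact: measurable_fst.
  exact: (measurableT_comp (measurable_ou_time x mg g0)).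
have f0 r z : 0 <= f (r, z) by apply: mule_ge0; [rewrite lee_fin mulr_ge0// p0|exact: ou_ge0].
transitivity (\int[mu]_(r in setT) \int[mu]_(z in setT) f (r, z)).
  rewrite wou_psubE; apply: eq_integral => r _.
  have [r0|r0] := ltP 0%R r; last first.
    rewrite psub_eq0// mul0e /f/=; under eq_integral do rewrite psub_eq0// mul0r mul0e.
    by rewrite integral0.
  rewrite ou_wou//; last 2 first.
  - exact: mp.
  - by move=> z _; exact: p0.
  have mz : measurable_fun [set: measurableTypeR R] (fun z : R => (psub s (z - r))%:E * ou z g x).
    apply: emeasurable_funM; last exact: measurable_ou_time.
    by apply/measurable_EFinP; apply: (measurableT_comp (mp s)); exact: measurable_funB.
  have z0 (z : R) : 0 <= (psub s (z - r))%:E * ou z g x by rewrite mule_ge0 ?lee_fin ?p0 ?ou_ge0.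
  have EE := ge0_integralZl_EFin mu measurableT (fun z _ => z0 z) mz (p0 t r t0).
  transitivity ((psub t r)%:E * \int[mu]_z ((psub s (z - r))%:E * ou z g x)); last first.
    by rewrite -EE; apply: eq_integral => z _; rewrite /f/= EFinM muleA.
  have SH := ge0_integral_shift r mz z0.
  apply: (congr1 (fun v => (psub t r)%:E * v)).
  rewrite -[RHS]SH [LHS]integral_mkcond; apply: eq_integral => z _.
  have -> : (r + z - r)%R = z by rewrite addrAC subrr add0r.
  rewrite patchE; case: ifPn => [_|]; first by [].
  by rewrite notin_setE poslineP => /negP; rewrite -leNgt => /psub_eq0 ->; rewrite mul0e.
rewrite (tonelli_on (A := setT) (B := setT) mu mu f)//; last exact: measurable_funTS.
rewrite wou_psubE; apply: eq_integral => z _.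
rewrite /f/= ge0_integralZr ?ou_ge0//; last 2 first.
- apply/measurable_EFinP; apply: measurable_funM => //.
  by apply: (measurableT_comp (mp s)); exact: measurable_funB.
- by move=> r _; rewrite lee_fin mulr_ge0 ?p0.
congr (_ * _).
have [z0|z0] := ltP 0%R z; last first.
  rewrite psub_eq0//; apply: integral0_eq => r _.
  have [r0|r0] := ltP 0%R r; last by rewrite psub_eq0// mul0r.
  by rewrite [X in (_ * X)%R]psub_eq0 ?mulr0// subr_le0 (le_trans z0)// ltW.
rewrite -psub_convolution// [RHS]integral_mkcond; apply: eq_integral => r _.
rewrite patchE mem_setE /= in_itv/=; case: ltrP => /= r0; last by rewrite psub_eq0// mul0r.
by case: ltrP => // zr; rewrite [X in (_ * X)%R]psub_eq0 ?mulr0// subr_le0.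
Qed.

End weighted_mehler.

(** * Signed functions and time derivatives *)

Section signed_operators.
Context {R : realType} {d : nat}.
Local Notation E := (d.-tuple R).
Local Notation gam := (gauss_measure d).
Local Notation mu := (@lebesgue_measure R).
Implicit Types (f h : E -> R) (x y : E) (r t s : R) (w : R -> R).

Lemma measurable_Rintegral_on d1 d2 (X : measurableType d1) (Y : measurableType d2)
    (m : {sigma_finite_measure set Y -> \bar R}) (B : set Y) (F : X * Y -> R) :
  measurable B -> measurable_fun setT F ->
  measurable_fun setT (fun a => \int[m]_(z in B) F (a, z)).
Proof.
move=> mB mF; apply: (measurableT_comp (fine_measurable measurableT)).
have mEF : measurable_fun setT (EFin \o F) by exact/measurable_EFinP.
have H (G : X * Y -> \bar R) : measurable_fun setT G -> (forall p, 0 <= G p)%E ->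
    measurable_fun setT (fun a => \int[m]_(z in B) G (a, z))%E.
  by move=> mG G0; apply: measurable_integral_on => //; exact: measurable_funTS.
apply: (eq_measurable_fun (fun a => \int[m]_(z in B) (EFin \o F)^\+%E (a, z) -
   \int[m]_(z in B) (EFin \o F)^\-%E (a, z))%E).
  move=> a _ /=.
  by rewrite [in RHS]integralE; congr (_ - _)%E; apply: eq_integral => z _;
     rewrite ?funeposE ?funenegE.
apply: emeasurable_funB; apply: H.
- exact: measurable_funepos.
- by move=> p; exact: funepos_ge0.
- exact: measurable_funeneg.
- by move=> p; exact: funeneg_ge0.
Qed.

Let mpos : measurable (posline : set (measurableTypeR R)).
Proof. exact: measurable_posline. Qed.

(** Real-valued counterpart of [ou], as [swt] is of [wou]; identities for signed functions are
    transferred from the nonnegative ones by splitting into positive and negative parts. *)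
Definition sou r h x : R := \int[gam]_y (mehler r x y * h y).

Definition swt w h x : R := \int[mu]_(r in posline) (w r * sou r h x).

Lemma measurable_sou_param dZ (Z : measurableType dZ) (a : Z -> R) (b : Z -> E)
    (G : Z * E -> R) : measurable_fun setT a -> measurable_fun setT b ->
  measurable_fun setT G ->
  measurable_fun setT (fun z => sou (a z) (fun y => G (z, y)) (b z)).
Proof.
move=> ma mb mG.
apply: (@measurable_Rintegral_on _ _ Z E gam setT
  (fun p => mehler (a p.1) (b p.1) p.2 * G p)) => //.
apply: measurable_funM => //; apply: measurable_mehler => //.
- exact: (measurableT_comp ma).
- exact: (measurableT_comp mb).
Qed.

Lemma measurable_swt_param dZ (Z : measurableType dZ) (w : Z -> R -> R) (b : Z -> E)
    (G : Z * E -> R) :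
  measurable_fun setT (fun p : Z * measurableTypeR R => w p.1 p.2) ->
  measurable_fun setT b -> measurable_fun setT G ->
  measurable_fun setT (fun z => swt (w z) (fun y => G (z, y)) (b z)).
Proof.
move=> mw mb mG.
apply: (@measurable_Rintegral_on _ _ Z (measurableTypeR R) mu posline
  (fun p => w p.1 p.2 * sou p.2 (fun y => G (p.1, y)) (b p.1))).
  exact: measurable_posline.
apply: measurable_funM => //.
apply: (@measurable_sou_param _ (Z * measurableTypeR R)%type snd (fun p => b p.1)
    (fun q => G (q.1.1, q.2))) => //.
- exact: (measurableT_comp mb).
- apply: (measurableT_comp mG); apply/measurable_fun_pairP; split => /=.
    exact: (measurableT_comp measurable_fst measurable_fst).
  exact: measurable_snd.
Qed.

Local Notation integrable h := (gam.-integrable setT (EFin \o h)).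

Lemma integrable_measurable h : integrable h -> measurable_fun setT h.
Proof. by move=> /integrableP[/measurable_EFinP]. Qed.

Lemma integrable_norm_fin h : integrable h -> (\int[gam]_y `|h y|%:E < +oo)%E.
Proof. by move=> /integrableP[]. Qed.

Lemma integrable_mehler r h x : 0 < r -> integrable h ->
  integrable (fun y => mehler r x y * h y).
Proof.
move=> r0 ih; set c := (mehler_std r)^-1 ^+ d * expR (enorm x ^+ 2).
apply: (le_integrable _ _ _ (integrableZl _ c ih)) => //.
  apply/measurable_EFinP; apply: measurable_funM; last exact: integrable_measurable.
  by apply/measurable_EFinP; exact: measurable_mehlerr.
move=> y _ /=; rewrite lee_fin !(normrM _ (h y)) ler_wpM2r// ger0_norm ?mehler_ge0//.
by apply: le_trans (mehler_le _ _ r0) _; exact: ler_norm.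
Qed.

Lemma sou_le r h x : 0 < r -> integrable h ->
  (`|sou r h x|%:E <= ou r (fun y => `|h y|%:E) x)%E.
Proof.
move=> r0 ih; have im := integrable_mehler x r0 ih.
rewrite EFin_normr_Rintegral//; apply: le_trans (le_abse_integral _ _ _) _ => //.
  by case/integrableP : im.
by apply: ge0_integral_mono => y _ //=; rewrite normrM ger0_norm ?mehler_ge0.
Qed.

Lemma souB r h1 h2 x : 0 < r -> integrable h1 -> integrable h2 ->
  sou r (fun y => h1 y - h2 y) x = sou r h1 x - sou r h2 x.
Proof.
move=> r0 i1 i2; rewrite -RintegralB//; try exact: integrable_mehler.
by apply: eq_Rintegral => y _; rewrite mulrBr.
Qed.

Lemma sou_ge0 r h x : (forall y, 0 <= h y) -> 0 <= sou r h x.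
Proof. by move=> h0; apply: Rintegral_ge0 => y _; rewrite mulr_ge0 ?mehler_ge0. Qed.

Lemma souE r h x : 0 < r -> integrable h -> (sou r h x)%:E =
  (\int[gam]_y (mehler r x y * h y)%:E)%E.
Proof.
by move=> r0 ih; rewrite /sou fineK//; apply: integrable_fin_num => //; exact: integrable_mehler.
Qed.

(* Weights [w] for which [swt w h] converges absolutely at every point: the last factor
   absorbs the blow-up of the Mehler kernel as [r -> 0]. *)
Definition tame w := measurable_fun [set: measurableTypeR R] w /\
  exists C b : R, [/\ 0 < C, 0 < b & forall r, 0 < r ->
    `|w r| <= C * (tailw b r * mehler_std r ^+ d)].

Lemma measurable_sqrtr dZ (Z : measurableType dZ) (g : Z -> R) :
  measurable_fun setT g -> measurable_fun setT (fun z => Num.sqrt (g z)).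
Proof.
move=> mg; apply: (eq_measurable_fun (fun z => Num.max (g z) 0 `^ 2^-1)).
  move=> z _; have [g0|g0] := lerP 0 (g z); first by rewrite powR12_sqrt.
  by rewrite powR0// ler0_sqrtr// ltW.
apply: (measurableT_comp (measurable_powR _)).
by apply: measurable_maxr => //; exact: measurable_cst.
Qed.

Lemma measurable_mehler_std : measurable_fun [set: measurableTypeR R] (@mehler_std R).
Proof.
apply: measurable_sqrtr.
apply: measurable_funB => //; apply: measurable_funX.
by apply: measurableT_comp.
Qed.

Lemma measurable_psubr t : measurable_fun [set: measurableTypeR R] (psub t).
Proof. exact: (@measurable_psub R _ _ (cst t) id). Qed.

Lemma measurable_dpsub dZ (Z : measurableType dZ) (a b : Z -> R) :
  measurable_fun setT a -> measurable_fun setT b ->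
  measurable_fun setT (fun z => dpsub (a z) (b z)).
Proof.
move=> ma mb; have mp := @measurable_psub R _ Z (cst 1) b (measurable_cst _) mb.
have mq : measurable_fun setT (fun z => (a z) ^+ 2 / (4 * b z)).
  apply: measurable_funM; first exact: measurable_funX.
  by apply: measurable_invr; exact: measurable_funM.
apply: (eq_measurable_fun (fun z => psub 1 (b z) * expR (1 ^+ 2 / (4 * b z)) *
  (1 - 2 * (a z ^+ 2 / (4 * b z))) * expR (- (a z ^+ 2 / (4 * b z))))).
  by move=> z _; rewrite /psub -(mulrA _ (expR _) (expR _)) -expRD addNr expR0 mulr1 div1r.
apply: measurable_funM; last by apply: measurableT_comp => //; exact: measurableT_comp.
apply: measurable_funM; last by apply: measurable_funB => //; exact: measurable_funM.
apply: measurable_funM => //; apply: measurableT_comp => //; apply: measurable_funM => //.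
by apply: measurable_invr; exact: measurable_funM.
Qed.

Lemma tame_psub t : 0 < t -> tame (psub t).
Proof.
move=> t0; split; first exact: measurable_psubr.
have [C C0 HC] := psub_std_le d t0.
exists (C * t), t; split => //; first by rewrite mulr_gt0.
by move=> r r0; have [H _] := HC t r (lexx _) r0; rewrite ger0_norm// psub_ge0// ltW.
Qed.

Lemma tame_dpsub t : 0 < t -> tame (dpsub t).
Proof.
move=> t0; split; first exact: (@measurable_dpsub _ _ (cst t) id).
have [C C0 HC] := psub_std_le d t0.
by exists C, t; split => // r r0; have [_ H] := HC t r (lexx _) r0.
Qed.

Lemma tame_tailw b : 0 < b -> tame (fun r => tailw b r * mehler_std r ^+ d).
Proof.
move=> b0; split.
  apply: measurable_funM; first exact: (@measurable_tailw R _ _ (cst b) id).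
  by apply: measurable_funX; exact: measurable_mehler_std.
exists 1, b; split => // r r0; rewrite mul1r ger0_norm// mulr_ge0 ?powR_ge0//.
by rewrite exprn_ge0// sqrtr_ge0.
Qed.

Let absE h : E -> \bar R := fun y => `|h y|%:E.

Let mabs h : integrable h -> measurable_fun setT (absE h).
Proof.
move=> ih; apply/measurable_EFinP; apply: measurableT_comp => //.
exact: integrable_measurable.
Qed.

Lemma wou_tame_fin w h x : tame w -> integrable h ->
  (wou (fun r => `|w r|%R) (absE h) x < +oo)%E.
Proof.
move=> [mw [C [b [C0 b0 wb]]]] ih; have mh := mabs ih.
have tw r : 0 < r -> 0 <= tailw b r * mehler_std r ^+ d.
  by move=> r0; rewrite mulr_ge0 ?powR_ge0 ?exprn_ge0 ?sqrtr_ge0.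
apply: (@le_lt_trans _ _ (C%:E * wou (fun r => tailw b r * mehler_std r ^+ d)%R (absE h) x)%E).
  rewrite /wou -ge0_integralZl_EFin ?(ltW C0)//; last 2 first.
  - by move=> r; rewrite poslineP => r0; rewrite mule_ge0 ?lee_fin ?tw ?ou_ge0// => y; rewrite lee_fin.
  - apply: emeasurable_funM; last first.
      by apply: measurable_funTS; apply: measurable_ou_time => // y; rewrite lee_fin.
    by apply/measurable_EFinP; apply: measurable_funTS; have [] := tame_tailw b0.
  apply: ge0_integral_mono => r; rewrite poslineP => r0.
    by rewrite mule_ge0 ?lee_fin ?ou_ge0// => y; rewrite lee_fin.
  by rewrite muleA -EFinM lee_wpmul2r ?lee_fin ?wb ?ou_ge0// => y; rewrite lee_fin.
have A0 y : (0 <= absE h y)%E by rewrite lee_fin.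
have := wou_tailw_std_le x b0 mh A0.
have : (\int[gam]_y absE h y < +oo)%E by exact: integrable_norm_fin.
have : (0 <= \int[gam]_y absE h y)%E by exact: integral_ge0.
case: (\int[gam]_y _)%E => [v| |]// v0 _ H.
by rewrite lte_mul_pinfty ?lee_fin ?(ltW C0)//; apply: le_lt_trans H _; rewrite -EFinM ltry.
Qed.

Lemma measurable_sou_time h x : integrable h ->
  measurable_fun [set: measurableTypeR R] (fun r => sou r h x).
Proof.
move=> /integrable_measurable mh.
apply: (@measurable_sou_param _ (measurableTypeR R) id (cst x) (fun p => h p.2)) => //.
exact: (measurableT_comp mh).
Qed.

Lemma integrable_swt w h x : tame w -> integrable h ->
  mu.-integrable posline (fun r => (w r * sou r h x)%:E).
Proof.
move=> tw ih; apply/integrableP; split.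
  apply/measurable_EFinP; apply: measurable_funTS; apply: measurable_funM.
    by have [] := tw.
  exact: measurable_sou_time.
apply: le_lt_trans (wou_tame_fin x tw ih).
apply: ge0_integral_mono => r; rewrite poslineP => r0; first exact: abse_ge0.
by rewrite abse_EFin normrM EFinM lee_wpmul2l ?lee_fin// sou_le.
Qed.

Lemma swt_le w h x : tame w -> integrable h ->
  (`|swt w h x|%:E <= wou (fun r => `|w r|%R) (absE h) x)%E.
Proof.
move=> tw ih; have iw := integrable_swt x tw ih.
rewrite EFin_normr_Rintegral//.
apply: le_trans (le_abse_integral _ _ _) _ => //.
  by case/integrableP : iw.
apply: ge0_integral_mono => r; rewrite poslineP => r0; first exact: abse_ge0.
by rewrite abse_EFin normrM EFinM lee_wpmul2l ?lee_fin// sou_le.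
Qed.

Lemma swtB w h1 h2 x : tame w -> integrable h1 -> integrable h2 ->
  swt w (fun y => h1 y - h2 y) x = swt w h1 x - swt w h2 x.
Proof.
move=> tw i1 i2; rewrite -RintegralB; [|exact: measurable_posline|exact: integrable_swt..].
by apply: eq_Rintegral => r; rewrite inE poslineP => r0; rewrite souB// mulrBr.
Qed.

Lemma swt_ge0E w h x : tame w -> (forall r, 0 < r -> 0 <= w r) -> integrable h ->
  (forall y, 0 <= h y) -> (swt w h x)%:E = wou w (EFin \o h) x.
Proof.
move=> tw w0 ih h0; rewrite /swt fineK; last first.
  by apply: integrable_fin_num; [exact: measurable_posline|exact: integrable_swt].
apply: eq_integral => r; rewrite inE poslineP => r0.
by rewrite EFinM souE//; congr (_ * _)%E; apply: eq_integral => y _; rewrite EFinM.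
Qed.

(** After integration over [x] each [T_r] preserves mass, so the factor [mehler_std r ^+ d <= 1] may
    be dropped and the integrability of [tailw b] suffices. *)
Lemma integrable_swt_fun w h : tame w -> integrable h -> integrable (swt w h).
Proof.
move=> tw ih; have mh := integrable_measurable ih; apply/integrableP; split.
  apply/measurable_EFinP.
  apply: (@measurable_swt_param _ E (fun _ => w) id (fun p => h p.2)) => //.
  - by have [mw _] := tw; exact: (measurableT_comp mw).
  - exact: (measurableT_comp mh).
have [mw [C [b [C0 b0 wb]]]] := tw.
have A0 y : (0 <= absE h y)%E by rewrite lee_fin.
apply: (@le_lt_trans _ _ (\int[gam]_x wou (fun r => C * tailw b r)%R (absE h) x)%E).
  apply: ge0_integral_mono => x _; first exact: abse_ge0.
  apply: le_trans (swt_le x tw ih) _; apply: wou_mono => [r r0|y].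
    rewrite normr_ge0/=; apply: le_trans (wb r r0) _; rewrite ler_wpM2l ?(ltW C0)//.
    rewrite ler_piMr ?powR_ge0// exprn_ile1 ?sqrtr_ge0// ltW// mehler_std_lt1//.
  by rewrite A0 lexx.
have mt : measurable_fun [set: measurableTypeR R] (tailw b).
  exact: (@measurable_tailw R _ _ (cst b) id).
rewrite ge0_integral_wou//; last 3 first.
- exact: measurable_funM.
- exact: mabs.
- by move=> r r0; rewrite mulr_ge0 ?powR_ge0// ltW.
under eq_integral do rewrite EFinM.
rewrite ge0_integralZl_EFin ?(ltW C0)//; last 2 first.
- by move=> r _; rewrite lee_fin powR_ge0.
- by apply/measurable_EFinP; exact: measurable_funTS.
rewrite integral_tailw// -EFinM.
apply: lte_mul_pinfty => //; last exact: integrable_norm_fin.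
by rewrite lee_fin mulr_ge0 ?divr_ge0// ltW.
Qed.

Let hp h y := Num.max (h y) 0.
Let hn h y := Num.max (- h y) 0.

Let hp0 h y : 0 <= hp h y. Proof. by rewrite le_max lexx orbT. Qed.
Let hn0 h y : 0 <= hn h y. Proof. by rewrite le_max lexx orbT. Qed.

Let hpn h : h = (fun y => hp h y - hn h y).
Proof.
by apply/funext => y; rewrite /hp /hn; have [H|H] := lerP 0 (h y);
   have [H'|H'] := lerP 0 (- h y); lra.
Qed.

Let ihp h : integrable h -> integrable (hp h).
Proof.
move=> ih; apply: (le_integrable _ _ _ ih) => //.
  apply/measurable_EFinP; apply: measurable_maxr; last exact: measurable_cst.
  exact: integrable_measurable.
by move=> y _ /=; rewrite lee_fin ger0_norm// /hp; have [H|H] := lerP 0 (h y);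
  rewrite ?normr_ge0 ?ler_norm.
Qed.

Let ihn h : integrable h -> integrable (hn h).
Proof.
move=> ih; apply: (le_integrable _ _ _ ih) => //.
  apply/measurable_EFinP; apply: measurable_maxr; last exact: measurable_cst.
  by apply: measurableT_comp => //; exact: integrable_measurable.
by move=> y _ /=; rewrite lee_fin ger0_norm// /hn; have [H|H] := lerP 0 (- h y);
  rewrite ?normr_ge0// -normrN ler_norm.
Qed.

(* Reduces identities between operators that are linear in [h] to [h >= 0]. *)
Lemma integrable_linear_ind (A B : (E -> R) -> R) :
  (forall h1 h2, integrable h1 -> integrable h2 ->
     A (fun y => h1 y - h2 y) = A h1 - A h2) ->
  (forall h1 h2, integrable h1 -> integrable h2 ->
     B (fun y => h1 y - h2 y) = B h1 - B h2) ->
  (forall h, integrable h -> (forall y, 0 <= h y) -> A h = B h) ->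
  forall h, integrable h -> A h = B h.
Proof.
move=> AB BB AE h ih; have i1 := ihp ih; have i2 := ihn ih.
by rewrite (hpn h) AB// BB// !AE.
Qed.

Lemma ornstein_uhlenbeckE r h x : 0 < r -> integrable h -> ornstein_uhlenbeck r h x = sou r h x.
Proof.
move=> r0 ih; rewrite /sou /ornstein_uhlenbeck.
set c := _ `^ _; have c0 : 0 < c by apply: powR_gt0; rewrite expR2N expRN_lt1.
rewrite -RintegralZl//; first by apply: eq_Rintegral => y _; rewrite mulrA.
have := integrableZl measurableT c^-1 (integrable_mehler x r0 ih).
apply: eq_integrable => // y _; rewrite /= -EFinM; congr EFin.
by rewrite /mehler -/c !mulrA mulVf ?mul1r// gt_eqF.
Qed.

Let pker t x u h := (Num.sqrt pi)^-1 * (expR (- u) / Num.sqrt u * sou (t ^+ 2 / (4 * u)) h x).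

Let continuous_mehler r x y : 0 < r -> {for r, continuous (fun r => mehler r x y)}.
Proof.
move=> r0; have e1 : 0 < 1 - expR (- (2 * r)) by rewrite expR2N expRN_lt1.
have cE (c : R) : {for r, continuous (fun r : R => expR (- (c * r)))}.
  apply: continuous_comp; last exact: continuous_expR.
  by apply: cvgN; apply: cvgMr.
have cE1 : {for r, continuous (fun r : R => expR (- r))}.
  by apply: continuous_comp; [exact: cvgN|exact: continuous_expR].
have c1 : {for r, continuous (fun r : R => 1 - expR (- (2 * r)))}.
  by apply: cvgB; [exact: cvg_cst|exact: cE].
apply: cvgM.
  apply: (@continuous_comp _ _ _ (fun r => 1 - expR (- (2 * r))) (fun z => z `^ _)) => //.
  exact: continuous_powR.
apply: continuous_comp; last exact: continuous_expR.
apply: cvgN; apply: cvgM; last by apply: cvgV => //; rewrite gt_eqF.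
apply: cvgB; first by apply: cvgMl; exact: cE.
by apply: cvgMl; apply: cvgMr.
Qed.

(** The change of variables is made for fixed [y], where the integrand depends on the time through
    the continuous [mehler r x y]; Tonelli before and after it brings the integral over [y]
    outside. *)
Lemma wou_psub_substitution t h x : 0 < t -> integrable h -> (forall y, 0 <= h y) ->
  (\int[mu]_(u in posline) (pker t x u h)%:E = wou (psub t) (EFin \o h) x)%E.
Proof.
move=> t0 ih h0; have mh := integrable_measurable ih.
have spi : 0 < Num.sqrt pi :> R by rewrite sqrtr_gt0 pi_gt0.
have posu u : 0 < u -> 0 < t ^+ 2 / (4 * u) by move=> u0; rewrite divr_gt0 ?exprn_gt0 ?mulr_gt0.
pose k (u : R) : R := (Num.sqrt pi)^-1 * (expR (- u) / Num.sqrt u).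
have k0 u : 0 <= k u by rewrite mulr_ge0 ?invr_ge0 ?divr_ge0 ?expR_ge0 ?sqrtr_ge0.
have mk : measurable_fun [set: measurableTypeR R] k.
  apply: measurable_funM => //; apply: measurable_funM; last first.
    by apply: measurable_invr; apply: measurable_sqrtr; exact: measurable_id.
  by apply: measurableT_comp.
have minv : measurable_fun [set: measurableTypeR R] (fun u : R => t ^+ 2 / (4 * u)).
  by apply: measurable_funM => //; apply: measurable_invr; exact: measurable_funM.
pose f (p : E * measurableTypeR R) : \bar R :=
  ((k p.2 * mehler (t ^+ 2 / (4 * p.2)) x p.1)%:E * (h p.1)%:E)%E.
have mf : measurable_fun setT f.
  apply: emeasurable_funM; apply/measurable_EFinP; last exact: (measurableT_comp mh).
  apply: measurable_funM; first exact: (measurableT_comp mk).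
  by apply: measurable_mehler => //; exact: (measurableT_comp minv).
pose f' (p : E * measurableTypeR R) : \bar R :=
  ((psub t p.2 * mehler p.2 x p.1)%:E * (h p.1)%:E)%E.
have mf' : measurable_fun setT f'.
  apply: emeasurable_funM; apply/measurable_EFinP; last exact: (measurableT_comp mh).
  apply: measurable_funM; first exact: (measurableT_comp (measurable_psubr t)).
  exact: measurable_mehler.
have f0 y u : posline u -> (0 <= f (y, u))%E.
  by move=> _; rewrite mule_ge0// lee_fin// mulr_ge0// mehler_ge0.
have f'0 y u : posline u -> (0 <= f' (y, u))%E.
  by move=> _; rewrite mule_ge0// lee_fin// mulr_ge0 ?mehler_ge0 ?psub_ge0// ltW.
transitivity (\int[mu]_(u in posline) \int[gam]_y f (y, u))%E.
  apply: eq_integral => u; rewrite inE poslineP => u0.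
  rewrite /pker mulrA EFinM souE ?posu// -ge0_integralZl_EFin//; last 2 first.
  - by move=> y _; rewrite lee_fin mulr_ge0 ?mehler_ge0.
  - apply/measurable_EFinP; apply: measurable_funM => //.
    by apply/measurable_EFinP; exact: measurable_mehlerr.
  by apply: eq_integral => y _; rewrite /f/= -!EFinM mulrA.
have T1 := tonelli_on (A := setT) (B := posline) gam mu f measurableT mpos
  (measurable_funTS mf) (fun y u _ => f0 y u).
apply: (etrans (esym T1)) => {T1}.
transitivity (\int[gam]_y \int[mu]_(r in posline) f' (y, r))%E.
  apply: eq_integral => y _; rewrite /f /f'/=.
  have hy0 : (0 <= (h y)%:E)%E by rewrite lee_fin.
  have my : measurable_fun posline (fun u : measurableTypeR R => (psub t u * mehler u x y)%:E).
    apply/measurable_EFinP; apply: measurable_funTS; apply: measurable_funM.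
      exact: measurable_psubr.
    by apply: measurable_mehler => //; exact: measurable_cst.
  transitivity (\int[mu]_(u in posline) (k u * mehler (t ^+ 2 / (4 * u)) x y)%:E * (h y)%:E)%E.
    apply: ge0_integralZr => //.
      apply/measurable_EFinP; apply: measurable_funTS; apply: measurable_funM => //.
      by apply: measurable_mehler => //; exact: measurable_cst.
    by move=> u _; rewrite lee_fin mulr_ge0 ?mehler_ge0.
  transitivity (\int[mu]_(r in posline) (psub t r * mehler r x y)%:E * (h y)%:E)%E; last first.
    apply/esym; apply: ge0_integralZr => //.
    by move=> u _; rewrite lee_fin mulr_ge0 ?mehler_ge0 ?psub_ge0// ltW.
  apply: (congr1 (fun v => v * (h y)%:E)%E); rewrite (@psub_substitution R t (fun r => mehler r x y))//.
  - by apply: eq_integral => u _; rewrite /k -!mulrA.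
  - by move=> r; exact: mehler_ge0.
  - by move=> r r0; exact: continuous_mehler.
have T2 := tonelli_on (A := setT) (B := posline) gam mu f' measurableT mpos
  (measurable_funTS mf') (fun y u _ => f'0 y u).
apply: (etrans T2) => {T2}.
apply: eq_integral => r; rewrite inE poslineP => r0.
rewrite /ou -ge0_integralZl_EFin ?psub_ge0 ?(ltW t0)//; last 2 first.
- by move=> y _; rewrite mule_ge0 ?lee_fin ?mehler_ge0.
- by apply: emeasurable_funM; [exact: measurable_mehlerr|exact/measurable_EFinP].
by apply: eq_integral => y _; rewrite /f'/= EFinM muleA.
Qed.

Let integrable_pker t h x : 0 < t -> integrable h ->
  mu.-integrable posline (fun u => (pker t x u h)%:E).
Proof.
move=> t0 ih.
have posu u : 0 < u -> 0 < t ^+ 2 / (4 * u) by move=> u0; rewrite divr_gt0 ?exprn_gt0 ?mulr_gt0.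
have msou h' : integrable h' -> measurable_fun posline (fun u => pker t x u h').
  move=> ih'; apply: measurable_funTS.
  apply: measurable_funM => //; apply: measurable_funM.
    apply: measurable_funM; first by apply: measurableT_comp.
    by apply: measurable_invr; apply: measurable_sqrtr; exact: measurable_id.
  apply: (measurableT_comp (measurable_sou_time x ih')).
  by apply: measurable_funM => //; apply: measurable_invr; exact: measurable_funM.
have pos h' : integrable h' -> (forall y, 0 <= h' y) ->
    mu.-integrable posline (fun u => (pker t x u h')%:E).
  move=> ih' h'0; apply/integrableP; split.
    by apply/measurable_EFinP; exact: msou.
  have -> : (\int[mu]_(u in posline) `|(pker t x u h')%:E| =
      \int[mu]_(u in posline) (pker t x u h')%:E)%E.
    apply: eq_integral => u _; rewrite gee0_abs// lee_fin.
    by rewrite mulr_ge0 ?invr_ge0 ?sqrtr_ge0// mulr_ge0 ?sou_ge0// divr_ge0 ?expR_ge0 ?sqrtr_ge0.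
  rewrite wou_psub_substitution//.
  by rewrite -swt_ge0E ?ltry//; [exact: tame_psub|move=> r _; rewrite psub_ge0// ltW].
have := integrableB mpos (pos _ (ihp ih) (hp0 h)) (pos _ (ihn ih) (hn0 h)).
apply: eq_integrable; first exact: measurable_posline.
move=> u; rewrite inE poslineP => u0 /=; rewrite -EFinB; congr EFin.
by rewrite [in RHS](hpn h) /pker souB ?posu//; [ring|exact: ihp|exact: ihn].
Qed.

Lemma poisson_hermiteE t h x : 0 < t -> integrable h ->
  poisson_hermite t h x = swt (psub t) h x.
Proof.
move=> t0 ih.
have posu u : 0 < u -> 0 < t ^+ 2 / (4 * u) by move=> u0; rewrite divr_gt0 ?exprn_gt0 ?mulr_gt0.
transitivity (\int[mu]_(u in posline) pker t x u h).
  have spi : 0 < Num.sqrt pi :> R by rewrite sqrtr_gt0 pi_gt0.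
  rewrite /poisson_hermite -RintegralZl.
  - apply: eq_Rintegral => u; rewrite inE poslineP => u0.
    by rewrite ornstein_uhlenbeckE ?posu.
  - exact: measurable_posline.
  - have := integrableZl mpos (Num.sqrt pi) (integrable_pker x t0 ih).
    apply: eq_integrable; first exact: measurable_posline.
    move=> u; rewrite inE poslineP => u0 /=; rewrite -EFinM; congr EFin.
    by rewrite /pker mulVKf ?gt_eqF// ornstein_uhlenbeckE ?posu.
move: h ih; apply: integrable_linear_ind.
- move=> h1 h2 i1 i2; rewrite -RintegralB; [|exact: measurable_posline|exact: integrable_pker..].
  by apply: eq_Rintegral => u; rewrite inE poslineP => u0; rewrite /pker souB ?posu//; ring.
- by move=> h1 h2 i1 i2; apply: swtB => //; exact: tame_psub.
- move=> h ih h0; apply: EFin_inj; rewrite swt_ge0E//; last 2 first.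
  + exact: tame_psub.
  + by move=> r _; rewrite psub_ge0// ltW.
  rewrite -wou_psub_substitution// fineK//; apply: integrable_fin_num.
    exact: measurable_posline.
  exact: integrable_pker.
Qed.

Lemma swt_psub_comp t s h x : 0 < t -> 0 < s -> integrable h ->
  swt (psub t) (swt (psub s) h) x = swt (psub (t + s)) h x.
Proof.
move=> t0 s0; have ts0 : 0 < t + s by rewrite addr_gt0.
move: h; apply: integrable_linear_ind.
- move=> h1 h2 i1 i2; rewrite -swtB; last 3 first.
  + exact: tame_psub.
  + by apply: integrable_swt_fun => //; exact: tame_psub.
  + by apply: integrable_swt_fun => //; exact: tame_psub.
  apply: (congr1 (fun g => swt (psub t) g x)); apply/funext => y.
  by apply: swtB => //; exact: tame_psub.
- by move=> h1 h2 i1 i2; apply: swtB => //; exact: tame_psub.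
move=> h ih h0.
have p0 (u r : R) : 0 < u -> 0 < r -> 0 <= psub u r by move=> u0 _; rewrite psub_ge0// ltW.
have swt0 y : 0 <= swt (psub s) h y.
  rewrite -lee_fin swt_ge0E//; [|exact: tame_psub|by move=> r; exact: p0].
  by apply: wou_ge0 => [r r0|z]; [exact: p0|rewrite lee_fin].
have is_ : integrable (swt (psub s) h) by apply: integrable_swt_fun => //; exact: tame_psub.
have mh : measurable_fun setT (EFin \o h) by apply/measurable_EFinP; exact: integrable_measurable.
apply: EFin_inj.
have -> := swt_ge0E x (tame_psub t0) (fun r => @p0 t r t0) is_ swt0.
have -> := swt_ge0E x (tame_psub ts0) (fun r => @p0 (t + s) r ts0) ih h0.
have <- := @wou_psub_comp R d t s (EFin \o h) x t0 s0 mh h0.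
apply: (congr1 (fun g => wou (psub t) g x)); apply/funext => y /=.
exact: (swt_ge0E y (tame_psub s0) (fun r => @p0 s r s0) ih h0).
Qed.

End signed_operators.

(** * Differentiation under the integral sign *)

Section poisson_derivatives.
Context {R : realType} {d : nat}.
Local Notation E := (d.-tuple R).
Local Notation gam := (gauss_measure d).
Local Notation mu := (@lebesgue_measure R).
Implicit Types (f h : E -> R) (x y : E) (r t s : R) (w : R -> R).
Local Notation integrable h := (gam.-integrable setT (EFin \o h)).

Let mpos : measurable (posline : set (measurableTypeR R)).
Proof. exact: measurable_posline. Qed.

(* A common dominating weight for the derivatives at times [t >= b]. *)
Let wt b r : R := tailw b r * mehler_std r ^+ d.

Let wt0 b r : 0 <= wt b r.
Proof. by rewrite mulr_ge0 ?powR_ge0 ?exprn_ge0 ?sqrtr_ge0. Qed.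

Lemma dpsub_wt_le b : 0 < b -> exists2 C : R, 0 < C & forall t r, b <= t -> 0 < r ->
  `|dpsub t r| <= C * wt b r.
Proof.
move=> b0; have [C C0 HC] := psub_std_le d b0.
exists C => // t r bt r0; have [_ H] := HC t r bt r0; apply: le_trans H _.
rewrite ler_wpM2l ?(ltW C0)// ler_wpM2r ?exprn_ge0 ?sqrtr_ge0//.
by apply: tailw_anti => //; exact: ltW.
Qed.

Lemma is_derive_swt_psub t h x : 0 < t -> integrable h ->
  is_derive t (1 : R) (fun t => swt (psub t) h x) (swt (dpsub t) h x).
Proof.
move=> t0 ih; have b0 : 0 < t / 2 by rewrite divr_gt0.
have [C C0 HC] := dpsub_wt_le b0.
pose F (u r : R) : R := psub u r * sou r h x.
pose G (r : R) : R := `|C * (wt (t / 2) r * sou r h x)|.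
have ta : `]t / 2, 2 * t[%classic t by rewrite /= in_itv/=; lra.
have Ipos u : `]t / 2, 2 * t[%classic u -> 0 < u.
  by rewrite /= in_itv/= => /andP[tu _]; exact: lt_trans tu.
have iF u : `]t / 2, 2 * t[%classic u -> mu.-integrable posline (EFin \o F u).
  by move=> /Ipos u0; apply: integrable_swt => //; exact: tame_psub.
have dF u r : is_derive u (1 : R) (F ^~ r) (dpsub u r * sou r h x).
  have := @is_deriveM R R^o (fun u => psub u r) (cst (sou r h x)) u 1 _ _
    (is_derive_psub u r) (is_derive_cst (sou r h x : R^o) u (1 : R^o)).
  by move/is_derive_eq; apply; rewrite scaler0 add0r /GRing.scale/= mulrC.
have derF u r : `]t / 2, 2 * t[%classic u -> posline r -> derivable (F ^~ r) u 1.
  by move=> _ _; have [] := dF u r.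
have iG : mu.-integrable posline (EFin \o G).
  apply: (@integrable_norm _ _ _ mu posline (fun r => C * (wt (t / 2) r * sou r h x))).
  have := integrableZl mpos C (integrable_swt x (tame_tailw b0) ih).
  by apply: eq_integrable.
have G0 r : 0 <= G r by exact: normr_ge0.
have GF u r : `]t / 2, 2 * t[%classic u -> posline r -> `|partial1of2 F u r| <= G r.
  rewrite poslineP /= in_itv/= => /andP[tu _] r0.
  rewrite partial1of2E; have [_ ->] := dF u r.
  rewrite /G (normrM (dpsub _ _)) (normrM C) (normrM (wt _ _)) (gtr0_norm C0) (ger0_norm (wt0 _ _)) mulrA.
  by rewrite ler_wpM2r// HC// ltW.
have D1 := derivable_under_integral mpos ta iF derF G0 iG GF.
have D2 := differentiation_under_integral mpos ta iF derF G0 iG GF.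
apply: DeriveDef => //; rewrite -derive1E D2.
by apply: eq_Rintegral => r _; rewrite partial1of2E; have [_ ->] := dF t r.
Qed.

(** The Poisson kernel. For fixed [t > 0] and [x] it is bounded in [y], so a single integral over
    the space replaces the double integral, and integrable majorants stay integrable after
    multiplication by it. *)
Let pk t x y : R := \int[mu]_(r in posline) (psub t r * mehler r x y).

Let psub_mehler_le t x : 0 < t -> exists2 C : R, 0 < C & forall y r, 0 < r ->
  0 <= psub t r * mehler r x y <= C * tailw t r.
Proof.
move=> t0; have [C C0 HC] := psub_std_le d t0.
exists (C * t * expR (enorm x ^+ 2)); first by rewrite !mulr_gt0 ?expR_gt0.
move=> y r r0; rewrite mulr_ge0 ?mehler_ge0 ?psub_ge0 ?(ltW t0)//=.
have [H _] := HC t r (lexx _) r0; have s0 := mehler_std_gt0 r0.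
apply: (@le_trans _ _ (C * t * (tailw t r * mehler_std r ^+ d) *
  ((mehler_std r)^-1 ^+ d * expR (enorm x ^+ 2)))).
  by apply: ler_pM => //; rewrite ?mehler_ge0 ?psub_ge0 ?(ltW t0)// mehler_le.
rewrite le_eqVlt; apply/orP; left; apply/eqP; rewrite exprVn.
by field; rewrite expf_eq0 negb_and gt_eqF ?orbT.
Qed.

Let integrable_pk t x y : 0 < t ->
  mu.-integrable posline (fun r => (psub t r * mehler r x y)%:E).
Proof.
move=> t0; have [C C0 HC] := psub_mehler_le x t0; apply/integrableP; split.
  apply/measurable_EFinP; apply: measurable_funTS; apply: measurable_funM.
    exact: measurable_psubr.
  by apply: measurable_mehler => //; exact: measurable_cst.
apply: (@le_lt_trans _ _ (\int[mu]_(r in posline) (C%:E * (tailw t r)%:E))%E).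
  apply: ge0_integral_mono => r; rewrite poslineP => r0; first exact: abse_ge0.
  by have /andP[H1 H2] := HC y r r0; rewrite gee0_abs ?lee_fin.
rewrite ge0_integralZl_EFin ?(ltW C0)//; last 2 first.
- by move=> r _; rewrite lee_fin powR_ge0.
- apply/measurable_EFinP; apply: measurable_funTS.
  exact: (@measurable_tailw R _ _ (cst t) id).
by rewrite integral_tailw// -EFinM ltry.
Qed.

Let pk_bound t x : 0 < t -> exists2 C : R, 0 < C & forall y, 0 <= pk t x y <= C.
Proof.
move=> t0; have [C C0 HC] := psub_mehler_le x t0.
exists (C * (3 / t)); first by rewrite mulr_gt0// divr_gt0.
move=> y; apply/andP; split.
  apply: Rintegral_ge0 => r; rewrite poslineP => r0.
  by have /andP[] := HC y r r0.
rewrite -lee_fin /pk fineK; last exact: integrable_fin_num (integrable_pk _ _ _).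
rewrite EFinM -integral_tailw// -ge0_integralZl_EFin ?(ltW C0)//; last 2 first.
- by move=> r _; rewrite lee_fin powR_ge0.
- apply/measurable_EFinP; apply: measurable_funTS.
  exact: (@measurable_tailw R _ _ (cst t) id).
apply: ge0_integral_mono => r; rewrite poslineP => r0; have /andP[H1 H2] := HC y r r0.
  by rewrite lee_fin.
by rewrite -EFinM lee_fin.
Qed.

Let measurable_pk t x : measurable_fun setT (pk t x).
Proof.
apply: (@measurable_Rintegral_on R _ _ E (measurableTypeR R) mu posline
  (fun p => psub t p.2 * mehler p.2 x p.1)) => //.
apply: measurable_funM; first exact: (measurableT_comp (measurable_psubr t)).
exact: measurable_mehler.
Qed.

Let integrable_pkM t x h : 0 < t -> integrable h -> integrable (fun y => pk t x y * h y).
Proof.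
move=> t0 ih; have [C C0 HC] := pk_bound x t0.
apply: (le_integrable _ _ _ (integrableZl measurableT C ih)) => //.
  apply/measurable_EFinP; apply: measurable_funM; first exact: measurable_pk.
  exact: integrable_measurable.
move=> y _ /=; have /andP[H1 H2] := HC y.
by rewrite lee_fin !normrM ler_wpM2r// !ger0_norm// ltW.
Qed.

Let swt_psub_kernel t h x : 0 < t -> integrable h ->
  swt (psub t) h x = \int[gam]_y (pk t x y * h y).
Proof.
move=> t0; move: h; apply: integrable_linear_ind.
- by move=> h1 h2 i1 i2; apply: swtB => //; exact: tame_psub.
- move=> h1 h2 i1 i2; rewrite -RintegralB//; try exact: integrable_pkM.
  by apply: eq_Rintegral => y _; rewrite mulrBr.
move=> h ih h0; have mh := integrable_measurable ih.
have p0 r : 0 <= psub t r by rewrite psub_ge0// ltW.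
apply: EFin_inj; rewrite swt_ge0E//; last exact: tame_psub.
rewrite fineK; last by apply: integrable_fin_num => //; exact: integrable_pkM.
pose f (p : E * measurableTypeR R) : \bar R :=
  ((psub t p.2 * mehler p.2 x p.1)%:E * (h p.1)%:E)%E.
have mf : measurable_fun setT f.
  apply: emeasurable_funM; apply/measurable_EFinP; last exact: (measurableT_comp mh).
  apply: measurable_funM; first exact: (measurableT_comp (measurable_psubr t)).
  exact: measurable_mehler.
have f0 y r : (0 <= f (y, r))%E.
  by rewrite mule_ge0// lee_fin// mulr_ge0// mehler_ge0.
transitivity (\int[mu]_(r in posline) \int[gam]_y f (y, r))%E.
  apply: eq_integral => r; rewrite inE poslineP => r0.
  rewrite /ou -ge0_integralZl_EFin//; last 2 first.
  - by move=> y _; rewrite mule_ge0 ?lee_fin ?mehler_ge0.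
  - by apply: emeasurable_funM; [exact: measurable_mehlerr|exact/measurable_EFinP].
  by apply: eq_integral => y _; rewrite /f/= EFinM muleA.
have T1 := tonelli_on (A := setT) (B := posline) gam mu f measurableT mpos
  (measurable_funTS mf) (fun y r _ _ => f0 y r).
apply: (etrans (esym T1)); apply: eq_integral => y _.
rewrite EFinM /pk fineK; last exact: integrable_fin_num (integrable_pk _ _ _).
rewrite /f/=; apply: ge0_integralZr => //.
- by have /integrableP[] := integrable_pk x y t0.
- by move=> r _; rewrite lee_fin mulr_ge0// mehler_ge0.
- by rewrite lee_fin.
Qed.

(** Here the derivative falls on the function and not on the weight; this is the side of the
    semigroup identity that is not covered by [is_derive_swt_psub]. *)
Lemma is_derive_swt_fun (tau s a b : R) (v dv : R -> E -> R) (G : E -> R) x :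
  0 < tau -> a < s < b -> (forall t, a < t < b -> integrable (v t)) ->
  (forall t y, a < t < b -> is_derive t (1 : R) (v ^~ y) (dv t y)) ->
  (forall t y, a < t < b -> `|dv t y| <= G y) -> integrable G ->
  integrable (dv s) ->
  is_derive s (1 : R) (fun s => swt (psub tau) (v s) x) (swt (psub tau) (dv s) x).
Proof.
move=> tau0 sab iv dvd dvG iG idv.
have [C C0 HC] := pk_bound x tau0.
pose F (u : R) y : R := pk tau x y * v u y.
have sI : `]a, b[%classic s by rewrite /= in_itv.
have G0 y : 0 <= G y by apply: le_trans (dvG s y sab).
have Iab u : `]a, b[%classic u -> a < u < b by rewrite /= in_itv.
have iF u : `]a, b[%classic u -> gam.-integrable setT (EFin \o F u).
  by move=> /Iab u0; apply: integrable_pkM => //; exact: iv.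
have dF u y : a < u < b -> is_derive u (1 : R) (F ^~ y) (pk tau x y * dv u y).
  by move=> uab; apply: (@is_deriveZ R R^o R^o (v ^~ y) (pk tau x y) u 1 _ (dvd u y uab)).
have derF u y : `]a, b[%classic u -> setT y -> derivable (F ^~ y) u 1.
  by move=> /Iab uab _; have [] := dF u y uab.
have iG' : gam.-integrable setT (EFin \o (fun y => C * G y)).
  exact: (integrableZl measurableT C iG).
have G'0 y : 0 <= C * G y by rewrite mulr_ge0// ltW.
have GF u y : `]a, b[%classic u -> setT y -> `|partial1of2 F u y| <= C * G y.
  move=> /Iab uab _; rewrite partial1of2E; have [_ ->] := dF u y uab.
  have /andP[H1 H2] := HC y.
  by rewrite normrM; apply: ler_pM => //; [rewrite ger0_norm|exact: dvG].
have D1 := derivable_under_integral measurableT sI iF derF G'0 iG' GF.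
have D2 := differentiation_under_integral measurableT sI iF derF G'0 iG' GF.
have H : is_derive s (1 : R) (fun u => \int[gam]_y F u y) (swt (psub tau) (dv s) x).
  apply: DeriveDef => //; rewrite -derive1E D2 swt_psub_kernel//.
  by apply: eq_Rintegral => y _; rewrite partial1of2E; have [_ ->] := dF s y sab.
apply: (near_eq_is_derive _ H).
near=> u; rewrite /= swt_psub_kernel//; apply: iv.
near: u; have := @near_in_itvoo R a b s; rewrite in_itv/= => /(_ sab).
by apply: filterS => u; rewrite in_itv.
Unshelve. all: end_near. Qed.

End poisson_derivatives.

(** * Time derivatives of the Poisson-Hermite semigroup *)

Section poisson_hermite_derivatives.
Context {R : realType} {d : nat}.
Local Notation E := (d.-tuple R).
Local Notation gam := (gauss_measure d).
Local Notation mu := (@lebesgue_measure R).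
Implicit Types (h : E -> R) (x y : E) (r t s : R) (w : R -> R).
Local Notation integrable h := (gam.-integrable setT (EFin \o h)).
Variable f : E -> R.
Hypothesis intf : integrable f.

Let v k t x : R := dpoisson_hermite k t f x.

Let v0E t x : 0 < t -> v 0 t x = swt (psub t) f x.
Proof. by move=> t0; exact: poisson_hermiteE t0 intf. Qed.

Let vS k t x : v k.+1 t x = derive1 (fun u => v k u x) t.
Proof. by []. Qed.

Let is_derive_shift (F : R -> R) (c t dF : R) :
  is_derive (c + t) (1 : R) F dF -> is_derive t (1 : R) (fun u => F (c + u)) dF.
Proof.
move=> H; have HS : is_derive t (1 : R) (fun u : R => c + u) 1.
  have := is_deriveD (is_derive_cst (c : R^o) t (1 : R^o)) (is_derive_id t (1 : R^o)).
  by move/is_derive_eq; apply; rewrite add0r.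
by have := @is_derive1_comp R F (fun u => c + u) t _ _ H HS; rewrite mulr1.
Qed.

Let semigroup k := forall s, 0 < s -> integrable (v k s) /\
  forall t x, 0 < t -> swt (psub t) (v k s) x = v k (t + s) x.

(** Near [t] one has [v_k(u) = P_(u-a) v_k(a)], so the derivative falls on the weight; only the
    first derivative of [psub] is ever formed. *)
Let derive_of_semigroup k a t x : semigroup k -> 0 < a -> a < t ->
  is_derive t (1 : R) (fun u => v k u x) (swt (dpsub (t - a)) (v k a) x).
Proof.
move=> Sk a0 at_; have [ik sk] := Sk a a0.
have ta : 0 < t - a by rewrite subr_gt0.
have H := is_derive_swt_psub x ta ik.
rewrite [in X in is_derive X](_ : t - a = - a + t) in H; last by rewrite addrC.
have := is_derive_shift H; apply: near_eq_is_derive.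
near=> u; rewrite sk; first by rewrite addrAC addNr add0r.
rewrite addrC subr_gt0; near: u; exact: lt_nbhsr.
Unshelve. all: end_near. Qed.

Let vSE k a t x : semigroup k -> 0 < a -> a < t ->
  v k.+1 t x = swt (dpsub (t - a)) (v k a) x.
Proof.
move=> Sk a0 at_; have [_ H] := derive_of_semigroup x Sk a0 at_.
by rewrite vS derive1E H.
Qed.

Let derive_v k t x : semigroup k -> 0 < t ->
  is_derive t (1 : R) (fun u => v k u x) (v k.+1 t x).
Proof.
move=> Sk t0; have t2 : 0 < t / 2 by rewrite divr_gt0.
rewrite (@vSE k (t / 2))//; last by lra.
by apply: derive_of_semigroup => //; lra.
Qed.

Let integrable_vS k s : semigroup k -> 0 < s -> integrable (v k.+1 s).
Proof.
move=> Sk s0; have s2 : 0 < s / 2 by rewrite divr_gt0.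
have -> : v k.+1 s = swt (dpsub (s - s / 2)) (v k (s / 2)).
  by apply/funext => x; apply: vSE => //; lra.
apply: integrable_swt_fun; last by have [] := Sk _ s2.
by apply: tame_dpsub; lra.
Qed.

(** Induction: the identity [P_tau v_k(s) = v_k(tau + s)] is differentiated in [s], on the left
    under the integral, on the right by translation. *)
Let semigroupP k : semigroup k.
Proof.
elim: k => [|k Sk] s s0.
  have vE : v 0 s = swt (psub s) f by apply/funext => x; exact: v0E.
  split; first by rewrite vE; apply: integrable_swt_fun => //; exact: tame_psub.
  by move=> t x t0; rewrite vE swt_psub_comp// v0E// addr_gt0.
split; first exact: integrable_vS.
move=> tau x tau0.
(* For [t > s / 2] one has [t - c >= c], so all [v_(k+1)(t)] near [s] share one majorant built from
   [v_k(c)]. *)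
pose c := s / 4; have c0 : 0 < c by rewrite /c; lra.
have [ic _] := Sk c c0.
have iac : integrable (fun y => `|v k c y|) by exact: (integrable_norm ic).
have [C C0 HC] := @dpsub_wt_le R d c c0.
have tw := @tame_tailw R d c c0.
pose G y : R := C * swt (fun r => tailw c r * mehler_std r ^+ d) (fun y => `|v k c y|) y.
have wt0 r : 0 <= tailw c r * mehler_std r ^+ d.
  by rewrite mulr_ge0 ?powR_ge0 ?exprn_ge0 ?sqrtr_ge0.
have iG : integrable G.
  exact: (integrableZl measurableT C (integrable_swt_fun tw iac)).
have GE y : ((G y)%:E = C%:E * wou (fun r => tailw c r * mehler_std r ^+ d)%R
    (EFin \o (fun y => `|v k c y|%R)) y)%E.
  by rewrite /G EFinM swt_ge0E// => r _; exact: wt0.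
have vG t y : s / 2 < t < 2 * s -> `|v k.+1 t y| <= G y.
  move=> /andP[st _]; have tc : c <= t - c by rewrite /c; lra.
  have tc0 : 0 < t - c by exact: lt_le_trans tc.
  rewrite (@vSE k c)//; last by rewrite -subr_gt0.
  rewrite -lee_fin GE; apply: le_trans (swt_le y (tame_dpsub tc0) ic) _.
  rewrite /wou -ge0_integralZl_EFin ?(ltW C0)//; last 3 first.
  - exact: measurable_posline.
  - by move=> r _; rewrite mule_ge0 ?lee_fin ?ou_ge0// => z; rewrite lee_fin.
  - apply: measurable_funTS; apply: emeasurable_funM.
      by apply/measurable_EFinP; have [] := tw.
    apply: measurable_ou_time => [|z]; last by rewrite lee_fin.
    by case/integrableP : iac.
  apply: ge0_integral_mono => r; rewrite poslineP => r0.
    by rewrite mule_ge0 ?lee_fin ?ou_ge0// => z; rewrite lee_fin.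
  rewrite muleA -EFinM lee_wpmul2r ?lee_fin ?ou_ge0 ?HC// => z; rewrite lee_fin//.
have s2 : s / 2 < s < 2 * s by lra.
have I0 t : s / 2 < t < 2 * s -> 0 < t by lra.
have [_ D1] := @is_derive_swt_fun R d tau s (s / 2) (2 * s) (v k) (v k.+1) G x tau0 s2
  (fun t H => proj1 (Sk t (I0 t H))) (fun t y H => derive_v y Sk (I0 t H)) vG iG
  (integrable_vS Sk s0).
have ts0 : 0 < tau + s by rewrite addr_gt0.
have [_ D2] := is_derive_shift (derive_v x Sk ts0).
rewrite -D1 -D2; apply: near_eq_derive.
near=> u; have [_ ->//] : integrable (v k u) /\ forall t x, 0 < t ->
   swt (psub t) (v k u) x = v k (t + u) x.
apply: Sk; near: u; exact: lt_nbhsr.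
Unshelve. all: end_near. Qed.

Lemma is_derive_dpoisson k t x : 0 < t ->
  is_derive t (1 : R) (fun u => dpoisson_hermite k u f x) (dpoisson_hermite k.+1 t f x).
Proof. by apply: derive_v; exact: semigroupP. Qed.

(** Joint measurability is not visible on an iterated derivative. It is visible on the recursion
    that writes [v_(k+1)(t)] as an integral of [v_k(t / 2)] against a weight depending on [t]. *)
Lemma measurable_dpoisson k : exists2 V : R * E -> R,
  measurable_fun [set: measurableTypeR R * E] V &
  forall t x, 0 < t -> dpoisson_hermite k t f x = V (t, x).
Proof.
elim: k => [|k [V mV VE]].
  exists (fun p => swt (psub p.1) f p.2); last by move=> t x t0; exact: v0E.
  apply: (@measurable_swt_param R d _ (measurableTypeR R * E)%type (fun p => psub p.1) snd
    (fun p => f p.2)) => //.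
  - apply: measurable_psub; last exact: measurable_snd.
    exact: (measurableT_comp measurable_fst measurable_fst).
  - exact: (measurableT_comp (integrable_measurable intf)).
exists (fun p => swt (dpsub (p.1 - p.1 / 2)) (fun y => V (p.1 / 2, y)) p.2).
  apply: (@measurable_swt_param R d _ (measurableTypeR R * E)%type
    (fun p => dpsub (p.1 - p.1 / 2)) snd (fun p => V (p.1.1 / 2, p.2))) => //.
  - have m1 : measurable_fun [set: (measurableTypeR R * E) * measurableTypeR R]
        (fun p => p.1.1).
      exact: (measurableT_comp measurable_fst measurable_fst).
    apply: measurable_dpsub; last exact: measurable_snd.
    by apply: measurable_funB => //; exact: measurable_funM.
  - apply: (measurableT_comp mV); apply/measurable_fun_pairP; split => /=.
      apply: measurable_funM => //.
      exact: (measurableT_comp measurable_fst measurable_fst).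
    exact: measurable_snd.
move=> t x t0; have t2 : 0 < t / 2 by rewrite divr_gt0.
have tt : t / 2 < t by lra.
have VkE : v k (t / 2) = (fun y => V (t / 2, y)) by apply/funext => y; exact: VE.
rewrite -[RHS]/(swt (dpsub (t - t / 2)) (fun y => V (t / 2, y)) x) -VkE.
exact: (vSE x (semigroupP k) t2 tt).
Qed.

(** The time [t - s] that separates [v_(k+1)(t)] from [v_k(s)] is at least [t / 2], and [tailw]
    decreases in its first argument; hence one weight for all such [s]. *)
Lemma dpoisson_le : exists2 C : R, 0 < C & forall k s t x, 0 < s -> s <= t / 2 ->
  (`|dpoisson_hermite k.+1 t f x|%:E <=
   C%:E * wou (tailw (t / 2)) (fun y => `|dpoisson_hermite k s f y|%:E) x)%E.
Proof.
have [C C0 HC] := @dpsub_le R; exists C => // k s t x s0 st.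
have ts : 0 < t - s by lra.
have [ik _] := semigroupP k s0.
have slt : s < t by rewrite -subr_gt0.
rewrite -[X in `|X|%:E]/(v k.+1 t x) (vSE x (semigroupP k) s0 slt).
apply: le_trans (swt_le x (tame_dpsub ts) ik) _.
rewrite /wou -ge0_integralZl_EFin ?(ltW C0)//; last 3 first.
- exact: measurable_posline.
- by move=> r _; rewrite mule_ge0 ?lee_fin ?powR_ge0 ?ou_ge0// => z; rewrite lee_fin.
- apply: measurable_funTS; apply: emeasurable_funM.
    apply/measurable_EFinP; exact: (@measurable_tailw R _ _ (cst (t / 2)) id).
  apply: measurable_ou_time => [|z]; last by rewrite lee_fin.
  by case/integrableP : (integrable_norm ik).
apply: ge0_integral_mono => r; rewrite poslineP => r0.
  by rewrite mule_ge0 ?lee_fin ?ou_ge0// => z; rewrite lee_fin.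
rewrite muleA -EFinM lee_wpmul2r ?lee_fin ?ou_ge0//.
apply: le_trans (HC _ _ ts r0) _; rewrite ler_wpM2l ?(ltW C0)//.
by apply: tailw_anti => //; lra.
Qed.

(** Supplies the vanishing boundary term in the tail formula. It concerns orders at least one, since
    [v_0] need not tend to [0]. The base time is [1], and [3 / (t - 1) <= 6 / t] for [t >= 2]. *)
Lemma dpoisson_decay k x : exists2 C : R, 0 < C & forall t, 2 <= t ->
  `|dpoisson_hermite k.+1 t f x| <= C / t.
Proof.
have [C C0 HC] := @psub_std_le R d 1 ltr01.
have [ik _] := semigroupP k (@ltr01 R).
have iak := integrable_norm ik.
have h0 y : (0 <= (EFin \o (fun y => `|v k 1 y|%R)) y)%E by rewrite lee_fin.
have mh : measurable_fun setT (EFin \o (fun y => `|v k 1 y|%R)) by case/integrableP : iak.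
pose N := \int[gam]_y `|v k 1 y|.
have N0 : 0 <= N by apply: Rintegral_ge0 => y _.
have NE : (\int[gam]_y (EFin \o (fun y => `|v k 1 y|%R)) y = N%:E)%E.
  by rewrite /N fineK//; exact: integrable_fin_num.
exists (C * (6 * expR (enorm x ^+ 2) * N) + 1).
  by rewrite ltr_wpDl// !mulr_ge0 ?expR_ge0// ltW.
move=> t t2; have t0 : 0 < t by lra.
have ts : 0 < t - 1 by lra.
have slt : 1 < t by rewrite -subr_gt0.
rewrite -[X in `|X|]/(v k.+1 t x) (vSE x (semigroupP k) ltr01 slt).
rewrite -lee_fin; apply: le_trans (swt_le x (tame_dpsub ts) ik) _.
have tw := @tame_tailw R d (t - 1) ts.
apply: (@le_trans _ _ (C%:E * wou (fun r => tailw (t - 1) r * mehler_std r ^+ d)%R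
    (EFin \o (fun y => `|v k 1 y|%R)) x)%E).
  rewrite /wou -ge0_integralZl_EFin ?(ltW C0)//; last 3 first.
  - exact: measurable_posline.
  - move=> r _; rewrite mule_ge0 ?ou_ge0// lee_fin.
    by rewrite mulr_ge0 ?powR_ge0 ?exprn_ge0 ?sqrtr_ge0.
  - apply: measurable_funTS; apply: emeasurable_funM.
      by apply/measurable_EFinP; have [] := tw.
    by apply: measurable_ou_time.
  apply: ge0_integral_mono => r; rewrite poslineP => r0.
    by rewrite mule_ge0 ?lee_fin ?ou_ge0// => z; rewrite lee_fin.
  rewrite muleA -EFinM lee_wpmul2r ?ou_ge0// lee_fin.
  by have [_ ] := HC (t - 1) r ltac:(lra) r0.
apply: (@le_trans _ _ (C%:E * ((3 / (t - 1) * expR (enorm x ^+ 2))%:E * N%:E))%E).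
  by rewrite lee_wpmul2l ?lee_fin ?(ltW C0)// -NE; exact: wou_tailw_std_le.
rewrite -!EFinM lee_fin.
have -> : (C * (6 * expR (enorm x ^+ 2) * N) + 1) / t =
  C * ((6 / t * expR (enorm x ^+ 2)) * N) + t^-1 by field; rewrite gt_eqF.
rewrite -[leLHS]addr0 lerD ?invr_ge0 ?(ltW t0)// ler_wpM2l ?(ltW C0)// ler_wpM2r//.
rewrite ler_wpM2r ?expR_ge0// ler_pdivrMr// mulrAC ler_pdivlMr//; lra.
Qed.

End poisson_hermite_derivatives.

(** * Hoelder and Minkowski inequalities *)

Section luxnorm_inequalities.
Local Open Scope ereal_scope.
Context dT (T : measurableType dT) (R : realType) (nu : {measure set T -> \bar R}).
Variable D : set T.
Hypothesis mD : measurable D.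
Implicit Types (f g : T -> \bar R) (p : T -> R).

(** With [M] the larger of [u ^ p0] and [w ^ p1], one has [u <= M ^ (1 / p0)] and
    [w <= M ^ (1 / p1)]; the relation between the exponents makes the product at most
    [M ^ (1 / p)]. *)
Lemma poweR_interpolate (th p0 p1 p : R) (u w : \bar R) : (0 < th < 1)%R ->
  (1 <= p0)%R -> (1 <= p1)%R -> (p^-1 = (1 - th) / p0 + th / p1)%R ->
  0 <= u -> 0 <= w -> (u `^ (1 - th) * w `^ th) `^ p <= u `^ p0 + w `^ p1.
Proof.
move=> /andP[th0 th1] p01 p11 pE u0 w0.
have p00 : (0 < p0)%R by lra.
have p10 : (0 < p1)%R by lra.
have pi : (0 < p^-1)%R by rewrite pE addr_gt0 ?divr_gt0//; lra.
have pp : (0 < p)%R by rewrite -[p]invrK invr_gt0.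
set X := u `^ p0; set Y := w `^ p1; pose M := maxe X Y.
have X0 : 0 <= X by exact: poweR_ge0.
have Y0 : 0 <= Y by exact: poweR_ge0.
have M0 : 0 <= M by rewrite le_max X0.
have MXY : M <= X + Y.
  by rewrite ge_max; apply/andP; split; [rewrite leeDl|rewrite leeDr].
apply: le_trans MXY.
have uM : u <= M `^ p0^-1.
  rewrite -[leLHS](@poweRe1 R)// -(@mulfV _ p0) ?gt_eqF// poweRrM.
  by apply: le_poweR; rewrite ?invr_ge0 ?(ltW p00)// le_max lexx.
have wM : w <= M `^ p1^-1.
  rewrite -[leLHS](@poweRe1 R)// -(@mulfV _ p1) ?gt_eqF// poweRrM.
  by apply: le_poweR; rewrite ?invr_ge0 ?(ltW p10)// le_max lexx orbT.
have [Moo|Mfin] := eqVneq M +oo; first by rewrite Moo leey.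
have MM : M = (M `^ p^-1) `^ p by rewrite -poweRrM mulVf ?gt_eqF// poweRe1.
rewrite {}[leRHS]MM; apply: le_poweR; [exact: ltW|by rewrite mule_ge0 ?poweR_ge0|].
have -> : M `^ p^-1 = (M `^ p0^-1) `^ (1 - th) * (M `^ p1^-1) `^ th.
  rewrite -!poweRrM pE (mulrC (1 - th)%R) (mulrC th) poweRD//.
  rewrite /poweRD_def; apply/implyP => H; exfalso; move: H.
  by rewrite gt_eqF// addr_gt0// mulr_gt0 ?invr_gt0//; lra.
by apply: lee_pmul; rewrite ?poweR_ge0//; apply: le_poweR => //; lra.
Qed.

(** The bounds [n0], [n1] lie strictly above the norms because the infima need not be attained,
    unless they are infinite. After normalisation the modular is at most the sum of two modulars,
    whence the factor [2]. *)
Lemma luxnorm_holder (th : R) p0 p1 p f g0 g1 (n0 n1 : \bar R) : (0 < th < 1)%R ->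
  measurable_fun D p0 -> measurable_fun D p1 -> measurable_fun D p ->
  (forall x, D x -> 1 <= p0 x)%R -> (forall x, D x -> 1 <= p1 x)%R ->
  (forall x, D x -> (p x)^-1 = (1 - th) / p0 x + th / p1 x)%R ->
  measurable_fun D f -> measurable_fun D g0 -> measurable_fun D g1 ->
  (forall x, D x -> 0 <= g0 x) -> (forall x, D x -> 0 <= g1 x) ->
  (forall x, D x -> `|f x| <= g0 x `^ (1 - th) * g1 x `^ th) ->
  0 < n0 -> 0 < n1 -> luxnorm nu D p0 g0 < n0 \/ n0 = +oo ->
  luxnorm nu D p1 g1 < n1 \/ n1 = +oo ->
  luxnorm nu D p f <= 2%:E * (n0 `^ (1 - th) * n1 `^ th).
Proof.
move=> th01 mp0 mp1 mp p01 p11 pE mf mg0 mg1 g00 g10 fg n00 n10 H0 H1.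
have [th0 th1] := andP th01; have t1 : (0 < 1 - th)%R by lra.
have [n0oo|n0fin] := eqVneq n0 +oo.
  rewrite n0oo poweRyr ?gt_eqF// gt0_mulye ?poweR_gt0//.
  by rewrite gt0_muley ?leey.
have [n1oo|n1fin] := eqVneq n1 +oo.
  rewrite n1oo poweRyr ?gt_eqF// gt0_muley ?poweR_gt0//.
  by rewrite gt0_muley ?leey.
case: H0 => [H0|H]; last by rewrite H eqxx in n0fin.
case: H1 => [H1|H]; last by rewrite H eqxx in n1fin.
case: n0 n00 H0 n0fin => [l0| |]// l00 H0 _; case: n1 n10 H1 n1fin => [l1| |]// l10 H1 _.
rewrite lte_fin in l00; rewrite lte_fin in l10.
pose l := (l0 `^ (1 - th) * l1 `^ th)%R.
have lp : (0 < l)%R by rewrite mulr_gt0 ?powR_gt0.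
rewrite -[X in _ <= X]/((2 * l)%R%:E) mulrC.
have pp x : D x -> (1 <= p x)%R.
  move=> Dx; have a := p01 x Dx; have b := p11 x Dx.
  have a0 : (0 < p0 x)%R by lra.
  have b0 : (0 < p1 x)%R by lra.
  have pi : (0 < (p x)^-1)%R by rewrite pE// addr_gt0 ?divr_gt0.
  rewrite -[p x]invrK invf_ge1// pE//.
  have : ((1 - th) / p0 x <= 1 - th)%R by rewrite ler_pdivrMr// ler_peMr// ltW.
  have : (th / p1 x <= th)%R by rewrite ler_pdivrMr// ler_peMr// ltW.
  lra.
apply: luxnorm_le_modular => //; first by lra.
have m0 := luxnorm_gt_modular (fun x Dx => le_trans ler01 (p01 x Dx)) H0.
have m1 := luxnorm_gt_modular (fun x Dx => le_trans ler01 (p11 x Dx)) H1.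
have li0 : (0 <= l0^-1)%R by rewrite invr_ge0 ltW.
have li1 : (0 <= l1^-1)%R by rewrite invr_ge0 ltW.
have mpow (c : R) (q : T -> R) (g : T -> \bar R) : measurable_fun D q -> measurable_fun D g ->
    measurable_fun D (fun x => `|c%:E * g x| `^ q x).
  move=> mq mg; apply: measurable_fun_poweR => //.
  by apply: measurableT_comp => //; exact: emeasurable_funM.
apply: (@le_trans _ _ (\int[nu]_(x in D) (`|(l0^-1)%:E * g0 x| `^ p0 x +
    `|(l1^-1)%:E * g1 x| `^ p1 x))); last first.
  rewrite ge0_integralD//; last 4 first.
  - by move=> x _; exact: poweR_ge0.
  - exact: mpow.
  - by move=> x _; exact: poweR_ge0.
  - exact: mpow.
  by rewrite -[X in _ <= X%:E]/(1 + 1)%R EFinD leeD.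
apply: ge0_integral_mono => x Dx; first exact: poweR_ge0.
have u0 : 0 <= (l0^-1)%:E * g0 x by rewrite mule_ge0 ?g00.
have w0 : 0 <= (l1^-1)%:E * g1 x by rewrite mule_ge0 ?g10.
rewrite (gee0_abs u0) (gee0_abs w0).
apply: le_trans (poweR_interpolate th01 (p01 x Dx) (p11 x Dx) (pE x Dx) u0 w0).
apply: le_poweR; [exact: le_trans (pp x Dx)|exact: abse_ge0|].
rewrite abseZl ?invr_ge0 ?(ltW lp)//.
rewrite !poweRM ?g00 ?g10// !poweR_EFin.
apply: (@le_trans _ _ ((l^-1)%:E * (g0 x `^ (1 - th) * g1 x `^ th))).
  by rewrite lee_wpmul2l ?fg// lee_fin invr_ge0 ltW.
rewrite le_eqVlt; apply/orP; left; apply/eqP.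
rewrite muleACA -EFinM; congr (_%:E * _); rewrite /l invfM.
by rewrite !powRV.
Qed.

(** If [a] and [b] are admissible for [f] and [g], then [(f + g) / (2 (a + b))] is at most the
    larger of [f / a] and [g / b], whose modular is at most [2]. *)
Lemma luxnorm_add_fin p f g : measurable_fun D p -> (forall x, D x -> 1 <= p x)%R ->
  measurable_fun D f -> measurable_fun D g ->
  (forall x, D x -> 0 <= f x) -> (forall x, D x -> 0 <= g x) ->
  luxnorm nu D p f < +oo -> luxnorm nu D p g < +oo ->
  luxnorm nu D p (fun x => f x + g x) < +oo.
Proof.
move=> mp p1 mf mg f0 g0 /luxnorm_ltP[a [a0 _ Ha]] /luxnorm_ltP[b [b0 _ Hb]].
have c0 : (0 < a + b)%R by rewrite addr_gt0.
apply: (@le_lt_trans _ _ ((2 * (a + b)) * 2)%:E); last exact: ltry.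
apply: luxnorm_le_modular => //; [exact: emeasurable_funD|by rewrite mulr_gt0|lra|].
have mpow (c : R) (h : T -> \bar R) : measurable_fun D h ->
    measurable_fun D (fun x => `|c%:E * h x| `^ p x).
  move=> mh; apply: measurable_fun_poweR => //.
  by apply: measurableT_comp => //; exact: emeasurable_funM.
apply: (@le_trans _ _ (\int[nu]_(x in D) (`|(a^-1)%:E * f x| `^ p x +
    `|(b^-1)%:E * g x| `^ p x))); last first.
  rewrite ge0_integralD//; last 4 first.
  - by move=> x _; exact: poweR_ge0.
  - exact: mpow.
  - by move=> x _; exact: poweR_ge0.
  - exact: mpow.
  by rewrite -[X in _ <= X%:E]/(1 + 1)%R EFinD leeD.
apply: ge0_integral_mono => x Dx; first exact: poweR_ge0.
have px0 : (0 <= p x)%R by exact: le_trans (p1 x Dx).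
have fx := f0 x Dx; have gx := g0 x Dx.
have ai : (0 <= a^-1)%R by rewrite invr_ge0 ltW.
have bi : (0 <= b^-1)%R by rewrite invr_ge0 ltW.
have ab0 : (0 <= (2 * (a + b))^-1)%R by rewrite invr_ge0 mulr_ge0// ltW.
rewrite !gee0_abs ?mule_ge0 ?adde_ge0//.
set u := (a^-1)%:E * f x; set w := (b^-1)%:E * g x.
have u0 : 0 <= u by rewrite mule_ge0.
have w0 : 0 <= w by rewrite mule_ge0.
have fu : f x = a%:E * u by rewrite muleA -EFinM mulfV ?mul1e// gt_eqF.
have gw : g x = b%:E * w by rewrite muleA -EFinM mulfV ?mul1e// gt_eqF.
have key : ((2 * (a + b))^-1)%:E * (f x + g x) <= maxe u w.
  rewrite lee_pdivrMl ?mulr_gt0//.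
  have uM : u <= maxe u w by rewrite le_max lexx.
  have wM : w <= maxe u w by rewrite le_max lexx orbT.
  have M0 : 0 <= maxe u w by rewrite le_max u0.
  apply: (@le_trans _ _ (a%:E * maxe u w + b%:E * maxe u w)).
    by rewrite fu gw leeD// lee_wpmul2l// lee_fin ltW.
  rewrite -ge0_muleDl ?lee_fin ?(ltW a0) ?(ltW b0)// -EFinD lee_wpmul2r// lee_fin; lra.
have kx0 : 0 <= ((2 * (a + b))^-1)%:E * (f x + g x).
  by rewrite mule_ge0 ?adde_ge0.
apply: le_trans (le_poweR px0 kx0 key) _.
case: (leP u w) => _; first by rewrite leeDr// poweR_ge0.
by rewrite leeDl// poweR_ge0.
Qed.

End luxnorm_inequalities.

Lemma muley_fin {R : realType} (C : R) (x : \bar R) : (0 < C)%R -> (x < +oo -> C%:E * x < +oo)%E.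
Proof.
move=> C0; case: x => [x| |]//; first by move=> _; rewrite -EFinM ltry.
by rewrite gt0_muleNy.
Qed.

Section holder_finite.
Local Open Scope ereal_scope.
Context dT (T : measurableType dT) (R : realType).
Variables (nu : {measure set T -> \bar R}) (D : set T).
Hypothesis mD : measurable D.

Lemma luxnorm_holder_fin (th C : R) (p0 p1 p : T -> R) f g0 g1 : (0 < th < 1)%R -> (0 < C)%R ->
  measurable_fun D p0 -> measurable_fun D p1 -> measurable_fun D p ->
  (forall x, D x -> 1 <= p0 x)%R -> (forall x, D x -> 1 <= p1 x)%R ->
  (forall x, D x -> (p x)^-1 = (1 - th) / p0 x + th / p1 x)%R ->
  (forall x, D x -> 0 <= p x)%R ->
  measurable_fun D g0 -> measurable_fun D g1 ->
  (forall x, D x -> 0 <= g0 x) -> (forall x, D x -> 0 <= g1 x) ->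
  (forall x, D x -> `|f x| <= C%:E * (g0 x `^ (1 - th) * g1 x `^ th)) ->
  luxnorm nu D p0 g0 < +oo -> luxnorm nu D p1 g1 < +oo -> luxnorm nu D p f < +oo.
Proof.
move=> th01 C0 mp0 mp1 mp p01 p11 pE pge0 mg0 mg1 g00 g10 fg H0 H1.
pose G x := g0 x `^ (1 - th) * g1 x `^ th.
have mG : measurable_fun D G by apply: emeasurable_funM; apply: measurable_fun_poweR.
have G0 x : 0 <= G x by rewrite mule_ge0 ?poweR_ge0.
apply: (@le_lt_trans _ _ (luxnorm nu D p (fun x => C%:E * G x))).
  apply: luxnorm_mono => // x Dx; apply: le_trans (fg x Dx) _.
  exact: lee_abs.
apply: le_lt_trans (luxnormZ_le _ _ _ _ C0) _; apply: muley_fin => //.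
have fin1 (n : \bar R) : 0 <= n -> n < +oo -> n < n + 1.
  by case: n => [n| |]// _ _; rewrite -EFinD lte_fin ltrDl.
have pos1 (n : \bar R) : 0 <= n -> 0 < n + 1.
  by case: n => [n| |]// n0; rewrite -EFinD lte_fin; rewrite lee_fin in n0; lra.
have L0 := luxnorm_ge0 nu D p0 g0; have L1 := luxnorm_ge0 nu D p1 g1.
have GG x : D x -> `|G x| <= G x by move=> _; rewrite gee0_abs.
have := luxnorm_holder mD th01 mp0 mp1 mp p01 p11 pE mG mg0 mg1 g00 g10 GG
  (pos1 _ L0) (pos1 _ L1) (or_introl (fin1 _ L0 H0)) (or_introl (fin1 _ L1 H1)).
move=> /le_lt_trans; apply; move: L0 L1 H0 H1.
case: (luxnorm _ _ p0 _) => [n0| |]//; case: (luxnorm _ _ p1 _) => [n1| |]//.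
by move=> _ _ _ _; rewrite -!EFinD !poweR_EFin -!EFinM ltry.
Qed.

End holder_finite.

(** * Minkowski's integral inequality for Luxemburg norms *)

Section minkowski.
Local Open Scope ereal_scope.
Context dT (T : measurableType dT) (R : realType).
Variables (nu : {sigma_finite_measure set T -> \bar R}) (p : T -> R).
Hypotheses (mp : measurable_fun setT p) (p1 : forall x, (1 <= p x)%R).
Local Notation mu := (@lebesgue_measure R).

(* Convexity: [F / n] has modular at most [1] for every [n] above the norm of [F], and
   the tail integral is an average of these quotients with weights [n / \int n]; the
   term [e] keeps the weights positive. *)
Lemma luxnorm_minkowski (t : R) (F : measurableTypeR R * T -> \bar R) : (0 < t)%R ->
  measurable_fun setT F -> (forall z, 0 <= F z) ->
  luxnorm nu setT p (fun x => \int[mu]_(s in `[t, +oo[) F (s, x)) <=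
  \int[mu]_(s in `[t, +oo[) luxnorm nu setT p (fun x => F (s, x)).
Proof.
move=> t0 mF F0; pose B := `[t, +oo[%classic : set (measurableTypeR R).
have mB : measurable B by exact: measurable_itv.
pose n (s : measurableTypeR R) := luxnorm nu setT p (fun x => F (s, x)).
have n0 s : 0 <= n s by exact: luxnorm_ge0.
have p0 x : (0 <= p x)%R by exact: le_trans (p1 x).
have mFl (c : measurableTypeR R -> R) : measurable_fun setT c ->
    measurable_fun setT (fun z : measurableTypeR R * T => `|(c z.1)%:E * F z| `^ p z.2).
  move=> mc; apply: measurable_fun_poweR => //; last exact: (measurableT_comp mp).
  apply: measurableT_comp => //; apply: emeasurable_funM => //.
  by apply/measurable_EFinP; exact: (measurableT_comp mc).
have mn : measurable_fun setT n.
  apply: measurable_luxnorm => // l l0.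
  apply: (@measurable_integral_on _ _ _ _ R nu setT setT
    (fun z => `|(l^-1)%:E * F z| `^ p z.2)) => //.
    by apply: measurable_funTS; exact: (mFl (cst (l^-1)%R) (measurable_cst _)).
  by move=> a b _ _; exact: poweR_ge0.
have mFs s : measurable_fun setT (fun x => F (s, x)).
  exact: (measurableT_comp mF (measurable_pair1 s)).
have mFx x : measurable_fun setT (fun s => F (s, x)).
  exact: (measurableT_comp mF (measurable_pair2 x)).
set I := \int[mu]_(s in B) n s.
have I0 : 0 <= I by exact: integral_ge0.
have [Ioo|Ifin] := eqVneq I +oo; first by rewrite -/(n _) -/I Ioo leey.
have IE : I = (fine I)%:E by rewrite fineK// ge0_fin_numE// lt_neqAle Ifin leey.
apply/lee_addgt0Pr => e e0; rewrite -[X in _ <= X + _]/I IE -EFinD.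
have fI0 : (0 <= fine I)%R by exact: fine_ge0.
set J := (fine I + e)%R; have J0 : (0 < J)%R by rewrite /J; lra.
have Ji0 : (0 <= J^-1)%R by rewrite invr_ge0 ltW.
(* Normalised so that its integral over [[t, +oo[] is [e]. *)
pose eta (s : R) : R := (e * t * s `^ (- 1 - 1))%R.
have eta0 s : (0 <= eta s)%R by rewrite !mulr_ge0 ?powR_ge0 ?ltW.
have meta : measurable_fun [set: measurableTypeR R] eta.
  by apply: measurable_funM => //; exact: measurable_powR.
have int_eta : \int[mu]_(s in B) (eta s)%:E = e%:E.
  rewrite /eta; under eq_integral do rewrite EFinM.
  rewrite ge0_integralZl_EFin ?mulr_ge0 ?(ltW e0) ?(ltW t0)//; last 2 first.
  - by move=> s _; rewrite lee_fin powR_ge0.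
  - by apply/measurable_EFinP; apply: measurable_funTS; exact: measurable_powR.
  rewrite integral_powR_infty// -EFinM; congr EFin.
  by rewrite powR_inv1 ?(ltW t0)// divr1 mulfK// gt_eqF.
have mnoo : measurable (n @^-1` [set +oo]).
  by rewrite -[X in measurable X]setTI; apply: mn => //; exact: emeasurable_set1.
(* Finiteness of [I] makes the set of times with infinite norm negligible; away from it the weights
   [m s] are real and positive. *)
pose N := B `&` n @^-1` [set +oo].
have mN : measurable N by exact: measurableI.
have N0 : mu N = 0.
  apply/(negligibleP _ mN).
  have : mu.-integrable B n.
    apply/integrableP; split; first exact: measurable_funTS.
    under eq_integral do rewrite gee0_abs//.
    by rewrite -/I IE ltry.
  move=> /(integrable_ae mB); apply: negligibleS => s [Bs nsoo] /(_ Bs).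
  by rewrite nsoo.
pose B' := B `\` N.
have mB' : measurable B' by exact: measurableD.
have B'B : B' `<=` B by move=> s [].
have nE s : B' s -> n s = (fine (n s))%:E.
  move=> [Bs Ns]; rewrite fineK// ge0_fin_numE// lt_neqAle leey andbT.
  by apply/eqP => nsoo; apply: Ns; split.
pose m (s : R) : R := (fine (n s) + eta s)%R.
have m0 s : B' s -> (0 < m s)%R.
  move=> [Bs _]; rewrite ltr_wpDl ?fine_ge0// !mulr_gt0// powR_gt0//.
  by move: Bs; rewrite /B/= in_itv/= andbT; exact: lt_le_trans.
have mm : measurable_fun [set: measurableTypeR R] m.
  apply: measurable_funD => //.
  exact: (measurableT_comp (fine_measurable measurableT) mn).
have mod1 s : B' s -> \int[nu]_x (`|((m s)^-1)%:E * F (s, x)| `^ p x) <= 1.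
  move=> B's; apply: luxnorm_gt_modular => //.
  rewrite -/(n s) nE// lte_fin ltrDl !mulr_gt0// powR_gt0//.
  by have := B'B _ B's; rewrite /B/= in_itv/= andbT; exact: lt_le_trans.
pose k (s : R) : \bar R := (m s / J)%:E.
have k0 s : B' s -> 0 <= k s by move=> /m0 ms; rewrite lee_fin divr_ge0 ?ltW.
have mk : measurable_fun [set: measurableTypeR R] k.
  by apply/measurable_EFinP; exact: measurable_funM.
have k1 : \int[mu]_(s in B') k s <= 1.
  apply: (@le_trans _ _ (\int[mu]_(s in B) ((J^-1)%:E * (n s + (eta s)%:E)))).
    apply: (@le_trans _ _ (\int[mu]_(s in B') ((J^-1)%:E * (n s + (eta s)%:E)))).
      apply: ge0_integral_mono => s B's; first exact: k0.
      by rewrite nE// -EFinD -EFinM mulrC.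
    apply: ge0_subset_integral => //.
      apply: emeasurable_funM => //; apply: measurable_funTS.
      by apply: emeasurable_funD => //; exact/measurable_EFinP.
    by move=> s _; rewrite mule_ge0 ?adde_ge0 ?lee_fin.
  rewrite ge0_integralZl_EFin//; last 2 first.
  - by move=> s _; rewrite adde_ge0 ?lee_fin.
  - by apply: measurable_funTS; apply: emeasurable_funD => //; exact/measurable_EFinP.
  rewrite ge0_integralD//; last 3 first.
  - exact: measurable_funTS.
  - by move=> s _; rewrite lee_fin.
  - by apply: measurable_funTS; exact/measurable_EFinP.
  by rewrite int_eta -/I IE -EFinD -EFinM mulVf// gt_eqF.
apply: luxnorm_le => //.
pose f (z : T * measurableTypeR R) : \bar R :=
  k z.2 * (`|((m z.2)^-1)%:E * F (z.2, z.1)| `^ p z.1).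
have mf : measurable_fun setT f.
  apply: emeasurable_funM; first exact: (measurableT_comp mk).
  have H := mFl (fun s => (m s)^-1)%R (measurable_invr mm).
  have msw : measurable_fun setT (fun z : T * measurableTypeR R => (z.2, z.1)).
    by apply/measurable_fun_pairP; split; [exact: measurable_snd|exact: measurable_fst].
  exact: (measurableT_comp H msw).
apply: (@le_trans _ _ (\int[nu]_x \int[mu]_(s in B') f (x, s))).
  apply: ge0_integral_mono => x _; first exact: poweR_ge0.
  have mx : measurable_fun B' (fun s => ((m s)^-1)%:E * F (s, x)).
    apply: measurable_funTS; apply: emeasurable_funM => //.
    by apply/measurable_EFinP; exact: measurable_invr.
  have -> : `|(J^-1)%:E * \int[mu]_(s in `[t, +oo[) F (s, x)| =
      \int[mu]_(s in B') (k s * (((m s)^-1)%:E * F (s, x))).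
    rewrite gee0_abs; last by rewrite mule_ge0 ?lee_fin// integral_ge0.
    rewrite -[X in _ * X]/(\int[mu]_(s in B) F (s, x)).
    rewrite (@ge0_negligible_integral _ _ R mu B N (fun s => F (s, x)))//; last exact: measurable_funTS.
    rewrite -ge0_integralZl_EFin//; last exact: measurable_funTS.
    apply: eq_integral => s; rewrite inE => B's.
    rewrite muleA -EFinM mulrAC mulfV ?mul1r// gt_eqF//; exact: m0.
  apply: le_trans (ge0_poweR_jensen _ _ _ _ _ (p1 x) k1) _ => //.
  - exact: measurable_funTS.
  - by move=> s B's; rewrite mule_ge0// lee_fin invr_ge0 ltW// m0.
  apply: ge0_integral_mono => s B's; first by rewrite mule_ge0 ?k0 ?poweR_ge0.
  by rewrite /f/= gee0_abs// mule_ge0// lee_fin invr_ge0 ltW// m0.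
have T1 := tonelli_on (A := setT) (B := B') nu mu f measurableT mB'
  (measurable_funTS mf) (fun x s _ B's => mule_ge0 (k0 s B's) (poweR_ge0 _ _)).
apply: (@le_trans _ _ (\int[mu]_(s in B') \int[nu]_x f (x, s))); first by rewrite T1.
apply: le_trans k1; apply: ge0_integral_mono => s B's.
  by apply: integral_ge0 => x _; rewrite mule_ge0 ?k0 ?poweR_ge0.
rewrite /f/= ge0_integralZl//; last 3 first.
- by have := mFl (cst (m s)^-1)%R (measurable_cst _) => H; exact: (measurableT_comp H (measurable_pair1 s)).
- by move=> x _; exact: poweR_ge0.
- exact: k0.
by rewrite -[leRHS]mule1 lee_wpmul2l ?k0 ?mod1.
Qed.

End minkowski.

(** * A Hardy inequality for variable exponents *)

Section haar_integral.
Context {R : realType}.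
Local Open Scope ereal_scope.
Local Notation mu := (@lebesgue_measure R).
Implicit Types (t s c e : R).

Let mpos : measurable (posline : set (measurableTypeR R)).
Proof. exact: measurable_posline. Qed.

Lemma measurable_invline : measurable_fun [set: measurableTypeR R] (fun t : R => (t^-1)%R).
Proof. by apply: measurable_invr. Qed.

Lemma ge0_integral_haar (f : R -> \bar R) : measurable_fun (posline : set (measurableTypeR R)) f ->
  (forall t, (0 < t)%R -> 0 <= f t) ->
  \int[haar_measure]_(t in posline) f t = \int[mu]_(t in posline) ((t^-1)%:E * f t).
Proof.
move=> mf f0; pose w := (fun t : R => (t^-1)%:E) \_ posline.
have mi : measurable_fun (posline : set (measurableTypeR R)) (fun t : R => (t^-1)%:E).
  by apply/measurable_EFinP; apply: measurable_funTS; exact: measurable_invline.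
have mw : measurable_fun [set: measurableTypeR R] w.
  by apply/(measurable_restrictT _ _).1.
have w0 t : 0 <= w t.
  rewrite /w patchE; case: ifPn => //; rewrite inE poslineP => t0.
  by rewrite lee_fin invr_ge0 ltW.
pose idR (t : R) : measurableTypeR R := t.
have mid : measurable_fun [set: R] idR by move=> _ A mA; rewrite setTI; exact: mA.
have nuE (A : set (measurableTypeR R)) : measurable A ->
    pushforward (@haar_measure R) idR A = \int[mu]_(t in A) w t.
  by move=> mA; rewrite /pushforward /haar_measure /= integral_mkcondr.
have f0' : {in (posline : set (measurableTypeR R)), forall t, 0 <= f t}.
  by move=> t; rewrite inE poslineP; exact: f0.
have E := ge0_integral_pushforward mid (@haar_measure R) mpos mf f0'.
apply: (etrans (esym E)); rewrite integral_mkcond.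
rewrite (ge0_integral_density (mu := mu) mw w0 nuE); last 2 first.
- by apply/(measurable_restrictT _ _).1.
- by move=> t; rewrite patchE; case: ifPn => //; rewrite inE poslineP; exact: f0.
rewrite [RHS]integral_mkcond; apply: eq_integral => t _.
by rewrite /w !patchE; case: ifPn => // _; rewrite mule0.
Qed.

(** This is [exp (- |ln t|)]. Its positive powers are integrable for [dt / t], and [- ln (hdist t)]
    is the scale on which the decay conditions on [q] act, both at [0] and at infinity. *)
Definition hdist t : R := Num.min t (t^-1)%R.

Lemma hdist_gt0 t : (0 < t)%R -> (0 < hdist t)%R.
Proof. by move=> t0; rewrite lt_min t0 invr_gt0. Qed.

Lemma hdist_le1 t : (0 < t)%R -> (hdist t <= 1)%R.
Proof.
move=> t0; rewrite ge_min; have [//|t1] := lerP t 1.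
by rewrite invf_le1// ltW.
Qed.

Lemma measurable_hdist : measurable_fun [set: measurableTypeR R] hdist.
Proof. by apply: measurable_minr => //; exact: measurable_invline. Qed.

(** The measure [dt / t] is invariant under dilations, hence the uniformity in [r]; the parts below
    and above [r] contribute at most [1 / c] each. *)
Lemma integral_hdist_scaled (r c : R) : (0 < r)%R -> (0 < c)%R ->
  \int[mu]_(t in posline) ((t^-1)%:E * (hdist (t / r) `^ c)%:E) <= (2 / c)%:E.
Proof.
move=> r0 c0.
have mh : measurable_fun [set: measurableTypeR R] (fun t => (t^-1)%:E * (hdist (t / r) `^ c)%:E).
  apply: emeasurable_funM; apply/measurable_EFinP; first exact: measurable_invline.
  apply: (measurableT_comp (measurable_powR _)); apply: (measurableT_comp measurable_hdist).
  exact: measurable_funM.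
have h0 t : (0 < t)%R -> 0 <= (t^-1)%:E * (hdist (t / r) `^ c)%:E.
  by move=> t0; rewrite mule_ge0 ?lee_fin ?powR_ge0 ?invr_ge0 ?ltW.
have -> : posline = `]0%R, r] `|` `]r, +oo[ :> set (measurableTypeR R).
  apply/seteqP; split => t; rewrite poslineP /= !in_itv/= ?andbT.
    by move=> t0; have [t1|t1] := lerP t r; [left|right]; rewrite ?t0.
  by move=> [/andP[]//|]; exact: lt_trans.
rewrite ge0_integral_setU//=; last 3 first.
- exact: measurable_funTS.
- move=> t [|] /=; rewrite in_itv/= ?andbT; first by move=> /andP[/h0].
  by move=> t1; apply: h0; exact: lt_trans t1.
- apply/disj_setPLR => t /=; rewrite !in_itv/= andbT => /andP[_ t1] t2.
  by rewrite ltNge t1 in t2.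
have rr : (r `^ (- c) * r `^ c = 1)%R.
  by rewrite powRN mulVf// gt_eqF// powR_gt0.
have -> : (2 / c)%:E = (r `^ (- c))%:E * (r `^ c / c)%:E + (r `^ c)%:E * (r `^ (- c) / c)%:E :> \bar R.
  rewrite -!EFinM -EFinD; congr EFin; rewrite !mulrA rr [(r `^ c * _)%R]mulrC rr.
  by rewrite -mulrDl.
rewrite -(integral_powR_near0 c0 (ltW r0)) -(integral_powR_infty c0 r0).
have mp e (I : set (measurableTypeR R)) : measurable_fun I (fun t => (t `^ e)%:E).
  by apply/measurable_EFinP; apply: measurable_funTS; exact: measurable_powR.
have pz e (I : set (measurableTypeR R)) t : I t -> 0 <= (t `^ e)%:E by rewrite lee_fin powR_ge0.
have mI1 : measurable (`]0%R, r] : set (measurableTypeR R)) by exact: measurable_itv.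
have mI2 : measurable (`[r, +oo[ : set (measurableTypeR R)) by exact: measurable_itv.
rewrite -(ge0_integralZl_EFin mu mI1 (pz (c - 1)%R _) (mp _ _) (powR_ge0 r (- c))).
rewrite -(ge0_integralZl_EFin mu mI2 (pz (- c - 1)%R _) (mp _ _) (powR_ge0 r c)).
apply: leeD.
  apply: ge0_integral_mono => t; rewrite /= in_itv/= => /andP[t0 t1]; first exact: h0.
  have tr : (0 < t / r)%R by rewrite divr_gt0.
  rewrite -!EFinM lee_fin.
  have -> : (r `^ (- c) * t `^ (c - 1) = t^-1 * (t / r) `^ c)%R.
    rewrite powRM ?invr_ge0 ?(ltW t0) ?(ltW r0)// powRV// -powRN.
    rewrite powRD; last by apply/implyP => _; rewrite gt_eqF.
    by rewrite powR_inv1 ?(ltW t0)//; ring.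
  rewrite ler_wpM2l ?invr_ge0 ?(ltW t0)//.
  apply: ge0_ler_powR; rewrite ?nnegrE ?(ltW c0) ?(ltW tr) ?(ltW (hdist_gt0 tr))//.
  by rewrite ge_min lexx.
apply: (@le_trans _ _ (\int[mu]_(t in `]r, +oo[) ((r `^ c)%:E * (t `^ (- c - 1))%:E))); last first.
  apply: ge0_subset_integral => //.
  - by apply: emeasurable_funM.
  - by move=> t _; rewrite mule_ge0 ?lee_fin ?powR_ge0.
  - by apply: subset_itvr; rewrite bnd_simp.
apply: ge0_integral_mono => t; rewrite /= in_itv/= andbT => t1; have t0 := lt_trans r0 t1.
  exact: h0.
have tr : (0 < t / r)%R by rewrite divr_gt0.
rewrite -!EFinM lee_fin.
have -> : (r `^ c * t `^ (- c - 1) = t^-1 * (t / r)^-1 `^ c)%R.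
  rewrite invf_div powRM ?invr_ge0 ?(ltW t0) ?(ltW r0)// powRV// -powRN.
  rewrite powRD; last by apply/implyP => _; rewrite gt_eqF.
  by rewrite powR_inv1 ?(ltW t0)//; ring.
rewrite ler_wpM2l ?invr_ge0 ?(ltW t0)//.
apply: ge0_ler_powR; rewrite ?nnegrE ?(ltW c0) ?invr_ge0 ?(ltW tr) ?(ltW (hdist_gt0 tr))//.
by rewrite ge_min lexx orbT.
Qed.

Lemma integral_hdist c : (0 < c)%R ->
  \int[mu]_(t in posline) ((t^-1)%:E * (hdist t `^ c)%:E) <= (2 / c)%:E.
Proof.
by move=> c0; have := integral_hdist_scaled ltr01 c0; under eq_integral do rewrite divr1.
Qed.

(** The cut at [t / 4] lets one kernel serve both directions: lowering the order integrates over
    [s >= t], raising it over [[t / 4, t / 2]]. *)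
Definition hkern e t s : R := ((t / s) `^ e / s * (t / 4 <= s)%R%:R)%R.

Lemma hkern_ge0 e t s : (0 < s)%R -> (0 <= hkern e t s)%R.
Proof. by move=> s0; rewrite mulr_ge0// divr_ge0 ?powR_ge0// ltW. Qed.

Lemma measurable_hkern e : measurable_fun [set: measurableTypeR R * measurableTypeR R]
  (fun z => hkern e z.1 z.2).
Proof.
have m1 : measurable_fun [set: measurableTypeR R * measurableTypeR R] (fun z => z.1).
  exact: measurable_fst.
have m2 : measurable_fun [set: measurableTypeR R * measurableTypeR R] (fun z => z.2).
  exact: measurable_snd.
apply: measurable_funM; last by apply: measurable_fun_leind => //; exact: measurable_funM.
apply: measurable_funM; last exact: measurable_invr.
apply: (measurableT_comp (measurable_powR _)).
by apply: measurable_funM => //; exact: measurable_invr.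
Qed.

Lemma hkern_le e t s : (0 < e)%R -> (0 < t)%R -> (0 < s)%R -> (hkern e t s <= 4 `^ e / s)%R.
Proof.
move=> e0 t0 s0; rewrite /hkern; have [ts|ts] := lerP (t / 4) s; last first.
  by rewrite mulr0 divr_ge0 ?powR_ge0// ltW.
rewrite mulr1 ler_wpM2r ?invr_ge0 ?(ltW s0)//; apply: ge0_ler_powR.
- exact: ltW.
- by rewrite nnegrE divr_ge0// ltW.
- by rewrite nnegrE.
- by rewrite ler_pdivrMr// mulrC -ler_pdivrMr.
Qed.

Lemma integral_hkern e t : (0 < e)%R -> (0 < t)%R ->
  \int[mu]_(s in posline) (hkern e t s)%:E = (4 `^ e / e)%:E.
Proof.
move=> e0 t0; have t4 : (0 < t / 4)%R by rewrite divr_gt0.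
transitivity (\int[mu]_(s in `[(t / 4)%R, +oo[) ((t `^ e)%:E * (s `^ (- e - 1))%:E)).
  rewrite integral_mkcond [RHS]integral_mkcond; apply: eq_integral => s _.
  rewrite !patchE !mem_setE /= !in_itv/= !andbT /hkern.
  case: ltrP => s0; last first.
    by case: ifPn => // ts; move: (lt_le_trans t4 (le_trans ts s0)); rewrite ltxx.
  case: ifPn => ts; rewrite ?mulr0// mulr1 -EFinM; congr EFin.
  rewrite powRM ?invr_ge0 ?(ltW t0) ?(ltW s0)// -mulrA; congr (_ * _)%R.
  rewrite powRD; last by apply/implyP => _; rewrite gt_eqF.
  by rewrite powR_inv1 ?(ltW s0)// powRV// powRN.
rewrite ge0_integralZl_EFin ?powR_ge0//; last 2 first.
- by move=> s _; rewrite lee_fin powR_ge0.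
- by apply/measurable_EFinP; apply: measurable_funTS; exact: measurable_powR.
rewrite integral_powR_infty// -EFinM mulrA; congr (_ / _)%:E.
rewrite -[X in (_ * X `^ _)%R]invrK invf_div powRN powRV ?divr_gt0// invrK.
by rewrite -powRM ?divr_ge0 ?(ltW t0)// mulrCA mulfV ?mulr1// gt_eqF.
Qed.

Lemma integral_hkern_fst e s : (0 < e)%R -> (0 < s)%R ->
  \int[mu]_(t in posline) (t^-1 * hkern e t s)%:E = (4 `^ e / e / s)%:E.
Proof.
move=> e0 s0.
transitivity (\int[mu]_(t in `]0%R, (4 * s)%R]) ((s^-1 `^ e / s)%:E * (t `^ (e - 1))%:E)).
  rewrite integral_mkcond [RHS]integral_mkcond; apply: eq_integral => t _.
  rewrite !patchE !mem_setE /= !in_itv/= !andbT /hkern.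
  case: ltrP => t0 //=; rewrite ler_pdivrMr// [(s * 4)%R]mulrC.
  case: ifPn => ts; rewrite ?mulr0// mulr1 -EFinM; congr EFin.
  rewrite powRM ?invr_ge0 ?(ltW t0) ?(ltW s0)//.
  rewrite powRD; last by apply/implyP => _; rewrite gt_eqF.
  by rewrite powR_inv1 ?(ltW t0)//; ring.
rewrite ge0_integralZl_EFin ?divr_ge0 ?powR_ge0 ?(ltW s0)//; last 2 first.
- by move=> t _; rewrite lee_fin powR_ge0.
- by apply/measurable_EFinP; apply: measurable_funTS; exact: measurable_powR.
rewrite integral_powR_near0//; last by rewrite mulr_ge0// ltW.
rewrite -EFinM powRM ?(ltW s0)// powRV//; congr EFin.
by field; rewrite !gt_eqF// powR_gt0.
Qed.

Definition hardy e (b : R -> \bar R) t : \bar R :=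
  \int[mu]_(s in posline) ((hkern e t s)%:E * b s).

Lemma hardy_ge0 e b t : (forall s, (0 < s)%R -> 0 <= b s) -> 0 <= hardy e b t.
Proof.
move=> b0; apply: integral_ge0 => s; rewrite poslineP => s0.
by rewrite mule_ge0 ?b0 ?lee_fin ?hkern_ge0.
Qed.

Lemma measurable_hardy e b : measurable_fun [set: measurableTypeR R] b ->
  (forall s, (0 < s)%R -> 0 <= b s) ->
  measurable_fun [set: measurableTypeR R] (hardy e b).
Proof.
move=> mb b0; apply: (@measurable_integral_on _ _ (measurableTypeR R) (measurableTypeR R) R
  mu setT posline (fun z => (hkern e z.1 z.2)%:E * b z.2)) => //.
- apply: measurable_funTS; apply: emeasurable_funM; last exact: (measurableT_comp mb).
  by apply/measurable_EFinP; exact: measurable_hkern.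
- by move=> t s _; rewrite poslineP => s0; rewrite mule_ge0 ?b0 ?lee_fin ?hkern_ge0.
Qed.

Lemma ge0_integral_lin4 (c1 c2 c3 c4 : R) (k1 k2 k3 k4 : measurableTypeR R -> \bar R) :
  (0 <= c1)%R -> (0 <= c2)%R -> (0 <= c3)%R -> (0 <= c4)%R ->
  measurable_fun posline k1 -> measurable_fun posline k2 ->
  measurable_fun posline k3 -> measurable_fun posline k4 ->
  (forall s, posline s -> 0 <= k1 s) -> (forall s, posline s -> 0 <= k2 s) ->
  (forall s, posline s -> 0 <= k3 s) -> (forall s, posline s -> 0 <= k4 s) ->
  \int[mu]_(s in posline) (c1%:E * k1 s + c2%:E * k2 s + c3%:E * k3 s + c4%:E * k4 s) =
  c1%:E * \int[mu]_(s in posline) k1 s + c2%:E * \int[mu]_(s in posline) k2 s +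
  c3%:E * \int[mu]_(s in posline) k3 s + c4%:E * \int[mu]_(s in posline) k4 s.
Proof.
move=> c10 c20 c30 c40 m1 m2 m3 m4 k10 k20 k30 k40.
have mc c (k : measurableTypeR R -> \bar R) : measurable_fun posline k ->
    measurable_fun posline (fun s => c%:E * k s) by move=> mk; exact: emeasurable_funM.
have z c (k : measurableTypeR R -> \bar R) : (0 <= c)%R -> (forall s, posline s -> 0 <= k s) ->
    forall s, posline s -> 0 <= c%:E * k s by move=> c0 k0 s ps; rewrite mule_ge0 ?k0.
have n1 := z _ _ c10 k10; have n2 := z _ _ c20 k20.
have n3 := z _ _ c30 k30; have n4 := z _ _ c40 k40.
have d1 := mc c1 _ m1; have d2 := mc c2 _ m2; have d3 := mc c3 _ m3; have d4 := mc c4 _ m4.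
have n12 s (ps : posline s) := adde_ge0 (n1 s ps) (n2 s ps).
have n123 s (ps : posline s) := adde_ge0 (n12 s ps) (n3 s ps).
have d12 := emeasurable_funD d1 d2; have d123 := emeasurable_funD d12 d3.
rewrite (ge0_integralD mu mpos n123 d123 n4 d4) (ge0_integralD mu mpos n12 d12 n3 d3).
rewrite (ge0_integralD mu mpos n1 d1 n2 d2).
rewrite (ge0_integralZl_EFin mu mpos k10 m1 c10) (ge0_integralZl_EFin mu mpos k20 m2 c20).
by rewrite (ge0_integralZl_EFin mu mpos k30 m3 c30) (ge0_integralZl_EFin mu mpos k40 m4 c40).
Qed.

Lemma hardy_le e b t : measurable_fun [set: measurableTypeR R] b ->
  (forall s, 0 <= b s) -> (0 < e)%R -> (0 < t)%R ->
  hardy e b t <= (4 `^ e)%:E * \int[mu]_(s in posline) ((s^-1)%:E * b s).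
Proof.
move=> mb b0 e0 t0.
have p1 s : posline s -> 0 <= (s^-1)%:E * b s.
  by rewrite poslineP => s0; rewrite mule_ge0// lee_fin invr_ge0 ltW.
have p2 : measurable_fun (posline : set (measurableTypeR R)) (fun s => (s^-1)%:E * b s).
  apply: measurable_funTS; apply: emeasurable_funM => //.
  by apply/measurable_EFinP; exact: measurable_invline.
apply: (@le_trans _ _ (\int[mu]_(s in posline) ((4 `^ e)%:E * ((s^-1)%:E * b s)))).
  apply: ge0_integral_mono => s; rewrite poslineP => s0.
    by rewrite mule_ge0 ?lee_fin ?hkern_ge0.
  by rewrite muleA lee_wpmul2r// -EFinM lee_fin hkern_le.
by rewrite (ge0_integralZl_EFin mu mpos p1 p2 (powR_ge0 _ _)).
Qed.

Lemma integral_hardy e b : measurable_fun [set: measurableTypeR R] b ->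
  (forall s, 0 <= b s) -> (0 < e)%R ->
  \int[mu]_(t in posline) ((t^-1)%:E * hardy e b t) =
  (4 `^ e / e)%:E * \int[mu]_(s in posline) ((s^-1)%:E * b s).
Proof.
move=> mb b0 e0.
have p3 t : (0 < t)%R -> (0 <= t^-1)%R by move=> t0; rewrite invr_ge0 ltW.
transitivity (\int[mu]_(t in posline) \int[mu]_(s in posline) ((t^-1 * hkern e t s)%:E * b s)).
  apply: eq_integral => t; rewrite inE poslineP => t0.
  have p1 s : posline s -> 0 <= (hkern e t s)%:E * b s.
    by rewrite poslineP => s0; rewrite mule_ge0// lee_fin hkern_ge0.
  have p2 : measurable_fun (posline : set (measurableTypeR R)) (fun s => (hkern e t s)%:E * b s).
    apply: measurable_funTS; apply: emeasurable_funM; last exact: mb.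
    apply/measurable_EFinP.
    exact: (measurableT_comp (@measurable_hkern e) (measurable_pair1 t)).
  apply: etrans (esym (ge0_integralZl_EFin mu mpos p1 p2 (p3 t t0))) _.
  by apply: eq_integral => s _; rewrite EFinM muleA.
apply: etrans (@tonelli_on _ _ (measurableTypeR R) (measurableTypeR R) R mu mu posline posline
  (fun z => (z.1^-1 * hkern e z.1 z.2)%:E * b z.2) _ _ _ _) _ => //.
- apply: measurable_funTS; apply: emeasurable_funM; last exact: (measurableT_comp mb).
  apply/measurable_EFinP; apply: measurable_funM; last exact: measurable_hkern.
  exact: (measurableT_comp measurable_invline).
- move=> t s; rewrite !poslineP => t0 s0.
  by rewrite mule_ge0// lee_fin mulr_ge0 ?hkern_ge0 ?p3.
have p1 s : posline s -> 0 <= (s^-1)%:E * b s.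
  by rewrite poslineP => s0; rewrite mule_ge0// lee_fin invr_ge0 ltW.
have p2 : measurable_fun (posline : set (measurableTypeR R)) (fun s => (s^-1)%:E * b s).
  apply: measurable_funTS; apply: emeasurable_funM => //.
  by apply/measurable_EFinP; exact: measurable_invline.
have c0 : (0 <= 4 `^ e / e :> R)%R by rewrite divr_ge0 ?powR_ge0// ltW.
apply: etrans (ge0_integralZl_EFin mu mpos p1 p2 c0).
apply: eq_integral => s; rewrite inE poslineP => s0 /=.
rewrite ge0_integralZr//.
- by rewrite integral_hkern_fst// muleA -EFinM.
- apply/measurable_EFinP; apply: measurable_funTS; apply: measurable_funM.
    exact: measurable_invline.
  exact: (measurableT_comp (@measurable_hkern e) (measurable_pair2 s)).
- by move=> t; rewrite poslineP => t0; rewrite lee_fin mulr_ge0 ?hkern_ge0 ?p3.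
Qed.

End haar_integral.

(** * Boundedness of the Hardy operator *)

Section hardy_bound.
Context {R : realType}.
Local Open Scope ereal_scope.
Local Notation mu := (@lebesgue_measure R).
Variables (q : R -> R) (Q A q0 qoo e : R).
Hypothesis mq : measurable_fun [set: measurableTypeR R] q.
Hypothesis qQ : forall t, (0 < t)%R -> (1 <= q t <= Q)%R.
Hypothesis A0 : (0 <= A)%R.
Hypothesis q_near0 : forall t, (0 < t)%R -> (t <= 2^-1)%R -> (`|q t - q0| <= A / ln (t^-1))%R.
Hypothesis q_nearoo : forall t, (2 < t)%R -> (`|q t - qoo| <= A / ln t)%R.
Hypothesis e0 : (0 < e)%R.

Let mpos : measurable (posline : set (measurableTypeR R)).
Proof. exact: measurable_posline. Qed.

Let q_osc t s : (0 < t)%R -> (0 < s)%R -> (`|q t - q s| <= Q)%R.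
Proof.
move=> t0 s0; have /andP[? ?] := qQ t0; have /andP[? ?] := qQ s0.
by rewrite ler_norml; apply/andP; split; lra.
Qed.

Let ln_ratio (u v : R) : (0 < v)%R -> (v <= 2 * u)%R -> (A / u * v <= 2 * A)%R.
Proof.
move=> v0 vu; have u0 : (0 < u)%R by lra.
have -> : (A / u * v = A * (v / u))%R by ring.
by rewrite [leRHS]mulrC ler_wpM2l// ler_pdivrMr.
Qed.

(* Either the oscillation of [q] is negligible on the scale [ln (1 / hdist t)], or [s] is so
   far from [t] that the kernel is as small as a power of [hdist t]. *)
Let dichotomy t s : (0 < t)%R -> (0 < s)%R -> (t / 4 <= s)%R ->
  (`|q t - q s| * - ln (hdist t) <= Q * ln 16 + 3 * A)%R \/
  ((t / s) `^ (e / 2) <= hdist t `^ (e / 4))%R.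
Proof.
move=> t0 s0 ts.
have l16 : (0 <= ln 16 :> R)%R by rewrite ln_ge0//; lra.
have Q0 : (0 <= Q)%R by have /andP[? ?] := qQ t0; lra.
have QA : (0 <= Q * ln 16)%R by rewrite mulr_ge0.
have sq0 : (0 < Num.sqrt t)%R by rewrite sqrtr_gt0.
have sqE : (Num.sqrt t * Num.sqrt t = t)%R by rewrite -expr2 sqr_sqrtr// ltW.
have [tl|tl] := lerP 16^-1 t; last first.
  have hE : hdist t = t.
    rewrite /hdist min_l// -[leLHS]invrK lef_pV2 ?posrE ?invr_gt0//.
    by apply: (@le_trans _ _ 1%R); [lra|rewrite invf_ge1//; lra].
  have lt : (0 < ln t^-1)%R by rewrite ln_gt0// invf_gt1//; lra.
  (* For [s <= sqrt t] the decay at [0] applies at both points, since [ln (1 / s)] is at least half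
     of [ln (1 / t)]; beyond, [t / s <= sqrt t] makes the kernel small. *)
  have [st|st] := lerP s (Num.sqrt t).
    have sq4 : (Num.sqrt t < 4^-1)%R by nra.
    left; rewrite hE -lnV ?posrE//.
    have H1 := q_near0 t0 (_ : t <= 2^-1)%R; have {}H1 := H1 ltac:(lra).
    have H2 := q_near0 s0 (_ : s <= 2^-1)%R; have {}H2 := H2 ltac:(lra).
    have ls : (ln t^-1 <= 2 * ln s^-1)%R.
      rewrite !lnV ?posrE// mulrN lerN2 -ler_pdivlMl//.
      apply: (@le_trans _ _ (ln (Num.sqrt t))); first by rewrite ler_ln ?posrE.
      by rewrite -powR12_sqrt ?(ltW t0)// ln_powR.
    apply: (@le_trans _ _ ((A / ln t^-1 + A / ln s^-1) * ln t^-1)%R).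
      rewrite ler_wpM2r ?(ltW lt)//.
      have -> : (q t - q s = (q t - q0) - (q s - q0))%R by ring.
      by apply: le_trans (ler_normB _ _) _; exact: lerD.
    rewrite mulrDl mulfVK ?gt_eqF//; have := ln_ratio lt ls; lra.
  right; rewrite hE.
  have -> : (e / 4 = 2^-1 * (e / 2))%R by field.
  rewrite (powRrM t) powR12_sqrt ?(ltW t0)//; apply: ge0_ler_powR.
  - by rewrite divr_ge0// ltW.
  - by rewrite nnegrE divr_ge0// ltW.
  - by rewrite nnegrE ltW.
  - by rewrite ler_pdivrMr// -[leLHS]sqE ler_wpM2l ?(ltW sq0)// ltW.
(* On [[1 / 16, 16]] the scale is at most [ln 16]. For [t > 16] one has [s >= t / 4 >= sqrt t], so
   [ln s] is at least half of [ln t] and the decay at infinity applies at both points. *)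
left; have [tu|tu] := lerP t 16.
  apply: (@le_trans _ _ (Q * ln 16)%R); last by rewrite lerDl mulr_ge0.
  have h0 := hdist_gt0 t0.
  apply: (@le_trans _ _ (Q * - ln (hdist t))%R).
    rewrite ler_wpM2r ?q_osc// oppr_ge0 ln_le0//; exact: hdist_le1.
  rewrite ler_wpM2l// -lnV ?posrE// ler_ln ?posrE ?invr_gt0//.
  rewrite invf_ple ?posrE// le_min tl/= lef_pV2 ?posrE//.
have hE : hdist t = (t^-1)%R.
  rewrite /hdist min_r//; have : (t^-1 <= 1)%R by rewrite invf_le1//; lra.
  lra.
have lt : (0 < ln t)%R by rewrite ln_gt0//; lra.
have sq4 : (4 < Num.sqrt t)%R by nra.
have st : (Num.sqrt t <= s)%R by nra.
rewrite hE lnV ?posrE// opprK.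
have H1 := q_nearoo (_ : 2 < t)%R; have {}H1 := H1 ltac:(lra).
have H2 := q_nearoo (_ : 2 < s)%R; have {}H2 := H2 ltac:(lra).
have ls : (ln t <= 2 * ln s)%R.
  rewrite -ler_pdivrMl//.
  apply: (@le_trans _ _ (ln (Num.sqrt t))); last by rewrite ler_ln ?posrE.
  by rewrite -powR12_sqrt ?(ltW t0)// ln_powR.
apply: (@le_trans _ _ ((A / ln t + A / ln s) * ln t)%R).
  rewrite ler_wpM2r ?(ltW lt)//.
  have -> : (q t - q s = (q t - qoo) - (q s - qoo))%R by ring.
  by apply: le_trans (ler_normB _ _) _; exact: lerD.
rewrite mulrDl mulfVK ?gt_eqF//; have := ln_ratio lt ls; lra.
Qed.

(** The first term bounds the positive power of [G] through [G <= 4 ^ e + 1]; the second bounds the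
    negative power through [G >= hdist t] and the first alternative of [dichotomy]. *)
Let K0 : R := ((4 `^ e + 1) `^ Q + expR (Q * ln 16 + 3 * A))%R.

(** In the first alternative this is [exponent_trade] with base [G]. In the second, half of the
    kernel becomes a power of [hdist t], and [v <= 1 + v ^ (q s)] replaces the trade. *)
Let hardy_pointwise (G t s v : R) : (0 < t)%R -> (0 < s)%R -> (0 <= v)%R ->
  (hdist t <= G)%R -> (G <= 4 `^ e + 1)%R ->
  (hkern e t s * v <= G `^ (q t)^-1 * hkern e t s +
    K0 * (G `^ (q t)^-1 / G) * (hkern e t s * v `^ q s) +
    hdist t `^ (e / 4) * hkern (e / 2) t s +
    hdist t `^ (e / 4) * (hkern (e / 2) t s * v `^ q s))%R.
Proof.
move=> t0 s0 v0 hG G4; set L := (G `^ _)%R; set g := (hdist t `^ _)%R.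
have h0 := hdist_gt0 t0; have G0 : (0 < G)%R by exact: lt_le_trans hG.
have L0 : (0 < L)%R by rewrite powR_gt0.
have g0 : (0 < g)%R by rewrite powR_gt0.
have KLG : (0 <= K0 * (L / G))%R.
  by rewrite mulr_ge0 ?addr_ge0 ?powR_ge0 ?expR_ge0// divr_ge0// ltW.
have [ts|ts] := leP (t / 4)%R s; last first.
  by rewrite /hkern [(t / 4 <= s)%R]leNgt ts/= !mulr0 !mul0r !mulr0 !addr0.
have hkp c : (0 < hkern c t s)%R by rewrite /hkern ts mulr1 divr_gt0// powR_gt0// divr_gt0.
have vq : (0 <= v `^ q s)%R by exact: powR_ge0.
have kv c : (0 <= hkern c t s * v `^ q s)%R by rewrite mulr_ge0// ltW.
have p0 : (0 <= L * hkern e t s)%R by rewrite ltW// mulr_gt0.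
have p1 : (0 <= K0 * (L / G) * (hkern e t s * v `^ q s))%R by exact: mulr_ge0.
have p2 : (0 <= g * hkern (e / 2) t s)%R by rewrite ltW// mulr_gt0.
have p3 : (0 <= g * (hkern (e / 2) t s * v `^ q s))%R by rewrite mulr_ge0// ltW.
have [HK|HK] := dichotomy t0 s0 ts.
  have T : (v <= L + K0 * (L / G) * v `^ q s)%R.
    have /andP[qt1 _] := qQ t0; have /andP[qs1 _] := qQ s0; apply: exponent_trade => //.
      apply: (@le_trans _ _ ((4 `^ e + 1) `^ Q)%R); last by rewrite lerDl expR_ge0.
      apply: (@le_trans _ _ ((4 `^ e + 1) `^ `|q t - q s|)%R).
        by apply: ge0_ler_powR => //; rewrite nnegrE ?(ltW G0)// addr_ge0 ?powR_ge0.
      by apply: ler_powR; [rewrite lerDr powR_ge0|exact: q_osc].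
    apply: (@le_trans _ _ (expR (Q * ln 16 + 3 * A))); last by rewrite lerDr powR_ge0.
    apply: (@le_trans _ _ (hdist t `^ (- `|q t - q s|))%R); last first.
      by rewrite /powR gt_eqF// ler_expR mulNr -mulrN.
    rewrite !powRN lef_pV2 ?posrE ?powR_gt0//.
    by apply: ge0_ler_powR; rewrite ?nnegrE ?(ltW h0) ?(ltW G0).
  apply: (@le_trans _ _ (hkern e t s * (L + K0 * (L / G) * v `^ q s))%R).
    by rewrite ler_wpM2l// ltW.
  have -> : (hkern e t s * (L + K0 * (L / G) * v `^ q s) =
    L * hkern e t s + K0 * (L / G) * (hkern e t s * v `^ q s))%R by ring.
  by rewrite -[leLHS]addr0 lerD// -[leLHS]addr0 lerD.
have kk : (hkern e t s <= g * hkern (e / 2) t s)%R.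
  rewrite /hkern ts !mulr1 mulrA ler_wpM2r ?invr_ge0 ?(ltW s0)//.
  have -> : (e = e / 2 + e / 2)%R by field.
  rewrite powRD; last by apply/implyP => _; rewrite gt_eqF// divr_gt0.
  rewrite -[(e / 2 + e / 2)%R in leRHS](_ : e = _)%R; last by field.
  by rewrite ler_wpM2r ?powR_ge0.
have v1 : (v <= 1 + v `^ q s)%R.
  have [vl|vl] := lerP v 1; first by rewrite -[leLHS]addr0 lerD.
  rewrite -[leLHS]add0r lerD//; have /andP[qs1 _] := qQ s0.
  by apply: le1r_powR => //; exact: ltW.
apply: (@le_trans _ _ (g * hkern (e / 2) t s * (1 + v `^ q s))%R).
  by apply: ler_pM => //; exact: ltW.
rewrite mulrDr mulr1 -mulrA; apply: lerD => //.
by rewrite -[leLHS]add0r lerD// addr_ge0.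
Qed.

Let hardy_power (C t u : R) : (0 < t)%R -> (0 <= u)%R -> (1 <= C)%R ->
  ((C * ((u + hdist t) `^ (q t)^-1 + hdist t `^ (e / 4))) `^ q t <=
   C `^ Q * 2 `^ Q * (u + hdist t + hdist t `^ (e / 4)))%R.
Proof.
move=> t0 u0 C1; have h0 := hdist_gt0 t0; have /andP[qt1 qtQ] := qQ t0.
have C0 : (0 <= C)%R by exact: le_trans C1.
have G0 : (0 < u + hdist t)%R by rewrite ltr_wpDl.
have g0 : (0 < hdist t `^ (e / 4))%R by rewrite powR_gt0.
have g1 : (hdist t `^ (e / 4) <= 1)%R.
  rewrite -[leRHS](powRr0 (hdist t)); apply: ger_powR; first by rewrite h0 hdist_le1.
  by rewrite divr_ge0// ltW.
rewrite powRM ?addr_ge0 ?powR_ge0// -mulrA.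
apply: ler_pM; rewrite ?powR_ge0//; first exact: ler_powR.
apply: le_trans (powR_add_le (powR_ge0 _ _) (ltW g0) (qQ t0)) _.
rewrite ler_wpM2l ?powR_ge0//; apply: lerD.
  by rewrite -powRrM mulVf ?powRr1 ?(ltW G0)// gt_eqF// (lt_le_trans ltr01).
by apply: ge1r_powR; rewrite ?g0 ?g1.
Qed.

(** The base is [G = F t + hdist t]: the first summand makes the traded term at most a multiple of
    [G ^ (1 / q t)], the second keeps [G] away from [0]. After raising to the power [q t], what is
    left is [F], integrable for [dt / t] by Tonelli, and two powers of [hdist], integrable as
    well. *)
Let hardy_modular : exists2 C : R, (1 <= C)%R & forall b : R -> \bar R,
  measurable_fun [set: measurableTypeR R] b -> (forall s, 0 <= b s) ->
  \int[mu]_(t in posline) ((t^-1)%:E * b t `^ q t) <= 1 ->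
  \int[mu]_(t in posline) ((t^-1)%:E * hardy e b t `^ q t) <= C%:E.
Proof.
have Q1 : (1 <= Q)%R by have /andP[? ?] := qQ (@ltr01 R); lra.
have p4 : (0 < 4 `^ e :> R)%R by rewrite powR_gt0.
have p42 : (0 < 4 `^ (e / 2) :> R)%R by rewrite powR_gt0.
have K00 : (0 < K0)%R by rewrite ltr_wpDl ?powR_ge0 ?expR_gt0.
pose C1 := (4 `^ e / e + K0 + 4 `^ (e / 2) / (e / 2) + 4 `^ (e / 2) + 1)%R.
have e2 : (0 < e / 2)%R by rewrite divr_gt0.
have f1 : (0 < 4 `^ e / e)%R by rewrite divr_gt0.
have f2 : (0 < 4 `^ (e / 2) / (e / 2))%R by rewrite divr_gt0.
have C11 : (1 <= C1)%R by rewrite /C1; lra.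
pose C2 := (C1 `^ Q * 2 `^ Q)%R.
have ge1_powR (c : R) : (1 <= c)%R -> (1 <= c `^ Q)%R.
  by move=> c1; rewrite -(powRr0 c); apply: ler_powR => //; lra.
have C20 : (1 <= C2)%R by rewrite -[leLHS]mulr1 ler_pM ?ge1_powR//; lra.
pose C3 := (4 `^ e / e + 2 / 1 + 2 / (e / 4))%R.
have e4 : (0 < e / 4)%R by rewrite divr_gt0.
exists (C2 * (1 + C3))%R.
  have : (0 < 2 / (e / 4) :> R)%R by rewrite divr_gt0.
  by move=> ?; rewrite -[leLHS]mulr1 ler_pM//; rewrite /C3; lra.
move=> b mb b0 bI.
pose B s := b s `^ q s.
have B0 s : 0 <= B s by exact: poweR_ge0.
have mB : measurable_fun [set: measurableTypeR R] B by apply: measurable_fun_poweR.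
pose F t := hardy e B t.
have F0 t : 0 <= F t by apply: hardy_ge0.
have mF : measurable_fun [set: measurableTypeR R] F by apply: measurable_hardy.
have minv : measurable_fun [set: measurableTypeR R] (fun t : R => (t^-1)%:E).
  by apply/measurable_EFinP; exact: measurable_invline.
have kerI c t : (0 < c)%R -> (0 < t)%R -> hardy c B t <= (4 `^ c)%:E.
  move=> c0 t0; apply: le_trans (hardy_le mB B0 c0 t0) _.
  by rewrite -[leRHS]mule1 lee_wpmul2l// lee_fin powR_ge0.
have Fle t : (0 < t)%R -> F t <= (4 `^ e)%:E by exact: kerI.
have Ffin t : (0 < t)%R -> F t = (fine (F t))%:E.
  by move=> t0; rewrite fineK// ge0_fin_numE// (le_lt_trans (Fle t t0))// ltry.
have pt t : (0 < t)%R ->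
    hardy e b t `^ q t <= C2%:E * (F t + (hdist t)%:E + (hdist t `^ (e / 4))%:E).
  move=> t0; set h := hdist t.
  have h0 : (0 < h)%R by exact: hdist_gt0.
  have h1 : (h <= 1)%R by exact: hdist_le1.
  have /andP[qt1 qtQ] := qQ t0.
  set f := fine (F t); have fE : F t = f%:E by exact: Ffin.
  have f0 : (0 <= f)%R by rewrite fine_ge0.
  have f4 : (f <= 4 `^ e)%R by rewrite -lee_fin -fE Fle.
  pose G := (f + h)%R; have G0 : (0 < G)%R by rewrite /G; lra.
  pose L := (G `^ (q t)^-1)%R; have L0 : (0 < L)%R by rewrite powR_gt0.
  pose g := (h `^ (e / 4))%R; have g0 : (0 < g)%R by rewrite powR_gt0.
  have g1 : (g <= 1)%R.
    by rewrite /g -[leRHS](powRr0 h); apply: ger_powR; rewrite ?h0 ?h1 ?(ltW e4).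
  have LG : (0 < L / G)%R by rewrite divr_gt0.
  have KLG : (0 < K0 * (L / G))%R by rewrite mulr_gt0.
  have hk c s : (0 < c)%R -> (0 < s)%R -> 0 <= (hkern c t s)%:E * B s.
    by move=> c0 s0; rewrite mule_ge0// lee_fin hkern_ge0.
  have ptw s : (0 < s)%R -> (hkern e t s)%:E * b s <=
      L%:E * (hkern e t s)%:E + (K0 * (L / G))%:E * ((hkern e t s)%:E * B s) +
      g%:E * (hkern (e / 2) t s)%:E + g%:E * ((hkern (e / 2) t s)%:E * B s).
    move=> s0; have /andP[qs1 qsQ] := qQ s0; rewrite /B; move: (b0 s).
    case: (b s) => [v| |]//; last first.
      move=> _; rewrite poweRyr; last by rewrite gt_eqF// (lt_le_trans ltr01).
      have [ts|ts] := leP (t / 4)%R s; last first.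
        by rewrite /hkern [(t / 4 <= s)%R]leNgt ts/= !mulr0 !mul0e !mule0 !adde0.
      have hkp c : (0 < hkern c t s)%R.
        by rewrite /hkern ts mulr1 divr_gt0// powR_gt0// divr_gt0.
      by rewrite !gt0_muley ?lte_fin.
    rewrite lee_fin => v0; rewrite poweR_EFin -!EFinM -!EFinD lee_fin.
    by apply: hardy_pointwise => //; rewrite /G ?lerDr// lerD.
  have mk c : measurable_fun posline (fun s => (hkern c t s)%:E : \bar R).
    apply/measurable_EFinP; apply: measurable_funTS.
    exact: (measurableT_comp (@measurable_hkern R c) (measurable_pair1 t)).
  have mkB c : measurable_fun posline (fun s => (hkern c t s)%:E * B s).
    by apply: emeasurable_funM => //; exact: measurable_funTS.
  have hle : hardy e b t <= (C1 * (L + g))%:E.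
    apply: (@le_trans _ _ (\int[mu]_(s in posline) (
      L%:E * (hkern e t s)%:E + (K0 * (L / G))%:E * ((hkern e t s)%:E * B s) +
      g%:E * (hkern (e / 2) t s)%:E + g%:E * ((hkern (e / 2) t s)%:E * B s)))).
      apply: ge0_integral_mono => s; rewrite poslineP => s0; last exact: ptw.
      by rewrite mule_ge0// lee_fin hkern_ge0.
    have k0 c s : posline s -> 0 <= (hkern c t s)%:E.
      by rewrite poslineP => s0; rewrite lee_fin hkern_ge0.
    have kB0 c s : posline s -> 0 <= (hkern c t s)%:E * B s.
      by move=> ps; apply: mule_ge0; [exact: k0|exact: B0].
    rewrite (ge0_integral_lin4 (ltW L0) (ltW KLG) (ltW g0) (ltW g0) (mk e) (mkB e)
      (mk (e / 2)%R) (mkB (e / 2)%R) (k0 e) (kB0 e) (k0 (e / 2)%R) (kB0 (e / 2)%R)).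
    rewrite !integral_hkern// -/(F t).
    rewrite -[X in _ + _ * X + _ + _]/(F t) fE.
    apply: (@le_trans _ _ (L%:E * (4 `^ e / e)%:E + (K0 * (L / G))%:E * f%:E +
       g%:E * (4 `^ (e / 2) / (e / 2))%:E + g%:E * (4 `^ (e / 2))%:E)).
      by apply: leeD => //; apply: lee_wpmul2l; rewrite ?lee_fin ?(ltW g0)//; exact: kerI.
    rewrite -!EFinM -!EFinD lee_fin.
    have KL : (K0 * (L / G) * f <= K0 * L)%R.
      rewrite -mulrA ler_wpM2l ?(ltW K00)// -mulrA ler_piMr ?(ltW L0)//.
      by rewrite mulrC ler_pdivrMr// /G; lra.
    apply: (@le_trans _ _ (L * (4 `^ e / e) + K0 * L + g * (4 `^ (e / 2) / (e / 2)) + g * 4 `^ (e / 2))%R); first by lra.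
    rewrite /C1; move: (4 `^ e / e)%R (4 `^ (e / 2) / (e / 2))%R (4 `^ (e / 2))%R f1 f2 p42 => x y z x0 y0 z0.
    by nra.
  apply: (@le_trans _ _ (((C1 * (L + g))%:E) `^ q t)).
    by apply: le_poweR => //; [exact: le_trans qt1|exact: hardy_ge0].
  by rewrite fE -!EFinD -EFinM poweR_EFin lee_fin; exact: hardy_power.
have m1 : measurable_fun (posline : set (measurableTypeR R)) (fun t => (t^-1)%:E * F t).
  by apply: measurable_funTS; exact: emeasurable_funM.
have mh c : measurable_fun (posline : set (measurableTypeR R)) (fun t => (t^-1)%:E * (hdist t `^ c)%:E).
  apply: measurable_funTS; apply: emeasurable_funM; first exact: minv.
  apply/measurable_EFinP.
  by apply: (measurableT_comp (measurable_powR _)); exact: measurable_hdist.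
have z1 t : posline t -> 0 <= (t^-1)%:E * F t.
  by rewrite poslineP => t0; rewrite mule_ge0// lee_fin invr_ge0 ltW.
have zh c t : posline t -> 0 <= (t^-1)%:E * (hdist t `^ c)%:E.
  by rewrite poslineP => t0; rewrite mule_ge0 ?lee_fin ?powR_ge0// invr_ge0 ltW.
apply: (@le_trans _ _ (\int[mu]_(t in posline) (C2%:E *
    ((t^-1)%:E * F t + (t^-1)%:E * (hdist t `^ 1)%:E + (t^-1)%:E * (hdist t `^ (e / 4))%:E)))).
  apply: ge0_integral_mono => t; rewrite poslineP => t0.
    by rewrite mule_ge0 ?poweR_ge0// lee_fin invr_ge0 ltW.
  apply: (@le_trans _ _ ((t^-1)%:E * (C2%:E * (F t + (hdist t)%:E + (hdist t `^ (e / 4))%:E)))).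
    by apply: lee_wpmul2l (pt t t0); rewrite lee_fin invr_ge0 ltW.
  rewrite (Ffin t t0) powRr1 ?(ltW (hdist_gt0 t0))//.
  move: (fine (F t)) (hdist t) (hdist t `^ (e / 4))%R => x y z.
  rewrite -[leLHS]/((t^-1 * (C2 * (x + y + z)))%:E).
  rewrite -[leRHS]/((C2 * (t^-1 * x + t^-1 * y + t^-1 * z))%:E) lee_fin.
  by rewrite le_eqVlt; apply/orP; left; apply/eqP; ring.
rewrite ge0_integralZl_EFin; first last.
- by lra.
- by do 2?apply: emeasurable_funD.
- by move=> t ps; rewrite !adde_ge0 ?z1 ?zh.
- exact: mpos.
rewrite [leRHS]EFinM; apply: lee_wpmul2l; first by rewrite lee_fin; lra.
rewrite ge0_integralD//=; first last.
- by move=> t; exact: zh.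
- exact: emeasurable_funD.
- by move=> t ps; rewrite !adde_ge0 ?z1 ?zh.
rewrite ge0_integralD//=; last by move=> t; exact: zh.
apply: (@le_trans _ _ ((4 `^ e / e)%:E + (2 / 1)%:E + (2 / (e / 4))%:E)); last first.
  by rewrite -!EFinD lee_fin /C3; lra.
apply: leeD; last exact: integral_hdist.
apply: leeD; last exact: integral_hdist.
rewrite /F integral_hardy//.
by rewrite -[leRHS]mule1 lee_wpmul2l// lee_fin ltW.
Qed.

Lemma hardyZ c (b : R -> \bar R) t : (0 <= c)%R -> measurable_fun [set: measurableTypeR R] b ->
  (forall s, 0 <= b s) -> hardy e (fun s => c%:E * b s) t = c%:E * hardy e b t.
Proof.
move=> c0 mb b0; have p1 s : posline s -> 0 <= (hkern e t s)%:E * b s.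
  by rewrite poslineP => s0; rewrite mule_ge0// lee_fin hkern_ge0.
have p2 : measurable_fun (posline : set (measurableTypeR R)) (fun s => (hkern e t s)%:E * b s).
  apply: measurable_funTS; apply: emeasurable_funM; last exact: mb.
  apply/measurable_EFinP.
  exact: (measurableT_comp (@measurable_hkern R e) (measurable_pair1 t)).
apply: etrans (ge0_integralZl_EFin mu mpos p1 p2 c0).
by apply: eq_integral => s _; rewrite muleCA.
Qed.

Lemma luxnorm_hardy : exists2 C : R, (0 < C)%R & forall b : R -> \bar R,
  measurable_fun [set: measurableTypeR R] b -> (forall s, 0 <= b s) ->
  luxnorm haar_measure posline q (hardy e b) <= C%:E * luxnorm haar_measure posline q b.
Proof.
have [C C1 HC] := hardy_modular; exists C; first by lra.
move=> b mb b0; have C0 : (0 < C)%R by lra.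
have q0' t : posline t -> (0 <= q t)%R.
  by rewrite poslineP => t0; have /andP[? ?] := qQ t0; lra.
have q1' t : posline t -> (1 <= q t)%R.
  by rewrite poslineP => t0; have /andP[? ?] := qQ t0; lra.
have h0 t : 0 <= hardy e b t by exact: hardy_ge0.
apply: le_mule_of_gt => //; first exact: luxnorm_ge0.
move=> l l0 bl; rewrite mulrC; apply: luxnorm_le_modular => //.
- exact: measurable_funTS.
- by apply: measurable_funTS; exact: measurable_hardy.
have li : (0 <= l^-1)%R by rewrite invr_ge0 ltW.
have := luxnorm_gt_modular q0' bl.
have mod (c : R -> \bar R) : measurable_fun [set: measurableTypeR R] c ->
    \int[haar_measure]_(t in posline) (`|(l^-1)%:E * c t| `^ q t) =
    \int[mu]_(t in posline) ((t^-1)%:E * `|(l^-1)%:E * c t| `^ q t).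
  move=> mc; apply: ge0_integral_haar; last by move=> t t0; exact: poweR_ge0.
  apply: measurable_fun_poweR => //; last exact: measurable_funTS.
  by apply: measurable_funTS; apply: measurableT_comp => //; exact: emeasurable_funM.
rewrite (mod _ mb) (mod _ (measurable_hardy e mb _))//.
move=> H; have mlb : measurable_fun [set: measurableTypeR R] (fun t => (l^-1)%:E * b t).
  exact: emeasurable_funM.
have lb0 t : 0 <= (l^-1)%:E * b t by rewrite mule_ge0// lee_fin.
apply: le_trans (HC _ mlb lb0 _).
  apply: ge0_integral_mono => t; rewrite poslineP => t0.
    by rewrite mule_ge0 ?poweR_ge0// lee_fin invr_ge0 ltW.
  by rewrite hardyZ// gee0_abs// mule_ge0 ?lee_fin.
apply: le_trans H; apply: ge0_integral_mono => t; rewrite poslineP => t0.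
  by rewrite mule_ge0 ?poweR_ge0// lee_fin invr_ge0 ltW.
by rewrite gee0_abs.
Qed.

End hardy_bound.

(** * Representatives and interpolation of the exponents in time *)

Section log_decay.
Context {R : realType}.
Implicit Types q : R -> R.

(* A real-valued representative of an exponent in [P0oo] with bounds valid everywhere. *)
Definition log_decay (Q : R) q : Prop :=
  [/\ measurable_fun [set: measurableTypeR R] q, forall t, 1 <= q t <= Q &
    exists q0 qoo A : R, [/\ 0 <= A, 1 <= q0 <= Q /\ 1 <= qoo <= Q,
      forall t, 0 < t -> t <= 2^-1 -> `|q t - q0| <= A / ln (t^-1) &
      forall t, 2 < t -> `|q t - qoo| <= A / ln t]].

Lemma ge1_clamp (Q u : R) : 1 <= Q -> 1 <= Num.max 1 (Num.min u Q) <= Q.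
Proof. by move=> Q1; rewrite le_max lexx/= ge_max Q1 ge_min lexx orbT. Qed.

Lemma clamp_dist (Q u v : R) :
  `|Num.max 1 (Num.min u Q) - Num.max 1 (Num.min v Q)| <= `|u - v|.
Proof.
rewrite /Num.max /Num.min.
have := ler_norm (u - v); have := ler_norm (v - u); rewrite distrC => h1 h2.
by rewrite ler_norml; apply/andP; split; repeat case: ifP; rewrite -?leNgt; lra.
Qed.

(** Clamping to [[1, Q]], with [Q] above the essential supremum, is a contraction and alters [q] on
    a null set only; the limits are clamped along with it. *)
Lemma P0oo_log_decay q : P0oo q -> exists Q q', [/\ 1 <= Q, log_decay Q q' &
  {ae haar_measure, forall t, posline t -> q t = q' t}].
Proof.
move=> [mq q_gt0 q1 qfin [q0 [qoo [A [_ _ Hn Hf]]]]].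
have [Q Q1 HQ] : exists2 Q : R, 1 <= Q & (ess_sup haar_measure (EFin \o q) <= Q%:E)%E.
  case: (ess_sup haar_measure (EFin \o q)) qfin => [v _| |_]//.
    exists (Num.max 1 v); first by rewrite le_max lexx.
    by rewrite lee_fin le_max lexx orbT.
  by exists 1; rewrite ?leNye.
have mpos : measurable (posline : set (measurableTypeR R)) by exact: measurable_posline.
exists Q, (fun t => Num.max 1 (Num.min ((q \_ posline) t) Q)); split => //.
  split.
  - apply: measurable_maxr => //; apply: measurable_minr => //.
    by apply/(measurable_restrictT _ mpos).
  - by move=> t; exact: ge1_clamp.
  (* The constant in [P0oo] carries no sign, hence its absolute value. *)
  exists (Num.max 1 (Num.min q0 Q)), (Num.max 1 (Num.min qoo Q)), `|A|; split => //.
  - by split; exact: ge1_clamp.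
  - move=> t t0 t2; apply: le_trans (clamp_dist _ _ _) _.
    rewrite patchE mem_set; last by rewrite poslineP.
    apply: le_trans (Hn t t0 t2) _; apply: ler_wpM2r (ler_norm A).
    by rewrite invr_ge0 ln_ge0// invf_ge1//; lra.
  - move=> t t2; apply: le_trans (clamp_dist _ _ _) _.
    rewrite patchE mem_set; last by rewrite poslineP; lra.
    apply: le_trans (Hf t t2) _; apply: ler_wpM2r (ler_norm A).
    by rewrite invr_ge0 ln_ge0//; lra.
have a1 : \forall t \ae haar_measure, (1 <= (EFin \o q) t)%E by exact/ess_infP.
have a2 : \forall t \ae haar_measure, ((EFin \o q) t <= Q%:E)%E by exact/ess_supP.
apply: filterS2 a1 a2 => t /=; rewrite !lee_fin => t1 t2 pt.
by rewrite patchE mem_set// min_l// max_r.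
Qed.

Lemma log_decay_widen Q Q' q : Q <= Q' -> log_decay Q q -> log_decay Q' q.
Proof.
move=> QQ [mq q1 [q0 [qoo [A [A0 [/andP[a b] /andP[c d]] Hn Hf]]]]]; split => //.
  by move=> t; have /andP[-> /le_trans ->] := q1 t.
exists q0, qoo, A; split => //; split; first by rewrite a (le_trans b).
by rewrite c (le_trans d).
Qed.

Definition interp (th u v : R) : R := ((1 - th) / u + th / v)^-1.

Lemma interp_bounds (th Q u v : R) : 0 < th < 1 -> 1 <= u <= Q -> 1 <= v <= Q ->
  1 <= interp th u v <= Q.
Proof.
move=> /andP[th0 th1] /andP[u1 uQ] /andP[v1 vQ].
have u0 : 0 < u by lra. have v0 : 0 < v by lra. have Q0 : 0 < Q by lra.
have iu : u^-1 <= 1 by rewrite invf_le1.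
have iv : v^-1 <= 1 by rewrite invf_le1.
have iu' : Q^-1 <= u^-1 by rewrite lef_pV2.
have iv' : Q^-1 <= v^-1 by rewrite lef_pV2.
have Qi : 0 < Q^-1 by rewrite invr_gt0.
have s1 : (1 - th) / u + th / v <= 1 by nra.
have s2 : Q^-1 <= (1 - th) / u + th / v by nra.
have s0 : 0 < (1 - th) / u + th / v by lra.
by rewrite /interp invf_ge1// s1 invf_ple ?posrE.
Qed.

Lemma interp_ge1 (th u v : R) : 0 < th < 1 -> 1 <= u -> 1 <= v -> 1 <= interp th u v.
Proof.
move=> th01 u1 v1; pose m := Num.max u v.
have um : 1 <= u <= m by rewrite u1 le_max lexx.
have vm : 1 <= v <= m by rewrite v1 le_max lexx orbT.
by have /andP[] := interp_bounds th01 um vm.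
Qed.

Lemma invr_dist (Q u v : R) : 1 <= u -> 1 <= v -> `|u^-1 - v^-1| <= `|u - v|.
Proof.
move=> u1 v1; have u0 : 0 < u by lra. have v0 : 0 < v by lra.
have -> : u^-1 - v^-1 = (v - u) / (u * v) by field; rewrite !gt_eqF.
rewrite normrM normfV distrC ler_piMr// ger0_norm; last by rewrite mulr_ge0 ?ltW.
by rewrite invf_le1 ?mulr_gt0//; nra.
Qed.

(** The reciprocal of the interpolated exponent is a convex combination of reciprocals, each a
    contraction on [[1, +oo[]; going back through [a - b = - a b (1 / a - 1 / b)] costs [Q ^ 2]. The
    decay conditions thus pass to the interpolated exponent. *)
Lemma interp_dist (th Q u v u' v' : R) : 0 < th < 1 -> 1 <= u <= Q -> 1 <= v <= Q ->
  1 <= u' <= Q -> 1 <= v' <= Q ->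
  `|interp th u v - interp th u' v'| <= Q ^+ 2 * (`|u - u'| + `|v - v'|).
Proof.
move=> th01 uQ vQ uQ' vQ'.
have /andP[a1 aQ] := interp_bounds th01 uQ vQ.
have /andP[b1 bQ] := interp_bounds th01 uQ' vQ'.
set a := interp th u v in a1 aQ *; set b := interp th u' v' in b1 bQ *.
have a0 : 0 < a by lra. have b0 : 0 < b by lra.
have -> : a - b = - (a * b) * (a^-1 - b^-1) by field; rewrite !gt_eqF.
have ab0 : 0 <= a * b by rewrite mulr_ge0// ltW.
rewrite normrM normrN (ger0_norm ab0).
apply: ler_pM; rewrite ?mulr_ge0 ?(ltW a0) ?(ltW b0)//.
  by rewrite expr2; apply: ler_pM => //; exact: ltW.
rewrite /a /b /interp !invrK.
have -> : (1 - th) / u + th / v - ((1 - th) / u' + th / v') =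
  (1 - th) * (u^-1 - u'^-1) + th * (v^-1 - v'^-1) by ring.
case/andP : th01 uQ vQ uQ' vQ' => th0 th1 /andP[? ?] /andP[? ?] /andP[? ?] /andP[? ?].
have d1 : `|u^-1 - u'^-1| <= `|u - u'| by exact: (invr_dist Q).
have d2 : `|v^-1 - v'^-1| <= `|v - v'| by exact: (invr_dist Q).
apply: le_trans (ler_normD _ _) _; apply: lerD; rewrite normrM ger0_norm; try lra.
  by apply: le_trans d1; rewrite ler_piMl//; lra.
by apply: le_trans d2; rewrite ler_piMl//; lra.
Qed.

Lemma log_decay_interp th Q q q' : 0 < th < 1 -> 1 <= Q -> log_decay Q q -> log_decay Q q' ->
  log_decay Q (fun t => interp th (q t) (q' t)).
Proof.
move=> th01 Q1 [mq qQ [q0 [qoo [A [A0 [b0 boo] Hn Hf]]]]].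
move=> [mq' qQ' [q0' [qoo' [A' [A0' [b0' boo'] Hn' Hf']]]]]; split.
- apply: measurable_invr; apply: measurable_funD; apply: measurable_funM => //;
    exact: measurable_invr.
- by move=> t; exact: interp_bounds.
have Q2 : 0 <= Q ^+ 2 by rewrite exprn_ge0//; lra.
exists (interp th q0 q0'), (interp th qoo qoo'), (Q ^+ 2 * (A + A')); split.
- by rewrite mulr_ge0// addr_ge0.
- by split; exact: interp_bounds.
- move=> t t0 t2; apply: le_trans (interp_dist th01 (qQ t) (qQ' t) b0 b0') _.
  by rewrite -[leRHS]mulrA ler_wpM2l// mulrDl lerD ?Hn ?Hn'.
- move=> t t2; apply: le_trans (interp_dist th01 (qQ t) (qQ' t) boo boo') _.
  by rewrite -[leRHS]mulrA ler_wpM2l// mulrDl lerD ?Hf ?Hf'.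
Qed.

End log_decay.

(** * Norms of the Poisson-Hermite derivatives *)

Lemma eq_luxnorm dT (T : measurableType dT) (R : realType)
    (nu : {measure set T -> \bar R}) (D : set T) (p : T -> R) (f g : T -> \bar R) :
  (forall x, D x -> f x = g x) -> luxnorm nu D p f = luxnorm nu D p g.
Proof.
move=> fg; rewrite /luxnorm; congr ereal_inf; congr image.
have E l : (\int[nu]_(x in D) (`|(l^-1)%:E * f x| `^ p x) =
    \int[nu]_(x in D) (`|(l^-1)%:E * g x| `^ p x))%E.
  by apply: eq_integral => x; rewrite inE => Dx; rewrite fg.
by apply/seteqP; split => l /=; rewrite E.
Qed.

Section poisson_derivative_norms.
Context {R : realType} {d : nat}.
Local Notation E := (d.-tuple R).
Local Notation gam := (gauss_measure d).
Local Notation mu := (@lebesgue_measure R).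
Implicit Types (x y : E) (t s : R) (k : nat).
Local Notation integrable h := (gam.-integrable setT (EFin \o h)).
Variable f : E -> R.
Hypothesis intf : integrable f.

Let mpos : measurable (posline : set (measurableTypeR R)).
Proof. exact: measurable_posline. Qed.

(* Extended by [0] to [t <= 0], so as to be jointly measurable. *)
Definition pdp k (z : measurableTypeR R * E) : R :=
  (0 < z.1)%R%:R * dpoisson_hermite k z.1 f z.2.

Lemma pdpE k t x : 0 < t -> pdp k (t, x) = dpoisson_hermite k t f x.
Proof. by move=> t0; rewrite /pdp/= t0 mul1r. Qed.

Lemma measurable_pdp k : measurable_fun setT (pdp k).
Proof.
have [V mV VE] := measurable_dpoisson intf k.
rewrite (_ : pdp k = fun z => (1 - (z.1 <= 0)%R%:R) * V z).
  apply: measurable_funM => //; apply: measurable_funB => //.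
  by apply: measurable_fun_leind => //; exact: measurable_fst.
apply/funext => -[t x]; rewrite /pdp/=; have [t0|t0] := ltrP 0 t; last by rewrite subrr !mul0r.
by rewrite subr0 !mul1r VE.
Qed.

Lemma measurable_pdp_abs k : measurable_fun setT (fun z => `|pdp k z|%:E).
Proof. by apply/measurable_EFinP; apply: measurableT_comp => //; exact: measurable_pdp. Qed.

Lemma measurable_pdp_snd k t : measurable_fun setT (fun x => pdp k (t, x)).
Proof. exact: (measurableT_comp (@measurable_pdp k) (measurable_pair1 (t : measurableTypeR R))). Qed.

Lemma continuous_dpoisson k t x : 0 < t ->
  {for t, continuous (fun u : R => dpoisson_hermite k u f x)}.
Proof.
move=> t0; have [+ _] := is_derive_dpoisson intf k x t0.
by move=> /derivable1_diffP /differentiable_continuous.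
Qed.

(** The fundamental theorem of calculus on [[t, b]], with the boundary term at [b] made as small as
    desired by [dpoisson_decay]. *)
Lemma dpoisson_tail k t x : 0 < t ->
  (`|pdp k.+1 (t, x)|%:E <= \int[mu]_(s in `[t, +oo[) `|pdp k.+2 (s, x)|%:E)%E.
Proof.
move=> t0; rewrite pdpE//; have [C C0 HC] := dpoisson_decay intf k x.
set I := (\int[mu]_(s in `[t, +oo[) `|pdp k.+2 (s, x)|%:E)%E.
have mk : measurable_fun [set: measurableTypeR R] (fun s => `|pdp k.+2 (s, x)|%:E).
  exact: (measurableT_comp (@measurable_pdp_abs k.+2) (measurable_pair2 x)).
apply/lee_addgt0Pr => e e0.
(* The three entries ensure that the interval is nondegenerate, that the decay bound applies at [b],
   and that it gives at most [e]. *)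
pose b := Num.max (t + 1) (Num.max 2 (C / e)).
have tb : t < b by rewrite !lt_max ltrDl ltr01.
have b2 : 2 <= b by rewrite !le_max lexx orbT.
have bC : C / e <= b by rewrite !le_max lexx !orbT.
have b0 : 0 < b by lra.
have be : C / b <= e by rewrite ler_pdivrMr// mulrC -ler_pdivrMr.
have F : (\int[mu]_(s in `[t, b]) (dpoisson_hermite k.+2 s f x)%:E =
    (dpoisson_hermite k.+1 b f x)%:E - (dpoisson_hermite k.+1 t f x)%:E)%E.
  have pos s : t <= s -> 0 < s by exact: lt_le_trans.
  apply: continuous_FTC2 => //.
  - apply: continuous_in_subspaceT => s; rewrite inE /= in_itv/= => /andP[ts _].
    by apply: (@continuous_dpoisson k.+2 s x); exact: pos.
  - split.
    + move=> s; rewrite in_itv/= => /andP[/ltW/pos s0 _].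
      by have [] := is_derive_dpoisson intf k.+1 x s0.
    + by apply: cvg_at_right_filter; exact: (@continuous_dpoisson k.+1 t x).
    + by apply: cvg_at_left_filter; exact: (@continuous_dpoisson k.+1 b x).
have -> : dpoisson_hermite k.+1 t f x = dpoisson_hermite k.+1 b f x -
   (dpoisson_hermite k.+1 b f x - dpoisson_hermite k.+1 t f x) by ring.
apply: (@le_trans _ _ (`|dpoisson_hermite k.+1 b f x - dpoisson_hermite k.+1 t f x|%:E +
    `|dpoisson_hermite k.+1 b f x|%:E)%E).
  by rewrite -EFinD lee_fin [leRHS]addrC ler_normB.
apply: leeD; last by rewrite lee_fin (le_trans (HC b b2)).
rewrite -abse_EFin EFinB -F.
have mb : measurable_fun (`[t, b] : set (measurableTypeR R))
    (fun s => (dpoisson_hermite k.+2 s f x)%:E).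
  apply: (@eq_measurable_fun _ _ _ _ _ (fun s => (pdp k.+2 (s, x))%:E)).
    move=> s; rewrite inE /= in_itv/= => /andP[ts _]; rewrite pdpE//; exact: lt_le_trans ts.
  apply: measurable_funTS; apply/measurable_EFinP.
  exact: (measurableT_comp (@measurable_pdp k.+2) (measurable_pair2 x)).
apply: le_trans (le_abse_integral mu _ mb) _ => //.
apply: (@le_trans _ _ (\int[mu]_(s in `[t, b]) `|pdp k.+2 (s, x)|%:E)%E).
  apply: ge0_integral_mono => s; rewrite /= in_itv/= => /andP[ts _]; first by [].
  by rewrite pdpE//; exact: lt_le_trans ts.
apply: ge0_subset_integral => //.
- exact: measurable_funTS.
- by move=> s; rewrite /= !in_itv/= => /andP[->].
Qed.

Definition pdnorm (p : E -> R) k t : \bar R :=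
  luxnorm gam setT p (fun x => (pdp k (t, x))%:E).

Lemma pdnorm_ge0 (p : E -> R) k t : (0 <= pdnorm p k t)%E.
Proof. exact: luxnorm_ge0. Qed.

Lemma measurable_pdnorm (p : E -> R) k : measurable_fun setT p -> (forall x, 1 <= p x) ->
  measurable_fun [set: measurableTypeR R] (pdnorm p k).
Proof.
move=> mp p1; apply: (@measurable_luxnorm _ _ (measurableTypeR R)).
  by move=> x _; apply: le_trans (p1 x).
move=> l l0; apply: (@measurable_integral_on _ _ (measurableTypeR R) E R gam setT setT
  (fun z => (`|(l^-1)%:E * (pdp k z)%:E| `^ p z.2)%E)) => //.
apply: measurable_funTS; apply: measurable_fun_poweR => //.
- apply: measurableT_comp => //; apply: emeasurable_funM => //.
  by apply/measurable_EFinP; exact: measurable_pdp.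
- exact: (measurableT_comp mp).
by move=> t x _ _; exact: poweR_ge0.
Qed.

Lemma pdnorm_tail (p : E -> R) k t : measurable_fun setT p -> (forall x, 1 <= p x) -> 0 < t ->
  (pdnorm p k.+1 t <= \int[mu]_(s in `[t, +oo[) pdnorm p k.+2 s)%E.
Proof.
move=> mp p1 t0.
have := @luxnorm_minkowski _ E R gam p mp p1 t (fun z => `|pdp k.+2 z|%:E) t0
  (@measurable_pdp_abs k.+2) (fun z => abse_ge0 (pdp k.+2 z)%:E).
move=> H; apply: le_trans (_ : _ <= luxnorm gam setT p
   (fun x => \int[mu]_(s in `[t, +oo[) `|pdp k.+2 (s, x)|%:E))%E _.
  apply: luxnorm_mono => [x _|x _]; first exact: le_trans (p1 x).
  apply: le_trans (dpoisson_tail k x t0) _.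
  by rewrite gee0_abs// integral_ge0.
apply: le_trans H _; apply: ge0_integral_mono => s _; first exact: luxnorm_ge0.
apply: luxnorm_mono => [x _|x _]; first exact: le_trans (p1 x).
by rewrite -abse_EFin abse_id.
Qed.

Lemma dpoisson_step : exists2 C : R, 0 < C & forall k s t x, 0 < s -> s <= t / 2 ->
  (`|pdp k.+1 (t, x)|%:E <= (C / t)%:E * oumax (fun y => `|pdp k (s, y)|%:E) x)%E.
Proof.
have [C C0 HC] := dpoisson_le intf; exists (C * 12); first by rewrite mulr_gt0.
move=> k s t x s0 st; have t0 : 0 < t by lra.
rewrite pdpE//; apply: le_trans (HC k s t x s0 st) _.
have -> : (fun y => `|dpoisson_hermite k s f y|%:E) = (fun y => `|pdp k (s, y)|%:E).
  by apply/funext => y; rewrite pdpE.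
have t2 : 0 < t / 2 by lra.
have -> : C * 12 / t = C * (6 / (t / 2)) by field; rewrite gt_eqF.
rewrite EFinM -muleA lee_wpmul2l ?lee_fin ?(ltW C0)//; apply: wou_tailw_le => //.
exact: (measurableT_comp (@measurable_pdp_abs k) (measurable_pair1 (s : measurableTypeR R))).
Qed.

Lemma pdnorm_step p : Pgamma p -> LH0 p -> (1 < ess_inf gam (EFin \o p))%E ->
  exists2 C : R, 0 < C & forall k s t, 0 < s -> s <= t / 2 ->
  (pdnorm p k.+1 t <= (C / t)%:E * pdnorm p k s)%E.
Proof.
move=> Pp Lp p1; have [C C0 HC] := luxnorm_oumax Pp Lp p1.
have [K K0 HK] := dpoisson_step; have [mp pge1 _] := Pp.
have pge0 x : setT x -> 0 <= p x by move=> _; apply: le_trans (pge1 x).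
exists (K * C); first by rewrite mulr_gt0.
move=> k s t s0 st; have t0 : 0 < t by lra.
have Kt : 0 < K / t by rewrite divr_gt0.
have ms : measurable_fun setT (fun y => `|pdp k (s, y)|%:E).
  exact: (measurableT_comp (@measurable_pdp_abs k) (measurable_pair1 (s : measurableTypeR R))).
apply: (@le_trans _ _ (luxnorm gam setT p (fun x =>
    ((K / t)%:E * oumax (fun y => `|pdp k (s, y)|%:E) x)%E))).
  apply: luxnorm_mono => // x _.
  rewrite [leRHS]gee0_abs; first exact: HK.
  by apply: le_trans (HK k s t x s0 st); rewrite lee_fin.
apply: le_trans; first exact: (luxnormZ_le _ _ _ _ Kt).
have -> : K * C / t = K / t * C by ring.
rewrite (EFinM (K / t)) -[leRHS]muleA lee_wpmul2l ?lee_fin ?(ltW Kt)//.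
apply: le_trans (HC _ ms _) _; first by move=> y; rewrite lee_fin.
apply: lee_wpmul2l; first by rewrite lee_fin ltW.
apply: luxnorm_mono => [|x _]; first exact: pge0.
by rewrite -abse_EFin abse_id.
Qed.

End poisson_derivative_norms.

(** * Besov-Lipschitz spaces *)

Section hardy_finite.
Context {R : realType}.
Local Notation mu := (@lebesgue_measure R).
Local Open Scope ereal_scope.
Variables (Q : R) (q : R -> R).
Hypothesis qd : log_decay Q q.
Let mpos : measurable (posline : set (measurableTypeR R)).
Proof. exact: measurable_posline. Qed.

Lemma luxnorm_haar_mono (b c : R -> \bar R) :
  (forall t, (0 < t)%R -> 0 <= b t) -> (forall t, (0 < t)%R -> b t <= c t) ->
  luxnorm haar_measure posline q b <= luxnorm haar_measure posline q c.
Proof.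
move=> b0 bc; apply: luxnorm_mono => t; rewrite poslineP => t0.
  by have [_ q1 _] := qd; have /andP[? _] := q1 t; lra.
by rewrite !gee0_abs ?bc ?b0// (le_trans (b0 t t0))// bc.
Qed.

Lemma luxnorm_le_hardy_fin (e C : R) (b c : R -> \bar R) : (0 < e)%R -> (0 < C)%R ->
  measurable_fun [set: measurableTypeR R] b -> (forall t, 0 <= b t) ->
  (forall t, (0 < t)%R -> 0 <= c t <= C%:E * hardy e b t) ->
  luxnorm haar_measure posline q b < +oo -> luxnorm haar_measure posline q c < +oo.
Proof.
move=> e0 C0 mb b0 cb bfin.
have [mq q1 [q0 [qoo [A [A0 _ Hn Hf]]]]] := qd.
have [K K0 HK] := luxnorm_hardy mq (fun t _ => q1 t) A0 Hn Hf e0.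
apply: le_lt_trans (_ : luxnorm haar_measure posline q (fun t => C%:E * hardy e b t) < +oo).
  by apply: luxnorm_haar_mono => t t0; have /andP[] := cb t t0.
apply: le_lt_trans; first exact: luxnormZ_le.
apply: muley_fin => //; apply: le_lt_trans; first exact: HK.
exact: muley_fin.
Qed.

(** Provides a strictly positive function of finite norm, which is later added to the levels so that
    strict bounds are available for [luxnorm_holder]. *)
Lemma luxnorm_hdist : luxnorm haar_measure posline q (fun t => (hdist t)%:E) < +oo.
Proof.
have [mq q1 _] := qd.
have mh : measurable_fun [set: measurableTypeR R] (fun t : R => (hdist t)%:E).
  by apply/measurable_EFinP; exact: measurable_hdist.
apply: (@le_lt_trans _ _ (1 * 2)%:E); last exact: ltry.
apply: luxnorm_le_modular => //.
- by move=> t _; have /andP[] := q1 t.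
- exact: measurable_funTS.
- exact: measurable_funTS.
- by lra.
rewrite ge0_integral_haar; first last.
- by move=> t _; exact: poweR_ge0.
- apply: measurable_fun_poweR => //; last exact: measurable_funTS.
  by apply: measurable_funTS; apply: measurableT_comp => //; exact: emeasurable_funM.
have := @integral_hdist R 1 ltr01; rewrite divr1; apply: le_trans.
apply: ge0_integral_mono => t; rewrite poslineP => t0.
  by rewrite mule_ge0 ?poweR_ge0// lee_fin invr_ge0 ltW.
rewrite invr1 mul1e; apply: lee_wpmul2l; first by rewrite lee_fin invr_ge0 ltW.
rewrite abse_EFin poweR_EFin lee_fin.
have h0 := hdist_gt0 t0; rewrite ger0_norm ?(ltW h0)//.
by apply: ger_powR; [rewrite h0 hdist_le1|have /andP[] := q1 t].
Qed.

End hardy_finite.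

(** * Changing the order in the Besov norm *)

Section besov_levels.
Context {R : realType} {d : nat}.
Local Notation E := (d.-tuple R).
Local Notation gam := (gauss_measure d).
Local Notation mu := (@lebesgue_measure R).
Variable f : E -> R.
Hypothesis intf : gam.-integrable setT (EFin \o f).
Variables (al Q : R) (p : E -> R) (q : R -> R).
Hypothesis qd : log_decay Q q.
Hypotheses (mp : measurable_fun setT p) (p1 : forall x, 1 <= p x).

Let mpos : measurable (posline : set (measurableTypeR R)).
Proof. exact: measurable_posline. Qed.

Definition blevel a (p' : E -> R) k (t : R) : \bar R :=
  ((t `^ (k%:R - a))%:E * pdnorm f p' k t)%E.

Lemma blevel_ge0 a p' k t : (0 <= blevel a p' k t)%E.
Proof. by rewrite mule_ge0 ?pdnorm_ge0// lee_fin powR_ge0. Qed.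

Lemma measurable_blevel a k : measurable_fun [set: measurableTypeR R] (blevel a p k).
Proof.
apply: emeasurable_funM; last exact: measurable_pdnorm.
by apply/measurable_EFinP; exact: measurable_powR.
Qed.

(** The one-step bound holds for every [s] in [[t / 4, t / 2]]. Averaging it over this interval, of
    length [t / 4], yields a Hardy operator with exponent [1], bounded for the variable [q]. *)
Lemma blevel_up k : LH0 p -> Pgamma p -> (1 < ess_inf gam (EFin \o p))%E ->
  (luxnorm haar_measure posline q (blevel al p k) < +oo)%E ->
  (luxnorm haar_measure posline q (blevel al p k.+1) < +oo)%E.
Proof.
move=> Lp Pp pinf; have [C C0 HC] := pdnorm_step intf Pp Lp pinf.
(* On the averaging interval [t / s] lies in [[2, 4]], whence the price of exchanging powers of [t]
   and [s]. *)
pose K := C * 4 `^ `|k%:R - al|.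
have K0 : 0 < K by rewrite mulr_gt0// powR_gt0.
apply: (@luxnorm_le_hardy_fin _ _ _ qd 1 K) => //.
- exact: measurable_blevel.
- by move=> t; exact: blevel_ge0.
move=> t t0; rewrite blevel_ge0/=.
pose I := `[t / 4, t / 2]%classic : set (measurableTypeR R).
have mI : measurable I by exact: measurable_itv.
have step s : t / 4 <= s -> s <= t / 2 -> ((4 / t)%:E * blevel al p k.+1 t <=
    K%:E * ((hkern 1 t s)%:E * blevel al p k s))%E.
  move=> ts st; have s0 : 0 < s by apply: lt_le_trans ts; rewrite divr_gt0.
  apply: (@le_trans _ _ ((4 / t)%:E * ((t `^ (k.+1%:R - al))%:E * ((C / t)%:E * pdnorm f p k s)))%E).
    rewrite lee_wpmul2l ?lee_fin ?divr_ge0 ?(ltW t0)// /blevel.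
    by rewrite lee_wpmul2l ?lee_fin ?powR_ge0// HC.
  rewrite /blevel !muleA -!EFinM lee_wpmul2r ?pdnorm_ge0// lee_fin.
  rewrite /hkern ts mulr1 powRr1; last by rewrite divr_ge0 ?(ltW t0) ?(ltW s0).
  have tk : t `^ (k.+1%:R - al) = t * t `^ (k%:R - al).
    rewrite -[in X in X * _](powRr1 (ltW t0)) -powRD; last by apply/implyP => _; rewrite gt_eqF.
    by congr powR; rewrite -natr1; ring.
  have tsk : t `^ (k%:R - al) <= 4 `^ `|k%:R - al| * s `^ (k%:R - al).
    have r0 : 0 < t / s by rewrite divr_gt0.
    rewrite -{1}[t](divfK (lt0r_neq0 s0)).
    rewrite powRM ?(ltW r0) ?(ltW s0)// ler_wpM2r ?powR_ge0//.
    apply: (@le_trans _ _ ((t / s) `^ `|k%:R - al|)).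
      by apply: ler_powR; [rewrite ler_pdivlMr//; lra|exact: ler_norm].
    apply: ge0_ler_powR => //; rewrite ?nnegrE ?(ltW r0)//.
    by rewrite ler_pdivrMr//; lra.
  rewrite tk; set T := t `^ _ in tsk *; set W := 4 `^ _ in tsk *; set S := s `^ _ in tsk *.
  have r1 : 4 / t <= t / s / s.
    have r2 : 2 <= t / s by rewrite ler_pdivlMr//; lra.
    rewrite ler_pdivrMr// (_ : t / s / s * t = (t / s) * (t / s)); last by ring.
    by move: (t / s) r2 => r r2; nra.
  have -> : 4 / t * (t * T) * (C / t) = C * (4 / t * T) by field; rewrite gt_eqF.
  have -> : K * (t / s / s) * S = C * (t / s / s * (W * S)) by rewrite /K -/W; ring.
  apply: ler_wpM2l; first exact: ltW.
  by apply: ler_pM => //; [rewrite divr_ge0// ltW|exact: powR_ge0].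
have ph s : posline s -> (0 <= (hkern 1 t s)%:E * blevel al p k s)%E.
  by rewrite poslineP => s0; rewrite mule_ge0 ?blevel_ge0// lee_fin hkern_ge0.
have mh : measurable_fun (posline : set (measurableTypeR R))
    (fun s => (hkern 1 t s)%:E * blevel al p k s)%E.
  apply: measurable_funTS; apply: emeasurable_funM; last exact: measurable_blevel.
  apply/measurable_EFinP.
  exact: (measurableT_comp (@measurable_hkern R 1) (measurable_pair1 t)).
have muI : mu I = (t / 4)%:E.
  rewrite lebesgue_measure_itv/= lte_fin ltr_pM2l// ltf_pV2 ?posrE// ltr_nat/= -EFinB.
  by congr EFin; field.
have -> : blevel al p k.+1 t = (\int[mu]_(s in I) ((4 / t)%:E * blevel al p k.+1 t))%E.
  apply: etrans (esym (integral_cst mu mI ((4 / t)%:E * blevel al p k.+1 t)%E)).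
  apply: (etrans _ (congr1 (fun w => ((4 / t)%:E * blevel al p k.+1 t * w)%E) (esym muI))).
  rewrite muleAC -EFinM (_ : 4 / t * (t / 4) = 1) ?mul1e//.
  by field; rewrite gt_eqF.
apply: (@le_trans _ _ (\int[mu]_(s in posline) (K%:E * ((hkern 1 t s)%:E * blevel al p k s)))%E).
  apply: (@le_trans _ _ (\int[mu]_(s in I) (K%:E * ((hkern 1 t s)%:E * blevel al p k s)))%E).
    apply: ge0_integral_mono => s; rewrite /I/= in_itv/= => /andP[ts st].
      by rewrite mule_ge0 ?blevel_ge0// lee_fin divr_ge0// ltW.
    exact: step.
  apply: ge0_subset_integral => //.
  - exact: emeasurable_funM.
  - by move=> s ps; rewrite mule_ge0 ?ph// lee_fin ltW.
  - move=> s; rewrite /I poslineP/= in_itv/= => /andP[+ _].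
    by apply: lt_le_trans; rewrite divr_gt0.
by rewrite (ge0_integralZl_EFin mu mpos ph mh (ltW K0)).
Qed.

(** After the weights are inserted, the tail formula is a Hardy operator with exponent [k.+1 - al];
    its positivity is exactly the condition on the order. *)
Lemma blevel_down k : al < k.+1%:R ->
  (luxnorm haar_measure posline q (blevel al p k.+2) < +oo)%E ->
  (luxnorm haar_measure posline q (blevel al p k.+1) < +oo)%E.
Proof.
move=> ak; have e0 : 0 < k.+1%:R - al by rewrite subr_gt0.
apply: (@luxnorm_le_hardy_fin _ _ _ qd (k.+1%:R - al) 1) => //.
- exact: measurable_blevel.
- by move=> t; exact: blevel_ge0.
move=> t t0; rewrite blevel_ge0 mul1e/=.
have mtail : measurable_fun (`[t, +oo[ : set (measurableTypeR R)) (pdnorm f p k.+2).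
  by apply: measurable_funTS; exact: measurable_pdnorm.
have ph s : posline s -> (0 <= (hkern (k.+1%:R - al) t s)%:E * blevel al p k.+2 s)%E.
  by rewrite poslineP => s0; rewrite mule_ge0 ?blevel_ge0// lee_fin hkern_ge0.
have mh : measurable_fun (posline : set (measurableTypeR R))
    (fun s => (hkern (k.+1%:R - al) t s)%:E * blevel al p k.+2 s)%E.
  apply: measurable_funTS; apply: emeasurable_funM; last exact: measurable_blevel.
  apply/measurable_EFinP.
  exact: (measurableT_comp (@measurable_hkern R _) (measurable_pair1 t)).
rewrite /blevel; apply: (@le_trans _ _ ((t `^ (k.+1%:R - al))%:E *
    \int[mu]_(s in `[t, +oo[) pdnorm f p k.+2 s)%E).
  by rewrite lee_wpmul2l ?lee_fin ?powR_ge0// pdnorm_tail.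
have mI : measurable (`[t, +oo[ : set (measurableTypeR R)) by exact: measurable_itv.
rewrite -(ge0_integralZl_EFin mu mI (fun s _ => pdnorm_ge0 f p k.+2 s) mtail (powR_ge0 _ _)).
apply: le_trans (_ : _ <= \int[mu]_(s in `[t, +oo[)
    ((hkern (k.+1%:R - al) t s)%:E * blevel al p k.+2 s))%E _.
  apply: ge0_integral_mono => s; rewrite /= in_itv/= andbT => ts.
    by rewrite mule_ge0 ?pdnorm_ge0// lee_fin powR_ge0.
  have s0 : 0 < s by exact: lt_le_trans ts.
  rewrite /blevel muleA lee_wpmul2r ?pdnorm_ge0// -EFinM lee_fin /hkern.
  have -> : (t / 4 <= s)%R by lra.
  rewrite mulr1 -mulrA; have -> : s^-1 * s `^ (k.+2%:R - al) = s `^ (k.+1%:R - al).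
    rewrite -(powR_inv1 (ltW s0)) -powRD; last by apply/implyP => _; rewrite gt_eqF.
    by congr powR; rewrite -!natr1; ring.
  by rewrite -powRM ?divr_ge0 ?(ltW t0) ?(ltW s0)// divfK// gt_eqF.
apply: ge0_subset_integral => //.
by move=> s; rewrite poslineP/= in_itv/= andbT; exact: lt_le_trans.
Qed.

End besov_levels.

Lemma luxnorm_abs dT (T : measurableType dT) (R : realType)
    (nu : {measure set T -> \bar R}) (D : set T) (p : T -> R) (f : T -> \bar R) :
  luxnorm nu D p (fun x => `|f x|)%E = luxnorm nu D p f.
Proof.
rewrite /luxnorm; congr ereal_inf; congr image.
have H (r : R) : (\int[nu]_(x in D) (`|(r^-1)%:E * `|f x| | `^ p x) =
    \int[nu]_(x in D) (`|(r^-1)%:E * f x| `^ p x))%E.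
  by apply: eq_integral => x _; rewrite !abseM abse_id.
by apply/seteqP; split => r /=; rewrite H.
Qed.

Lemma truncn_interp {R : realType} (th al0 al1 : R) : 0 < th < 1 ->
  (Num.truncn (al0 * (1 - th) + al1 * th) <= maxn (Num.truncn al0) (Num.truncn al1))%N.
Proof.
move=> /andP[th0 th1]; rewrite leq_max; have [a01|a10] := lerP al0 al1.
  by apply/orP; right; apply: le_truncn; nra.
by apply/orP; left; apply: le_truncn; nra.
Qed.

(** * Interpolation of Besov norms at a common order *)

Section besov_interpolation.
Context {R : realType} {d : nat}.
Local Notation E := (d.-tuple R).
Local Notation gam := (gauss_measure d).
Variable f : E -> R.
Hypothesis intf : gam.-integrable setT (EFin \o f).

Let mpos : measurable (posline : set (measurableTypeR R)).
Proof. exact: measurable_posline. Qed.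

Lemma blevel_up_le (al Q : R) (p : E -> R) (q : R -> R) k l : log_decay Q q ->
  LH0 p -> Pgamma p -> (1 < ess_inf gam (EFin \o p))%E -> (k <= l)%N ->
  (luxnorm haar_measure posline q (blevel f al p k) < +oo)%E ->
  (luxnorm haar_measure posline q (blevel f al p l) < +oo)%E.
Proof.
move=> qd Lp Pp pinf kl H; rewrite -(subnK kl); elim: (l - k)%N => [|n IH]; first exact: H.
have [mp p1 _] := Pp; rewrite addSn; exact: (blevel_up intf qd mp p1 Lp Pp pinf IH).
Qed.

Lemma blevel_down_le (al Q : R) (p : E -> R) (q : R -> R) k l : log_decay Q q ->
  measurable_fun setT p -> (forall x, 1 <= p x) -> al < k.+1%:R -> (k <= l)%N ->
  (luxnorm haar_measure posline q (blevel f al p l.+1) < +oo)%E ->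
  (luxnorm haar_measure posline q (blevel f al p k.+1) < +oo)%E.
Proof.
move=> qd mp p1 ak kl; rewrite -(subnK kl); elim: (l - k)%N => [|n IH]; first exact: id.
move=> H; apply: IH.
apply: (blevel_down intf qd mp p1 _ H); apply: lt_le_trans ak _.
by rewrite ler_nat ltnS leq_addl.
Qed.

Section levels.
Variables (th Q al0 al1 : R) (p0 p1 : E -> R) (q0 q1 : R -> R) (l : nat).
Hypotheses (th01 : 0 < th < 1) (Q1 : 1 <= Q).
Hypotheses (mp0 : measurable_fun setT p0) (mp1 : measurable_fun setT p1).
Hypotheses (p0ge1 : forall x, 1 <= p0 x) (p1ge1 : forall x, 1 <= p1 x).
Hypotheses (qd0 : log_decay Q q0) (qd1 : log_decay Q q1).
Let p x := interp th (p0 x) (p1 x).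
Let q t := interp th (q0 t) (q1 t).
Let al := al0 * (1 - th) + al1 * th.

Let measurable_p : measurable_fun setT p.
Proof.
by apply: measurable_invr; apply: measurable_funD; apply: measurable_funM => //;
  exact: measurable_invr.
Qed.

Let qd : log_decay Q q.
Proof. exact: log_decay_interp. Qed.

(** The level plus a positive function of finite norm: a strict majorant of the level wherever the
    latter is finite, still of finite norm in [t]. *)
Let g a (p' : E -> R) t : \bar R := (blevel f a p' l t + (hdist t)%:E)%E.

Let g_gt0 a p' t : 0 < t -> (0 < g a p' t)%E.
Proof.
move=> t0; apply: lt_le_trans (_ : (0 < (hdist t)%:E)%E) _; first by rewrite lte_fin hdist_gt0.
by rewrite leeDr// blevel_ge0.
Qed.

(** The majorant with the weight in [t] removed; it exceeds the norm in [x] strictly or is infinite,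
    as [luxnorm_holder] asks. *)
Let M a p' t : \bar R := ((t `^ (a - l%:R))%:E * g a p' t)%E.

Let M_gt0 a p' t : 0 < t -> (0 < M a p' t)%E.
Proof. by move=> t0; rewrite mule_gt0 ?g_gt0// lte_fin powR_gt0. Qed.

Let pdnorm_lt_M a p' t : 0 < t -> (pdnorm f p' l t < M a p' t)%E \/ M a p' t = +oo%E.
Proof.
move=> t0; rewrite /M /g /blevel.
have T0 : 0 < t `^ (l%:R - a) by rewrite powR_gt0.
have T0' : 0 < t `^ (a - l%:R) by rewrite powR_gt0.
have TT : t `^ (a - l%:R) * t `^ (l%:R - a) = 1.
  rewrite -powRD; last by apply/implyP => _; rewrite gt_eqF.
  by rewrite (_ : a - l%:R + (l%:R - a) = 0) ?powRr0//; ring.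
case: (pdnorm f p' l t) (pdnorm_ge0 f p' l t) => [v| |]// _; last first.
  by right; rewrite gt0_muley ?lte_fin// addye// gt0_muley ?lte_fin.
left; rewrite -[ltRHS]/((t `^ (a - l%:R) * (t `^ (l%:R - a) * v + hdist t))%:E).
rewrite lte_fin mulrDr mulrA TT mul1r ltrDl.
by rewrite mulr_gt0// hdist_gt0.
Qed.

Let measurable_g a (p' : E -> R) : measurable_fun setT p' -> (forall x, 1 <= p' x) ->
  measurable_fun [set: measurableTypeR R] (g a p').
Proof.
move=> mp' p'1; apply: emeasurable_funD; first exact: measurable_blevel.
by apply/measurable_EFinP; exact: measurable_hdist.
Qed.

Let pdnorm_interp t : 0 < t ->
  (pdnorm f p l t <= 2%:E * (M al0 p0 t `^ (1 - th) * M al1 p1 t `^ th))%E.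
Proof.
move=> t0.
have mv : measurable_fun setT (fun x => (pdp f l (t, x))%:E).
  by apply/measurable_EFinP; exact: measurable_pdp_snd.
have mav : measurable_fun setT (fun x => `|pdp f l (t, x)|%:E).
  by apply/measurable_EFinP; apply: measurableT_comp => //; exact: measurable_pdp_snd.
have absE p' : pdnorm f p' l t = luxnorm gam setT p' (fun x => `|pdp f l (t, x)|%:E).
  exact: esym (luxnorm_abs gam setT p' (fun x => (pdp f l (t, x))%:E)).
apply: (luxnorm_holder (D := setT) measurableT th01 mp0 mp1 measurable_p
  (g0 := fun x => `|pdp f l (t, x)|%:E) (g1 := fun x => `|pdp f l (t, x)|%:E)) => //.
- by move=> x _; rewrite /p /interp invrK.
- move=> x _; rewrite !poweR_EFin -EFinM abse_EFin lee_fin.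
  rewrite -powRD ?subrK ?powRr1//.
  by rewrite oner_eq0.
- exact: M_gt0.
- exact: M_gt0.
- by rewrite -absE; exact: pdnorm_lt_M.
- by rewrite -absE; exact: pdnorm_lt_M.
Qed.

Let luxnorm_g a (p' : E -> R) q' : log_decay Q q' -> measurable_fun setT p' -> (forall x, 1 <= p' x) ->
  (luxnorm haar_measure posline q' (blevel f a p' l) < +oo)%E ->
  (luxnorm haar_measure posline q' (g a p') < +oo)%E.
Proof.
move=> q'd mp' p'1 H; have [mq' q'1 _] := q'd.
apply: luxnorm_add_fin => //.
- exact: measurable_funTS.
- by move=> t _; have /andP[] := q'1 t.
- by apply: measurable_funTS; exact: measurable_blevel.
- by apply: measurable_funTS; apply/measurable_EFinP; exact: measurable_hdist.
- by move=> t _; exact: blevel_ge0.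
- by move=> t; rewrite poslineP => t0; rewrite lee_fin ltW// hdist_gt0.
- exact: luxnorm_hdist q'd.
Qed.

(** The powers [t ^ (al_j - l)] in the two majorants combine, with weights [1 - th] and [th], into
    [t ^ (al - l)], which cancels the weight of the interpolated level and leaves a product to which
    Hoelder's inequality in [t] applies. *)
Lemma blevel_interp :
  (luxnorm haar_measure posline q0 (blevel f al0 p0 l) < +oo)%E ->
  (luxnorm haar_measure posline q1 (blevel f al1 p1 l) < +oo)%E ->
  (luxnorm haar_measure posline q (blevel f al p l) < +oo)%E.
Proof.
have [th0 th1] := andP th01; have t1 : 0 < 1 - th by lra.
move=> /(luxnorm_g qd0 mp0 p0ge1) H0 /(luxnorm_g qd1 mp1 p1ge1) H1.
pose G t := (g al0 p0 t `^ (1 - th) * g al1 p1 t `^ th)%E.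
have bG t : 0 < t -> (blevel f al p l t <= 2%:E * G t)%E.
  move=> t0; apply: (@le_trans _ _ ((t `^ (l%:R - al))%:E *
      (2%:E * (M al0 p0 t `^ (1 - th) * M al1 p1 t `^ th)))%E).
    by rewrite lee_wpmul2l ?lee_fin ?powR_ge0// pdnorm_interp.
  rewrite /M !poweRM ?lee_fin ?powR_ge0 ?(ltW (g_gt0 _ _ t0))//.
  rewrite !poweR_EFin muleCA; apply: lee_wpmul2l => //; rewrite /G.
  move: (g al0 p0 t `^ (1 - th))%E (g al1 p1 t `^ th)%E => y z.
  rewrite muleACA muleA -!EFinM -!powRrM -!powRD; last 2 first.
  - by apply/implyP => _; rewrite gt_eqF.
  - by apply/implyP => _; rewrite gt_eqF.
  rewrite (_ : l%:R - al + ((al0 - l%:R) * (1 - th) + (al1 - l%:R) * th) = 0) ?powRr0 ?mul1e//.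
  by rewrite /al; ring.
have [mq0 q0b _] := qd0; have [mq1 q1b _] := qd1; have [mq qb _] := qd.
have mg0 := measurable_g al0 mp0 p0ge1; have mg1 := measurable_g al1 mp1 p1ge1.
have gp a p' t : posline t -> (0 <= g a p' t)%E by rewrite poslineP => t0; exact/ltW/g_gt0.
have two0 : 0 < 2 :> R by [].
apply: (luxnorm_holder_fin (nu := haar_measure) mpos th01 two0 (p0 := q0) (p1 := q1) (p := q)
  (g0 := g al0 p0) (g1 := g al1 p1)); try exact: measurable_funTS.
- by move=> t _; have /andP[] := q0b t.
- by move=> t _; have /andP[] := q1b t.
- by move=> t _; rewrite /q /interp invrK.
- by move=> t _; have /andP[? _] := qb t; exact: le_trans ler01 _.
- by move=> t; exact: gp.
- by move=> t; exact: gp.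
- move=> t; rewrite poslineP => t0.
  by rewrite gee0_abs; [exact: bG|exact: blevel_ge0].
- exact: H0.
- exact: H1.
Qed.

End levels.
End besov_interpolation.

(** * Membership in the spaces and the Besov interpolation *)

Section variable_lebesgue.
Context {R : realType} {d : nat}.
Local Notation E := (d.-tuple R).
Local Notation gam := (gauss_measure d).
Implicit Types (f : E -> R).

(** From [v <= 1 + v ^ p] and the finite mass of the Gaussian measure. Integrability is the only
    form in which [f] enters the semigroup part. *)
Lemma integrable_Lvar (p : E -> R) f : Pgamma p -> Lvar p f ->
  gam.-integrable setT (EFin \o f).
Proof.
move=> [mp p1 _] [mf /luxnorm_ltP[l [l0 _ H]]].
have mf' : measurable_fun setT (EFin \o f) by apply/measurable_EFinP.
apply/integrableP; split => //.
have mg : measurable_fun setT (fun x => `|(l^-1)%:E * (EFin \o f) x| `^ p x)%E.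
  apply: measurable_fun_poweR => //; apply: measurableT_comp => //.
  exact: emeasurable_funM.
apply: (@le_lt_trans _ _ (\int[gam]_x (l%:E * (1 + `|(l^-1)%:E * (EFin \o f) x| `^ p x)))%E).
  apply: ge0_integral_mono => x _; first exact: abse_ge0.
  have -> : `|(l^-1)%:E * (EFin \o f) x|%E = (`|l^-1 * f x|)%:E by [].
  rewrite poweR_EFin -[leLHS]/(`|f x|%:E) -EFinD -EFinM lee_fin.
  rewrite -ler_pdivrMl// normrM (ger0_norm (_ : 0 <= l^-1)) ?invr_ge0 ?(ltW l0)//.
  set v := l^-1 * `|f x|; have v0 : 0 <= v by rewrite mulr_ge0// invr_ge0 ltW.
  have [v1|v1] := lerP v 1; first by have := powR_ge0 v (p x); lra.
  have : v <= v `^ p x by apply: le1r_powR => //; exact: ltW.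
  by lra.
have ad (x : E) : [set: E] x -> (0 <= 1 + `|(l^-1)%:E * (EFin \o f) x| `^ p x)%E.
  by move=> _; rewrite adde_ge0 ?poweR_ge0.
rewrite (ge0_integralZl_EFin gam measurableT ad _ (ltW l0)); last exact: emeasurable_funD.
rewrite ge0_integralD//; last by move=> x _; exact: poweR_ge0.
rewrite muley_fin// integral_cst// mul1e.
apply: (@le_lt_trans _ _ (gam setT + 1)%E); first by rewrite leeD2l.
by rewrite probability_setT -EFinD ltry.
Qed.

Lemma Lvar_interp (th : R) (p0 p1 p : E -> R) f : 0 < th < 1 -> Pgamma p0 -> Pgamma p1 ->
  measurable_fun setT p ->
  {ae gam, forall x, (p x)^-1 = (1 - th) / p0 x + th / p1 x} ->
  Lvar p0 f -> Lvar p1 f -> Lvar p f.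
Proof.
move=> th01 [mp0 p0ge1 _] [mp1 p1ge1 _] mp pE [mf H0] [_ H1]; split; first exact: mf.
have mf' : measurable_fun setT (EFin \o f) by apply/measurable_EFinP.
have mp' : measurable_fun setT (fun x => interp th (p0 x) (p1 x)).
  by apply: measurable_invr; apply: measurable_funD; apply: measurable_funM => //;
    exact: measurable_invr.
have pE' : {ae gam, forall x, [set: E] x -> p x = interp th (p0 x) (p1 x)}.
  by apply: filterS pE => x pE _; rewrite /interp -pE invrK.
rewrite (luxnorm_ae_eq measurableT mf' mp mp' pE').
have maf : measurable_fun setT (fun x => `|(EFin \o f) x|%E) by exact: measurableT_comp.
rewrite -luxnorm_abs in H0; rewrite -luxnorm_abs in H1.
apply: (luxnorm_holder_fin measurableT th01 ltr01 mp0 mp1 mp'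
  (g0 := fun x => `|(EFin \o f) x|%E) (g1 := fun x => `|(EFin \o f) x|%E)).
- by move=> x _; exact: p0ge1.
- by move=> x _; exact: p1ge1.
- by move=> x _; rewrite /interp invrK.
- by move=> x _; apply: le_trans ler01 _; exact: interp_ge1.
- exact: maf.
- exact: maf.
- by move=> x _; exact: abse_ge0.
- by move=> x _; exact: abse_ge0.
- move=> x _; have -> : `|(EFin \o f) x|%E = `|f x|%:E by [].
  rewrite mul1e !poweR_EFin -EFinM lee_fin.
  by rewrite -powRD ?subrK ?powRr1// oner_eq0.
- exact: H0.
- exact: H1.
Qed.

Let mpos : measurable (posline : set (measurableTypeR R)).
Proof. exact: measurable_posline. Qed.

Lemma luxnorm_blevel (al Q : R) (p p' : E -> R) (q q' : R -> R) k f :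
  gam.-integrable setT (EFin \o f) ->
  measurable_fun setT p -> measurable_fun setT p' -> (forall x, 1 <= p' x) ->
  {ae gam, forall x, p x = p' x} ->
  measurable_fun posline q -> log_decay Q q' ->
  {ae haar_measure, forall t, posline t -> q t = q' t} ->
  luxnorm haar_measure posline q (fun t => (t `^ (k%:R - al))%:E *
       luxnorm gam setT p (fun x => (dpoisson_hermite k t f x)%:E))%E =
  luxnorm haar_measure posline q' (blevel f al p' k).
Proof.
move=> intf mp mp' p'1 pp' mq [mq' _ _] qq'.
have mb : measurable_fun posline (blevel f al p' k).
  by apply: measurable_funTS; exact: measurable_blevel.
have mq'' : measurable_fun posline q' by exact: measurable_funTS.
apply: etrans (luxnorm_ae_eq measurable_posline mb mq mq'' qq').
apply: eq_luxnorm => t; rewrite poslineP => t0.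
apply: (congr1 (fun v => (t `^ (k%:R - al))%:E * v)%E).
have mv : measurable_fun setT (fun x => (pdp f k (t, x))%:E).
  by apply/measurable_EFinP; exact: measurable_pdp_snd.
have pp'T : {ae gam, forall x, [set: E] x -> p x = p' x} by apply: filterS pp' => x.
apply: etrans (luxnorm_ae_eq measurableT mv mp mp' pp'T).
by apply: eq_luxnorm => x _; rewrite pdpE.
Qed.

Lemma besov_lipschitz_interp (th al0 al1 : R) (p0 p1 p : E -> R) (q0 q1 q : R -> R) f :
  0 < th < 1 -> Pgamma p0 -> LH0 p0 -> Pgamma p1 -> LH0 p1 -> P0oo q0 -> P0oo q1 ->
  (1 < ess_inf gam (EFin \o p0))%E -> (1 < ess_inf gam (EFin \o p1))%E ->
  0 <= al0 -> 0 <= al1 ->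
  besov_lipschitz al0 p0 q0 f -> besov_lipschitz al1 p1 q1 f ->
  measurable_fun setT p -> measurable_fun posline q ->
  {ae gam, forall x, (p x)^-1 = (1 - th) / p0 x + th / p1 x} ->
  {ae haar_measure, forall t, (q t)^-1 = (1 - th) / q0 t + th / q1 t} ->
  besov_lipschitz (al0 * (1 - th) + al1 * th) p q f.
Proof.
move=> th01 Pp0 Lp0 Pp1 Lp1 Pq0 Pq1 i0 i1 al00 al10 [Lf0 B0] [Lf1 B1] mp mq pE qE.
split; first exact: Lvar_interp pE Lf0 Lf1.
have intf := integrable_Lvar Pp0 Lf0.
have [mp0 p0ge1 _] := Pp0; have [mp1 p1ge1 _] := Pp1.
have [mq0 _ _ _ _] := Pq0; have [mq1 _ _ _ _] := Pq1.
have [Q0 [q0' [Q01 qd0 qq0]]] := P0oo_log_decay Pq0.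
have [Q1 [q1' [Q11 qd1 qq1]]] := P0oo_log_decay Pq1.
pose Q := Num.max Q0 Q1; have Q1' : 1 <= Q by rewrite le_max Q01.
have {}qd0 : log_decay Q q0' by apply: log_decay_widen qd0; rewrite le_max lexx.
have {}qd1 : log_decay Q q1' by apply: log_decay_widen qd1; rewrite le_max lexx orbT.
have aeid (p' : E -> R) : {ae gam, forall x, p' x = p' x} by exact: nearW.
move: B0 B1 => /=.
rewrite (luxnorm_blevel _ _ intf mp0 mp0 p0ge1 (aeid p0) mq0 qd0 qq0).
rewrite (luxnorm_blevel _ _ intf mp1 mp1 p1ge1 (aeid p1) mq1 qd1 qq1).
move=> B0 B1; set k0 := order_above al0 in B0; set k1 := order_above al1 in B1.
have qd := log_decay_interp th01 Q1' qd0 qd1.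
pose p' x := interp th (p0 x) (p1 x).
have mp' : measurable_fun setT p'.
  by apply: measurable_invr; apply: measurable_funD; apply: measurable_funM => //;
    exact: measurable_invr.
have p'1 x : 1 <= p' x by exact: interp_ge1.
have pp' : {ae gam, forall x, p x = p' x}.
  by apply: filterS pE => x pE; rewrite /p' /interp -pE invrK.
have qq' : {ae haar_measure, forall t, posline t -> q t = interp th (q0' t) (q1' t)}.
  apply: filterS3 qE qq0 qq1 => t qE e0 e1 pt.
  by rewrite /interp -e0// -e1// -qE invrK.
rewrite (luxnorm_blevel _ _ intf mp mp' p'1 pp' mq qd qq').
set al := al0 * (1 - th) + al1 * th.
(* The prescribed orders are [truncn] plus one, so [l.+1] dominates all three of them, and every
   order met on the way down is positive, as the tail formula requires. *)
pose l := maxn (Num.truncn al0) (Num.truncn al1).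
have ka : (Num.truncn al <= l)%N by exact: truncn_interp.
apply: (@blevel_down_le _ _ f intf al Q p' _ (Num.truncn al) l qd mp' p'1 _ ka).
  exact: truncnS_gt.
apply: (blevel_interp intf th01 Q1' mp0 mp1 p0ge1 p1ge1 qd0 qd1).
  by apply: (blevel_up_le intf qd0 Lp0 Pp0 i0 _ B0); rewrite ltnS leq_maxl.
by apply: (blevel_up_le intf qd1 Lp1 Pp1 i1 _ B1); rewrite ltnS leq_maxr.
Qed.

End variable_lebesgue.

(** * Triebel-Lizorkin spaces *)

Section maximal_extra.
Context {R : realType} {d : nat}.
Local Open Scope ereal_scope.
Local Notation E := (d.-tuple R).
Local Notation gam := (gauss_measure d).
Local Notation mu := (@lebesgue_measure R).
Implicit Types (g : E -> \bar R) (x y : E).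

Lemma oumax_mono g g' x : (forall y, 0 <= g y <= g' y) -> oumax g x <= oumax g' x.
Proof.
move=> gg; apply/ereal_supP => _ [[n N] _ <-] /=.
apply: le_trans (oumax_ge _ _ n N); apply: lee_wpmul2l.
  by rewrite lee_fin invr_ge0 divr_ge0// exprn_ge0.
apply: ge0_integral_mono => r _; first by apply: ou_ge0 => y; have /andP[] := gg y.
by apply: ou_mono => y; have /andP[] := gg y.
Qed.

Lemma oumaxZ_le (c : R) g x : (0 < c)%R -> measurable_fun setT g -> (forall x, 0 <= g x) ->
  oumax (fun y => c%:E * g y) x <= c%:E * oumax g x.
Proof.
move=> c0 mg g0; rewrite -lee_pdivrMl//.
have ci : (0 <= c^-1)%R by rewrite invr_ge0 ltW.
have mcg : measurable_fun setT (fun y => c%:E * g y) by exact: emeasurable_funM.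
have cg0 y : 0 <= c%:E * g y by rewrite mule_ge0// lee_fin ltW.
apply: le_trans (oumaxZ x ci mcg cg0) _.
have -> : (fun y => (c^-1)%:E * (c%:E * g y)) = g; last by [].
by apply/funext => y; rewrite muleA -EFinM mulVf ?mul1e// gt_eqF.
Qed.

Lemma integral_wou (w : R -> R) (I : set (measurableTypeR R))
    (G : measurableTypeR R * E -> \bar R) x : measurable I ->
  measurable_fun setT w -> (forall r, (0 < r)%R -> (0 <= w r)%R) ->
  measurable_fun setT G -> (forall z, 0 <= G z) ->
  \int[mu]_(s in I) wou w (fun y => G (s, y)) x =
  wou w (fun y => \int[mu]_(s in I) G (s, y)) x.
Proof.
move=> mI mw w0 mG G0.
have mGI : measurable_fun setT (fun y => \int[mu]_(s in I) G (s, y)).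
  apply: (@measurable_integral_on _ _ E (measurableTypeR R) R mu setT I
    (fun z => G (z.2, z.1))) => //.
  apply: measurable_funTS; apply: (measurableT_comp mG).
  by apply/measurable_fun_pairP; split; [exact: measurable_snd|exact: measurable_fst].
pose F (z : measurableTypeR R * measurableTypeR R) :=
  (w z.2)%:E * ou z.2 (fun y => G (z.1, y)) x.
have mF : measurable_fun setT F.
  apply: emeasurable_funM.
    by apply/measurable_EFinP; exact: (measurableT_comp mw measurable_snd).
  apply: (@measurable_ou_param R d _ (measurableTypeR R * measurableTypeR R)%type snd (fun=> x)
    (fun u => G (u.1.1, u.2))) => //.
  apply: (measurableT_comp mG); apply/measurable_fun_pairP; split => /=.
    exact: (measurableT_comp measurable_fst measurable_fst).
  exact: measurable_snd.
have F0 s r : I s -> posline r -> 0 <= F (s, r).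
  by rewrite poslineP => _ r0; rewrite mule_ge0 ?lee_fin ?w0// ou_ge0.
apply: etrans (tonelli_on mu mu F mI measurable_posline (measurable_funTS mF) F0) _.
apply: eq_integral => r; rewrite inE poslineP => r0; rewrite /F /=.
have mo : measurable_fun I (fun s => ou r (fun y => G (s, y)) x).
  apply: measurable_funTS.
  exact: (@measurable_ou_param R d _ (measurableTypeR R) (fun=> r) (fun=> x) G).
have o0 s : I s -> 0 <= ou r (fun y => G (s, y)) x by move=> _; exact: ou_ge0.
apply: (etrans (ge0_integralZl_EFin mu mI o0 mo (w0 r r0))).
apply: (congr1 (fun v => (w r)%:E * v)); rewrite /ou.
pose H (z : measurableTypeR R * E) := (mehler r x z.2)%:E * G z.
have mH : measurable_fun setT H.
  apply: emeasurable_funM => //.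
  exact: (measurableT_comp (measurable_mehlerr r x) measurable_snd).
have H0 s y : I s -> setT y -> 0 <= H (s, y).
  by move=> _ _; rewrite mule_ge0// lee_fin mehler_ge0.
apply: etrans (tonelli_on mu gam H mI measurableT (measurable_funTS mH) H0) _.
apply: eq_integral => y _; rewrite /H /=.
have mGy : measurable_fun I (fun s => G (s, y)).
  by apply: measurable_funTS; exact: (measurableT_comp mG (measurable_pair2 y)).
exact: (ge0_integralZl_EFin mu mI (fun s _ => G0 (s, y)) mGy (mehler_ge0 r x y)).
Qed.

End maximal_extra.

(** * Raising the order in the Triebel-Lizorkin case *)

Section triebel_levels.
Context {R : realType} {d : nat}.
Local Notation E := (d.-tuple R).
Local Notation gam := (gauss_measure d).
Local Notation mu := (@lebesgue_measure R).
Variable f : E -> R.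
Hypothesis intf : gam.-integrable setT (EFin \o f).

Let mpos : measurable (posline : set (measurableTypeR R)).
Proof. exact: measurable_posline. Qed.

Definition tnorm a (q : R -> R) k (x : E) : \bar R :=
  luxnorm haar_measure posline q (fun t => (t `^ (k%:R - a) * pdp f k (t, x))%:E).

Lemma tnorm_ge0 a q k x : (0 <= tnorm a q k x)%E.
Proof. exact: luxnorm_ge0. Qed.

Lemma measurable_tfun a k : measurable_fun setT
  (fun z : measurableTypeR R * E => (z.1 `^ (k%:R - a) * pdp f k z)%:E).
Proof.
apply/measurable_EFinP; apply: measurable_funM; last exact: measurable_pdp.
exact: (measurableT_comp (measurable_powR _) measurable_fst).
Qed.

Lemma measurable_tfun_fst a k x : measurable_fun [set: measurableTypeR R]
  (fun t => (t `^ (k%:R - a) * pdp f k (t, x))%:E).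
Proof. exact: (measurableT_comp (measurable_tfun a k) (measurable_pair2 x)). Qed.

Lemma measurable_tnorm a q k Q : log_decay Q q -> measurable_fun setT (tnorm a q k).
Proof.
move=> [mq q1 _]; apply: measurable_luxnorm => [t _|l l0].
  by have /andP[? _] := q1 t; lra.
have mz : measurable_fun setT (fun z : E * measurableTypeR R => (z.2, z.1)).
  by apply/measurable_fun_pairP; split; [exact: measurable_snd|exact: measurable_fst].
have mL : measurable_fun setT (fun z : measurableTypeR R * E =>
    (`|(l^-1)%:E * (z.1 `^ (k%:R - a) * pdp f k z)%:E| `^ q z.1)%E).
  apply: measurable_fun_poweR => //.
    by apply: measurableT_comp => //; apply: emeasurable_funM => //; exact: measurable_tfun.
  exact: (measurableT_comp mq measurable_fst).
have H : measurable_fun setT (fun x : E => \int[mu]_(t in posline) ((t^-1)%:E *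
    (`|(l^-1)%:E * (t `^ (k%:R - a) * pdp f k (t, x))%:E| `^ q t)))%E.
  apply: (@measurable_integral_on _ _ E (measurableTypeR R) R mu setT posline
    (fun z => ((z.2^-1)%:E * (`|(l^-1)%:E * (z.2 `^ (k%:R - a) * pdp f k (z.2, z.1))%:E|
      `^ q z.2))%E)) => //.
    apply: measurable_funTS; apply: emeasurable_funM; last exact: (measurableT_comp mL mz).
    apply/measurable_EFinP.
    exact: (measurableT_comp (@measurable_invline R) measurable_snd).
  move=> x t _; rewrite poslineP => t0.
  by rewrite mule_ge0 ?poweR_ge0// lee_fin invr_ge0 ltW.
apply: eq_measurable_fun H => x _; apply/esym/ge0_integral_haar.
  by apply: measurable_funTS; exact: (measurableT_comp mL (measurable_pair2 x)).
by move=> t _; exact: poweR_ge0.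
Qed.

(** On [[t / 4, t / 2]] the measures [ds / s] and [ds / t] are comparable and [u <= 1 + u ^ (q s)];
    a modular at most [1] therefore bounds the mean of the normalised function. *)
Lemma tnorm_local a q k Q : log_decay Q q -> exists2 C : R, 0 < C & forall t x, 0 < t ->
  (\int[mu]_(s in `[(t / 4)%R, (t / 2)%R]) `|pdp f k (s, x)|%:E <=
   (C * t `^ (a - k%:R + 1))%:E * tnorm a q k x)%E.
Proof.
move=> [mq q1 _]; pose r := a - k%:R + 1; pose K := 4 `^ `|r|.
exists (2 * K); first by rewrite mulr_gt0// powR_gt0.
move=> t x t0; apply: le_mule_of_gt; rewrite ?tnorm_ge0 ?mulr_gt0 ?powR_gt0//.
move=> n n0 Nn; have q0 s : posline s -> 0 <= q s.
  by move=> _; have /andP[? _] := q1 s; lra.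
have ni : 0 <= n^-1 by rewrite invr_ge0 ltW.
have := luxnorm_gt_modular q0 Nn.
pose I := `[t / 4, t / 2]%classic : set (measurableTypeR R).
have mI : measurable I by exact: measurable_itv.
pose u s := `|n^-1 * (s `^ (k%:R - a) * pdp f k (s, x))|.
have mu' : measurable_fun [set: measurableTypeR R] (fun s => (u s)%:E).
  apply/measurable_EFinP; apply: measurableT_comp => //; apply: measurable_funM => //.
  by move/measurable_EFinP : (measurable_tfun_fst a k x).
have mpw : measurable_fun [set: measurableTypeR R] (fun s => ((s^-1)%:E * (u s)%:E `^ q s)%E).
  apply: emeasurable_funM; last by apply: measurable_fun_poweR => // s _; rewrite lee_fin normr_ge0.
  by apply/measurable_EFinP; exact: measurable_invline.
rewrite ge0_integral_haar; last 2 first.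
- apply: measurable_fun_poweR => //; last exact: measurable_funTS.
  exact: measurable_funTS.
- by move=> s _; exact: poweR_ge0.
move=> H.
have IP s : I s -> [/\ t / 4 <= s, s <= t / 2 & 0 < s].
  rewrite /I/= in_itv/= => /andP[ts st]; split => //.
  by apply: lt_le_trans ts; rewrite divr_gt0.
have muI : mu I = (t / 4)%:E.
  rewrite lebesgue_measure_itv/= lte_fin ltr_pM2l// ltf_pV2 ?posrE// ltr_nat/= -EFinB.
  by congr EFin; field.
apply: (@le_trans _ _ (\int[mu]_(s in I) ((n * K * t `^ r)%:E *
    ((4 / t)%:E + (s^-1)%:E * (u s)%:E `^ q s)))%E).
  apply: ge0_integral_mono => s // /IP[ts st s0].
  have si : 0 < s^-1 by rewrite invr_gt0.
  rewrite -[leRHS]/((n * K * t `^ r * (4 / t + s^-1 * u s `^ q s))%:E) lee_fin.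
  have u0 : 0 <= u s by exact: normr_ge0.
  have uq : u s <= 1 + u s `^ q s.
    have [u1|u1] := lerP (u s) 1; first by have := powR_ge0 (u s) (q s); lra.
    have : u s <= u s `^ q s by apply: le1r_powR; [exact: ltW|have /andP[] := q1 s].
    by lra.
  have s4 : s^-1 <= 4 / t by rewrite -[4 / t]invf_div lef_pV2 ?posrE// divr_gt0.
  have -> : `|pdp f k (s, x)| = n * s `^ r * (s^-1 * u s).
    rewrite /u; move: (pdp f k (s, x)) => v.
    rewrite !normrM (ger0_norm ni) (ger0_norm (powR_ge0 _ _)).
    have -> : n * s `^ r * (s^-1 * (n^-1 * (s `^ (k%:R - a) * `|v|))) =
      (n * n^-1) * (s `^ r * s^-1 * s `^ (k%:R - a)) * `|v| by ring.
    rewrite mulfV ?gt_eqF// mul1r -(powR_inv1 (ltW s0)) -!powRD; last 2 first.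
    - by apply/implyP => _; rewrite gt_eqF.
    - by apply/implyP => _; rewrite gt_eqF.
    by rewrite (_ : r + -1 + (k%:R - a) = 0) ?powRr0 ?mul1r// /r; ring.
  have sr : s `^ r <= K * t `^ r.
    have t1 : 0 < s / t by rewrite divr_gt0.
    rewrite -{1}[s](divfK (lt0r_neq0 t0)) powRM ?(ltW t1) ?(ltW t0)//.
    rewrite ler_wpM2r ?powR_ge0//.
    apply: (@le_trans _ _ ((s / t)^-1 `^ `|r|)); last first.
      apply: ge0_ler_powR => //; rewrite ?nnegrE ?invr_ge0 ?(ltW t1)//.
      by rewrite invf_div ler_pdivrMr//; lra.
    rewrite powRV// -powRN; apply: ger_powR; last by rewrite lerNl -normrN ler_norm.
    by rewrite t1 ler_pdivrMr//; lra.
  apply: ler_pM; rewrite ?mulr_ge0 ?powR_ge0 ?(ltW n0) ?(ltW si)//.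
    by rewrite -mulrA ler_wpM2l ?(ltW n0).
  have : s^-1 * u s <= s^-1 * (1 + u s `^ q s) by rewrite ler_wpM2l ?(ltW si).
  by lra.
have c0 : 0 <= n * K * t `^ r by rewrite !mulr_ge0 ?powR_ge0// ltW.
have p1 s : I s -> (0 <= (4 / t)%:E)%E by move=> _; rewrite lee_fin divr_ge0// ltW.
have p2 s : I s -> (0 <= (s^-1)%:E * (u s)%:E `^ q s)%E.
  by move=> /IP[_ _ s0]; rewrite mule_ge0 ?poweR_ge0// lee_fin invr_ge0 ltW.
have mpwI : measurable_fun I (fun s => ((s^-1)%:E * (u s)%:E `^ q s)%E) by exact: measurable_funTS.
have mc : measurable_fun I (fun=> (4 / t)%:E) by exact: measurable_cst.
have p12 s : I s -> (0 <= (4 / t)%:E + (s^-1)%:E * (u s)%:E `^ q s)%E.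
  by move=> Is; apply: adde_ge0; [exact: p1 Is|exact: p2].
rewrite (ge0_integralZl_EFin mu mI p12 (emeasurable_funD mc mpwI) c0).
rewrite (ge0_integralD mu mI p1 mc p2 mpwI).
have -> : (2 * K * t `^ (a - k%:R + 1) * n)%:E = ((n * K * t `^ r)%:E * (1 + 1)%:E)%E.
  by rewrite -EFinM; congr EFin; rewrite /r; ring.
apply: lee_wpmul2l; first by rewrite lee_fin.
rewrite EFinD; apply: leeD.
  apply: (@le_trans _ _ ((4 / t)%:E * mu I)%E); first by rewrite -integral_cst.
  by rewrite muI -EFinM lee_fin (_ : 4 / t * (t / 4) = 1)//; field; rewrite gt_eqF.
apply: le_trans H; apply: ge0_subset_integral => //.
- exact: measurable_funTS.
- by move=> s; rewrite poslineP => s0; rewrite mule_ge0 ?poweR_ge0// lee_fin invr_ge0 ltW.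
- by move=> s /IP[_ _ s0]; rewrite poslineP.
Qed.

(** The average over [s] is taken inside the superposition of operators, before any maximal function
    appears; the inner function is then at most a multiple of [tnorm], a scalar function of [x]. The
    constant [48] is [12] from the maximal bound at [t / 2] times [4] from the length [t / 4]. *)
Lemma triebel_step a q k Q : log_decay Q q -> exists2 C : R, 0 < C & forall t x, 0 < t ->
  (`|pdp f k.+1 (t, x)|%:E <= (C * t `^ (a - k.+1%:R))%:E * oumax (tnorm a q k) x)%E.
Proof.
move=> qd; have [K K0 HK] := tnorm_local a k qd.
have [C C0 HC] := dpoisson_le intf.
exists (C * K * 48); first by rewrite !mulr_gt0.
move=> t x t0; pose N := tnorm a q k.
have mN : measurable_fun setT N by exact: measurable_tnorm qd.
have N0 y : (0 <= N y)%E by exact: tnorm_ge0.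
pose I := `[t / 4, t / 2]%classic : set (measurableTypeR R).
have mI : measurable I by exact: measurable_itv.
have t2 : 0 < t / 2 by rewrite divr_gt0.
pose G (z : measurableTypeR R * E) := `|pdp f k z|%:E.
have mG : measurable_fun setT G by exact: measurable_pdp_abs.
have G0 z : (0 <= G z)%E by rewrite lee_fin.
have mw : measurable_fun setT (tailw (t / 2)) by exact: measurable_tailw.
have w0 r : 0 < r -> 0 <= tailw (t / 2) r by move=> _; exact: tailw_ge0.
have muI : mu I = (t / 4)%:E.
  rewrite lebesgue_measure_itv/= lte_fin ltr_pM2l// ltf_pV2 ?posrE// ltr_nat/= -EFinB.
  by congr EFin; field.
have mwou : measurable_fun I (fun s => wou (tailw (t / 2)) (fun y => G (s, y)) x).
  apply: measurable_funTS.
  apply: (@measurable_wou_param R d _ (measurableTypeR R) (fun=> tailw (t / 2)) (fun=> x) G) => //.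
  exact: (measurableT_comp mw measurable_snd).
have wou0 s : I s -> (0 <= wou (tailw (t / 2)) (fun y => G (s, y)) x)%E.
  by move=> _; apply: wou_ge0.
pose c := K * t `^ (a - k%:R + 1); have c0 : 0 < c by rewrite mulr_gt0// powR_gt0.
have mcN : measurable_fun setT (fun y => c%:E * N y)%E by exact: emeasurable_funM.
have cN0 y : (0 <= c%:E * N y)%E by rewrite mule_ge0// lee_fin ltW.
have J : ((t / 4)%:E * `|pdp f k.+1 (t, x)|%:E <= (C * (12 / t * c))%:E * oumax N x)%E.
  apply: (@le_trans _ _ (\int[mu]_(s in I) cst `|pdp f k.+1 (t, x)|%:E s)%E).
    by rewrite integral_cst// muleC; apply: lee_wpmul2l; rewrite ?lee_fin// -muI.
  apply: (@le_trans _ _ (\int[mu]_(s in I) (C%:E *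
      wou (tailw (t / 2)%R) (fun y => G (s, y)) x))%E).
    apply: ge0_integral_mono => s; rewrite /I/= in_itv/= => /andP[ts st]; first by rewrite lee_fin.
    have s0 : 0 < s by apply: lt_le_trans ts; rewrite divr_gt0.
    rewrite pdpE//; apply: le_trans (HC k s t x s0 st) _.
    rewrite /G (_ : (fun y => `|pdp f k (s, y)|%:E) =
      (fun y => `|dpoisson_hermite k s f y|%:E))//.
    by apply/funext => y; rewrite pdpE.
  rewrite (ge0_integralZl_EFin mu mI wou0 mwou (ltW C0)).
  rewrite EFinM -muleA; apply: lee_wpmul2l; first by rewrite lee_fin ltW.
  apply: le_trans (_ : wou (tailw (t / 2)) (fun y => c%:E * N y)%E x <= _)%E.
    rewrite (integral_wou x mI mw w0 mG G0); apply: wou_mono => [r r0|y].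
      by rewrite w0 ?lexx.
    apply/andP; split; first exact: integral_ge0.
    exact: HK.
  apply: le_trans (wou_tailw_le x t2 mcN cN0) _.
  have -> : 12 / t * c = 6 / (t / 2) * c by field; rewrite gt_eqF.
  rewrite (EFinM (6 / (t / 2)) c) -[leRHS]muleA; apply: lee_wpmul2l; last exact: oumaxZ_le.
  by rewrite lee_fin divr_ge0// ltW.
have t4 : 0 < t / 4 by rewrite divr_gt0.
move: J; rewrite -lee_pdivlMl// muleA -EFinM => /le_trans; apply.
rewrite (_ : (t / 4)^-1 * (C * (12 / t * c)) = C * K * 48 * t `^ (a - k.+1%:R))//.
have -> : t `^ (a - k.+1%:R) = t^-1 * t^-1 * t `^ (a - k%:R + 1).
  rewrite -(powR_inv1 (ltW t0)) -!powRD; last 2 first.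
  - by apply/implyP => _; rewrite gt_eqF.
  - by apply/implyP => _; rewrite gt_eqF.
  by congr powR; rewrite -natr1; ring.
by rewrite /c; field; rewrite gt_eqF.
Qed.

(** The first step replaces the inner norm by a supremum in [t]. Every later step uses [s = t / 2]
    and one more maximal function, which preserves the space of variable exponent [p]. *)
Lemma triebel_up a (p : E -> R) q Q k n : log_decay Q q ->
  Pgamma p -> LH0 p -> (1 < ess_inf gam (EFin \o p))%E ->
  (luxnorm gam setT p (tnorm a q k) < +oo)%E ->
  exists A : E -> \bar R, [/\ measurable_fun setT A, forall x, (0 <= A x)%E,
    (luxnorm gam setT p A < +oo)%E & forall t x, 0 < t ->
    (`|pdp f (k.+1 + n) (t, x)|%:E <= (t `^ (a - (k.+1 + n)%:R))%:E * A x)%E].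
Proof.
move=> qd Pp Lp pinf Hk; have [M M0 HM] := luxnorm_oumax Pp Lp pinf.
have mN : measurable_fun setT (tnorm a q k) by exact: measurable_tnorm qd.
have mcst (C : R) (A : E -> \bar R) : measurable_fun setT A ->
  measurable_fun setT (fun x => C%:E * A x)%E by move=> mA; exact: emeasurable_funM.
have ccst (C : R) (A : E -> \bar R) : 0 < C -> (forall x, 0 <= A x)%E ->
  forall x, (0 <= C%:E * A x)%E by move=> C0 A0 x; rewrite mule_ge0// lee_fin ltW.
elim: n => [|n [A [mA A0 LA HA]]].
  rewrite addn0; have [C C0 HC] := triebel_step a k qd.
  have mo := measurable_oumax mN (tnorm_ge0 a q k).
  have o0 x := oumax_ge0 x (tnorm_ge0 a q k).
  exists (fun x => C%:E * oumax (tnorm a q k) x)%E; split.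
  - exact: mcst.
  - exact: ccst.
  - apply: le_lt_trans (luxnormZ_le _ _ _ _ C0) _; apply: muley_fin => //.
    apply: le_lt_trans (HM _ mN (tnorm_ge0 a q k)) _; exact: muley_fin.
  - move=> t x t0; apply: le_trans (HC t x t0) _.
    by rewrite (mulrC C) EFinM muleA.
have [C C0 HC] := dpoisson_step intf.
pose m := (k.+1 + n)%N; pose r := a - m%:R.
have mo := measurable_oumax mA A0; have o0 x := oumax_ge0 x A0.
pose c := C * 2^-1 `^ r; have c0 : 0 < c by rewrite mulr_gt0// powR_gt0.
exists (fun x => c%:E * oumax A x)%E; split.
- exact: mcst.
- exact: ccst.
- apply: le_lt_trans (luxnormZ_le _ _ _ _ c0) _; apply: muley_fin => //.
  by apply: le_lt_trans (HM _ mA A0) _; exact: muley_fin.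
move=> t x t0; have t2 : 0 < t / 2 by rewrite divr_gt0.
rewrite addnS; apply: le_trans (HC (k.+1 + n)%N (t / 2) t x t2 (lexx _)) _.
have cc : 0 < (t / 2) `^ r by rewrite powR_gt0.
apply: (@le_trans _ _ ((C / t)%:E * (((t / 2) `^ r)%:E * oumax A x))%E).
  apply: lee_wpmul2l; first by rewrite lee_fin divr_ge0// ltW.
  apply: le_trans (oumaxZ_le x cc mA A0); apply: oumax_mono => y.
  by rewrite lee_fin normr_ge0; exact: HA.
rewrite !muleA -!EFinM.
rewrite (_ : C / t * (t / 2) `^ r = t `^ (a - (k.+1 + n).+1%:R) * c)//.
rewrite powRM ?invr_ge0 ?(ltW t0)//.
have -> : t `^ (a - (k.+1 + n).+1%:R) = t^-1 * t `^ r.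
  rewrite -(powR_inv1 (ltW t0)) -powRD; last by apply/implyP => _; rewrite gt_eqF.
  by congr powR; rewrite /r /m -natr1; ring.
by rewrite /c; ring.
Qed.

End triebel_levels.

Lemma geo_le {R : realType} (th v X Y : R) : 0 < th < 1 -> 0 <= v -> v <= X -> v <= Y ->
  v <= X `^ (1 - th) * Y `^ th.
Proof.
move=> /andP[th0 th1] v0 vX vY.
have -> : v = v `^ (1 - th) * v `^ th by rewrite -powRD ?subrK ?powRr1// oner_eq0.
apply: ler_pM; rewrite ?powR_ge0//; apply: ge0_ler_powR; rewrite ?nnegrE//; lra.
Qed.

(** * Pointwise descent and interpolation for distinct smoothness *)

Section triebel_interpolation.
Context {R : realType} {d : nat}.
Local Notation E := (d.-tuple R).
Local Notation gam := (gauss_measure d).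
Local Notation mu := (@lebesgue_measure R).
Variable f : E -> R.
Hypothesis intf : gam.-integrable setT (EFin \o f).

Let mpos : measurable (posline : set (measurableTypeR R)).
Proof. exact: measurable_posline. Qed.

Lemma dpoisson_descend x m (b K : R) : b < m.+1%:R -> 0 <= K ->
  (forall t, 0 < t -> `|pdp f m.+2 (t, x)| <= K * t `^ (b - m.+2%:R)) ->
  forall t, 0 < t -> `|pdp f m.+1 (t, x)| <= K / (m.+1%:R - b) * t `^ (b - m.+1%:R).
Proof.
move=> bm K0 H t t0; have c0 : 0 < m.+1%:R - b by rewrite subr_gt0.
rewrite -lee_fin; apply: le_trans (dpoisson_tail intf m x t0) _.
have mI : measurable (`[t, +oo[ : set (measurableTypeR R)) by exact: measurable_itv.
apply: (@le_trans _ _ (\int[mu]_(s in `[t, +oo[) (K%:E * (s `^ (- (m.+1%:R - b) - 1))%:E))%E).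
  apply: ge0_integral_mono => s; rewrite /= in_itv/= andbT => ts; first by rewrite lee_fin.
  rewrite -EFinM lee_fin; have s0 : 0 < s by exact: lt_le_trans ts.
  have -> : - (m.+1%:R - b) - 1 = b - m.+2%:R by rewrite -[m.+2%:R]natr1; ring.
  exact: H.
have mp : measurable_fun (`[t, +oo[ : set (measurableTypeR R))
    (fun s => (s `^ (- (m.+1%:R - b) - 1))%:E).
  by apply/measurable_EFinP; apply: measurable_funTS; exact: measurable_powR.
have p0 s : `[t, +oo[%classic s -> (0 <= (s `^ (- (m.+1%:R - b) - 1))%:E)%E.
  by move=> _; rewrite lee_fin powR_ge0.
rewrite (ge0_integralZl_EFin mu mI p0 mp K0) integral_powR_infty// -EFinM lee_fin opprB.
by rewrite mulrAC mulrA.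
Qed.

(** Each integration divides by [m.+1 - b], which is at least [e] at every order from [k]
    upwards. *)
Lemma dpoisson_descend_le x k l (b e K : R) : 0 < e -> e <= k.+1%:R - b -> 0 <= K -> (k <= l)%N ->
  (forall t, 0 < t -> `|pdp f l.+1 (t, x)| <= K * t `^ (b - l.+1%:R)) ->
  forall t, 0 < t -> `|pdp f k.+1 (t, x)| <= K * e^-1 ^+ (l - k) * t `^ (b - k.+1%:R).
Proof.
move=> e0 ek K0 kl; rewrite -{1 2}(subnK kl).
elim: (l - k)%N K K0 => [|n IH] K K0 H t t0; first by rewrite expr0 mulr1; exact: H.
have kn : (k.+1%:R <= (n + k).+1%:R :> R) by rewrite ler_nat ltnS leq_addl.
have Ke : 0 <= K / e by rewrite divr_ge0// ltW.
rewrite exprS mulrA; apply: IH => // s s0.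
have bn : b < (n + k).+1%:R by lra.
apply: le_trans (dpoisson_descend bn K0 H s0) _.
rewrite ler_wpM2r ?powR_ge0// ler_wpM2l// lef_pV2 ?posrE//; lra.
Qed.

Lemma tnorm_interp_distinct (th al0 al1 Q : R) (q : R -> R) k l : 0 < th < 1 -> al0 != al1 ->
  let al := al0 * (1 - th) + al1 * th in al < k.+1%:R -> (k <= l)%N -> log_decay Q q ->
  exists2 C : R, 0 < C & forall x a b, 0 < a -> 0 < b ->
    (forall t, 0 < t -> `|pdp f l.+1 (t, x)| <= t `^ (al0 - l.+1%:R) * a) ->
    (forall t, 0 < t -> `|pdp f l.+1 (t, x)| <= t `^ (al1 - l.+1%:R) * b) ->
    (tnorm f al q k.+1 x <= (C * (a `^ (1 - th) * b `^ th))%:E)%E.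
Proof.
move=> /andP[th0 th1] a01 al alk kl [mq q1 _].
pose de := al1 - al0; have de0 : de != 0 by rewrite subr_eq0 eq_sym.
have nde : 0 < `|de| by rewrite normr_gt0.
pose e := (k.+1%:R - al) / 2; have e0 : 0 < e by rewrite divr_gt0// subr_gt0.
(* The first two entries keep [th +- et] inside []0, 1[]; the third keeps the shifted smoothness at
   distance at least [e] below [k.+1], so that the descent remains possible. *)
pose et := Num.min (Num.min (th / 2) ((1 - th) / 2)) (e / `|de|).
have et0 : 0 < et by rewrite !lt_min !divr_gt0//; lra.
have et1 : et <= th / 2 by rewrite !ge_min lexx.
have et2 : et <= (1 - th) / 2 by rewrite !ge_min lexx orbT.
have et3 : et * `|de| <= e by rewrite -ler_pdivlMr// ge_min lexx orbT.
pose D := e^-1 ^+ (l - k); have D0 : 0 < D by rewrite exprn_gt0// invr_gt0.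
pose c := et * `|de|; have c0 : 0 < c by rewrite mulr_gt0.
have c20 : 0 < 2 / c by rewrite divr_gt0.
exists (D * (1 + 2 / c)); first by rewrite mulr_gt0//; lra.
move=> x a b a0 b0 Ha Hb.
pose L := D * (a `^ (1 - th) * b `^ th); have L0 : 0 < L by rewrite !mulr_gt0 ?powR_gt0.
(* The time at which the two bounds agree, that is [t ^ (al1 - al0) = a / b]. *)
pose r := (a / b) `^ (de^-1); have r0 : 0 < r by rewrite powR_gt0// divr_gt0.
(* A shift [s] of the smoothness corresponds to the parameter [th + s / de]. Both signs are used:
   [s = c] for [t <= r] and [s = - c] beyond. *)
have bnd s t : `|s| = c -> 0 < t -> t `^ (k.+1%:R - al) * `|pdp f k.+1 (t, x)| <= L * (t / r) `^ s.
  move=> sc t0; pose sg := s / de.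
  have sge : `|sg| = et by rewrite /sg normrM normfV sc /c mulfK// gt_eqF.
  have sE : s = sg * de by rewrite /sg divfK.
  have [sg1 sg2] : sg <= et /\ - et <= sg.
    by rewrite -sge; split; [exact: ler_norm|rewrite lerNl -normrN ler_norm].
  have th'01 : 0 < th + sg < 1 by apply/andP; split; lra.
  have sc' : s <= c by rewrite -sc ler_norm.
  have ek : e <= k.+1%:R - (al + s) by move: et3; rewrite -/c /e => ?; rewrite /e; lra.
  pose K := a `^ (1 - (th + sg)) * b `^ (th + sg).
  have K0 : 0 <= K by rewrite mulr_ge0 ?powR_ge0.
  have HK u : 0 < u -> `|pdp f l.+1 (u, x)| <= K * u `^ (al + s - l.+1%:R).
    move=> u0; apply: le_trans (geo_le th'01 (normr_ge0 _) (Ha u u0) (Hb u u0)) _.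
    rewrite !powRM ?powR_ge0 ?(ltW a0) ?(ltW b0)// -!powRrM.
    rewrite mulrACA -powRD; last by apply/implyP => _; rewrite gt_eqF.
    rewrite mulrC /K le_eqVlt; apply/orP; left; apply/eqP.
    by apply: (congr1 (fun v => K * u `^ v)); rewrite sE /al /de; ring.
  have := dpoisson_descend_le e0 ek K0 kl HK t0; rewrite -/D => HD.
  apply: (@le_trans _ _ (t `^ (k.+1%:R - al) * (K * D * t `^ (al + s - k.+1%:R)))).
    by rewrite ler_wpM2l ?powR_ge0.
  have -> : t `^ (k.+1%:R - al) * (K * D * t `^ (al + s - k.+1%:R)) = D * K * t `^ s.
    have -> : t `^ s = t `^ (k.+1%:R - al) * t `^ (al + s - k.+1%:R).
      rewrite -powRD; last by apply/implyP => _; rewrite gt_eqF.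
      by congr powR; ring.
    by ring.
  have -> : K = a `^ (1 - th) * b `^ th * (a `^ (- sg) * b `^ sg).
    rewrite mulrACA -!powRD; last 2 first.
    - by apply/implyP => _; rewrite gt_eqF.
    - by apply/implyP => _; rewrite gt_eqF.
    by rewrite /K; congr (powR _ _ * _); ring.
  have -> : (t / r) `^ s = t `^ s * (a `^ (- sg) * b `^ sg).
    rewrite powRM ?invr_ge0 ?(ltW t0) ?(ltW r0)//; congr (_ * _).
    rewrite powRV// /r -powRrM (_ : de^-1 * s = sg); last by rewrite /sg mulrC.
    rewrite powRM ?invr_ge0 ?(ltW a0) ?(ltW b0)// powRV// invfM invrK.
    by rewrite -powRN.
  by rewrite /L le_eqVlt; apply/orP; left; apply/eqP; ring.
have hb t : 0 < t -> t `^ (k.+1%:R - al) * `|pdp f k.+1 (t, x)| <= L * hdist (t / r) `^ c.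
  move=> t0; have w0 : 0 < t / r by rewrite divr_gt0.
  have [w1|w1] := lerP (t / r) 1.
    have -> : hdist (t / r) = t / r.
      by rewrite /hdist min_l// (le_trans w1)// invf_ge1.
    by apply: bnd => //; rewrite gtr0_norm.
  have -> : hdist (t / r) `^ c = (t / r) `^ (- c).
    rewrite /hdist min_r; first by rewrite powRV// powRN.
    by rewrite (le_trans _ (ltW w1))// invf_le1// ltW.
  by apply: bnd => //; rewrite normrN gtr0_norm.
have -> : D * (1 + 2 / c) * (a `^ (1 - th) * b `^ th) = L * (1 + 2 / c) by rewrite /L; ring.
have mt := measurable_tfun_fst intf al k.+1 x.
apply: luxnorm_le_modular => //.
- by move=> t _; have /andP[] := q1 t.
- exact: measurable_funTS.
- exact: measurable_funTS.
- by lra.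
rewrite ge0_integral_haar; last 2 first.
- apply: measurable_fun_poweR => //; last exact: measurable_funTS.
  by apply: measurable_funTS; apply: measurableT_comp => //; exact: emeasurable_funM.
- by move=> t _; exact: poweR_ge0.
apply: (@le_trans _ _ (2 / c)%:E); last by rewrite lee_fin; lra.
apply: le_trans (integral_hdist_scaled r0 c0).
apply: ge0_integral_mono => t; rewrite poslineP => t0.
  by rewrite mule_ge0 ?poweR_ge0// lee_fin invr_ge0 ltW.
have w0 : 0 < t / r by rewrite divr_gt0.
apply: lee_wpmul2l; first by rewrite lee_fin invr_ge0 ltW.
have hc1 : hdist (t / r) `^ c <= 1.
  by rewrite -[leRHS](powRr0 (hdist (t / r))); apply: ger_powR;
    rewrite ?hdist_gt0 ?hdist_le1// ltW.
have hc0 : 0 < hdist (t / r) `^ c by rewrite powR_gt0// hdist_gt0.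
(* The majorant is at most [1], so raising it to [q t >= 1] only decreases it; this is how the
   variable exponent disappears from the integral. *)
apply: (@le_trans _ _ ((hdist (t / r) `^ c)%:E `^ q t)%E).
  apply: le_poweR; [by have /andP[? _] := q1 t; lra|exact: abse_ge0|].
  rewrite -EFinM -[leLHS]/(`|L^-1 * (t `^ (k.+1%:R - al) * pdp f k.+1 (t, x))|%:E) lee_fin.
  move: (pdp f k.+1 (t, x)) (hb t t0) => v hv.
  rewrite !normrM (ger0_norm (powR_ge0 _ _)) gtr0_norm ?invr_gt0//.
  by rewrite ler_pdivrMl.
by rewrite poweR_EFin lee_fin; apply: ge1r_powR; rewrite ?hc0 ?hc1//; have /andP[] := q1 t.
Qed.

End triebel_interpolation.

(** * The Triebel-Lizorkin interpolation *)

Section triebel_spaces.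
Context {R : realType} {d : nat}.
Local Notation E := (d.-tuple R).
Local Notation gam := (gauss_measure d).
Implicit Types (f : E -> R).

Let mpos : measurable (posline : set (measurableTypeR R)).
Proof. exact: measurable_posline. Qed.

Lemma luxnorm_add1_fin (p : E -> R) (g : E -> \bar R) : Pgamma p -> measurable_fun setT g ->
  (forall x, 0 <= g x)%E -> (luxnorm gam setT p g < +oo)%E ->
  (luxnorm gam setT p (fun x => g x + 1) < +oo)%E.
Proof.
move=> [mp p1 _] mg g0 gfin; apply: luxnorm_add_fin => //.
apply: le_lt_trans (_ : (luxnorm gam setT p (fun=> 1%E) <= 1%:E)%E) (ltry 1).
apply: luxnorm_le => //; rewrite (_ : (fun x => _) = cst 1%E).
  by rewrite integral_gauss_cst.
by apply/funext => x; rewrite invr1 mul1e abse1 poweR_EFin powR1.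
Qed.

Lemma tnormE (al Q : R) (q q' : R -> R) k f x :
  gam.-integrable setT (EFin \o f) -> measurable_fun posline q -> log_decay Q q' ->
  {ae haar_measure, forall t, posline t -> q t = q' t} ->
  luxnorm haar_measure posline q
    (fun t => (t `^ (k%:R - al) * dpoisson_hermite k t f x)%:E) = tnorm f al q' k x.
Proof.
move=> intf mq [mq' _ _] qq'.
have mt : measurable_fun posline (fun t => (t `^ (k%:R - al) * pdp f k (t, x))%:E).
  by apply: measurable_funTS; exact: measurable_tfun_fst.
have mq'' : measurable_fun posline q' by exact: measurable_funTS.
apply: etrans (luxnorm_ae_eq measurable_posline mt mq mq'' qq').
by apply: eq_luxnorm => t; rewrite poslineP => t0; rewrite pdpE.
Qed.

(** Adding [1] to each inner norm yields a bound that is strict or infinite, as Hoelder's inequality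
    for Luxemburg norms asks; constants have finite norm in [x], so this is harmless there. *)
Lemma tnorm_interp_same (th al Q : R) (q0 q1 : R -> R) k f x : 0 < th < 1 -> 1 <= Q ->
  gam.-integrable setT (EFin \o f) -> log_decay Q q0 -> log_decay Q q1 ->
  (tnorm f al (fun t => interp th (q0 t) (q1 t)) k x <=
   2%:E * ((tnorm f al q0 k x + 1) `^ (1 - th) * (tnorm f al q1 k x + 1) `^ th))%E.
Proof.
move=> th01 Q1 intf qd0 qd1; have [mq _ _] := log_decay_interp th01 Q1 qd0 qd1.
have [mq0 q0b _] := qd0; have [mq1 q1b _] := qd1.
pose g t : \bar R := (t `^ (k%:R - al) * pdp f k (t, x))%:E.
have mg : measurable_fun (posline : set (measurableTypeR R)) g.
  by apply: measurable_funTS; exact: measurable_tfun_fst.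
have mag : measurable_fun (posline : set (measurableTypeR R)) (fun t => `|g t|%E).
  exact: measurableT_comp.
have fin1 (n : \bar R) : (0 <= n -> n < n + 1 \/ n + 1 = +oo)%E.
  case: n => [n| |]// _; last by right; rewrite addye.
  by left; rewrite -EFinD lte_fin ltrDl.
have pos1 (n : \bar R) : (0 <= n -> 0 < n + 1)%E.
  by case: n => [n| |]// n0; rewrite -EFinD lte_fin; rewrite lee_fin in n0; lra.
have absE q' : luxnorm haar_measure posline q' (fun t => `|g t|%E) = tnorm f al q' k x.
  exact: luxnorm_abs.
apply: (luxnorm_holder (D := posline) mpos th01 (p0 := q0) (p1 := q1)
  (g0 := fun t => `|g t|%E) (g1 := fun t => `|g t|%E)).
- exact: measurable_funTS.
- exact: measurable_funTS.
- exact: measurable_funTS.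
- by move=> t _; have /andP[] := q0b t.
- by move=> t _; have /andP[] := q1b t.
- by move=> t _; rewrite /interp invrK.
- exact: mg.
- exact: mag.
- exact: mag.
- by move=> t _; exact: abse_ge0.
- by move=> t _; exact: abse_ge0.
- move=> t _; rewrite -[X in (X `^ _ * _)%E]/(`|t `^ (k%:R - al) * pdp f k (t, x)|%:E).
  rewrite -[X in (_ * X `^ _)%E]/(`|t `^ (k%:R - al) * pdp f k (t, x)|%:E).
  rewrite !poweR_EFin -EFinM lee_fin.
  by rewrite -powRD ?subrK ?powRr1// oner_eq0.
- by apply: pos1; exact: tnorm_ge0.
- by apply: pos1; exact: tnorm_ge0.
- by rewrite absE; apply: fin1; exact: tnorm_ge0.
- by rewrite absE; apply: fin1; exact: tnorm_ge0.
Qed.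

(** The scalar estimate wants positive real coefficients. Adding [1] makes finite values positive,
    and an infinite value makes the right-hand side infinite, the other factor being positive. *)
Lemma tnorm_interp_ereal (th al0 al1 Q : R) (q : R -> R) k l f (A B : E -> \bar R) :
  gam.-integrable setT (EFin \o f) -> 0 < th < 1 -> al0 != al1 ->
  let al := al0 * (1 - th) + al1 * th in al < k.+1%:R -> (k <= l)%N -> log_decay Q q ->
  (forall x, 0 <= A x)%E -> (forall x, 0 <= B x)%E ->
  (forall (t : R) x, (0 < t)%R -> `|pdp f l.+1 (t, x)|%:E <= (t `^ (al0 - l.+1%:R))%:E * A x)%E ->
  (forall (t : R) x, (0 < t)%R -> `|pdp f l.+1 (t, x)|%:E <= (t `^ (al1 - l.+1%:R))%:E * B x)%E ->
  exists2 C : R, 0 < C & forall x,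
    (tnorm f al q k.+1 x <= C%:E * ((A x + 1) `^ (1 - th) * (B x + 1) `^ th))%E.
Proof.
move=> intf th01 a01 al alk kl qd A0 B0 HA HB.
have [th0 th1] := andP th01; have t1 : 0 < 1 - th by lra.
have [C C0 HC] := tnorm_interp_distinct intf th01 a01 alk kl qd; exists C => // x.
have pos1 (n : \bar R) : (0 <= n -> 0 < n + 1)%E.
  by case: n => [n| |]// n0; rewrite -EFinD lte_fin; rewrite lee_fin in n0; lra.
have pA := pos1 _ (A0 x); have pB := pos1 _ (B0 x).
have [Aoo|Afin] := eqVneq (A x) +oo%E.
  rewrite Aoo addye// poweRyr ?gt_eqF// gt0_mulye ?poweR_gt0//.
  by rewrite gt0_muley ?leey.
have [Boo|Bfin] := eqVneq (B x) +oo%E.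
  rewrite Boo addye// poweRyr ?gt_eqF// gt0_muley ?poweR_gt0//.
  by rewrite gt0_muley ?leey.
move: (A0 x) (B0 x) Afin Bfin (fun t => HA t x) (fun t => HB t x).
case: (A x) => [a| |]// a0 + _; case: (B x) => [b| |]// b0 _ Ha Hb.
rewrite !lee_fin in a0 b0; rewrite -!EFinD !poweR_EFin -!EFinM.
apply: HC; rewrite ?ltr_wpDl// => t tp.
  have := Ha t tp; rewrite -EFinM lee_fin => /le_trans; apply.
  by rewrite ler_wpM2l ?powR_ge0// lerDl.
have := Hb t tp; rewrite -EFinM lee_fin => /le_trans; apply.
by rewrite ler_wpM2l ?powR_ge0// lerDl.
Qed.

Lemma triebel_lizorkin_interp (th al0 al1 : R) (p0 p1 p : E -> R) (q0 q1 q : R -> R) f :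
  0 < th < 1 -> Pgamma p0 -> LH0 p0 -> Pgamma p1 -> LH0 p1 -> P0oo q0 -> P0oo q1 ->
  (1 < ess_inf gam (EFin \o p0))%E -> (1 < ess_inf gam (EFin \o p1))%E ->
  triebel_lizorkin al0 p0 q0 f -> triebel_lizorkin al1 p1 q1 f ->
  measurable_fun setT p -> measurable_fun posline q ->
  {ae gam, forall x, (p x)^-1 = (1 - th) / p0 x + th / p1 x} ->
  {ae haar_measure, forall t, (q t)^-1 = (1 - th) / q0 t + th / q1 t} ->
  triebel_lizorkin (al0 * (1 - th) + al1 * th) p q f.
Proof.
move=> th01 Pp0 Lp0 Pp1 Lp1 Pq0 Pq1 i0 i1 [Lf0 B0] [Lf1 B1] mp mq pE qE.
split; first exact: Lvar_interp pE Lf0 Lf1.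
have intf := integrable_Lvar Pp0 Lf0.
have [mp0 p0ge1 _] := Pp0; have [mp1 p1ge1 _] := Pp1.
have [mq0 _ _ _ _] := Pq0; have [mq1 _ _ _ _] := Pq1.
have [Q0 [q0' [Q01 qd0 qq0]]] := P0oo_log_decay Pq0.
have [Q1 [q1' [Q11 qd1 qq1]]] := P0oo_log_decay Pq1.
pose Q := Num.max Q0 Q1; have Q1' : 1 <= Q by rewrite le_max Q01.
have {}qd0 : log_decay Q q0' by apply: log_decay_widen qd0; rewrite le_max lexx.
have {}qd1 : log_decay Q q1' by apply: log_decay_widen qd1; rewrite le_max lexx orbT.
pose q' t := interp th (q0' t) (q1' t).
have qd : log_decay Q q' := log_decay_interp th01 Q1' qd0 qd1.
have qq' : {ae haar_measure, forall t, posline t -> q t = q' t}.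
  apply: filterS3 qE qq0 qq1 => t qE e0 e1 pt.
  by rewrite /q' /interp -e0// -e1// -qE invrK.
have tE (a : R) (r : E -> R) (s s' : R -> R) k : measurable_fun posline s ->
    log_decay Q s' -> {ae haar_measure, forall t, posline t -> s t = s' t} ->
    luxnorm gam setT r (fun x => luxnorm haar_measure posline s
      (fun t => (t `^ (k%:R - a) * dpoisson_hermite k t f x)%:E)) =
    luxnorm gam setT r (tnorm f a s' k).
  by move=> m1 m2 m3; apply: eq_luxnorm => x _; exact: (@tnormE a Q s s' k f x intf m1 m2 m3).
have {}B0 := eq_ind _ (fun v => (v < +oo)%E) B0 _ (tE _ p0 _ _ _ mq0 qd0 qq0).
have {}B1 := eq_ind _ (fun v => (v < +oo)%E) B1 _ (tE _ p1 _ _ _ mq1 qd1 qq1).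
apply: (eq_ind _ (fun v => (v < +oo)%E) _ _ (esym (tE _ p _ _ _ mq qd qq'))).
pose p' x := interp th (p0 x) (p1 x).
have mp' : measurable_fun setT p'.
  by apply: measurable_invr; apply: measurable_funD; apply: measurable_funM => //;
    exact: measurable_invr.
have p'0 x : [set: E] x -> 0 <= p' x.
  by move=> _; apply: le_trans ler01 _; exact: interp_ge1.
have pp' : {ae gam, forall x, [set: E] x -> p x = p' x}.
  by apply: filterS pE => x pE _; rewrite /p' /interp -pE invrK.
have mt al' k : measurable_fun setT (tnorm f al' q' k) by exact: measurable_tnorm qd.
rewrite (luxnorm_ae_eq measurableT (mt _ _) mp mp' pp').
have key (A B : E -> \bar R) (C : R) k : 0 < C ->
    measurable_fun setT A -> measurable_fun setT B ->
    (forall x, 0 <= A x)%E -> (forall x, 0 <= B x)%E ->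
    (luxnorm gam setT p0 A < +oo)%E -> (luxnorm gam setT p1 B < +oo)%E ->
    (forall x, tnorm f (al0 * (1 - th) + al1 * th) q' k x <=
      C%:E * ((A x + 1) `^ (1 - th) * (B x + 1) `^ th))%E ->
    (luxnorm gam setT p' (tnorm f (al0 * (1 - th) + al1 * th) q' k) < +oo)%E.
  move=> C0 mA mB A0 B0' LA LB H.
  apply: (luxnorm_holder_fin measurableT th01 C0 mp0 mp1 mp' (g0 := fun x => (A x + 1)%E)
    (g1 := fun x => (B x + 1)%E)).
  - by move=> x _; exact: p0ge1.
  - by move=> x _; exact: p1ge1.
  - by move=> x _; rewrite /p' /interp invrK.
  - exact: p'0.
  - exact: emeasurable_funD.
  - exact: emeasurable_funD.
  - by move=> x _; apply: adde_ge0.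
  - by move=> x _; apply: adde_ge0.
  - by move=> x _; rewrite gee0_abs; [exact: H|exact: tnorm_ge0].
  - exact: luxnorm_add1_fin.
  - exact: luxnorm_add1_fin.
(* Equal smoothness gives equal orders, for the target as well, so the inner norms are compared at
   that order directly. *)
have [a01|a01] := eqVneq al0 al1.
  have alE : al0 * (1 - th) + al1 * th = al0 by rewrite -a01; ring.
  rewrite -a01 in B1; rewrite alE in key *.
  apply: (key _ _ 2 _ _ _ _ _ _ B0 B1 _) => //.
  - exact: measurable_tnorm qd0.
  - exact: measurable_tnorm qd1.
  - by move=> x; exact: tnorm_ge0.
  - by move=> x; exact: tnorm_ge0.
  - by move=> x; exact: tnorm_interp_same Q1' intf qd0 qd1.
set k0 := order_above al0 in B0; set k1 := order_above al1 in B1.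
(* The first raising step already costs one order, hence the common order [l.+1]. *)
pose l := maxn k0 k1.
have [A [mA A0 LA HA]] := triebel_up intf (l - k0) qd0 Pp0 Lp0 i0 B0.
have [B [mB B0' LB HB]] := triebel_up intf (l - k1) qd1 Pp1 Lp1 i1 B1.
have l0 : (k0.+1 + (l - k0))%N = l.+1 by rewrite addSn subnKC// leq_maxl.
have l1 : (k1.+1 + (l - k1))%N = l.+1 by rewrite addSn subnKC// leq_maxr.
rewrite l0 in HA; rewrite l1 in HB.
have kl : (Num.truncn (al0 * (1 - th) + al1 * th) <= l)%N.
  apply: leq_trans (truncn_interp al0 al1 th01) _.
  by rewrite geq_max !leq_max leqnSn /= leqnSn orbT.
have [C C0 HC] := tnorm_interp_ereal intf th01 a01 (truncnS_gt _) kl qd A0 B0' HA HB.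
exact: (key A B C _ C0 mA mB A0 B0' LA LB HC).
Qed.

End triebel_spaces.

Theorem theorem3p1 (R : realType) (d : nat) (hd : (0 < d)%N)
  (p0 p1 : d.-tuple R -> R) (q0 q1 : R -> R) (alpha0 alpha1 : R)
  (hp0 : Pgamma p0) (hp0' : LH0 p0) (hp1 : Pgamma p1) (hp1' : LH0 p1)
  (hq0 : P0oo q0) (hq1 : P0oo q1)
  (hp0_inf : (1 < ess_inf (gauss_measure d) (EFin \o p0))%E)
  (hp1_inf : (1 < ess_inf (gauss_measure d) (EFin \o p1))%E)
  (hq0_inf : (1 < ess_inf haar_measure (EFin \o q0))%E)
  (hq1_inf : (1 < ess_inf haar_measure (EFin \o q1))%E)
  (hp0_sup : (ess_sup (gauss_measure d) (EFin \o p0) < +oo)%E)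
  (hp1_sup : (ess_sup (gauss_measure d) (EFin \o p1) < +oo)%E)
  (hq0_sup : (ess_sup haar_measure (EFin \o q0) < +oo)%E)
  (hq1_sup : (ess_sup haar_measure (EFin \o q1) < +oo)%E)
  (halpha0 : 0 <= alpha0) (halpha1 : 0 <= alpha1) :
  (forall f : d.-tuple R -> R,
     besov_lipschitz alpha0 p0 q0 f -> besov_lipschitz alpha1 p1 q1 f ->
     forall (theta : R) (p : d.-tuple R -> R) (q : R -> R),
       0 < theta -> theta < 1 ->
       measurable_fun setT p -> measurable_fun posline q ->
       {ae gauss_measure d, forall x,
         (p x)^-1 = (1 - theta) / p0 x + theta / p1 x} ->
       {ae haar_measure, forall t,
         (q t)^-1 = (1 - theta) / q0 t + theta / q1 t} ->
       besov_lipschitz (alpha0 * (1 - theta) + alpha1 * theta) p q f)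
  /\
  (forall f : d.-tuple R -> R,
     triebel_lizorkin alpha0 p0 q0 f -> triebel_lizorkin alpha1 p1 q1 f ->
     forall (theta : R) (p : d.-tuple R -> R) (q : R -> R),
       0 < theta -> theta < 1 ->
       measurable_fun setT p -> measurable_fun posline q ->
       {ae gauss_measure d, forall x,
         (p x)^-1 = (1 - theta) / p0 x + theta / p1 x} ->
       {ae haar_measure, forall t,
         (q t)^-1 = (1 - theta) / q0 t + theta / q1 t} ->
       triebel_lizorkin (alpha0 * (1 - theta) + alpha1 * theta) p q f).
Proof.
split=> f f0 f1 theta p q th0 th1 mp mq pE qE; have th01 : 0 < theta < 1 by rewrite th0.
  exact: (besov_lipschitz_interp th01 hp0 hp0' hp1 hp1' hq0 hq1 hp0_inf hp1_inf
    halpha0 halpha1 f0 f1 mp mq pE qE).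
exact: (triebel_lizorkin_interp th01 hp0 hp0' hp1 hp1' hq0 hq1 hp0_inf hp1_inf
  f0 f1 mp mq pE qE).
Qed.
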